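(* Let $(X_1,Y_1),(X_2,Y_2),\ldots$ be i.i.d. copies of a pair $(X,Y)$ of real random variables whose marginal distribution functions $F_X$ and $F_Y$ are continuous. Let $\rho_{R1}=\rho_{\mathrm{Pear}}(\tilde X,\tilde Y)$ and $\rho_{R2}=\rho_{\mathrm{Pear}}(\tilde X^2,\tilde Y^2)$, where $\tilde X=\Phi^{-1}(F_X(X))$ and $\tilde Y=\Phi^{-1}(F_Y(Y))$, and let $\widehat{\rho_{R1}},\widehat{\rho_{R2}}$ be the rank-based estimators, defined in the context, computed from $(X_1,Y_1),\ldots,(X_n,Y_n)$. Then, as $n\to\infty$, $\sqrt n\,\big((\widehat{\rho_{R1}},\widehat{\rho_{R2}})-(\rho_{R1},\rho_{R2})\big)$ is asymptotically normally distributed, i.e. it converges in distribution to a bivariate normal distribution $\mathcal N_2(0,\Sigma)$ for some (possibly singular) covariance matrix $\Sigma$. If, furthermore, $X$ and $Y$ are independent, then $\sqrt n\,(\widehat{\rho_{R1}},\widehat{\rho_{R2}})$ is asymptotically bivariate standard normally distributed, i.e. it converges in distribution to $\mathcal N_2(0,I_2)$ with $I_2$ the $2\times 2$ identity matrix.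
   Context: $\rho_{\mathrm{Pear}}$ is the Pearson correlation coefficient and $\Phi$ is the standard normal distribution function. Ranks: $Q(i)=\sum_{j=1}^n\mathbf 1\{X_j\le X_i\}$ is the rank of $X_i$ within $X_1,\ldots,X_n$, and $R(i)=\sum_{j=1}^n\mathbf 1\{Y_j\le Y_i\}$ is the rank of $Y_i$ within $Y_1,\ldots,Y_n$. Scores (depending on $n$): $a(j)=\Phi^{-1}\big(\tfrac{j}{n+1}\big)$ and $b(j)=a(j)^2$ for $j=1,\ldots,n$; $\bar a=\frac1n\sum_{j=1}^n a(j)$ (which equals $0$), $s_a^2=\frac1n\sum_{j=1}^n(a(j)-\bar a)^2$, $\bar b=\frac1n\sum_{j=1}^n b(j)$, $s_b^2=\frac1n\sum_{j=1}^n(b(j)-\bar b)^2$. Estimators: $$\widehat{\rho_{R1}}=\frac{\sum_{j=1}^n a(Q(j))\,a(R(j))}{n\,s_a^2},\qquad \widehat{\rho_{R2}}=\frac{\sum_{j=1}^n\big(b(Q(j))-\bar b\big)\big(b(R(j))-\bar b\big)}{n\,s_b^2}.$$ For the finitely many small $n$ for which a denominator vanishes the estimators may be given arbitrary values. *)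

(* Defs.v *)
From HB Require Import structures.
From mathcomp Require Import all_boot all_order all_algebra finmap.
From mathcomp Require Import all_classical all_reals all_analysis.

Set Implicit Arguments.
Unset Strict Implicit.
Unset Printing Implicit Defensive.

Import Order.TTheory GRing.Theory Num.Theory.
Import numFieldNormedType.Exports.

Local Open Scope classical_set_scope.
Local Open Scope ring_scope.

(* [normal_prob 0 1], whose carrier is [measurableTypeR R], seen as a
   probability on [R] itself. *)
Definition std_normal {R : realType} : set R -> \bar R :=
  normal_prob (0 : R) 1.

Section std_normal_probability.
Context {R : realType}.

Let std_normal0 : std_normal (set0 : set R) = 0%E.
Proof. exact: (measure0 (normal_prob (0 : R) 1)). Qed.

Let std_normal_ge0 (A : set R) : (0 <= std_normal A)%E.
Proof. exact: (measure_ge0 (normal_prob (0 : R) 1)). Qed.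

Let std_normal_sigma_additive : semi_sigma_additive (@std_normal R).
Proof. exact: (@measure_semi_sigma_additive _ _ _ (normal_prob (0 : R) 1)). Qed.

HB.instance Definition _ := isMeasure.Build _ _ _ (@std_normal R)
  std_normal0 std_normal_ge0 std_normal_sigma_additive.

Let std_normal_setT : std_normal (setT : set R) = 1%E.
Proof. exact: (@probability_setT _ _ _ (normal_prob (0 : R) 1)). Qed.

HB.instance Definition _ := Measure_isProbability.Build _ _ _ (@std_normal R)
  std_normal_setT.

End std_normal_probability.

Definition Phi {R : realType} (x : R) : R := fine (std_normal `]-oo, x]).

(* [Phi] is a bijection from R onto ]0, 1[; outside ]0, 1[ its inverse is set
   to 0. *)
Definition Phi_inv {R : realType} : R -> R := 'pinv_(fun=> 0) setT Phi.

Definition rcdf {d} {T : measurableType d} {R : realType} {P : probability T R}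
  (X : {RV P >-> R}) (x : R) : R := fine (cdf X x).

Definition pearson {d} {T : measurableType d} {R : realType}
    (P : probability T R) (U V : T -> R) : R :=
  fine (covariance P U V) /
    (Num.sqrt (fine 'V_P[U]) * Num.sqrt (fine 'V_P[V])).

Definition normal_score {d} {T : measurableType d} {R : realType}
  {P : probability T R} (X : {RV P >-> R}) (w : T) : R :=
  Phi_inv (rcdf X (X w)).

Definition rho_R1 {d} {T : measurableType d} {R : realType}
    {P : probability T R} (X Y : {RV P >-> R}) : R :=
  pearson P (normal_score X) (normal_score Y).

Definition rho_R2 {d} {T : measurableType d} {R : realType}
    {P : probability T R} (X Y : {RV P >-> R}) : R :=
  pearson P (fun w => normal_score X w ^+ 2) (fun w => normal_score Y w ^+ 2).

(* Samples of size n are indexed by 0, ..., n - 1; ranks run from 1 to n. *)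
Definition rank_in {R : realType} (n : nat) (x : nat -> R) (i : nat) : nat :=
  (\sum_(j < n) (x j <= x i)%R)%N.

Definition score_a {R : realType} (n j : nat) : R :=
  Phi_inv (j%:R / n.+1%:R).

Definition score_b {R : realType} (n j : nat) : R := score_a n j ^+ 2.

Definition score_mean {R : realType} (n : nat) (c : nat -> R) : R :=
  n%:R^-1 * \sum_(1 <= j < n.+1) c j.

Definition score_var {R : realType} (n : nat) (c : nat -> R) : R :=
  n%:R^-1 * \sum_(1 <= j < n.+1) (c j - score_mean n c) ^+ 2.

(* When a denominator below vanishes (n <= 1, resp. n <= 2), the value is 0 by
   the convention x / 0 = 0. *)
Definition rho_R1_hat {R : realType} (n : nat) (x y : nat -> R) : R :=
  (\sum_(j < n) score_a n (rank_in n x j) * score_a n (rank_in n y j)) /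
  (n%:R * score_var n (score_a n)).

Definition rho_R2_hat {R : realType} (n : nat) (x y : nat -> R) : R :=
  (\sum_(j < n) (score_b n (rank_in n x j) - score_mean n (score_b n)) *
                (score_b n (rank_in n y j) - score_mean n (score_b n))) /
  (n%:R * score_var n (score_b n)).

Definition independent_RV {d} {T : measurableType d} {R : realType}
    (P : probability T R) {d1 d2} {T1 : measurableType d1}
    {T2 : measurableType d2} (U : T -> T1) (V : T -> T2) : Prop :=
  forall A B, measurable A -> measurable B ->
    (P (U @^-1` A `&` V @^-1` B) = P (U @^-1` A) * P (V @^-1` B))%E.

Definition mutually_independent {d} {T : measurableType d} {R : realType}
    (P : probability T R) {d1} {T1 : measurableType d1} {I : choiceType}
    (Z : I -> T -> T1) : Prop :=
  forall (J : {fset I}) (A : I -> set T1), (forall i, measurable (A i)) ->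
    (P (\bigcap_(i in [set` J]) (Z i @^-1` A i)) =
     \prod_(i <- J) P (Z i @^-1` A i))%E.

Definition same_law {d d'} {T : measurableType d} {T' : measurableType d'}
    {R : realType} (P : probability T R) (P' : probability T' R)
    {d1} {T1 : measurableType d1} (U : T -> T1) (V : T' -> T1) : Prop :=
  forall A, measurable A -> P (U @^-1` A) = P' (V @^-1` A).

(* The sequence Z and the random element Z0 it copies may live on different
   probability spaces. *)
Definition iid_copies {d d'} {T : measurableType d} {T' : measurableType d'}
    {R : realType} (P : probability T R) (P' : probability T' R)
    {d1} {T1 : measurableType d1} (Z : nat -> T -> T1) (Z0 : T' -> T1) : Prop :=
  mutually_independent P Z /\ forall i, same_law P P' (Z i) Z0.

Definition cvg_in_distribution {d} {T : measurableType d} {R : realType}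
    (P : probability T R) (Z : nat -> T -> R * R)
    (mu : probability (R * R)%type R) : Prop :=
  forall f : R * R -> R, continuous f ->
    (exists M : R, forall z, `|f z| <= M) ->
    ('E_P[f \o Z n] @[n --> \oo] --> 'E_mu[f])%E.

Definition mulmx_pair {R : realType} (A : 'M[R]_2) (z : R * R) : R * R :=
  (A 0 0 * z.1 + A 0 1 * z.2, A 1 0 * z.1 + A 1 1 * z.2).

(* N_2(m, Sigma) is the law of m + A G with G standard normal on R^2 and
   A A^T = Sigma; it does not depend on the choice of A, and such an A exists
   exactly when Sigma is a (possibly singular) covariance matrix. *)
Definition is_normal2 {R : realType} (m : R * R) (Sigma : 'M[R]_2)
    (mu : probability (R * R)%type R) : Prop :=
  exists2 A : 'M[R]_2, A *m A^T = Sigma &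
    forall B : set (R * R), measurable B ->
      mu B = (@std_normal R \x @std_normal R)%E
               ((fun z => m + mulmx_pair A z) @^-1` B).

Definition cvg_to_normal2 {d} {T : measurableType d} {R : realType}
    (P : probability T R) (Z : nat -> T -> R * R) (m : R * R)
    (Sigma : 'M[R]_2) : Prop :=
  exists2 mu : probability (R * R)%type R,
    is_normal2 m Sigma mu & cvg_in_distribution P Z mu.

(* Main.v *)
(** Ranks only depend on the uniform variables U = F_X(X) and V = F_Y(Y), so both
    estimators are normalized rank sums T(J,K) = sum_i J(Q(i)/(n+1)) K(R(i)/(n+1)), with
    J = K = Phi^-1 and J = K = (Phi^-1)^2 - 1 respectively. A bound of Efron-Stein type,
    combined with Hardy's inequality over the ranks, makes the variance of T(D,K)
    at most n times a fourth-moment quantity that is small when D is supported near 0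
    and 1. Hence, up to a small error in L2, the scores may be truncated; a rank sum
    with smooth bounded scores differs from a sum of i.i.d. influences by a term of
    bounded variance. A central limit theorem for the pair of sums (Lindeberg's
    exchange argument on smooth test functions, Bernstein polynomials to reach
    general ones) then gives the limit, whose covariance is a limit point of
    the covariances of the truncated influences. Given (U(i),V(i)), the rank of i is one
    plus a binomial variable, whence a bias E T(J,K)/n - E J(U)K(V) of order (log n)^2/n,
    negligible at scale sqrt n. When U and V are independent
    the influence reduces to J(u)K(v), which has variance proportional to that of the
    normalization and is uncorrelated between the two estimators, so that the limiting
    covariance is the identity. *)

Require Import Defs.
From HB Require Import structures.
From mathcomp Require Import all_boot all_order all_algebra finmap.
From mathcomp Require Import all_classical all_reals all_analysis.
From mathcomp Require Import measurable_realfun.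
From mathcomp Require Import ring lra zify.

Set Implicit Arguments.
Unset Strict Implicit.
Unset Printing Implicit Defensive.

Import Order.TTheory GRing.Theory Num.Theory.
Import numFieldNormedType.Exports.

Local Open Scope classical_set_scope.
Local Open Scope ring_scope.

(** The obstacle is that the normal scores and their derivatives blow up at 0 and 1, exactly where a
    shift of a rank by one unit matters most. Errors are therefore measured in the logit [ell]:
    Mills' ratio makes [Phi_inv] and its square Lipschitz in it, and deleting one observation moves
    the logit of a rank by an amount of the order of the reciprocal of its distance to one end. The
    leave-one-out errors are then averages of the kind that Hardy's inequality bounds in l2.
    Truncation continues the score by its tangent lines, which keeps a quadratic Taylor bound and
    costs only a factor 2 in the logit Lipschitz constant. A limit point of the covariances is
    enough for convergence of the whole sequence: each fixed truncation level approximates the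
    statistic for all large n, so only the levels run through a subsequence. The bias is expanded
    with a remainder whose expectation under a binomial law is explicit; its singularity at the ends
    costs logarithms, obtained by dyadic cutoffs. *)

Local Notation mfunT := (measurable_fun setT).

(** * Real-valued expectations and their rules *)

Section expectation.
Context {d} {T : measurableType d} {R : realType}.
Implicit Types (P : probability T R) (f g : T -> R).

(** Taken in [R] and not in the extended reals so that [ring] and [lra] apply; the additive rules
    therefore carry the integrability hypothesis [itg]. *)
Definition Ex P f : R := \int[P]_w f w.

Definition itg P f : Prop := P.-integrable setT (EFin \o f).

(** At a fixed sample size a rank statistic takes finitely many values, so integrability mostly
    comes from the closure rules of this class. *)
Definition bmf f : Prop :=
  mfunT f /\ exists M, forall w, `|f w| <= M.

Lemma bmf_itg P f : bmf f -> itg P f.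
Proof.
move=> [mf [M fM]]; apply: measurable_bounded_integrable => //.
  by rewrite /= probability_setT ltry.
exists M; split; first exact: num_real.
by move=> x Mx t _ /=; apply: (le_trans (fM t)); exact: ltW.
Qed.

Lemma itg_measurable P f : itg P f -> mfunT f.
Proof. by move=> /integrableP[/measurable_EFinP]. Qed.

Lemma bmf_cst c : bmf (fun=> c).
Proof. by split; [exact: measurable_cst|exists `|c|]. Qed.

Lemma bmfD f g : bmf f -> bmf g -> bmf (fun w => f w + g w).
Proof.
move=> [mf [M fM]] [mg [N gN]]; split; first exact: measurable_funD.
by exists (M + N) => w; rewrite (le_trans (ler_normD _ _))// lerD.
Qed.

Lemma bmfM f g : bmf f -> bmf g -> bmf (fun w => f w * g w).
Proof.
move=> [mf [M fM]] [mg [N gN]]; split; first exact: measurable_funM.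
by exists (M * N) => w; rewrite normrM ler_pM.
Qed.

Lemma bmfN f : bmf f -> bmf (fun w => - f w).
Proof.
move=> [mf [M fM]]; split; first exact: measurableT_comp.
by exists M => w; rewrite normrN.
Qed.

Lemma bmfB f g : bmf f -> bmf g -> bmf (fun w => f w - g w).
Proof. by move=> bf bg; apply: bmfD => //; exact: bmfN. Qed.

Lemma bmfZ c f : bmf f -> bmf (fun w => c * f w).
Proof. by move=> bf; apply: bmfM => //; exact: bmf_cst. Qed.

Lemma bmfX n f : bmf f -> bmf (fun w => f w ^+ n).
Proof.
move=> bf; elim: n => [|n IH]; first exact: bmf_cst.
by rewrite (_ : (fun _ => _) = fun w => f w * f w ^+ n);
  [exact: bmfM|apply/funext => w; rewrite exprS].
Qed.

Lemma bmf_norm f : bmf f -> bmf (fun w => `|f w|).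
Proof.
move=> [mf [M fM]]; split; first exact: measurableT_comp.
by exists M => w; rewrite normr_id.
Qed.

Lemma bmf_sum (I : Type) (s : seq I) (Q : pred I) (F : I -> T -> R) :
  (forall i, Q i -> bmf (F i)) -> bmf (fun w => \sum_(i <- s | Q i) F i w).
Proof.
move=> bF; elim: s => [|i s IH].
  rewrite (_ : (fun _ => _) = fun=> 0); first exact: bmf_cst.
  by apply/funext => w; rewrite big_nil.
rewrite (_ : (fun _ => _) = fun w =>
    (if Q i then F i w else 0) + \sum_(j <- s | Q j) F j w).
  by apply: bmfD => //; case Qi: (Q i); [exact: bF|exact: bmf_cst].
by apply/funext => w; rewrite big_cons; case: ifP; rewrite ?add0r.
Qed.

Lemma bmf_bool (b : T -> bool) : mfunT b ->
  bmf (fun w => (b w)%:R).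
Proof.
move=> mb; split; last first.
  by exists 1 => w; case: (b w); rewrite ?normr1 ?normr0.
apply: (measurableT_comp (f := fun c : bool => c%:R : R)) => //.
Qed.

Lemma ExZ P c f : itg P f -> Ex P (fun w => c * f w) = c * Ex P f.
Proof. by move=> fi; rewrite /Ex RintegralZl. Qed.

Lemma itgZ P c f : itg P f -> itg P (fun w => c * f w).
Proof.
move=> fi; rewrite /itg (_ : EFin \o _ = fun w => (c%:E * (EFin \o f) w)%E) //.
exact: integrableZl.
Qed.

Lemma itgD P f g : itg P f -> itg P g -> itg P (fun w => f w + g w).
Proof. by move=> fi gi; exact: (integrableD measurableT fi gi). Qed.

Lemma itgN P f : itg P f -> itg P (fun w => - f w).
Proof. by move=> fi; exact: (integrableN fi). Qed.

Lemma itgB P f g : itg P f -> itg P g -> itg P (fun w => f w - g w).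
Proof. by move=> fi gi; apply: itgD => //; exact: itgN. Qed.

Lemma itg_norm P f : itg P f -> itg P (fun w => `|f w|).
Proof. by move=> fi; exact: integrable_norm. Qed.

Lemma itg_cst P c : itg P (fun=> c).
Proof. by apply: bmf_itg; exact: bmf_cst. Qed.

Lemma itg_le P f g : mfunT f -> itg P g ->
  (forall w, `|f w| <= g w) -> itg P f.
Proof.
move=> mf gi fg; apply: (le_integrable measurableT _ _ gi).
  exact/measurable_EFinP.
by move=> w _ /=; rewrite lee_fin (le_trans (fg w))// ler_norm.
Qed.

Lemma ExD P f g : itg P f -> itg P g ->
  Ex P (fun w => f w + g w) = Ex P f + Ex P g.
Proof. by move=> fi gi; rewrite /Ex RintegralD. Qed.

Lemma ExB P f g : itg P f -> itg P g ->
  Ex P (fun w => f w - g w) = Ex P f - Ex P g.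
Proof. by move=> fi gi; rewrite /Ex RintegralB. Qed.

Lemma Ex_cst P c : Ex P (fun=> c) = c.
Proof.
rewrite /Ex (@Rintegral_cst _ _ _ P setT measurableT c).
rewrite (_ : fine _ = 1) ?mulr1//; exact: (congr1 fine (probability_setT P)).
Qed.

Lemma ExN P f : itg P f -> Ex P (fun w => - f w) = - Ex P f.
Proof.
move=> fi; have := ExB (itg_cst P 0) fi.
by under eq_fun do rewrite sub0r; rewrite Ex_cst sub0r.
Qed.

Lemma itg_sum P (I : Type) (s : seq I) (Q : pred I) (F : I -> T -> R) :
  (forall i, Q i -> itg P (F i)) -> itg P (fun w => \sum_(i <- s | Q i) F i w).
Proof.
move=> bF; elim: s => [|i s IH].
  by under eq_fun do rewrite big_nil; exact: itg_cst.
rewrite (_ : (fun _ => _) = fun w =>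
    (if Q i then F i w else 0) + \sum_(j <- s | Q j) F j w).
  by apply: itgD => //; case Qi: (Q i); [exact: bF|exact: itg_cst].
by apply/funext => w; rewrite big_cons; case: ifP; rewrite ?add0r.
Qed.

Lemma Ex_sum P (I : Type) (s : seq I) (Q : pred I) (F : I -> T -> R) :
  (forall i, Q i -> itg P (F i)) ->
  Ex P (fun w => \sum_(i <- s | Q i) F i w) = \sum_(i <- s | Q i) Ex P (F i).
Proof.
move=> bF; elim: s => [|i s IH].
  by under eq_fun do rewrite big_nil; rewrite Ex_cst big_nil.
under eq_fun do rewrite big_cons.
rewrite big_cons; case: ifP => // Qi.
by rewrite ExD ?IH//; [exact: bF|exact: itg_sum].
Qed.

Lemma le_Ex P f g : itg P f -> itg P g -> (forall w, f w <= g w) ->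
  Ex P f <= Ex P g.
Proof. by move=> fi gi fg; apply: le_Rintegral. Qed.

Lemma Ex_ge0 P f : (forall w, 0 <= f w) -> 0 <= Ex P f.
Proof. by move=> f0; apply: Rintegral_ge0. Qed.

Lemma Ex_le_cst P f c : itg P f -> (forall w, f w <= c) -> Ex P f <= c.
Proof.
by move=> fi fc; rewrite -[leRHS](Ex_cst P); apply: le_Ex => //; exact: itg_cst.
Qed.

Lemma norm_Ex P f : itg P f -> `|Ex P f| <= Ex P (fun w => `|f w|).
Proof. by move=> fi; exact: le_normr_Rintegral. Qed.

Lemma norm_Ex_le P f g : itg P f -> itg P g -> (forall w, `|f w| <= g w) ->
  `|Ex P f| <= Ex P g.
Proof.
move=> fi gi fg; apply: (le_trans (norm_Ex fi)).
by apply: le_Ex => //; exact: itg_norm.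
Qed.

Lemma norm_Ex_cst P f c : itg P f -> (forall w, `|f w| <= c) -> `|Ex P f| <= c.
Proof.
move=> fi fc; apply: (le_trans (norm_Ex fi)).
by apply: Ex_le_cst => //; exact: itg_norm.
Qed.

Lemma Ex_ae P f g : itg P f -> itg P g -> {ae P, forall w, f w = g w} ->
  Ex P f = Ex P g.
Proof.
move=> fi gi fg; congr fine; apply: ae_eq_integral => //.
- by case/integrableP : fi.
- by case/integrableP : gi.
- by apply: filterS fg => w fg _ /=; rewrite fg.
Qed.

(** The function [min f g] is a version of [f] that lies below [g] everywhere, which reduces the
    claim to pointwise monotonicity. *)
Lemma le_Ex_ae P f g : itg P f -> itg P g -> {ae P, forall w, f w <= g w} ->
  Ex P f <= Ex P g.
Proof.
move=> fi gi fg.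
have mi : itg P (fun w => Num.min (f w) (g w)).
  apply: (@itg_le P _ (fun w => `|f w| + `|g w|)).
  - by apply: measurable_minr; [exact: itg_measurable fi|exact: itg_measurable gi].
  - by apply: itgD; exact: itg_norm.
  - move=> w; rewrite /Num.min; case: ifP => _; first by rewrite lerDl.
    by rewrite lerDr.
rewrite (@Ex_ae P f (fun w => Num.min (f w) (g w)))//.
  by apply: le_Ex => // w; rewrite ge_min lexx orbT.
by apply: filterS fg => w fg; rewrite min_l.
Qed.

Lemma Ex_CS P f g : itg P (fun w => f w * g w) ->
  itg P (fun w => f w ^+ 2) -> itg P (fun w => g w ^+ 2) ->
  Ex P (fun w => f w * g w) ^+ 2 <=
  Ex P (fun w => f w ^+ 2) * Ex P (fun w => g w ^+ 2).
Proof.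
move=> fgi ffi ggi.
set a := Ex P (fun w => f w ^+ 2); set b := Ex P (fun w => g w ^+ 2).
set c := Ex P (fun w => f w * g w).
have H s t : 0 <= s ^+ 2 * a + (2 * s * t) * c + t ^+ 2 * b.
  rewrite /a /b /c -!ExZ// -!ExD//; try by do ?apply: itgD; exact: itgZ.
  apply: Ex_ge0 => w.
  rewrite (_ : _ + _ = (s * f w + t * g w) ^+ 2) ?sqr_ge0//; ring.
have a0 : 0 <= a by apply: Ex_ge0 => w; exact: sqr_ge0.
have b0 : 0 <= b by apply: Ex_ge0 => w; exact: sqr_ge0.
(* The quadratic form at [(- c, a)] equals [a] times the Cauchy-Schwarz gap; when [a] vanishes, the
   point [(- (b + 1), c)] forces [c] to vanish. *)
have := H (- c) a; rewrite [X in 0 <= X](_ : _ = a * (a * b - c ^+ 2)); last ring.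
have [a_eq0 _|an0] := eqVneq a 0.
  have := H (- (b + 1)) c; rewrite a_eq0 mulr0 add0r mul0r.
  rewrite [X in 0 <= X](_ : _ = - (c ^+ 2 * (b + 2))); last ring.
  by rewrite oppr_ge0 pmulr_lle0//; apply: ltr_wpDl.
by rewrite pmulr_rge0 ?lt_neqAle 1?eq_sym ?an0// subr_ge0.
Qed.

End expectation.

(** * Fubini for bounded functions *)

Section fubini_bounded.
Context {d1 d2 : measure_display} {T1 : measurableType d1}
  {T2 : measurableType d2} {R : realType}.
Variables (P : probability T1 R) (Q : probability T2 R) (F : T1 * T2 -> R).
Hypothesis bF : bmf F.

Let iF : (P \x Q)%E.-integrable setT (EFin \o F).
Proof. exact: (bmf_itg (P \x Q)%E bF). Qed.

Lemma bmf_pair1 x : bmf (fun y => F (x, y)).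
Proof.
case: bF => mF [M FM]; split; last by exists M.
by apply: measurableT_comp => //; exact: pair1_measurable.
Qed.

Lemma bmf_pair2 y : bmf (fun x => F (x, y)).
Proof.
case: bF => mF [M FM]; split; last by exists M.
by apply: measurableT_comp => //; exact: pair2_measurable.
Qed.

Lemma bmf_Ex1 : bmf (fun x => Ex Q (fun y => F (x, y))).
Proof.
split; last first.
  case: bF => mF [M FM]; exists M => x.
  by apply: norm_Ex_cst => //; exact: bmf_itg (bmf_pair1 x).
have /= mf := measurable_fubini_F iF.
by apply: (measurableT_comp (f := fine)) mf.
Qed.

Lemma bmf_Ex2 : bmf (fun y => Ex P (fun x => F (x, y))).
Proof.
split; last first.
  case: bF => mF [M FM]; exists M => x.
  by apply: norm_Ex_cst => //; exact: bmf_itg (bmf_pair2 x).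
have /= mf := measurable_fubini_G iF.
by apply: (measurableT_comp (f := fine)) mf.
Qed.

Lemma Ex_prod1 : Ex (P \x Q)%E F = Ex P (fun x => Ex Q (fun y => F (x, y))).
Proof.
rewrite /Ex /Rintegral -(integral12_prod_meas1 iF); congr fine.
apply: eq_integral => x _ /=; rewrite fineK//.
exact: (integrable_fin_num measurableT (bmf_itg Q (bmf_pair1 x))).
Qed.

Lemma Ex_prod2 : Ex (P \x Q)%E F = Ex Q (fun y => Ex P (fun x => F (x, y))).
Proof.
rewrite /Ex /Rintegral -(integral21_prod_meas1 iF); congr fine.
apply: eq_integral => x _ /=; rewrite fineK//.
exact: (integrable_fin_num measurableT (bmf_itg P (bmf_pair2 x))).
Qed.

Lemma Ex_swap : Ex P (fun x => Ex Q (fun y => F (x, y))) =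
  Ex Q (fun y => Ex P (fun x => F (x, y))).
Proof. by rewrite -Ex_prod1 Ex_prod2. Qed.

End fubini_bounded.

Lemma probability_prodE_prob {d1 d2} {T1 : measurableType d1}
    {T2 : measurableType d2} {R : realType} (P : probability T1 R)
    (Q : probability T2 R) A B : measurable A -> measurable B ->
  ((P \x Q)%E : probability _ R) (A `*` B) = (P A * Q B)%E.
Proof. by move=> mA mB; exact: product_measure1E. Qed.

(** * Laws and independence of two random elements *)

Section laws.
Context {d} {T : measurableType d} {R : realType}
  {d1} {T1 : measurableType d1}.
Variables (P : probability T R) (U : T -> T1).
Hypothesis mU : mfunT U.

Let U' : {mfun T >-> T1} := HB.pack U (isMeasurableFun.Build _ _ _ _ _ mU).

Definition law : probability T1 R := distribution P U'.

Lemma lawE A : law A = P (U @^-1` A).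
Proof. by []. Qed.

Lemma itg_law f : mfunT f -> itg P (f \o U) -> itg law f.
Proof.
move=> mf fi; apply: (@integrable_pushforward _ _ _ _ _ U) => //.
exact/measurable_EFinP.
Qed.

Lemma itg_law_comp f : itg law f -> itg P (f \o U).
Proof.
move=> /integrableP[mf fi]; apply/integrableP; split.
  exact: (measurableT_comp mf mU).
move: fi; rewrite /law ge0_integral_distribution//.
exact: (measurableT_comp (f := abse)).
Qed.

Lemma Ex_law f : mfunT f -> itg P (f \o U) ->
  Ex law f = Ex P (f \o U).
Proof.
move=> mf fi; congr fine; rewrite /law integral_distribution//.
exact/measurable_EFinP.
Qed.

End laws.

Section same_law.
Context {d d' : measure_display} {T : measurableType d} {T' : measurableType d'}
  {R : realType} {d1} {T1 : measurableType d1}.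
Variables (P : probability T R) (P' : probability T' R)
  (U : T -> T1) (V : T' -> T1).
Hypotheses (mU : mfunT U) (mV : mfunT V)
  (UV : same_law P P' U V).

Lemma itg_same_law f : itg P' (f \o V) -> mfunT f ->
  itg P (f \o U).
Proof.
move=> fV mf; apply: (itg_law_comp (mU := mU)).
have := itg_law mV mf fV.
move=> /integrableP[mf' fi]; apply/integrableP; split => //.
rewrite (eq_measure_integral (law P' mV))// => A mA _.
exact: UV.
Qed.

Lemma Ex_same_law f : itg P' (f \o V) -> mfunT f ->
  Ex P (f \o U) = Ex P' (f \o V).
Proof.
move=> fV mf; rewrite -(Ex_law mV mf fV) -(Ex_law mU mf); last exact: itg_same_law.
congr fine; apply: eq_measure_integral => A mA _; exact: UV.
Qed.

End same_law.

Section independent_pair.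
Context {d} {T : measurableType d} {R : realType}
  {d1 d2 : measure_display} {T1 : measurableType d1} {T2 : measurableType d2}.
Variables (P : probability T R) (U : T -> T1) (V : T -> T2).
Hypotheses (mU : mfunT U) (mV : mfunT V)
  (UV : independent_RV P U V).

(** The law of [(U, V)] and the product of the two laws agree on rectangles, hence everywhere.
    Fubini then evaluates [V] at an independent point [w'] of the same probability space, which
    plays the part of a conditional expectation. *)
Lemma Ex_independent F : bmf F ->
  Ex P (fun w => F (U w, V w)) = Ex P (fun w => Ex P (fun w' => F (U w, V w'))).
Proof.
move=> bF; have [mF _] := bF.
have mUV : mfunT (fun w => (U w, V w)).
  exact/measurable_fun_pair.
have E : Ex (law P mU \x law P mV)%E F = Ex P (fun w => F (U w, V w)).
  rewrite -(@Ex_law _ _ _ _ _ P _ mUV F)//; last first.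
    apply: bmf_itg; split; first exact: measurableT_comp.
    by case: bF => _ [M FM]; exists M => w /=.
  congr fine; apply: eq_measure_integral => A mA _.
  apply: (product_measure_unique (m' := law P mUV)) => //= B C mB mC.
rewrite -E Ex_prod1// (Ex_law mU); last 2 first.
- by case: (bmf_Ex1 (law P mU) (law P mV) bF).
- apply: bmf_itg; case: (bmf_Ex1 (law P mU) (law P mV) bF) => m1 [M FM].
  by split; [exact: measurableT_comp|exists M => w /=].
congr (Ex P _); apply/funext => w /=.
rewrite (Ex_law mV) //; first by case: (bmf_pair1 bF (U w)).
apply: bmf_itg; case: (bmf_pair1 bF (U w)) => m1 [M FM].
by split; [exact: (measurableT_comp m1)|exists M => w' /=].
Qed.

Lemma Ex_independentM f g : bmf f -> bmf g ->
  Ex P (fun w => f (U w) * g (V w)) =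
  Ex P (fun w => f (U w)) * Ex P (fun w => g (V w)).
Proof.
move=> bf bg.
have bfU : bmf (f \o U).
  by case: bf => m1 [M FM]; split; [exact: measurableT_comp|exists M => w /=].
have bgV : bmf (g \o V).
  by case: bg => m1 [M FM]; split; [exact: measurableT_comp|exists M => w /=].
rewrite (@Ex_independent (fun z => f z.1 * g z.2)); last first.
  apply: bmfM.
  - case: bf => m1 [M FM]; split; last by exists M => w.
    exact: (measurableT_comp m1).
  - case: bg => m1 [M FM]; split; last by exists M => w.
    exact: (measurableT_comp m1).
rewrite mulrC -ExZ; last exact: bmf_itg.
congr (Ex P _); apply/funext => w /=.
by rewrite ExZ; [rewrite mulrC|exact: bmf_itg].
Qed.

End independent_pair.

Lemma split_lshift m k (i : 'I_m) : fintype.split (lshift k i) = inl i.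
Proof. exact: (unsplitK (inl i)). Qed.

Lemma split_rshift m k (i : 'I_k) : fintype.split (rshift m i) = inr i.
Proof. exact: (unsplitK (inr i)). Qed.

(** * Finite blocks of an i.i.d. sequence *)

Section tuple_rectangles.
Context {d} {E : measurableType d}.

Definition rect m (A : 'I_m -> set E) : set (m.-tuple E) :=
  [set t | forall i, A i (tnth t i)].

Lemma measurable_rect m (A : 'I_m -> set E) :
  (forall i, measurable (A i)) -> measurable (rect A).
Proof.
move=> mA; rewrite (_ : rect A = \bigcap_(i in [set: 'I_m]) ((@tnth _ E)^~ i @^-1` A i)).
  apply: fin_bigcap_measurable => // i _.
  by rewrite -[X in measurable X]setTI; exact: measurable_tnth.
by apply/seteqP; split => t /= tA i; [move=> _|]; exact: tA.
Qed.

(** The tuple sigma-algebra is generated by single coordinates, and a cylinder is a rectangle with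
    [setT] in the other places. Rectangles are preferred because they are stable under intersection,
    as uniqueness of measures requires. *)
Lemma measurable_rectE m :
  (@measurable _ (m.-tuple E)) =
  <<s [set B | exists2 A, (forall i, measurable (A i)) & B = rect (m:=m) A] >>.
Proof.
apply/seteqP; split.
- apply: smallest_sub; first exact: smallest_sigma_algebra.
  case: m => [|m]; first by rewrite big_ord0.
  rewrite -bigcup_mkord_ord; apply: bigcup_sub => i Ii.
  move=> _ [A mA <-]; apply: sub_sigma_algebra => /=.
  exists (fun j => if j == inord i then A else setT).
    by move=> j; case: ifP.
  rewrite setTI; apply/seteqP; split => t /=.
    by move=> At j; case: ifP => // /eqP ->.
  by move=> /(_ (inord i)); rewrite eqxx.
- apply: smallest_sub; first exact: sigma_algebra_measurable.
  by move=> _ [A mA ->]; exact: measurable_rect.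
Qed.

Lemma rect_unique {R : realType} m (m1 m2 : probability (m.-tuple E) R) :
  (forall A, (forall i, measurable (A i)) -> m1 (rect A) = m2 (rect A)) ->
  forall B, measurable B -> m1 B = m2 B.
Proof.
move=> m12 B mB.
apply: (measure_unique _ (fun=> setT) (measurable_rectE m)) => //.
- move=> _ _ [A1 mA1 ->] [A2 mA2 ->]; exists (fun i => A1 i `&` A2 i).
    by move=> i; exact: measurableI.
  apply/seteqP; split => t /=.
    by move=> [t1 t2] i; split; [exact: t1|exact: t2].
  by move=> H; split => i; case: (H i).
- move=> _; exists (fun=> setT) => //.
  by apply/seteqP; split.
- by apply/seteqP; split => // t _; exists 0%N.
- by move=> _ [A mA ->]; exact: m12.
- by move=> _; apply: (le_lt_trans (probability_le1 m1 measurableT)); exact: ltry.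
Qed.

Lemma same_law_rect {d1 d2} {T1 : measurableType d1} {T2 : measurableType d2}
    {R : realType} (P1 : probability T1 R) (P2 : probability T2 R) m
    (U : T1 -> m.-tuple E) (V : T2 -> m.-tuple E) :
  mfunT U -> mfunT V ->
  (forall A, (forall i, measurable (A i)) ->
    P1 (U @^-1` rect A) = P2 (V @^-1` rect A)) ->
  same_law P1 P2 U V.
Proof.
move=> mU mV H A mA; rewrite -(lawE P1 mU) -(lawE P2 mV).
by apply: rect_unique => // B mB; rewrite !lawE; exact: H.
Qed.

End tuple_rectangles.

Section iid_tuples.
Context {dT} {T : measurableType dT} {R : realType}
  {d} {E : measurableType d}.
Variables (P : probability T R) (Z : nat -> T -> E).
Hypotheses (mZ : forall i, mfunT (Z i))
  (indepZ : mutually_independent P Z)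
  (idZ : forall i, same_law P P (Z i) (Z 0)).

Definition pick_tuple m (s : 'I_m -> nat) (w : T) : m.-tuple E :=
  [tuple Z (s i) w | i < m].

Lemma measurable_pick_tuple m (s : 'I_m -> nat) :
  mfunT (pick_tuple s).
Proof.
apply/measurable_fun_tnthP => i.
rewrite (_ : _ \o _ = Z (s i)); first exact: mZ.
by apply/funext => w /=; rewrite tnth_mktuple.
Qed.

Lemma probability_pick_rect m (s : 'I_m -> nat) (A : 'I_m -> set E) :
  injective s -> (forall i, measurable (A i)) ->
  P (pick_tuple s @^-1` rect A) = (\prod_(i < m) P (Z 0 @^-1` A i))%E.
Proof.
move=> sI mA.
(* Mutual independence takes sets indexed by all of [nat]. The value off the image of [s] is
   immaterial, since [J] is that image. *)
pose A' j := if [pick i | s i == j] is Some i then A i else setT.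
have A'E i : A' (s i) = A i.
  rewrite /A'; case: pickP => [k /eqP/sI -> //|/(_ i)]; by rewrite eqxx.
have mA' j : measurable (A' j) by rewrite /A'; case: pickP.
pose J := [fset s i | i in [set: 'I_m]%SET]%fset.
have := indepZ J mA'.
rewrite (_ : \bigcap_(i in _) _ = pick_tuple s @^-1` rect A); last first.
  apply/seteqP; split => w /=.
    move=> H i; rewrite tnth_mktuple; rewrite -A'E; apply: H => /=.
    by apply/imfsetP; exists i; rewrite ?inE.
  rewrite /J => H j /= /imfsetP[i _ ->]; rewrite A'E.
  by have := H i; rewrite tnth_mktuple.
move=> ->; rewrite big_imfset/=; last by move=> i j _ _; exact: sI.
rewrite big_enum /=; apply: eq_big => [i|i _]; first by rewrite inE.
by rewrite A'E; apply: idZ.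
Qed.

Lemma same_law_pick m (s t : 'I_m -> nat) : injective s -> injective t ->
  same_law P P (pick_tuple s) (pick_tuple t).
Proof.
move=> sI tI; apply: same_law_rect; [exact: measurable_pick_tuple..|].
by move=> A mA; rewrite !probability_pick_rect.
Qed.

(** The concatenated tuple has the law of a tuple [V] on [T * T] whose two blocks read different
    coordinates, since both give the same product on rectangles. Equality of laws on the set [W] is
    then the independence of the blocks. *)
Lemma independent_pick m k (s : 'I_m -> nat) (t : 'I_k -> nat) :
  injective s -> injective t -> (forall i j, s i != t j) ->
  independent_RV P (pick_tuple s) (pick_tuple t).
Proof.
move=> sI tI st A B mA mB.
pose r (i : 'I_(m + k)) := match fintype.split i with inl a => s a | inr b => t b end.
have rI : injective r.
  move=> i j; rewrite /r; case: (split_ordP i) => i' ->;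
    case: (split_ordP j) => j' -> ; rewrite ?split_lshift ?split_rshift; last by move/tI ->.
  - by move/sI ->.
  - by move/eqP; rewrite (negbTE (st _ _)).
  - by move/eqP; rewrite eq_sym (negbTE (st _ _)).
pose V (z : T * T) : (m + k).-tuple E :=
  [tuple (match fintype.split i with inl a => Z (s a) z.1 | inr b => Z (t b) z.2 end) | i < m + k].
have mV : mfunT V.
  apply/measurable_fun_tnthP => i.
  rewrite (_ : _ \o _ = fun z => match fintype.split i with inl a => Z (s a) z.1 | inr b => Z (t b) z.2 end); last first.
    by apply/funext => w /=; rewrite tnth_mktuple.
  by case: (fintype.split i) => a; apply: measurableT_comp.
have rV : same_law P (P \x P)%E (pick_tuple r) V.
  apply: same_law_rect => //; first exact: measurable_pick_tuple.
  move=> C mC; rewrite probability_pick_rect//.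
  rewrite (_ : V @^-1` rect C =
     (pick_tuple s @^-1` rect (fun a => C (lshift k a))) `*`
     (pick_tuple t @^-1` rect (fun b => C (rshift m b)))); last first.
    apply/seteqP; split => -[w w'] /=.
      move=> H; split => i.
        by have := H (lshift k i); rewrite !tnth_mktuple split_lshift.
      by have := H (rshift m i); rewrite !tnth_mktuple split_rshift.
    move=> [H1 H2] i; rewrite tnth_mktuple; case: (split_ordP i) => j ->.
      by have := H1 j; rewrite tnth_mktuple.
    by have := H2 j; rewrite tnth_mktuple.
  have mp n (u : 'I_n -> nat) (D : 'I_n -> set E) : (forall i, measurable (D i)) ->
      measurable (pick_tuple u @^-1` rect D).
    move=> mD; rewrite -[X in measurable X]setTI.
    by apply: measurable_pick_tuple => //; exact: measurable_rect.
  apply: (@etrans _ _ (P (pick_tuple s @^-1` rect (fun a => C (lshift k a))) *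
     P (pick_tuple t @^-1` rect (fun b => C (rshift m b))))%E); last first.
    have m1 := mp _ s _ (fun a => mC (lshift k a)).
    have m2 := mp _ t _ (fun b => mC (rshift m b)).
    move: m1 m2; move: (_ @^-1` _) => X1; move: (_ @^-1` _) => X2 m1 m2.
    by rewrite (probability_prodE_prob P P m1 m2).
  by rewrite !probability_pick_rect// big_split_ord.
pose W : set ((m + k).-tuple E) :=
  [set x | A [tuple tnth x (lshift k i) | i < m] /\ B [tuple tnth x (rshift m i) | i < k]].
have mW : measurable W.
  have m1 : mfunT (fun x : (m + k).-tuple E => [tuple tnth x (lshift k i) | i < m]).
    apply/measurable_fun_tnthP => i; rewrite (_ : _ \o _ = (@tnth _ E)^~ (lshift k i)).
      exact: measurable_tnth.
    by apply/funext => x /=; rewrite tnth_mktuple.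
  have m2 : mfunT (fun x : (m + k).-tuple E => [tuple tnth x (rshift m i) | i < k]).
    apply/measurable_fun_tnthP => i; rewrite (_ : _ \o _ = (@tnth _ E)^~ (rshift m i)).
      exact: measurable_tnth.
    by apply/funext => x /=; rewrite tnth_mktuple.
  apply: measurableI; rewrite -[X in measurable X]setTI; [exact: m1|exact: m2].
have r1 w : [tuple tnth (pick_tuple r w) (lshift k i) | i < m] = pick_tuple s w.
  by apply: eq_from_tnth => i; rewrite !tnth_mktuple /r split_lshift.
have r2 w : [tuple tnth (pick_tuple r w) (rshift m i) | i < k] = pick_tuple t w.
  by apply: eq_from_tnth => i; rewrite !tnth_mktuple /r split_rshift.
have v1 z : [tuple tnth (V z) (lshift k i) | i < m] = pick_tuple s z.1.
  by apply: eq_from_tnth => i; rewrite !tnth_mktuple split_lshift.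
have v2 z : [tuple tnth (V z) (rshift m i) | i < k] = pick_tuple t z.2.
  by apply: eq_from_tnth => i; rewrite !tnth_mktuple split_rshift.
have rW : pick_tuple r @^-1` W = pick_tuple s @^-1` A `&` pick_tuple t @^-1` B.
  by apply/funext => w; rewrite /W /preimage/= r1 r2.
have VW : V @^-1` W = (pick_tuple s @^-1` A) `*` (pick_tuple t @^-1` B).
  by apply/funext => z; rewrite /W /preimage/= v1 v2.
have := rV W mW; rewrite rW VW => ->.
have m1 : measurable (pick_tuple s @^-1` A).
  by rewrite -[X in measurable X]setTI; exact: measurable_pick_tuple.
have m2 : measurable (pick_tuple t @^-1` B).
  by rewrite -[X in measurable X]setTI; exact: measurable_pick_tuple.
move: m1 m2; move: (_ @^-1` A) => X1; move: (_ @^-1` B) => X2 m1 m2.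
by rewrite (probability_prodE_prob P P m1 m2).
Qed.

End iid_tuples.

(** * Statistics of a sequence and the Efron-Stein bound *)

Section statistics.
Context {R : realType} {d} {E : measurableType d}.
Implicit Types (f g : (nat -> E) -> R) (F : (nat -> E) -> (nat -> E) -> R).

Definition mfamily {d'} {S : measurableType d'} (z : S -> nat -> E) : Prop :=
  forall i, mfunT (fun s => z s i).

(** No sigma-algebra is put on [nat -> E]: a statistic is measurable when it is so along every
    measurable family of sequences. This passes at once to re-indexed sequences [z \o s]. *)
Definition bstat f : Prop :=
  (forall d' (S : measurableType d') (z : S -> nat -> E), mfamily z ->
    mfunT (fun s => f (z s))) /\
  exists M, forall z, `|f z| <= M.

Definition bstat2 F : Prop :=
  (forall d' (S : measurableType d') (z z' : S -> nat -> E), mfamily z ->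
    mfamily z' -> mfunT (fun s => F (z s) (z' s))) /\
  exists M, forall z z', `|F z z'| <= M.

Definition depends m f : Prop :=
  forall z z', (forall i, (i < m)%N -> z i = z' i) -> f z = f z'.

Lemma bstat_bmf f {d'} {S : measurableType d'} (z : S -> nat -> E) :
  bstat f -> mfamily z -> bmf (fun s => f (z s)).
Proof. by move=> [mf [M fM]] mz; split; [exact: mf|exists M => s]. Qed.

Lemma bstat2_bmf F {d'} {S : measurableType d'} (z z' : S -> nat -> E) :
  bstat2 F -> mfamily z -> mfamily z' -> bmf (fun s => F (z s) (z' s)).
Proof. by move=> [mf [M fM]] mz mz'; split; [exact: mf|exists M => s]. Qed.

Lemma bstatM f g : bstat f -> bstat g -> bstat (fun z => f z * g z).
Proof.
move=> [mf [M fM]] [mg [N gN]]; split.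
  by move=> d' S z mz; apply: measurable_funM; [exact: mf|exact: mg].
by exists (M * N) => z; rewrite normrM ler_pM.
Qed.

Lemma bstatD f g : bstat f -> bstat g -> bstat (fun z => f z + g z).
Proof.
move=> [mf [M fM]] [mg [N gN]]; split.
  by move=> d' S z mz; apply: measurable_funD; [exact: mf|exact: mg].
by exists (M + N) => z; rewrite (le_trans (ler_normD _ _))// lerD.
Qed.

Lemma bstat_cst c : bstat (fun=> c).
Proof. by split; [move=> *; exact: measurable_cst|exists `|c|]. Qed.

Lemma bstatN f : bstat f -> bstat (fun z => - f z).
Proof.
move=> bf; under eq_fun do rewrite -mulN1r.
by apply: bstatM => //; exact: bstat_cst.
Qed.

Lemma bstatB f g : bstat f -> bstat g -> bstat (fun z => f z - g z).
Proof. by move=> bf bg; apply: bstatD => //; exact: bstatN. Qed.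

Lemma bstatZ c f : bstat f -> bstat (fun z => c * f z).
Proof. by move=> bf; apply: bstatM => //; exact: bstat_cst. Qed.

Lemma bstatX n f : bstat f -> bstat (fun z => f z ^+ n).
Proof.
move=> bf; elim: n => [|n IH]; first exact: bstat_cst.
by under eq_fun do rewrite exprS; exact: bstatM.
Qed.

Lemma bstat_sum (I : Type) (s : seq I) (Q : pred I) (G : I -> (nat -> E) -> R) :
  (forall i, Q i -> bstat (G i)) -> bstat (fun z => \sum_(i <- s | Q i) G i z).
Proof.
move=> bF; elim: s => [|i s IH].
  by under eq_fun do rewrite big_nil; exact: bstat_cst.
under eq_fun do rewrite big_cons.
by case Qi: (Q i) => //; apply: bstatD => //; exact: bF.
Qed.

Lemma bstat_comp f (s : nat -> nat) : bstat f -> bstat (fun z => f (z \o s)).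
Proof.
move=> [mf [M fM]]; split; last by exists M => z.
by move=> d' S z mz; apply: (mf _ _ (fun x => z x \o s)) => i; exact: mz.
Qed.

Lemma bstat_coord (h : E -> R) i : bmf h -> bstat (fun z => h (z i)).
Proof.
move=> [mh [M hM]]; split; last by exists M => z.
by move=> d' S z mz; apply: (measurableT_comp mh); exact: mz.
Qed.

Lemma dependsW m n f : (m <= n)%N -> depends m f -> depends n f.
Proof.
by move=> mn df z z' zz'; apply: df => i im; apply: zz'; exact: leq_trans mn.
Qed.

End statistics.

Section iid_statistics.
Context {dT} {T : measurableType dT} {R : realType}
  {d} {E : measurableType d}.
Variables (P : probability T R) (Z : nat -> T -> E).
Hypotheses (mZ : forall i, mfunT (Z i))
  (indepZ : mutually_independent P Z)
  (idZ : forall i, same_law P P (Z i) (Z 0)).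

Definition smp (w : T) : nat -> E := fun i => Z i w.

Lemma mfamily_smp : mfamily smp. Proof. by []. Qed.

Lemma mfamily_smp_comp s : mfamily (fun w => smp w \o s).
Proof. by move=> i; exact: mZ. Qed.

Hint Resolve mfamily_smp mfamily_smp_comp : core.

Definition inj_below m (s : nat -> nat) : Prop :=
  forall i j, (i < m)%N -> (j < m)%N -> s i = s j -> i = j.

Let seqt m (t : m.-tuple E) : nat -> E := nth (Z 0 point) t.

Let mfamily_seqt m : mfamily (@seqt m).
Proof.
move=> i; have [im|im] := ltnP i m.
  rewrite (_ : (fun _ => _) = (@tnth m E)^~ (Ordinal im)); first exact: measurable_tnth.
  by apply/funext => t; rewrite (tnth_nth (Z 0 point)).
rewrite (_ : (fun _ => _) = fun=> Z 0 point); first exact: measurable_cst.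
by apply/funext => t; rewrite /seqt nth_default// size_tuple.
Qed.

Let seqt_pick m (s : nat -> nat) w i : (i < m)%N ->
  seqt (pick_tuple Z (fun i : 'I_m => s i) w) i = (smp w \o s) i.
Proof.
move=> im; rewrite /seqt -(tnth_nth _ _ (Ordinal im)) tnth_mktuple//.
Qed.

Let injI m s : inj_below m s -> injective (fun i : 'I_m => s i).
Proof. by move=> sI i j /(sI i j (ltn_ord i) (ltn_ord j)) ij; exact: val_inj. Qed.

(** Only the first [m] coordinates are read, and [m] distinct observations have the law of the first
    [m]. *)
Lemma Ex_exchangeable m s f : bstat f -> depends m f -> inj_below m s ->
  Ex P (fun w => f (smp w \o s)) = Ex P (fun w => f (smp w)).
Proof.
move=> bf df sI.
have E1 u : Ex P (fun w => f (smp w \o u)) =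
    Ex P ((fun t => f (seqt t)) \o pick_tuple Z (fun i : 'I_m => u i)).
  by congr (Ex P _); apply/funext => w /=; apply: df => i im; rewrite seqt_pick.
rewrite E1 (_ : (fun w => f (smp w)) = fun w => f (smp w \o id))// (E1 id).
have mp (u : 'I_m -> nat) := measurable_pick_tuple mZ u.
apply: Ex_same_law; [exact: mp|exact: mp| | |].
- by apply: same_law_pick => //; [exact: injI|exact: val_inj].
- apply: bmf_itg; apply: (bstat_bmf (z := fun w => seqt (pick_tuple Z _ w)) bf).
  by move=> i; apply: (measurableT_comp (@mfamily_seqt m i)); exact: mp.
- by case: (bstat_bmf bf (@mfamily_seqt m)).
Qed.

(** The substitute for conditioning: of two groups of observations with disjoint indices, the second
    may be drawn afresh from an independent [w']. With a group of size one it conditions on a single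
    observation. *)
Lemma Ex_blocks m k s t F : bstat2 F ->
  (forall z', depends m (F^~ z')) -> (forall z, depends k (F z)) ->
  inj_below m s -> inj_below k t ->
  (forall i j, (i < m)%N -> (j < k)%N -> s i != t j) ->
  Ex P (fun w => F (smp w \o s) (smp w \o t)) =
  Ex P (fun w => Ex P (fun w' => F (smp w \o s) (smp w' \o t))).
Proof.
move=> bF dF1 dF2 sI tI st.
pose ps := pick_tuple Z (fun i : 'I_m => s i).
pose pt := pick_tuple Z (fun i : 'I_k => t i).
have FE w w' : F (smp w \o s) (smp w' \o t) = F (seqt (ps w)) (seqt (pt w')).
  rewrite (dF1 _ _ (seqt (ps w))); last by move=> i im; rewrite seqt_pick.
  by apply: dF2 => i im; rewrite seqt_pick.
rewrite (_ : (fun w => F (smp w \o s) (smp w \o t)) =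
  fun w => (fun p => F (seqt p.1) (seqt p.2)) (ps w, pt w)); last first.
  by apply/funext => w; rewrite FE.
rewrite (Ex_independent (U := ps) (V := pt) _ _ _ (F := fun p => F (seqt p.1) (seqt p.2))).
- congr (Ex P _); apply/funext => w; congr (Ex P _); apply/funext => w'.
  by rewrite FE.
- exact: measurable_pick_tuple.
- exact: measurable_pick_tuple.
- apply: independent_pick => //; [exact: injI|exact: injI|].
  by move=> i j; apply: st.
- apply: (bstat2_bmf bF) => i.
    by apply: (measurableT_comp (@mfamily_seqt m i)).
  by apply: (measurableT_comp (@mfamily_seqt k i)).
Qed.

Definition swapn i n (j : nat) : nat :=
  if j == i then n else if j == n then i else j.

Section efron_stein.
Variables (n : nat) (f c : (nat -> E) -> R).
Hypotheses (bf : bstat f) (bc : bstat c) (df : depends n f)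
  (dc : depends n.+1 c)
  (sc : forall i z, (i < n)%N -> c (z \o swapn i n) = c z).

Let D := Ex P (fun w => (f (smp w) - c (smp w)) ^+ 2).

Let bitg g : bstat g -> itg P (fun w => g (smp w)).
Proof. by move=> bg; apply: bmf_itg; exact: bstat_bmf. Qed.

Let bitgs g s : bstat g -> itg P (fun w => g (smp w \o s)).
Proof. by move=> bg; apply: (bitg (bstat_comp s bg)). Qed.

(** As [c] is unchanged when [i] and [n] are exchanged, both values of [f] are compared with the
    same [c], by [(a - b)^2 <= 2 (a - c)^2 + 2 (b - c)^2]. In the applications [c] is the same
    statistic on one more observation. *)
Let swap_le e i : (i < n)%N -> inj_below n.+1 e ->
  Ex P (fun w => (f (smp w \o e) - f (smp w \o e \o swapn i n)) ^+ 2) <= 4 * D.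
Proof.
move=> i_n eI.
have E1 s : inj_below n.+1 s ->
    Ex P (fun w => (f (smp w \o s) - c (smp w \o s)) ^+ 2) = D.
  move=> sI; apply: (@Ex_exchangeable n.+1 s (fun z => (f z - c z) ^+ 2)) => //.
    by apply: bstatX; exact: bstatB.
  move=> z z' zz'; rewrite (df (z':=z')) ?(dc (z':=z'))// => j jn.
  by apply: zz'; exact: ltnW.
have sI : inj_below n.+1 (e \o swapn i n).
  move=> j k jn kn /= /eI; rewrite /swapn => H; apply/eqP; move: H.
  by do !case: ifP => /eqP; lia.
have bd : bstat (fun z => (f z - c z) ^+ 2) by apply: bstatX; exact: bstatB.
have A1 := E1 _ eI.
have scE w : c (smp w \o e \o swapn i n) = c (smp w \o e) by exact: sc.
have A2 : Ex P (fun w => (f (smp w \o e \o swapn i n) - c (smp w \o e)) ^+ 2) = D.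
  by rewrite -[RHS](E1 _ sI); congr (Ex P _); apply/funext => w; rewrite -scE.
have I2 : itg P (fun w => (f (smp w \o e \o swapn i n) - c (smp w \o e)) ^+ 2).
  rewrite (_ : (fun _ => _) = (fun w => (f (smp w \o e \o swapn i n) -
      c (smp w \o e \o swapn i n)) ^+ 2)); last by apply/funext => w; rewrite scE.
  exact: (bitgs (e \o swapn i n) bd).
have I1 := bitgs e bd.
have -> : 4 * D = Ex P (fun w => 2 * (f (smp w \o e) - c (smp w \o e)) ^+ 2 +
    2 * (f (smp w \o e \o swapn i n) - c (smp w \o e)) ^+ 2).
  by rewrite ExD ?ExZ ?A1 ?A2; [ring|exact: I2|exact: I1|exact: itgZ I1|exact: itgZ I2].
apply: le_Ex.
- apply: (bitgs e (g := fun z => (f z - f (z \o swapn i n)) ^+ 2)).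
  by apply: bstatX; apply: bstatB => //; exact: bstat_comp.
- by apply: itgD; apply: itgZ.
- move=> w; set a := f _; set b := f _; set u := c _.
  rewrite -subr_ge0 (_ : _ - _ = (a + b - 2 * u) ^+ 2) ?sqr_ge0//; ring.
Qed.

(* Chatterjee's proof of the Efron-Stein inequality: with an independent copy
   at indices [n, 2n), telescope [f(Z) - f(Z')] over the hybrids [hyb i], and
   symmetrize each increment by exchanging the indices [i] and [n + i]. *)
Lemma variance_le_add_one :
  Ex P (fun w => (f (smp w) - Ex P (fun w => f (smp w))) ^+ 2) <=
  2 * n%:R * Ex P (fun w => (f (smp w) - c (smp w)) ^+ 2).
Proof.
pose hyb i j := if (j < i)%N then (n + j)%N else j.
set m := Ex P (fun w => f (smp w)).
have vE : Ex P (fun w => (f (smp w) - m) ^+ 2) =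
    Ex P (fun w => f (smp w) * (f (smp w \o hyb 0) - f (smp w \o hyb n))).
  have -> : (fun w => f (smp w) * (f (smp w \o hyb 0) - f (smp w \o hyb n))) =
     (fun w => f (smp w) ^+ 2 - f (smp w) * f (smp w \o hyb n)).
    by apply/funext => w; rewrite mulrBr; congr (_ - _); rewrite expr2.
  rewrite ExB; last 2 first.
  - by apply: (bitg (g := fun z => f z ^+ 2)); exact: bstatX.
  - apply: (bitg (g := fun z => f z * f (z \o hyb n))).
    by apply: bstatM => //; exact: bstat_comp.
  have -> : Ex P (fun w => f (smp w) * f (smp w \o hyb n)) = m ^+ 2.
    have := @Ex_blocks n n id (addn n) (fun z z' => f z * f z').
    rewrite (_ : (fun w => f (smp w \o id) * f (smp w \o addn n)) =
       (fun w => f (smp w) * f (smp w \o hyb n))); last first.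
      apply/funext => w; congr (_ * _); apply: df => i i_n.
      by rewrite /hyb/= i_n.
    move=> ->.
    - have -> : (fun w => Ex P (fun w' => f (smp w \o id) * f (smp w' \o addn n))) =
         (fun w => m * f (smp w)).
        apply/funext => w; rewrite ExZ; last exact: bitgs.
        rewrite (@Ex_exchangeable n (addn n) f)// 1?mulrC//.
        by move=> i j _ _ /addnI.
      by rewrite ExZ ?expr2//; exact: bitg.
    - split; last first.
        case: bf => _ [M fM]; exists (M * M) => z z'.
        by rewrite normrM ler_pM.
      move=> d' S z z' mz mz'; apply: measurable_funM; first by case: (bstat_bmf bf mz).
      by case: (bstat_bmf bf mz').
    - by move=> z' z1 z2 z12; congr (_ * _); exact: df.
    - by move=> z' z1 z2 z12; congr (_ * _); exact: df.
    - by [].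
    - by move=> i j _ _ /addnI.
    - by move=> i j i_n j_n; lia.
  have -> : (fun w => (f (smp w) - m) ^+ 2) =
      (fun w => f (smp w) ^+ 2 - (2 * m * f (smp w) - m ^+ 2)).
    by apply/funext => w; ring.
  have i2 : itg P (fun w => f (smp w) ^+ 2).
    by apply: (bitg (g := fun z => f z ^+ 2)); exact: bstatX.
  have i1 := itgZ (2 * m) (bitg bf).
  have i0 := itg_cst P (m ^+ 2).
  rewrite ExB//; last exact: itgB.
  rewrite ExB// Ex_cst ExZ; last exact: bitg.
  by rewrite -/m; ring.
have step i : (i < n)%N ->
    Ex P (fun w => f (smp w) * (f (smp w \o hyb i) - f (smp w \o hyb i.+1))) <= 2 * D.
  move=> i_n.
  have dh k : (k <= n)%N -> depends (n + n) (fun z : nat -> E => f (z \o hyb k)).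
    by move=> kn z z' zz'; apply: df => j jn /=; apply: zz'; rewrite /hyb; case: ifP; lia.
  have bh k : bstat (fun z => f (z \o hyb k)) by exact: bstat_comp.
  have dn : depends (n + n) f by apply: dependsW df; lia.
  pose g z := f z * (f (z \o hyb i) - f (z \o hyb i.+1)).
  have bg : bstat g by apply: bstatM => //; exact: bstatB.
  have tI : inj_below (n + n) (swapn i (n + i)).
    move=> j k jn kn /=; rewrite /swapn => H; apply/eqP; move: H.
    by do !case: ifP => /eqP; lia.
  have := @Ex_exchangeable (n + n) (swapn i (n + i)) g bg _ tI.
  rewrite (_ : (fun w => g (smp w \o swapn i (n + i))) =
    (fun w => f (smp w \o swapn i (n + i)) * (f (smp w \o hyb i.+1) - f (smp w \o hyb i)))); last first.
    apply/funext => w; rewrite /g; congr (_ * (_ - _)); apply: df => j jn /=;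
      congr (smp w); rewrite /hyb /swapn;
      by do !case: ifP => //; lia.
  move=> gE.
  have -> : Ex P (fun w => g (smp w)) =
     2^-1 * Ex P (fun w => (f (smp w) - f (smp w \o swapn i (n + i))) *
       (f (smp w \o hyb i) - f (smp w \o hyb i.+1))).
    apply: (@mulfI _ 2) => //; rewrite mulrA divff// mul1r.
    rewrite mulr_natl mulr2n -{2}gE; last first.
      move=> z z' zz'; rewrite /g (dn _ _ zz') (dh i _ _ _ zz') 1?ltnW//.
      by rewrite (dh i.+1 _ _ _ zz').
    rewrite -ExD.
    - by congr (Ex P _); apply/funext => w; rewrite /g; ring.
    - exact: bitg.
    - apply: (bitg (g := fun z => f (z \o swapn i (n + i)) * (f (z \o hyb i.+1) - f (z \o hyb i)))).
      by apply: bstatM; [exact: bstat_comp|exact: bstatB].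
  (* Both increments replace coordinate [i] by the fresh observation [n + i]. Read through [e1] and
     [e2] they become exchanges with the last index of a sample of size [n + 1], which is the
     setting of [swap_le]. *)
  pose e1 j := if j == n then (n + i)%N else j.
  pose e2 j := if j == n then (n + i)%N else hyb i j.
  have e1I : inj_below n.+1 e1.
    by move=> j k jn kn; rewrite /e1; do !case: ifP => /eqP; lia.
  have e2I : inj_below n.+1 e2.
    move=> j k jn kn; rewrite /e2 /hyb => H; apply/eqP; move: H.
    by do !case: ifP => ?; lia.
  have := swap_le i_n e1I; have := swap_le i_n e2I.
  set A := (X in Ex P X <= _); set B := (X in _ -> Ex P X <= _ -> _).
  have AE : A = fun w => (f (smp w \o hyb i) - f (smp w \o hyb i.+1)) ^+ 2.
    apply/funext => w; rewrite /A; congr ((_ - _) ^+ 2); apply: df => j jn /=;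
      congr (smp w); rewrite /e2 /hyb /swapn;
      by do !case: ifP => //; lia.
  have BE : B = fun w => (f (smp w) - f (smp w \o swapn i (n + i))) ^+ 2.
    apply/funext => w; rewrite /B; congr ((_ - _) ^+ 2); apply: df => j jn /=;
      congr (smp w); rewrite /e1 /swapn;
      by do !case: ifP => //; lia.
  rewrite AE BE => hA hB.
  have bA : bstat (fun z => (f (z \o hyb i) - f (z \o hyb i.+1)) ^+ 2).
    by apply: bstatX; exact: bstatB.
  have bB : bstat (fun z => (f z - f (z \o swapn i (n + i))) ^+ 2).
    by apply: bstatX; apply: bstatB => //; exact: bstat_comp.
  have : Ex P (fun w => (f (smp w) - f (smp w \o swapn i (n + i))) *
       (f (smp w \o hyb i) - f (smp w \o hyb i.+1))) <=
    Ex P (fun w => 2^-1 * (f (smp w) - f (smp w \o swapn i (n + i))) ^+ 2 +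
      2^-1 * (f (smp w \o hyb i) - f (smp w \o hyb i.+1)) ^+ 2).
    apply: le_Ex.
    - apply: (bitg (g := fun z => (f z - f (z \o swapn i (n + i))) * (f (z \o hyb i) - f (z \o hyb i.+1)))).
      by apply: bstatM; apply: bstatB => //; exact: bstat_comp.
    - by apply: itgD; apply: itgZ; [exact: (bitg bB)|exact: (bitg bA)].
    - move=> w; set a := _ - _; set b := _ - _.
      have := sqr_ge0 (a - b); rewrite sqrrB; lra.
  rewrite ExD ?ExZ; [|exact: (bitg bA)|exact: (bitg bB)|by apply: itgZ; exact: (bitg bB)|by apply: itgZ; exact: (bitg bA)].
  by rewrite -/D; lra.
rewrite vE.
have -> : (fun w => f (smp w) * (f (smp w \o hyb 0) - f (smp w \o hyb n))) =
    (fun w => \sum_(i < n) f (smp w) * (f (smp w \o hyb i) - f (smp w \o hyb i.+1))).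
  apply/funext => w; rewrite -mulr_sumr; congr (_ * _).
  rewrite -(big_mkord xpredT (fun i => f (smp w \o hyb i) - f (smp w \o hyb i.+1))).
  under eq_bigr do rewrite -opprB.
  by rewrite sumrN telescope_sumr// opprB.
rewrite Ex_sum; last first.
  move=> i _; apply: (bitg (g := fun z => f z * (f (z \o hyb i) - f (z \o hyb i.+1)))).
  by apply: bstatM => //; apply: bstatB; exact: bstat_comp.
apply: (@le_trans _ _ (\sum_(i < n) 2 * D)).
  by apply: ler_sum => i _; exact: step.
by rewrite sumr_const card_ord -[_ *+ n]mulr_natr mulrAC.
Qed.

End efron_stein.

End iid_statistics.

(** * Hardy's inequality for a total relation *)

Section hardy.
Context {R : realFieldType} {I : finType}.
Variables (r : rel I) (w : I -> R).
Hypotheses (rtot : total r) (w0 : forall k, 0 <= w k).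

Let N k : R := \sum_i (r k i)%:R.
Let x k : R := w k / N k.
Let A i : R := \sum_k (r k i)%:R * x k.

Let N_gt0 k : 0 < N k.
Proof.
rewrite /N (bigD1 k)//= ltr_pwDl//; last by apply: sumr_ge0.
by have := rtot k k; rewrite orbb => ->.
Qed.

Let x_ge0 k : 0 <= x k.
Proof. by rewrite divr_ge0// ltW. Qed.

(** In the double sum over pairs [k], [l], totality puts one of the two below the other; each half
    is then a sum in which the lower index runs under the upper one. *)
Let A_sqr i : A i ^+ 2 <= 2 * \sum_k (r k i)%:R * x k * A k.
Proof.
have -> : A i ^+ 2 = \sum_k \sum_l (r k i)%:R * (r l i)%:R * (x k * x l).
  rewrite expr2 /A mulr_suml; apply: eq_bigr => k _; rewrite mulr_sumr.
  by apply: eq_bigr => l _; ring.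
apply: (@le_trans _ _ (\sum_k \sum_l ((r k i)%:R * (r l k)%:R * (x k * x l) +
    (r l i)%:R * (r k l)%:R * (x k * x l)))).
  apply: ler_sum => k _; apply: ler_sum => l _.
  rewrite -mulrDl ler_wpM2r//; first by rewrite mulr_ge0 ?x_ge0.
  rewrite -!natrM -natrD ler_nat.
  by have := rtot k l; case: (r k l); case: (r l k) => //= _; case: (r k i); case: (r l i).
under eq_bigr do rewrite big_split/=.
rewrite big_split/= [X in _ + X]exchange_big/= mulr_natl mulr2n.
rewrite (_ : \sum_k \sum_l _ = \sum_k (r k i)%:R * x k * A k); last first.
  apply: eq_bigr => k _; rewrite /A mulr_sumr; apply: eq_bigr => l _; ring.
rewrite lerD2l le_eqVlt; apply/orP; left; apply/eqP.
by apply: eq_bigr => k _; rewrite /A mulr_sumr; apply: eq_bigr => l _; ring.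
Qed.

(** Summing [A_sqr] over [i] makes the count of the successors of [k] appear, which cancels the
    denominator of [x k] and leaves [2 * \sum_k w k * A k]. Absorbing half of the sum of [A k ^+ 2]
    yields the constant 4. Stated for a relation, it applies to both [<=] and [>=] on the sample
    without sorting it. *)
Lemma hardy_total :
  \sum_i (\sum_k (r k i)%:R * (w k / \sum_j (r k j)%:R)) ^+ 2 <=
  4 * \sum_k w k ^+ 2.
Proof.
have H : \sum_i A i ^+ 2 <= 2 * \sum_k w k * A k.
  apply: (le_trans (ler_sum _ (fun i _ => A_sqr i))).
  rewrite -mulr_sumr exchange_big/= ler_pM2l// le_eqVlt; apply/orP; left; apply/eqP.
  apply: eq_bigr => k _; rewrite -!mulr_suml -/(N k) /x.
  by rewrite mulrCA divff ?mulr1// gt_eqF.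
have H2 : 2 * \sum_k w k * A k <= \sum_k (2 * w k ^+ 2 + A k ^+ 2 / 2).
  rewrite mulr_sumr; apply: ler_sum => k _.
  have := sqr_ge0 (2 * w k - A k); rewrite sqrrB exprMn; lra.
have := le_trans H H2; rewrite big_split/= -mulr_sumr -mulr_suml => H3.
rewrite -/(\sum_i A i ^+ 2); set a := (X in X <= _).
have {}H3 : a <= 2 * (\sum_i w i ^+ 2) + a / 2 by exact: H3.
by move: H3; set b := \sum_i _; lra.
Qed.

End hardy.

(** * Ranks and deletion of one observation *)

Section swap_last.

Lemma swapnK i n : involutive (swapn i n).
Proof. by move=> j; rewrite /swapn; do !case: ifP => /eqP; lia. Qed.

Lemma swapn_ltn i n j : (i <= n)%N -> (j < n.+1)%N -> (swapn i n j < n.+1)%N.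
Proof. by move=> i_n jn; rewrite /swapn; do !case: ifP => ?; lia. Qed.

(** After exchanging [i] with [n], the first [n] positions carry the sample with [i] left out.
    Deletion is thus expressed by a permutation, to which exchangeability applies. *)
Lemma big_swapn {A : Type} {idx : A} (op : Monoid.com_law idx) i n (F : nat -> A) :
  (i <= n)%N ->
  \big[op/idx]_(k < n) F (swapn i n k) = \big[op/idx]_(k < n.+1 | k != i :> nat) F k.
Proof.
move=> i_n.
pose s (k : 'I_n.+1) : 'I_n.+1 := Ordinal (swapn_ltn i_n (ltn_ord k)).
have sK : involutive s by move=> k; apply: val_inj; exact: swapnK.
rewrite [RHS](reindex_inj (inv_inj sK)) /= [RHS]big_mkcond big_ord_recr /=.
have -> /= : swapn i n n == i by rewrite /swapn eqxx; case: ifP => // /eqP ->.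
rewrite Monoid.mulm1; apply: eq_bigr => k _.
rewrite /swapn; have := ltn_ord k; do !case: ifP => //; lia.
Qed.

Lemma big_swapn_all {A : Type} {idx : A} (op : Monoid.com_law idx) i n (F : nat -> A) :
  (i <= n)%N ->
  \big[op/idx]_(k < n.+1) F (swapn i n k) = \big[op/idx]_(k < n.+1) F k.
Proof.
move=> i_n.
pose s (k : 'I_n.+1) : 'I_n.+1 := Ordinal (swapn_ltn i_n (ltn_ord k)).
have sK : involutive s by move=> k; apply: val_inj; exact: swapnK.
by rewrite [RHS](reindex_inj (inv_inj sK)).
Qed.

End swap_last.

Section ranks.
Context {R : realType}.
Implicit Types (x y : nat -> R) (h : nat -> R).

Definition distinct n x : Prop :=
  forall i j, (i < n)%N -> (j < n)%N -> x i = x j -> i = j.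

Lemma rank_in_swapn i n x k : (i <= n)%N ->
  rank_in n (x \o swapn i n) k =
  (rank_in n.+1 x (swapn i n k) - (x i <= x (swapn i n k))%R)%N.
Proof.
move=> i_n; rewrite /rank_in /=.
rewrite (big_swapn _ (fun j => (x j <= x (swapn i n k))%R : nat) i_n).
rewrite [in RHS](bigD1 (Ordinal (i_n : (i < n.+1)%N)))//= addKn.
by apply: eq_bigl => j.
Qed.

Lemma rank_in_swapn_all i n x k : (i <= n)%N ->
  rank_in n.+1 (x \o swapn i n) k = rank_in n.+1 x (swapn i n k).
Proof.
move=> i_n; rewrite /rank_in /=.
exact: (big_swapn_all _ (fun j => (x j <= x (swapn i n k))%R : nat) i_n).
Qed.

Lemma rank_in_gt0 n x k : (k < n)%N -> (0 < rank_in n x k)%N.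
Proof.
by move=> kn; rewrite /rank_in (bigD1 (Ordinal kn))//= lexx.
Qed.

Lemma rank_in_le n x k : (rank_in n x k <= n)%N.
Proof.
rewrite -[leqRHS](card_ord n) -sum1_card; apply: leq_sum => j _.
exact: leq_b1.
Qed.

Lemma rank_in_lt n x i j : (j < n)%N -> x i < x j ->
  (rank_in n x i < rank_in n x j)%N.
Proof.
move=> jn xij; rewrite /rank_in (bigD1 (Ordinal jn))//=.
rewrite [ltnRHS](bigD1 (Ordinal jn))//= lexx leNgt xij add0n add1n ltnS.
apply: leq_sum => k _; case: (leP (x k) (x i)) => // xki.
by rewrite (le_trans xki (ltW xij)).
Qed.

Lemma rank_in_inj n x i j : distinct n x -> (i < n)%N -> (j < n)%N ->
  rank_in n x i = rank_in n x j -> i = j.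
Proof.
move=> dx i_n jn; have [xij|xij|xij] := ltgtP (x i) (x j); last by move=> _; exact: dx.
  by have := rank_in_lt jn xij => /[swap] ->; rewrite ltnn.
by have := rank_in_lt i_n xij => /[swap] ->; rewrite ltnn.
Qed.

(** Without ties the ranks permute [1, ..., n], so a sum over the sample of a function of one rank
    is deterministic. *)
Lemma big_rank_in {A : Type} {idx : A} (op : Monoid.com_law idx) n x (h : nat -> A) :
  distinct n x ->
  \big[op/idx]_(k < n) h (rank_in n x k) = \big[op/idx]_(1 <= p < n.+1) h p.
Proof.
move=> dx; case: n dx => [|n] dx; first by rewrite big_ord0 big_geq.
have Hlt (k : 'I_n.+1) : ((rank_in n.+1 x k).-1 < n.+1)%N.
  have := rank_in_le n.+1 x k; have := rank_in_gt0 x (ltn_ord k); lia.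
pose s k : 'I_n.+1 := Ordinal (Hlt k).
have sI : injective s.
  move=> i j /(congr1 val)/= H; apply/val_inj/(rank_in_inj dx); [exact: ltn_ord|exact: ltn_ord|].
  move: (rank_in_gt0 x (ltn_ord i)) (rank_in_gt0 x (ltn_ord j)) H => /=.
  by case: (rank_in n.+1 x i) => // a; case: (rank_in n.+1 x j) => // b _ _ /= ->.
rewrite big_add1 /= big_mkord [RHS](reindex_inj sI)/=.
by apply: eq_bigr => k _; rewrite prednK// rank_in_gt0.
Qed.

Lemma card_ge_rank n x k : distinct n x -> (k < n)%N ->
  (\sum_(j < n) (x k <= x j)%R = n.+1 - rank_in n x k)%N.
Proof.
move=> dx kn; have rn := rank_in_le n x k.
suff H : (\sum_(j < n) (x k <= x j)%R + rank_in n x k = n + 1)%N by lia.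
rewrite /rank_in -big_split/= (bigD1 (Ordinal kn))//= lexx.
rewrite (eq_bigr (fun=> 1%N)).
  have := sum1_card 'I_n; rewrite (bigD1 (Ordinal kn))//= card_ord.
  by lia.
move=> j jk; case: (ltgtP (x k) (x j)) => // /dx; move=> /(_ kn (ltn_ord j)) E.
by move: jk; rewrite -val_eqE/= E eqxx.
Qed.

End ranks.

(** * Scores that are Lipschitz in the logit *)

Section logit.
Context {R : realType}.
Implicit Types (u w : R).

Definition ell u : R := ln u - ln (1 - u).

Lemma ell_frac (a b : R) : 0 < a -> a < b -> ell (a / b) = ln a - ln (b - a).
Proof.
move=> a0 ab; have b0 : 0 < b by exact: lt_trans ab.
have ba : 0 < b - a by rewrite subr_gt0.
rewrite /ell (_ : 1 - a / b = (b - a) / b); last first.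
  by rewrite mulrBl divff// gt_eqF.
by rewrite !ln_div ?posrE//; ring.
Qed.

Lemma ln_succ_le (a : R) : 0 < a -> 0 <= ln (a + 1) - ln a <= a^-1.
Proof.
move=> a0; rewrite -ln_div ?posrE ?addr_gt0//.
rewrite mulrDl divff ?gt_eqF// mul1r; apply/andP; split.
  by rewrite ln_ge0// lerDl invr_ge0 ltW.
by rewrite le_ln1Dx// (@lt_le_trans _ _ 0)// ?ltrN10// invr_ge0 ltW.
Qed.

(** The class for which a shift of one rank costs at most a constant times the reciprocal of a count
    of observations. Since [ell] has derivative [1 / (u (1 - u))], it covers scores of logarithmic
    growth. *)
Definition score (C : R) (J : R -> R) : Prop :=
  forall u w, 0 < u < 1 -> 0 < w < 1 -> `|J u - J w| <= C * `|ell u - ell w|.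

Definition envelope u : R := 1 + `|ell u|.

Lemma envelope_ge1 u : 1 <= envelope u.
Proof. by rewrite lerDl. Qed.

Lemma score_envelope C J u : 0 <= C -> score C J -> `|J 2^-1| <= C ->
  0 < u < 1 -> `|J u| <= C * envelope u.
Proof.
move=> C0 sJ J2 u01; have h01 : 0 < (2^-1 : R) < 1 by lra.
have := sJ _ _ u01 h01; have -> : ell 2^-1 = 0.
  by rewrite /ell (_ : 1 - 2^-1 = 2^-1) ?subrr//; lra.
rewrite subr0 => H; rewrite -[J u](subrK (J 2^-1)) (le_trans (ler_normD _ _))//.
by rewrite /envelope mulrDr mulr1 addrC lerD.
Qed.

Lemma scoreB C J J' : score C J -> score C J' ->
  score (2 * C) (fun u => J u - J' u).
Proof.
move=> sJ sJ' u w u01 w01.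
rewrite (_ : _ - _ = (J u - J w) - (J' u - J' w)); last by ring.
rewrite (le_trans (ler_normB _ _))// (_ : 2 * C = C + C) ?mulrDl; last by ring.
by apply: lerD; [exact: sJ|exact: sJ'].
Qed.

Lemma score_le C C' J : C <= C' -> score C J -> score C' J.
Proof.
by move=> CC' sJ u w u01 w01; rewrite (le_trans (sJ _ _ u01 w01))// ler_wpM2r.
Qed.

(* [16^8] comes from [x <= e^x] applied to [x = - ln u / 16]. *)
Lemma ln_pow8 u : 0 < u < 1 -> ln u ^+ 8 <= 16 ^+ 8 * (Num.sqrt u)^-1.
Proof.
move=> /andP[u0 u1].
set x := - ln u; have x0 : 0 <= x by rewrite oppr_ge0 ln_le0// ltW.
have -> : ln u ^+ 8 = x ^+ 8 by rewrite /x exprNn -signr_odd expr0 mul1r.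
have -> : (Num.sqrt u)^-1 = expR (x / 2).
  have E : Num.sqrt u = expR (- (x / 2)).
    rewrite -[RHS]ger0_norm ?expR_ge0// -sqrtr_sqr; congr (Num.sqrt _).
    rewrite -expRM_natl (_ : 2 * - (x / 2) = ln u); last by rewrite /x; field.
    by rewrite lnK// posrE.
  by rewrite E expRN invrK.
have -> : x / 2 = 8%:R * (x / 16) by field.
rewrite expRM_natl; have -> : x = 16 * (x / 16) by field.
rewrite exprMn ler_pM2l ?exprn_gt0// (_ : 16 * (x / 16) / 16 = x / 16); last by field.
apply: lerXn2r; rewrite ?nnegrE ?expR_ge0 ?divr_ge0//.
have := expR_ge1Dx (x / 16); lra.
Qed.

(** A summable majorant for the eighth power of the logarithmic envelope: the inverse square roots
    have grid sums of order [n]. *)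
Definition envelope_bound u : R :=
  1 + (Num.sqrt u)^-1 + (Num.sqrt (1 - u))^-1.

Lemma expr8_le3 (a b c : R) : 0 <= a -> 0 <= b -> 0 <= c ->
  (a + b + c) ^+ 8 <= 3 ^+ 8 * (a ^+ 8 + b ^+ 8 + c ^+ 8).
Proof.
move=> a0 b0 c0; set m := Num.max a (Num.max b c).
have am : a <= m by rewrite le_max lexx.
have bm : b <= m by rewrite !le_max lexx orbT.
have cm : c <= m by rewrite !le_max lexx !orbT.
have m0 : 0 <= m by exact: le_trans am.
apply: (@le_trans _ _ ((3 * m) ^+ 8)).
  apply: lerXn2r; rewrite ?nnegrE ?addr_ge0 ?mulr_ge0//; lra.
rewrite exprMn ler_pM2l ?exprn_gt0//.
rewrite /m /Num.max; do !case: ifP => _; rewrite ?lerDl ?lerDr;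
  have := exprn_ge0 8 a0; have := exprn_ge0 8 b0; have := exprn_ge0 8 c0; lra.
Qed.

(** The eighth power is needed because squares of products of two envelopes are squared once more in
    [tail_am] and then separated. The constant is 3, from the three summands, times 16, from
    [ln_pow8]. *)
Lemma envelope_pow8 u : 0 < u < 1 ->
  envelope u ^+ 8 <= 48 ^+ 8 * envelope_bound u.
Proof.
move=> /[dup] u01 /andP[u0 u1].
have v01 : 0 < 1 - u < 1 by lra.
apply: (@le_trans _ _ ((1 + `|ln u| + `|ln (1 - u)|) ^+ 8)).
  apply: lerXn2r; rewrite ?nnegrE ?addr_ge0//.
  by rewrite /envelope -addrA lerD2l ler_normB.
apply: (le_trans (expr8_le3 _ _ _)) => //.
have -> : 48 ^+ 8 = 3 ^+ 8 * 16 ^+ 8 :> R by ring.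
rewrite -mulrA ler_pM2l ?exprn_gt0// /envelope_bound !mulrDr mulr1.
rewrite expr1n; apply: lerD; [apply: lerD|].
- by rewrite exprn_ege1//; lra.
- by rewrite -normrX ger0_norm ?ln_pow8// exprn_even_ge0.
- by rewrite -normrX ger0_norm ?ln_pow8// exprn_even_ge0.
Qed.

End logit.

(** * Sums over the rank grid *)

Section grid_sums.
Context {R : realType}.

Lemma sum_inv_sqrt n : \sum_(1 <= p < n.+1) (Num.sqrt p%:R)^-1 <= 2 * Num.sqrt n%:R :> R.
Proof.
elim: n => [|n IH]; first by rewrite big_geq// sqrtr0 mulr0.
rewrite big_nat_recr//= (le_trans (lerD IH (lexx _)))//.
set a := Num.sqrt n%:R; set b := Num.sqrt n.+1%:R.
have a0 : 0 <= a by exact: sqrtr_ge0.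
have b0 : 0 < b by rewrite sqrtr_gt0.
have ab : b ^+ 2 = a ^+ 2 + 1 by rewrite !sqr_sqrtr// -natr1.
rewrite -(ler_pM2r b0) mulrDl mulVf ?gt_eqF//.
have := sqr_ge0 (b - a); rewrite sqrrB; nra.
Qed.

(** The reflection [p -> n + 1 - p] identifies the two singular sums, each at most [4 n] by
    [sum_inv_sqrt]; with the constant term, 9 is 1 + 4 + 4. *)
Lemma sum_envelope_bound n : (0 < n)%N ->
  \sum_(1 <= p < n.+1) envelope_bound (p%:R / n.+1%:R) <= 9 * n%:R :> R.
Proof.
move=> n0; rewrite /envelope_bound.
have R1 p : (Num.sqrt (p%:R / n.+1%:R))^-1 = Num.sqrt n.+1%:R * (Num.sqrt p%:R)^-1 :> R.
  by rewrite sqrtrM// sqrtrV// invfM invrK mulrC.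
rewrite !big_split/=.
have -> : \sum_(1 <= p < n.+1) (Num.sqrt (1 - p%:R / n.+1%:R))^-1 =
   \sum_(1 <= p < n.+1) (Num.sqrt (p%:R / n.+1%:R))^-1 :> R.
  rewrite big_nat_rev/=; apply: eq_big_nat => p /andP[p1 pn].
  congr (Num.sqrt _)^-1; rewrite add1n subSS natrB; last by lia.
  by rewrite mulrBl divff ?pnatr_eq0// opprB addrCA subrr addr0.
have -> : \sum_(1 <= p < n.+1) (Num.sqrt (p%:R / n.+1%:R))^-1 =
   Num.sqrt n.+1%:R * \sum_(1 <= p < n.+1) (Num.sqrt p%:R)^-1 :> R.
  by rewrite mulr_sumr; apply: eq_bigr => p _; exact: R1.
rewrite sumr_const_nat subn1/=.
have S := sum_inv_sqrt n.
have nR : (1 : R) <= n%:R by rewrite ler1n.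
have H : Num.sqrt n.+1%:R * \sum_(1 <= p < n.+1) (Num.sqrt p%:R)^-1 <= 4 * n%:R :> R.
  apply: (@le_trans _ _ (Num.sqrt n.+1%:R * (2 * Num.sqrt n%:R))).
    by rewrite ler_wpM2l// sqrtr_ge0.
  set a := Num.sqrt n%:R; set b := Num.sqrt n.+1%:R.
  have a0 : 0 <= a by exact: sqrtr_ge0.
  have b0 : 0 <= b by exact: sqrtr_ge0.
  have ab : b ^+ 2 = a ^+ 2 + 1 by rewrite !sqr_sqrtr// -natr1.
  have an : a ^+ 2 = n%:R by rewrite sqr_sqrtr.
  have := sqr_ge0 (b - a); rewrite sqrrB -an; lra.
lra.
Qed.

End grid_sums.

(** * Leave-one-out ranks *)

Section leave_one_out.
Context {R : realType}.
Implicit Types (x y : nat -> R) (z : nat -> R * R) (J K D : R -> R).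

Definition full n x k : R := (rank_in n x k)%:R / n.+1%:R.

(** The normalized rank of [k] once [i] is removed from a sample of size [n + 1]. Its denominator is
    that of a sample of size [n], one less than the denominator [n + 2] in [full n.+1]. *)
Definition loo n x i k : R :=
  (rank_in n.+1 x k - (x i <= x k)%R)%N%:R / n.+1%:R.

Definition rank_sum J K n z : R :=
  \sum_(k < n) J (full n (fst \o z) k) * K (full n (snd \o z) k).

Lemma rank_sum_swapn J K i n z : (i <= n)%N ->
  rank_sum J K n (z \o swapn i n) =
  \sum_(k < n.+1 | k != i :> nat) J (loo n (fst \o z) i k) * K (loo n (snd \o z) i k).
Proof.
move=> i_n; rewrite -(big_swapn _ (fun k => J (loo n (fst \o z) i k) * K (loo n (snd \o z) i k)) i_n).
apply: eq_bigr => k _; rewrite /full /loo.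
by rewrite -!(rank_in_swapn _ _ i_n).
Qed.

Lemma rank_sum_swapn_all J K i n z : (i <= n)%N ->
  rank_sum J K n.+1 (z \o swapn i n) = rank_sum J K n.+1 z.
Proof.
move=> i_n; rewrite /rank_sum.
rewrite -(big_swapn_all _ (fun k => J (full n.+1 (fst \o z) k) * K (full n.+1 (snd \o z) k)) i_n).
apply: eq_bigr => k _; rewrite /full.
by rewrite -!(rank_in_swapn_all _ _ i_n).
Qed.

(** The two quotients are the kernels of [hardy_total] for the two orders on the sample; away from
    ties only one is nonzero when [k] differs from [i]. The counts include [k] itself, so they are
    positive. *)
Definition rank_shift n x i k : R :=
  (x k <= x i)%R%:R / (\sum_(j < n) (x k <= x j)%R%:R) +
  (x i <= x k)%R%:R / (\sum_(j < n) (x j <= x k)%R%:R).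

Lemma count_ge1 n (b : 'I_n -> bool) k : b k -> 1 <= \sum_(j < n) (b j)%:R :> R.
Proof. by move=> bk; rewrite (bigD1 k)//= bk lerDl sumr_ge0. Qed.

Lemma rank_shift_bounds n x i k : (k < n)%N -> 0 <= rank_shift n x i k <= 2.
Proof.
move=> kn; set o := Ordinal kn.
have a1 : 1 <= \sum_(j < n) (x k <= x j)%R%:R :> R by apply: (@count_ge1 _ _ o) => /=.
have b1 : 1 <= \sum_(j < n) (x j <= x k)%R%:R :> R by apply: (@count_ge1 _ _ o) => /=.
have H (b : bool) (c : R) : 1 <= c -> 0 <= b%:R / c <= 1.
  move=> c1; rewrite divr_ge0//= ?(le_trans ler01)//.
  rewrite ler_pdivrMr ?(lt_le_trans ltr01)// mul1r (le_trans _ c1)//.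
  by case: b.
have := H (x k <= x i) _ a1; have := H (x i <= x k) _ b1.
rewrite /rank_shift => /andP[? ?] /andP[? ?]; apply/andP; split.
  exact: addr_ge0.
by rewrite (_ : 2 = 1 + 1)// lerD.
Qed.

Lemma full_itv n x k : (k < n)%N -> 0 < full n x k < 1.
Proof.
move=> kn; have := rank_in_le n x k; have := rank_in_gt0 x kn => r0 rn.
rewrite /full divr_gt0 ?ltr0n//= ltr_pdivrMr ?ltr0n// mul1r ltr_nat; lia.
Qed.

Section one_pair.
Variables (n : nat) (x : nat -> R) (i k : nat).
Hypotheses (dx : distinct n.+1 x) (i_n : (i < n.+1)%N) (kn : (k < n.+1)%N)
  (ki : k != i).

Lemma rank_loo_itv :
  (0 < rank_in n.+1 x k - (x i <= x k)%R <= n)%N.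
Proof.
have r0 := rank_in_gt0 x kn; have rn := rank_in_le n.+1 x k.
case: (ltgtP (x i) (x k)) => xik /=; last first.
- by move: ki; rewrite (dx i_n kn xik) eqxx.
- have := rank_in_lt i_n xik; have := rank_in_le n.+1 x i; lia.
- have := rank_in_lt kn xik; have := rank_in_gt0 x i_n; lia.
Qed.

Lemma loo_itv : 0 < loo n x i k < 1.
Proof.
have /andP[r0 rn] := rank_loo_itv.
rewrite /loo divr_gt0 ?ltr0n//= ltr_pdivrMr ?ltr0n// mul1r ltr_nat; lia.
Qed.

(** Removing [i] also lowers the denominator by one, so exactly one of the two distances of the rank
    to the ends changes, and by one unit: the upper one if [x i] is above [x k], the lower one
    otherwise. The factor 2 replaces [1 / a] by [2 / (a + 1)]. *)
Lemma loo_full_ell : `|ell (loo n x i k) - ell (full n.+1 x k)| <= 2 * rank_shift n.+1 x i k.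
Proof.
have /andP[r0 rn] := rank_loo_itv.
have q0 := rank_in_gt0 x kn; have qn := rank_in_le n.+1 x k.
have EN : \sum_(j < n.+1) (x j <= x k)%R%:R = (rank_in n.+1 x k)%:R :> R.
  by rewrite /rank_in natr_sum.
have EP : \sum_(j < n.+1) (x k <= x j)%R%:R = (n.+2 - rank_in n.+1 x k)%N%:R :> R.
  by rewrite -(card_ge_rank dx kn) natr_sum.
have ellE a b : (0 < a)%N -> (a < b)%N ->
    ell (a%:R / b%:R) = ln a%:R - ln (b - a)%N%:R :> R.
  by move=> a0 ab; rewrite ell_frac ?ltr0n ?ltr_nat// natrB// ltnW.
rewrite /loo /full /rank_shift EN EP !ellE//.
move: r0 rn; set q := rank_in n.+1 x k in q0 qn *.
have inv2 (a : nat) : (0 < a)%N -> (a%:R)^-1 <= 2 * (a.+1%:R)^-1 :> R.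
  move=> a0; rewrite -[2]invrK -invfM lef_pV2 ?posrE ?ltr0n//.
  rewrite -(@ler_pM2l _ 2)// mulrA divff// mul1r -natr1.
  have : (1 : R) <= a%:R by rewrite ler1n.
  lra.
have L (a : nat) : (0 < a)%N -> `|ln a.+1%:R - ln a%:R| <= (a%:R : R)^-1.
  move=> a0; have := @ln_succ_le R a%:R; rewrite ltr0n => /(_ a0).
  by rewrite natr1 => /andP[? ?]; rewrite ger0_norm.
case: (ltgtP (x i) (x k)) => xik /=; last first.
- by move: ki; rewrite (dx i_n kn xik) eqxx.
- rewrite subn0 => _ qn'; rewrite mul0r addr0 mul1r.
  rewrite (_ : _ - _ = ln (n.+2 - q)%N%:R - ln (n.+1 - q)%N%:R); last by ring.
  have -> : (n.+2 - q = (n.+1 - q).+1)%N by lia.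
  by rewrite (le_trans (L _ _)) ?inv2//; lia.
- rewrite subn1 => q1 qn'; rewrite mul0r add0r mul1r.
  have -> : (n.+1 - q.-1 = n.+2 - q)%N by lia.
  rewrite (_ : _ - _ = - (ln q%:R - ln q.-1%:R)); last by ring.
  rewrite normrN; have {1 3}-> : q = q.-1.+1 by lia.
  by rewrite (le_trans (L _ _)) ?inv2//; lia.
Qed.

Lemma loo_full_dist : `|loo n x i k - full n.+1 x k| <= (n.+2%:R)^-1.
Proof.
have /andP[r0 rn] := rank_loo_itv.
have q0 := rank_in_gt0 x kn; have qn := rank_in_le n.+1 x k.
rewrite /loo /full; move: r0 rn; set q := rank_in n.+1 x k in q0 qn *.
have n2 : (0 : R) < n.+2%:R by rewrite ltr0n.
have n1 : (0 : R) < n.+1%:R by rewrite ltr0n.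
move=> r0 rn.
rewrite -(ler_pM2r n2) mulVf ?gt_eqF// -[X in _ * X <= _](gtr0_norm n2) -normrM mulrBl divfK ?gt_eqF//.
rewrite -(ler_pM2r n1) mul1r -[X in _ * X <= _](gtr0_norm n1) -normrM mulrBl mulrAC divfK ?gt_eqF//.
move: r0 rn; case: (x i <= x k) => /= r0 rn.
- rewrite subn1 -(natrM _ q.-1) -natrM.
  have le1 : (q.-1 * n.+2 <= q * n.+1)%N by nia.
  rewrite ler0_norm ?subr_le0 ?ler_nat// opprB lerBlDr -natrD ler_nat; nia.
- have le1 : (q * n.+1 <= q * n.+2)%N by nia.
  rewrite subn0 -!natrM ger0_norm ?subr_ge0 ?ler_nat// lerBlDr -natrD ler_nat; nia.
Qed.

End one_pair.

End leave_one_out.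

(** * Ranks near the ends *)

Section counting.
Context {R : realType}.

Lemma count_lt_le (y : R) m : 0 <= y -> \sum_(1 <= p < m) (p%:R < y)%R%:R <= y.
Proof.
move=> y0; elim: m => [|m IH]; first by rewrite big_geq.
case: m IH => [|m] IH; first by rewrite big_geq.
rewrite big_nat_recr//=; case: (ltP m.+1%:R y) => my; last by rewrite addr0.
apply: le_trans (ltW my); rewrite -natr1 lerD2r.
apply: (@le_trans _ _ (\sum_(1 <= p < m.+1) 1)); last first.
  by rewrite sumr_const_nat subn1.
by apply: ler_sum => p _; rewrite lern1 leq_b1.
Qed.

Definition tail (e u : R) : bool := (u < e) || (1 - e < u).

Lemma sum_tail e n : 0 <= e ->
  \sum_(1 <= p < n.+2) (tail e (p%:R / n.+2%:R))%:R <= 4 * e * n.+1%:R :> R.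
Proof.
move=> e0; have n2 : (0 : R) < n.+2%:R by rewrite ltr0n.
have H : \sum_(1 <= p < n.+2) (p%:R / n.+2%:R < e)%R%:R <= e * n.+2%:R :> R.
  under eq_bigr do rewrite ltr_pdivrMr//.
  by apply: count_lt_le; rewrite mulr_ge0// ltW.
have H' : \sum_(1 <= p < n.+2) (1 - e < p%:R / n.+2%:R)%R%:R <= e * n.+2%:R :> R.
  rewrite big_nat_rev/= (le_trans _ H)// ler_sum_nat// => p /andP[p1 pn].
  rewrite add1n subSS natrB; last by lia.
  by rewrite mulrBl divff ?gt_eqF// ltrD2l ltrN2.
apply: (@le_trans _ _ (e * n.+2%:R + e * n.+2%:R)).
  apply: le_trans (lerD H H'); rewrite -big_split/=; apply: ler_sum => p _.
  by rewrite /tail -natrD ler_nat; case: (_ < _); case: (_ < _).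
have : (n.+2%:R : R) <= 2 * n.+1%:R.
  by rewrite -natrM ler_nat; lia.
move=> /(ler_wpM2l e0); lra.
Qed.

End counting.

(** * The jackknife bound for scores supported near the ends *)

Section jackknife.
Context {R : realType}.

(** Here 5100 is 300 from [sqr3_le] times the 17 that collects the tail terms, 8 comes from counting
    ranks in the tail [2 * eta ^+ 2], and 18 is 9 from [sum_envelope_bound] for each coordinate. *)
Definition jack_const : R := 5100 * (8 + 18 * 48 ^+ 8).

Lemma sum_sqr_shift n x (w : 'I_n.+1 -> R) : (forall k, 0 <= w k) ->
  \sum_(i < n.+1) (\sum_(k < n.+1) rank_shift n.+1 x i k * w k) ^+ 2 <=
  16 * \sum_k w k ^+ 2.
Proof.
move=> w0.
pose r1 (k i : 'I_n.+1) := (x k <= x i)%R; pose r2 (k i : 'I_n.+1) := (x i <= x k)%R.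
have t1 : total r1 by move=> i j; exact: le_total.
have t2 : total r2 by move=> i j; exact: le_total.
have H1 := hardy_total t1 w0; have H2 := hardy_total t2 w0.
apply: (@le_trans _ _ (2 * (4 * \sum_k w k ^+ 2) + 2 * (4 * \sum_k w k ^+ 2))); last by lra.
apply: le_trans (lerD (ler_wpM2l _ H1) (ler_wpM2l _ H2)) => //.
rewrite !mulr_sumr -big_split/=; apply: ler_sum => i _.
have -> : \sum_(k < n.+1) rank_shift n.+1 x i k * w k =
   \sum_k (r1 k i)%:R * (w k / (\sum_j (r1 k j)%:R)) +
   \sum_k (r2 k i)%:R * (w k / (\sum_j (r2 k j)%:R)).
  rewrite -big_split/=; apply: eq_bigr => k _; rewrite /rank_shift mulrDl /r1 /r2.
  by congr (_ + _); rewrite -mulrA [_^-1 * _]mulrC.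
set a := \sum_k _; set b := \sum_k _.
have := sqr_ge0 (a - b); rewrite sqrrB sqrrD; lra.
Qed.

Lemma sqr3_le (a b c : R) :
  (10 * a + 2 * b + c) ^+ 2 <= 300 * (a ^+ 2 + b ^+ 2 + c ^+ 2).
Proof.
have := sqr_ge0 (10 * a - 2 * b); have := sqr_ge0 (10 * a - c).
have := sqr_ge0 (2 * b - c); have := sqr_ge0 a; have := sqr_ge0 b.
have := sqr_ge0 c; nra.
Qed.

(** A tail indicator against an unbounded weight: the indicators are few, of order [eta ^+ 2] times
    the sample size, so both terms on the right end up of order [eta]. *)
Lemma tail_am (t : bool) (eta y : R) : 0 < eta -> 0 <= y ->
  t%:R * y <= t%:R / (2 * eta) + eta / 2 * y ^+ 2.
Proof.
move=> eta0 y0; case: t; rewrite ?mul0r ?add0r ?mul1r; last first.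
  by rewrite mulr_ge0 ?sqr_ge0// divr_ge0// ltW.
rewrite -subr_ge0 (_ : _ - _ = eta / 2 * (y - eta^-1) ^+ 2); last first.
  by field; rewrite gt_eqF.
by rewrite mulr_ge0 ?sqr_ge0// divr_ge0// ltW.
Qed.

Variables (C eta : R) (D K : R -> R) (n : nat) (z : nat -> R * R).
Hypotheses (C0 : 0 <= C) (eta0 : 0 < eta) (sD : score C D) (sK : score C K)
  (D2 : `|D 2^-1| <= C) (K2 : `|K 2^-1| <= C)
  (Dmid : forall u, eta ^+ 2 <= u <= 1 - eta ^+ 2 -> D u = 0)
  (n_big : 1 <= n.+2%:R * eta ^+ 2)
  (dx : distinct n.+1 (fst \o z)) (dy : distinct n.+1 (snd \o z)).

Let f1 k := full n.+1 (fst \o z) k.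
Let f2 k := full n.+1 (snd \o z) k.
(** The level is twice the one in [Dmid]: a leave-one-out rank moves by at most [1 / (n + 2)], which
    [n_big] bounds by [eta ^+ 2]. Outside this tail [D] thus vanishes at both ranks. *)
Let t k := tail (2 * eta ^+ 2) (f1 k).
Let L1 k := envelope (f1 k).
Let L2 k := envelope (f2 k).
Let S1 i k := rank_shift n.+1 (fst \o z) i k.
Let S2 i k := rank_shift n.+1 (snd \o z) i k.

Let L1_ge1 k : 1 <= L1 k. Proof. exact: envelope_ge1. Qed.
Let L2_ge1 k : 1 <= L2 k. Proof. exact: envelope_ge1. Qed.
Let L1_ge0 k : 0 <= L1 k. Proof. exact: le_trans (L1_ge1 k). Qed.
Let L2_ge0 k : 0 <= L2 k. Proof. exact: le_trans (L2_ge1 k). Qed.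

Let Df1 k : (k < n.+1)%N -> `|D (f1 k)| <= C * ((t k)%:R * L1 k).
Proof.
move=> kn; have [tk|] := boolP (t k).
  by rewrite mul1r; apply: (score_envelope C0 sD D2); exact: full_itv.
rewrite /t /tail negb_or -!leNgt => /andP[a b].
by rewrite mul0r mulr0 Dmid ?normr0//; have := sqr_ge0 eta; lra.
Qed.

Let Kf2 k : (k < n.+1)%N -> `|K (f2 k)| <= C * L2 k.
Proof. by move=> kn; apply: (score_envelope C0 sK K2); exact: full_itv. Qed.

(** The product rule for the pair of scores. As [rank_shift] is at most 2, the shifted [K] exceeds
    its bound by at most [4 C], whence the factor 5 on [L2], doubled to 10 by [loo_full_ell]. *)
Let off_diag i k : (i < n.+1)%N -> (k < n.+1)%N -> k != i ->
  `|D (loo n (fst \o z) i k) * K (loo n (snd \o z) i k) - D (f1 k) * K (f2 k)| <=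
  C ^+ 2 * (10 * (S1 i k * ((t k)%:R * L2 k)) + 2 * (S2 i k * ((t k)%:R * L1 k))).
Proof.
move=> i_n kn ki; set a := loo _ _ _ _; set b := loo _ _ _ _.
have /andP[s10 s12] := @rank_shift_bounds R n.+1 (fst \o z) i k kn.
have /andP[s20 s22] := @rank_shift_bounds R n.+1 (snd \o z) i k kn.
have hD : `|D a - D (f1 k)| <= C * (2 * (S1 i k * (t k)%:R)).
  have [tk|] := boolP (t k).
    rewrite mulr1 (le_trans (sD _ _))//; [exact: loo_itv|exact: full_itv|].
    by rewrite ler_wpM2l//; exact: loo_full_ell.
  rewrite /t /tail negb_or -!leNgt => /andP[h1 h2].
  have /ler_normlP[d1 d2] := loo_full_dist dx i_n kn ki.
  have n2 : (0 : R) < n.+2%:R by rewrite ltr0n.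
  have : (n.+2%:R : R)^-1 <= eta ^+ 2.
    by rewrite -(ler_pM2l n2) divff ?gt_eqF.
  move=> h3; rewrite (Dmid (u := a)) ?(Dmid (u := f1 k)) ?subrr ?normr0 ?mulr0//.
    by have := sqr_ge0 eta; lra.
  move: d1 d2; rewrite -/a -/(f1 k); move: (n.+2%:R^-1) (eta ^+ 2) (f1 k) a h1 h2 h3.
  move=> c1 c2 c3 c4 c5 c6 c7 c8 c9; apply/andP; split; lra.
have hK : `|K b - K (f2 k)| <= C * (2 * S2 i k).
  rewrite (le_trans (sK _ _))//; [exact: loo_itv|exact: full_itv|].
  by rewrite ler_wpM2l//; exact: loo_full_ell.
have hKb : `|K b| <= C * (5 * L2 k).
  rewrite -[K b](subrK (K (f2 k))) (le_trans (ler_normD _ _))//.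
  rewrite (le_trans (lerD hK (Kf2 kn)))// -mulrDr ler_wpM2l//.
  by have := L2_ge1 k; rewrite /S2; lra.
have -> : D a * K b - D (f1 k) * K (f2 k) =
   (D a - D (f1 k)) * K b + D (f1 k) * (K b - K (f2 k)) by ring.
rewrite (le_trans (ler_normD _ _))// !normrM.
apply: (@le_trans _ _ ((C * (2 * (S1 i k * (t k)%:R))) * (C * (5 * L2 k)) +
   (C * ((t k)%:R * L1 k)) * (C * (2 * S2 i k)))).
  by apply: lerD; apply: ler_pM => //; exact: Df1.
by rewrite le_eqVlt; apply/orP; left; apply/eqP; ring.
Qed.

Let diff_le i : (i < n.+1)%N ->
  `|rank_sum D K n (z \o swapn i n) - rank_sum D K n.+1 z| <=
  C ^+ 2 * (10 * (\sum_(k < n.+1) S1 i k * ((t k)%:R * L2 k)) +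
            2 * (\sum_(k < n.+1) S2 i k * ((t k)%:R * L1 k)) +
            (t i)%:R * (L1 i * L2 i)).
Proof.
move=> i_n; rewrite rank_sum_swapn// /rank_sum.
rewrite [X in _ - X](bigD1 (Ordinal i_n))//= opprD addrA addrAC -sumrB.
rewrite (le_trans (ler_normB _ _))// mulrDr; apply: lerD; last first.
  rewrite normrM expr2; apply: (@le_trans _ _ ((C * ((t i)%:R * L1 i)) * (C * L2 i))).
    by apply: ler_pM => //; [exact: Df1|exact: Kf2].
  by rewrite le_eqVlt; apply/orP; left; apply/eqP; ring.
rewrite !mulr_sumr -big_split/= mulr_sumr.
apply: (le_trans (ler_norm_sum _ _ _)).
rewrite [leRHS](bigD1 (Ordinal i_n))//= -[leLHS]add0r; apply: lerD.
  have /andP[s10 _] := @rank_shift_bounds R n.+1 (fst \o z) i i i_n.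
  have /andP[s20 _] := @rank_shift_bounds R n.+1 (snd \o z) i i i_n.
  apply: mulr_ge0; first exact: sqr_ge0.
  by apply: addr_ge0; apply: mulr_ge0 => //; apply: mulr_ge0 => //; apply: mulr_ge0.
apply: ler_sum => k ki; apply: off_diag => //.
Qed.

Let sum_pow8 (x : nat -> R) : distinct n.+1 x ->
  \sum_(k < n.+1) envelope (full n.+1 x k) ^+ 8 <= 9 * 48 ^+ 8 * n.+1%:R.
Proof.
move=> dxx; rewrite /full.
rewrite (big_rank_in _ (fun p => envelope (p%:R / n.+2%:R) ^+ 8))//.
apply: (@le_trans _ _ (\sum_(1 <= p < n.+2) 48 ^+ 8 * envelope_bound (p%:R / n.+2%:R : R))).
  apply: ler_sum_nat => p /andP[p1 pn]; apply: envelope_pow8.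
  by rewrite divr_gt0 ?ltr0n//= ltr_pdivrMr ?ltr0n// mul1r ltr_nat.
rewrite -mulr_sumr.
have := @sum_envelope_bound R n.+1 isT => /(ler_wpM2l _) => /(_ (48 ^+ 8) _) H.
apply: (le_trans (H _)) => //; rewrite ?exprn_ge0//.
by rewrite le_eqVlt; apply/orP; left; apply/eqP; ring.
Qed.

(** The off-diagonal part of each leave-one-out error is a [rank_shift] average of tail weights, so
    the sum of all squares is bounded through [sum_sqr_shift] by the sum of squared weights. That
    sum is deterministic by [big_rank_in], and [tail_am] makes it proportional to [eta]. *)
Lemma jackknife_bound :
  \sum_(i < n.+1) (rank_sum D K n (z \o swapn i n) - rank_sum D K n.+1 z) ^+ 2 <=
  jack_const * C ^+ 4 * eta * n.+1%:R.
Proof.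
set w1 := fun k : 'I_n.+1 => (t k)%:R * L1 k.
set w2 := fun k : 'I_n.+1 => (t k)%:R * L2 k.
have w10 k : 0 <= w1 k by exact: mulr_ge0.
have w20 k : 0 <= w2 k by exact: mulr_ge0.
have h300 : 0 <= 300 * C ^+ 4.
  by apply: mulr_ge0; [exact: ler0n|exact: exprn_ge0].
have B1 : \sum_(i < n.+1) (rank_sum D K n (z \o swapn i n) - rank_sum D K n.+1 z) ^+ 2 <=
  300 * C ^+ 4 * (16 * (\sum_k w2 k ^+ 2) + 16 * (\sum_k w1 k ^+ 2) +
    \sum_(k < n.+1) ((t k)%:R * (L1 k * L2 k)) ^+ 2).
  have := sum_sqr_shift (fst \o z) w20; have := sum_sqr_shift (snd \o z) w10.
  rewrite -/S1 -/S2 => h1 h2.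
  apply: (@le_trans _ _ (300 * C ^+ 4 * (
     \sum_(i < n.+1) (\sum_(k < n.+1) S1 i k * w2 k) ^+ 2 +
     \sum_(i < n.+1) (\sum_(k < n.+1) S2 i k * w1 k) ^+ 2 +
     \sum_(k < n.+1) ((t k)%:R * (L1 k * L2 k)) ^+ 2))); last first.
    apply: ler_wpM2l; first exact: h300.
    exact: lerD (lerD h2 h1) (lexx _).
  rewrite -!big_split/= mulr_sumr; apply: ler_sum => i _.
  rewrite -real_normK ?num_real//.
  apply: (@le_trans _ _ ((C ^+ 2 * (10 * (\sum_(k < n.+1) S1 i k * w2 k) +
            2 * (\sum_(k < n.+1) S2 i k * w1 k) +
            (t i)%:R * (L1 i * L2 i))) ^+ 2)).
    have H := diff_le (ltn_ord i).
    by apply: lerXn2r; rewrite ?nnegrE// (le_trans _ H).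
  set a := \sum_(k < n.+1) _; set b := \sum_(k < n.+1) _; set c := _ * (L1 i * _).
  rewrite (_ : (C ^+ 2 * _) ^+ 2 = C ^+ 4 * (10 * a + 2 * b + c) ^+ 2); last by ring.
  rewrite (_ : 300 * C ^+ 4 * _ = C ^+ 4 * (300 * (a ^+ 2 + b ^+ 2 + c ^+ 2))); last by ring.
  by apply: ler_wpM2l; [exact: exprn_ge0|exact: sqr3_le].
apply: (le_trans B1).
have tt k : (t k)%:R ^+ 2 = (t k)%:R :> R by case: (t k); rewrite ?expr1n ?expr0n.
have B2 k : 16 * w2 k ^+ 2 + 16 * w1 k ^+ 2 + ((t k)%:R * (L1 k * L2 k)) ^+ 2 <=
  17 * ((t k)%:R / eta + eta * (L1 k ^+ 8 + L2 k ^+ 8)).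
  rewrite /w1 /w2 !exprMn tt.
  have h1 := tail_am (t k) eta0 (sqr_ge0 (L1 k)).
  have h2 := tail_am (t k) eta0 (sqr_ge0 (L2 k)).
  have h3 := tail_am (t k) eta0 (mulr_ge0 (sqr_ge0 (L1 k)) (sqr_ge0 (L2 k))).
  rewrite -!exprM exprMn -!exprM/= in h1 h2 h3.
  have e1 : L1 k ^+ 4 <= L1 k ^+ 8 by apply: ler_weXn2l.
  have e2 : L2 k ^+ 4 <= L2 k ^+ 8 by apply: ler_weXn2l.
  have e3 : L1 k ^+ 4 * L2 k ^+ 4 <= L1 k ^+ 8 + L2 k ^+ 8.
    have := sqr_ge0 (L1 k ^+ 4 - L2 k ^+ 4); rewrite sqrrB -!exprM/=.
    have := exprn_ge0 8 (L1_ge0 k); have := exprn_ge0 8 (L2_ge0 k); lra.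
  have e0 : 0 <= (t k)%:R / eta :> R by rewrite divr_ge0// ltW.
  have h4 : (t k)%:R / (2 * eta) = ((t k)%:R / eta) / 2 :> R.
    by field; rewrite gt_eqF.
  have f1' := ler_wpM2l (ltW eta0) e1; have f2' := ler_wpM2l (ltW eta0) e2.
  have f3' := ler_wpM2l (ltW eta0) e3; have g1 := mulr_ge0 (ltW eta0) (exprn_ge0 8 (L1_ge0 k)).
  have g2 := mulr_ge0 (ltW eta0) (exprn_ge0 8 (L2_ge0 k)).
  rewrite mulrDr in f3'.
  lra.
rewrite !mulr_sumr -!big_split/=.
apply: (@le_trans _ _ (300 * C ^+ 4 *
   \sum_(k < n.+1) 17 * ((t k)%:R / eta + eta * (L1 k ^+ 8 + L2 k ^+ 8)))).
  by apply: ler_wpM2l; [exact: h300|exact: ler_sum].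
rewrite -mulr_sumr big_split/= -mulr_suml -mulr_sumr big_split/=.
have T : \sum_(k < n.+1) (t k)%:R <= 8 * eta ^+ 2 * n.+1%:R :> R.
  rewrite /t /f1 /full (big_rank_in _ (fun p => (tail (2 * eta ^+ 2) (p%:R / n.+2%:R))%:R))//.
  have e0 : 0 <= 2 * eta ^+ 2 by rewrite mulr_ge0// sqr_ge0.
  by have := sum_tail n e0; lra.
have T' : (\sum_(k < n.+1) (t k)%:R) / eta <= 8 * eta * n.+1%:R :> R.
  rewrite ler_pdivrMr// (le_trans T)// expr2 le_eqVlt; apply/orP; left; apply/eqP; ring.
have P1 := ler_wpM2l (ltW eta0) (sum_pow8 dx).
have P2 := ler_wpM2l (ltW eta0) (sum_pow8 dy).
rewrite mulrDr /jack_const.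
rewrite (_ : 5100 * _ * _ * _ * _ = 300 * C ^+ 4 * (17 * (8 * eta * n.+1%:R +
  (eta * (9 * 48 ^+ 8 * n.+1%:R) + eta * (9 * 48 ^+ 8 * n.+1%:R))))); last by ring.
apply: ler_wpM2l; first exact: h300.
rewrite -mulrDr; apply: ler_wpM2l; first exact: ler0n.
by apply: lerD; [exact: T'|rewrite mulrDr; exact: lerD].
Qed.

End jackknife.

(** * Rank sums as statistics *)

Section rank_sum_statistics.
Context {R : realType}.
Notation E := (R * R)%type.

Lemma bstat_bool (b : (nat -> E) -> bool) :
  (forall d' (S : measurableType d') (z : S -> nat -> E), mfamily z ->
    mfunT (fun s => b (z s))) -> bstat (fun z => (b z)%:R : R).
Proof.
move=> mb; split; last by exists 1 => z; case: (b z); rewrite ?normr1 ?normr0.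
by move=> d' S z mz; case: (@bmf_bool _ _ R _ (mb _ _ _ mz)).
Qed.

Section coordinate.
Variable c : E -> R.
Hypothesis mc : mfunT c.

Lemma bstat_le i j : bstat (fun z : nat -> E => ((c (z i)) <= c (z j))%R%:R : R).
Proof.
apply: bstat_bool => d' S z mz.
by apply: measurable_fun_ler; apply: (measurableT_comp mc); exact: mz.
Qed.

Lemma bstat_rank (h : nat -> R) n k :
  bstat (fun z : nat -> E => h (rank_in n (c \o z) k)).
Proof.
have -> : (fun z : nat -> E => h (rank_in n (c \o z) k)) =
    fun z => \sum_(p < n.+1) h p * (rank_in n (c \o z) k == p :> nat)%:R.
  apply/funext => z; have rn := rank_in_le n (c \o z) k.
  rewrite (bigD1 (Ordinal (rn : (_ < n.+1)%N)))//= eqxx mulr1 big1 ?addr0// => p.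
  by rewrite -val_eqE/= eq_sym => /negbTE ->; rewrite mulr0.
apply: bstat_sum => p _; apply: bstatZ; apply: bstat_bool => d' S z mz.
have -> : (fun s => rank_in n (c \o z s) k == p :> nat) =
    fun s => (\sum_(j < n) (c (z s j) <= c (z s k))%R%:R == p%:R :> R).
  by apply/funext => s; rewrite -natr_sum eqr_nat.
apply: measurable_fun_eqr => //.
have [H _] : bstat (fun z : nat -> E => \sum_(j < n) (c (z j) <= c (z k))%R%:R : R).
  by apply: bstat_sum => j _; exact: bstat_le.
exact: H.
Qed.

End coordinate.

Lemma bstat_rank_sum (J K : R -> R) n : bstat (rank_sum J K n).
Proof.
apply: bstat_sum => k _; apply: bstatM.
  exact: (bstat_rank (c := fst) _ (fun p => J (p%:R / n.+1%:R))).
exact: (bstat_rank (c := snd) _ (fun p => K (p%:R / n.+1%:R))).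
Qed.

Lemma rank_in_local n (x y : nat -> R) k : (k < n)%N ->
  (forall i, (i < n)%N -> x i = y i) -> rank_in n x k = rank_in n y k.
Proof.
by move=> kn xy; rewrite /rank_in; apply: eq_bigr => j _; rewrite !xy.
Qed.

Lemma depends_rank_sum (J K : R -> R) n : depends n (rank_sum J K n).
Proof.
move=> z z' zz'; apply: eq_bigr => k _; rewrite /full.
by congr (J (_%:R / _) * K (_%:R / _)); apply: rank_in_local => // i im /=; rewrite zz'.
Qed.

End rank_sum_statistics.

(** * Uniform marginals and absence of ties *)

Section uniform.
Context {R : realType} {d} {T : measurableType d}.
Variable (P : probability T R).

Lemma Ex_bool (b : T -> bool) : mfunT b ->
  Ex P (fun w => (b w)%:R) = fine (P [set w | b w]).
Proof.
move=> mb; have mB : measurable [set w | b w].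
  by rewrite -[X in measurable X]setTI; exact: (mb measurableT [set true]).
rewrite -(setIT [set w | b w]) -[P _](integral_indic P measurableT mB).
rewrite /Ex /Rintegral; congr fine; apply: eq_integral => w _.
by rewrite indicE; congr (_%:R%:E); rewrite mem_setE.
Qed.

Lemma Ex_bool0_ae (b : T -> bool) : mfunT b ->
  Ex P (fun w => (b w)%:R) = 0 -> {ae P, forall w, ~~ b w}.
Proof.
move=> mb E0; have mB : measurable [set w | b w].
  by rewrite -[X in measurable X]setTI; exact: (mb measurableT [set true]).
have EB : ~` [set w | ~~ b w] = [set w | b w].
  by apply/seteqP; split => w /=; [move/negP; rewrite negbK|move=> ->].
change (P.-negligible (~` [set w | ~~ b w])); rewrite EB.
apply/negligibleP => //.
have := E0; rewrite Ex_bool// => /eqP; rewrite fine_eq0; first by move/eqP.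
exact: fin_num_measure.
Qed.

Definition uniform01 (X : T -> R) : Prop :=
  [/\ mfunT X, forall w, 0 <= X w <= 1 &
      forall u, 0 <= u <= 1 -> Ex P (fun w => (X w <= u)%R%:R) = u].

Lemma uniform01_point (X : T -> R) x : uniform01 X ->
  Ex P (fun w => (X w == x)%:R) = 0.
Proof.
move=> [mX X01 uX].
have ile u : itg P (fun w => (X w <= u)%R%:R).
  by apply/bmf_itg/bmf_bool; exact: measurable_fun_ler.
have ieq : itg P (fun w => (X w == x)%:R).
  by apply/bmf_itg/bmf_bool; exact: measurable_fun_eqr.
have E0 : 0 <= Ex P (fun w => (X w == x)%:R) by apply: Ex_ge0 => w; rewrite ler0n.
apply/eqP; rewrite eq_le E0 andbT.
have [x0|x0] := leP x 0.
  rewrite -(uX 0) ?lexx ?ler01//; apply: le_Ex => // w; rewrite ler_nat.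
  by case: eqP => // ->; rewrite x0.
have [x1|x1] := ltP 1 x.
  rewrite -[leRHS](Ex_cst P 0); apply: le_Ex => //; first exact: itg_cst.
  move=> w; have /andP[_ Xw] := X01 w.
  by rewrite (_ : _ == _ = false)//; apply/negbTE; rewrite lt_eqF// (le_lt_trans Xw).
apply/ler_addgt0Pr => e e0; rewrite add0r.
pose e' := Num.min e x.
have e'0 : 0 < e' by rewrite lt_min e0 x0.
apply: (@le_trans _ _ e'); last by rewrite ge_min lexx.
have e'x : e' <= x by rewrite ge_min lexx orbT.
apply: (@le_trans _ _ (Ex P (fun w => (X w <= x)%R%:R - (X w <= x - e')%R%:R))).
  apply: le_Ex => //; first exact: itgB.
  move=> w; have [->|_] := eqVneq (X w) x.
    by rewrite lexx (_ : x <= x - e' = false) ?subr0//; apply/negbTE; rewrite -ltNge ltrBlDr ltrDl.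
  rewrite subr_ge0 ler_nat; case: (leP (X w) (x - e')) => // h.
  by rewrite (le_trans h)// lerBlDr lerDl ltW.
by rewrite ExB// !uX; lra.
Qed.

End uniform.

Section iid_uniform.
Context {R : realType} {d} {T : measurableType d}.
Notation E := (R * R)%type.
Variables (P : probability T R) (Z : nat -> T -> E).
Hypotheses (mZ : forall i, mfunT (Z i))
  (indepZ : mutually_independent P Z)
  (idZ : forall i, same_law P P (Z i) (Z 0))
  (uZ1 : uniform01 P (fst \o Z 0)) (uZ2 : uniform01 P (snd \o Z 0)).

Notation smp := (smp Z).

Section one_coordinate.
Variable c : E -> R.
Hypotheses (mc : mfunT c) (uc : uniform01 P (c \o Z 0)).

(** With one of two observations held fixed, a tie means that a uniform variable hits a given point,
    which has probability zero; there are countably many pairs. *)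
Lemma no_ties : {ae P, forall w, forall n, distinct n (c \o smp w)}.
Proof.
have H i j : i != j -> {ae P, forall w, c (Z i w) != c (Z j w)}.
  move=> ij; apply: (Ex_bool0_ae (b := fun w => c (Z i w) == c (Z j w))).
    by apply: measurable_fun_eqr; apply: (measurableT_comp mc).
  have := @Ex_blocks _ _ R _ E P Z mZ indepZ idZ 1 1 (fun=> i) (fun=> j)
    (fun z z' => (c (z 0%N) == c (z' 0%N))%:R).
  move=> /= ->.
  - rewrite -[RHS](Ex_cst P); congr (Ex P _); apply/funext => w.
    have m1 : mfunT (fun e : E => (c (Z i w) == c e)%:R : R).
      apply: (measurableT_comp (f := fun b : bool => b%:R : R)) => //.
      exact: measurable_fun_eqr.
    have := @Ex_same_law _ _ _ _ R _ _ P P (Z j) (Z 0) (mZ j) (mZ 0) (idZ j) _ _ m1.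
    rewrite /smp /comp => ->.
      by rewrite -(uniform01_point (c (Z i w)) uc); congr (Ex P _); apply/funext => w' /=; rewrite eq_sym.
    by apply/bmf_itg/bmf_bool; apply: measurable_fun_eqr => //; apply: (measurableT_comp mc).
  - split; last by exists 1 => z z'; case: eqP; rewrite ?normr1 ?normr0.
    move=> d' S z z' mz mz'.
    apply: (measurableT_comp (f := fun b : bool => b%:R : R)) => //.
    by apply: measurable_fun_eqr; apply: (measurableT_comp mc).
  - by move=> z' z1 z2 ->.
  - by move=> z' z1 z2 ->.
  - by move=> [|?] [|?].
  - by move=> [|?] [|?].
  - by [].
have A i j : {ae P, forall w, i != j -> c (Z i w) != c (Z j w)}.
  have [->|/H] := eqVneq i j; first exact: aeW.
  by apply: filterS.
have : {ae P, forall w, forall i j, i != j -> c (Z i w) != c (Z j w)}.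
  by apply: ae_foralln => i; apply: ae_foralln => j; exact: A.
apply: filterS => w Hw n i j _ _ /= cij; apply/eqP/negPn/negP => /Hw.
by rewrite /smp in cij; rewrite cij eqxx.
Qed.

End one_coordinate.

Lemma no_ties2 : {ae P, forall w, forall n,
  distinct n (fst \o smp w) /\ distinct n (snd \o smp w)}.
Proof.
have H1 := no_ties measurable_fst uZ1; have H2 := no_ties measurable_snd uZ2.
by apply: filterS2 H1 H2 => w h1 h2 n; split; [exact: h1|exact: h2].
Qed.

Lemma itg_bstat f : bstat f -> itg P (fun w => f (smp w)).
Proof. by move=> bf; apply: bmf_itg; apply: bstat_bmf. Qed.

(** Efron-Stein is applied with [c] the rank sum of [n + 1] observations. By exchangeability [n + 1]
    times its second moment of error is the expectation of the jackknife sum, which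
    [jackknife_bound] controls path by path off ties. *)
Lemma variance_rank_sum_tail C eta D K n : 0 <= C -> 0 < eta ->
  score C D -> score C K -> `|D 2^-1| <= C -> `|K 2^-1| <= C ->
  (forall u, eta ^+ 2 <= u <= 1 - eta ^+ 2 -> D u = 0) ->
  1 <= n.+2%:R * eta ^+ 2 ->
  Ex P (fun w => (rank_sum D K n (smp w) -
                  Ex P (fun w => rank_sum D K n (smp w))) ^+ 2) <=
  2 * n%:R * (jack_const * C ^+ 4 * eta).
Proof.
move=> C0 eta0 sD sK D2 K2 Dmid nbig.
have b1 := @bstat_rank_sum R D K n; have b2 := @bstat_rank_sum R D K n.+1.
apply: (le_trans (variance_le_add_one mZ indepZ idZ b1 b2 _ _ _)).
- exact: depends_rank_sum.
- exact: depends_rank_sum.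
- by move=> i z i_n; rewrite rank_sum_swapn_all// ltnW.
apply: ler_wpM2l; first exact: mulr_ge0.
have bd : bstat (fun z => (rank_sum D K n z - rank_sum D K n.+1 z) ^+ 2).
  by apply: bstatX; exact: bstatB.
have dd : depends n.+1 (fun z => (rank_sum D K n z - rank_sum D K n.+1 z) ^+ 2).
  move=> z z' zz'; rewrite (depends_rank_sum _ _ zz') (@depends_rank_sum _ D K n _ z')// => j jn.
  by apply: zz'; exact: ltnW.
have n1 : (0 : R) < n.+1%:R by rewrite ltr0n.
rewrite -(ler_pM2r n1).
have -> : Ex P (fun w => (rank_sum D K n (smp w) - rank_sum D K n.+1 (smp w)) ^+ 2) * n.+1%:R =
  Ex P (fun w => \sum_(i < n.+1) (rank_sum D K n (smp w \o swapn i n) -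
                                  rank_sum D K n.+1 (smp w)) ^+ 2).
  have E i : (i < n.+1)%N -> Ex P (fun w => (rank_sum D K n (smp w \o swapn i n) -
      rank_sum D K n.+1 (smp w)) ^+ 2) =
      Ex P (fun w => (rank_sum D K n (smp w) - rank_sum D K n.+1 (smp w)) ^+ 2).
    move=> i_n; rewrite -[RHS](@Ex_exchangeable _ _ _ _ _ _ _ mZ indepZ idZ _ (swapn i n) _ bd dd).
      by congr (Ex P _); apply/funext => w; rewrite rank_sum_swapn_all.
    by move=> j k _ _ /(inv_inj (swapnK i n)).
  rewrite Ex_sum; last first.
    move=> i _; apply: (itg_bstat (f := fun z => (rank_sum D K n (z \o swapn i n) - rank_sum D K n.+1 z) ^+ 2)).
    by apply: bstatX; apply: bstatB => //; exact: bstat_comp.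
  rewrite (eq_bigr (fun=> Ex P (fun w => (rank_sum D K n (smp w) - rank_sum D K n.+1 (smp w)) ^+ 2))).
    by rewrite sumr_const card_ord mulr_natr.
  by move=> i _; exact: E.
rewrite -[leRHS](Ex_cst P); apply: le_Ex_ae.
- apply: (itg_bstat (f := fun z => \sum_(i < n.+1) (rank_sum D K n (z \o swapn i n) - rank_sum D K n.+1 z) ^+ 2)).
  by apply: bstat_sum => i _; apply: bstatX; apply: bstatB => //; exact: bstat_comp.
- exact: itg_cst.
- apply: filterS no_ties2 => w /(_ n.+1)[dx dy].
  exact: (jackknife_bound C0 eta0 sD sK D2 K2 Dmid nbig dx dy).
Qed.

End iid_uniform.

(** * Smooth bounded scores *)

Section smooth_scores.
Context {R : realType}.
Implicit Types (B : R) (J j K k : R -> R).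

(** The sample lies in the unit square, where clipping changes nothing; it makes the statistics
    bounded on arbitrary sequences, as [bstat] demands. *)
Definition clip01 (u : R) : R := Num.max 0 (Num.min 1 u).

Lemma clip01_id u : 0 <= u <= 1 -> clip01 u = u.
Proof. by move=> /andP[u0 u1]; rewrite /clip01 min_r// max_r. Qed.

Lemma clip01_itv u : 0 <= clip01 u <= 1.
Proof.
by rewrite /clip01 le_max lexx/= ge_max ler01/= ge_min lexx.
Qed.

(** Here [j] plays the derivative of [J], but only a quadratic Taylor bound is recorded. A score
    continued by tangent lines satisfies it without being twice differentiable. *)
Definition smooth B J j : Prop :=
  [/\ mfunT J, mfunT j,
      (forall u, `|J u| <= B), (forall u, `|j u| <= B) &
      forall u w, 0 <= u <= 1 -> 0 <= w <= 1 ->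
        `|J w - J u - (w - u) * j u| <= B * (w - u) ^+ 2].

Section consequences.
Variables (B : R) (J j : R -> R).
Hypothesis sJ : smooth B J j.

Lemma smooth_bound_ge0 : 0 <= B.
Proof. by case: sJ => _ _ H _ _; exact: le_trans (H 0). Qed.

Lemma smooth_lip u w : 0 <= u <= 1 -> 0 <= w <= 1 ->
  `|J w - J u| <= 2 * B * `|w - u|.
Proof.
move=> u01 w01; have B0 := smooth_bound_ge0.
have [_ _ _ bj T] := sJ; have h := T u w u01 w01.
rewrite -[J w - J u](subrK ((w - u) * j u)).
rewrite (le_trans (ler_normD _ _))//.
have h1 : `|(w - u) * j u| <= B * `|w - u|.
  by rewrite normrM mulrC ler_wpM2r.
have h2 : B * (w - u) ^+ 2 <= B * `|w - u|.
  apply: ler_wpM2l => //; rewrite -real_normK ?num_real// expr2 ler_piMr//.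
  by apply/ler_normlP; split; lra.
lra.
Qed.

(** Adding the Taylor bounds from [u] to [w] and from [w] to [u] cancels [J] and leaves
    [(w - u) (j w - j u)]. *)
Lemma smooth_deriv_lip u w : 0 <= u <= 1 -> 0 <= w <= 1 ->
  `|j w - j u| <= 2 * B * `|w - u|.
Proof.
move=> u01 w01; have B0 := smooth_bound_ge0.
have [_ _ _ _ T] := sJ; have h1 := T u w u01 w01; have h2 := T w u w01 u01.
have [->|wu] := eqVneq w u; first by rewrite !subrr normr0 mulr0.
have wu0 : 0 < `|w - u| by rewrite normr_gt0 subr_eq0.
rewrite -(ler_pM2l wu0) -normrM.
rewrite (_ : (w - u) * _ = (J w - J u - (w - u) * j u) + (J u - J w - (u - w) * j w)); last by ring.
rewrite (le_trans (ler_normD _ _))//.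
rewrite (_ : `|w - u| * _ = B * (w - u) ^+ 2 + B * (u - w) ^+ 2) ?lerD//.
rewrite -[(u - w) ^+ 2]sqrrN opprB -[(w - u) ^+ 2]real_normK ?num_real//; ring.
Qed.

End consequences.

(** In use, [a] and [a'] are the ranks of one point before and after a new observation, and [b]
    tells whether the new one lies below; then [N (a - a') = a - b] exactly. So [N] times the change
    is a derivative along [a - b], and moving the base point from [(a, c)] to [(u, v)] costs
    Lipschitz terms. The 5 is 1 + 2 + 2 for each of the two distances, and exceeds the 4 found for
    [N^-1]. *)
Lemma product_expansion B J j K k (a a' c c' u v b b2 N : R) :
  smooth B J j -> smooth B K k -> 1 <= N ->
  0 <= a <= 1 -> 0 <= a' <= 1 -> 0 <= c <= 1 -> 0 <= c' <= 1 ->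
  0 <= u <= 1 -> 0 <= v <= 1 -> 0 <= b <= 1 -> 0 <= b2 <= 1 ->
  N * (a - a') = a - b -> N * (c - c') = c - b2 ->
  `|N * (J a * K c - J a' * K c') +
     (j u * K v * (b - u) + J u * k v * (b2 - v))| <=
  5 * B ^+ 2 * (`|a - u| + `|c - v| + N^-1).
Proof.
move=> sJ sK N1 a01 a'01 c01 c'01 u01 v01 b01 b201 Na Nc.
have B0 := smooth_bound_ge0 sJ; have N0 : 0 < N by exact: lt_le_trans N1.
have [_ _ bJ bj TJ] := sJ; have [_ _ bK bk TK] := sK.
have dlt x y b' : 0 <= x <= 1 -> 0 <= b' <= 1 -> N * (x - y) = x - b' ->
    N * (y - x) ^+ 2 <= N^-1.
  move=> x01 b'01 e; rewrite -(ler_pM2l N0) mulrA divff ?gt_eqF//.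
  rewrite -expr2 -exprMn -opprB mulrN e -real_normK ?num_real// expr_le1//.
  by rewrite normrN; clear - x01 b'01; apply/ler_normlP; split; lra.
have e1 := TJ a a' a01 a'01; have e2 := TK c c' c01 c'01.
set E1 := J a' - J a - _ in e1; set E2 := K c' - K c - _ in e2.
have -> : N * (J a * K c - J a' * K c') +
     (j u * K v * (b - u) + J u * k v * (b2 - v)) =
  (a - u) * (j a * K c) + (u - b) * ((j a - j u) * K c) + (u - b) * (j u * (K c - K v)) +
  (c - v) * (k c * J a') + (v - b2) * ((k c - k v) * J a') + (v - b2) * (k v * (J a' - J u)) -
  N * (E1 * K c + J a' * E2).
  rewrite /E1 /E2.
  have -> : J a * K c - J a' * K c' = (J a - J a') * K c + J a' * (K c - K c') by ring.
  rewrite [RHS](_ : _ = (N * (J a - J a') * K c + J a' * (N * (K c - K c'))) +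
     ((a - b) - N * (a - a')) * (j a * K c) + ((c - b2) - N * (c - c')) * (k c * J a') +
     (j u * K v * (b - u) + J u * k v * (b2 - v))); last by ring.
  by rewrite Na Nc !subrr !mul0r; ring.
have BB : 0 <= B * B by exact: mulr_ge0.
have m2 (x y X Y : R) : `|x| <= X -> `|y| <= Y -> `|x * y| <= X * Y.
  by move=> hx hy; rewrite normrM ler_pM.
have ub : `|u - b| <= 1 by clear - u01 b01; apply/ler_normlP; split; lra.
have vb : `|v - b2| <= 1 by clear - v01 b201; apply/ler_normlP; split; lra.
have ja := smooth_deriv_lip sJ u01 a01; have kc := smooth_deriv_lip sK v01 c01.
have Kc := smooth_lip sK v01 c01.
have Ja : `|J a' - J u| <= 2 * B * (`|a - u| + N^-1).
  rewrite (le_trans (smooth_lip sJ u01 a'01))//; apply: ler_wpM2l; first exact: mulr_ge0.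
  rewrite (_ : a' - u = (a - u) - (a - a')); last by ring.
  rewrite (le_trans (ler_normB _ _))// lerD2l -(ler_pM2l N0) divff ?gt_eqF//.
  by rewrite -{1}(gtr0_norm N0) -normrM Na; clear - a01 b01; apply/ler_normlP; split; lra.
have t1 := m2 _ _ _ _ (lexx `|a - u|) (m2 _ _ _ _ (bj a) (bK c)).
have t2 := m2 _ _ _ _ ub (m2 _ _ _ _ ja (bK c)).
have t3 := m2 _ _ _ _ ub (m2 _ _ _ _ (bj u) Kc).
have t4 := m2 _ _ _ _ (lexx `|c - v|) (m2 _ _ _ _ (bk c) (bJ a')).
have t5 := m2 _ _ _ _ vb (m2 _ _ _ _ kc (bJ a')).
have t6 := m2 _ _ _ _ vb (m2 _ _ _ _ (bk v) Ja).
have t7 : `|N * (E1 * K c + J a' * E2)| <= 2 * (B * B) * N^-1.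
  have d1 := dlt a a' b a01 b01 Na; have d2 := dlt c c' b2 c01 b201 Nc.
  rewrite normrM gtr0_norm//.
  apply: (@le_trans _ _ (N * ((B * (a' - a) ^+ 2) * B + B * (B * (c' - c) ^+ 2)))).
    rewrite ler_pM2l// (le_trans (ler_normD _ _))//.
    by apply: lerD; apply: m2.
  rewrite (_ : N * _ = (B * B) * (N * (a' - a) ^+ 2) + (B * B) * (N * (c' - c) ^+ 2)); last by ring.
  by have := ler_wpM2l BB d1; have := ler_wpM2l BB d2; clear; lra.
rewrite (le_trans (ler_normB _ _))// (le_trans (lerD (le_trans (ler_normD _ _) (lerD
   (le_trans (ler_normD _ _) (lerD (le_trans (ler_normD _ _) (lerD (le_trans (ler_normD _ _)
   (lerD (le_trans (ler_normD _ _) (lerD t1 t2)) t3)) t4)) t5)) t6)) t7))//.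
have au : 0 <= (B * B) * `|a - u| by exact: mulr_ge0.
have cv : 0 <= (B * B) * `|c - v| by exact: mulr_ge0.
have nn : 0 <= (B * B) * N^-1 by rewrite mulr_ge0// invr_ge0 ltW.
rewrite expr2; clear - au cv nn; lra.
Qed.

Lemma sqr_sum_le (n : nat) (a : 'I_n -> R) :
  (\sum_i a i) ^+ 2 <= n%:R * \sum_i a i ^+ 2.
Proof.
have -> : n%:R * \sum_i a i ^+ 2 = \sum_i \sum_l (a i ^+ 2 / 2 + a l ^+ 2 / 2).
  rewrite [RHS](eq_bigr (fun i => n%:R * (a i ^+ 2 / 2) + (\sum_l a l ^+ 2) / 2)).
    by rewrite big_split/= -mulr_sumr -mulr_suml sumr_const card_ord -mulr_natl; field.
  by move=> i _; rewrite big_split/= sumr_const card_ord -[_ *+ n]mulr_natl -mulr_suml.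
rewrite expr2 mulr_suml; apply: ler_sum => i _; rewrite mulr_sumr.
by apply: ler_sum => l _; have := sqr_ge0 (a i - a l); rewrite sqrrB; lra.
Qed.

Lemma sqr6_le (a b c d e f : R) : (a + b + c + d + e + f) ^+ 2 <=
  6 * (a ^+ 2 + b ^+ 2 + c ^+ 2 + d ^+ 2 + e ^+ 2 + f ^+ 2).
Proof.
have S (x y : R) : x * y <= (x ^+ 2 + y ^+ 2) / 2.
  by have := sqr_ge0 (x - y); rewrite sqrrB; lra.
have := S a b; have := S a c; have := S a d; have := S a e; have := S a f.
have := S b c; have := S b d; have := S b e; have := S b f; have := S c d.
have := S c e; have := S c f; have := S d e; have := S d f; have := S e f.
nra.
Qed.

End smooth_scores.

(** * A conditional second moment bound *)

Section law_of_large_numbers.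
Context {R : realType} {dT dE : measure_display} {T : measurableType dT}
  {E : measurableType dE}.
Variables (P : probability T R) (Z : nat -> T -> E).
Hypotheses (mZ : forall i, mfunT (Z i))
  (indepZ : mutually_independent P Z)
  (idZ : forall i, same_law P P (Z i) (Z 0)).

Lemma bmf_comp {d1 d2} {T1 : measurableType d1} {T2 : measurableType d2}
  (h : T2 -> R) (f : T1 -> T2) : bmf h -> mfunT f ->
  bmf (fun x => h (f x)).
Proof.
by move=> [mh [M hM]] mf; split; [exact: measurableT_comp|exists M => x].
Qed.

Lemma Ex_iid (h : E -> R) i : bmf h ->
  Ex P (fun w => h (Z i w)) = Ex P (fun w => h (Z 0 w)).
Proof.
move=> bh; apply: (Ex_same_law (mZ i) (mZ 0) (idZ i) (f := h)).
  by apply: bmf_itg; exact: bmf_comp.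
by case: bh.
Qed.

Variable h : E * E -> R.
Hypothesis bh : bmf h.

Definition partial_mean (e : E) : R := Ex P (fun w => h (Z 0 w, e)).

Lemma bmf_partial_mean : bmf partial_mean.
Proof.
have bg : bmf (fun p : T * E => h (Z 0 p.1, p.2)).
  apply: (bmf_comp (f := fun p : T * E => (Z 0 p.1, p.2)) bh).
  by apply/measurable_fun_pair => //; exact: (measurableT_comp (mZ 0)).
exact: (bmf_Ex2 P (law P (mZ 0)) bg).
Qed.

Let g e e0 : R := h (e, e0) - partial_mean e0.

Let bg : bmf (fun p : E * E => g p.1 p.2).
Proof.
apply: bmfB; last exact: (bmf_comp bmf_partial_mean).
by apply: (bmf_comp bh); apply/measurable_fun_pair.
Qed.

Let bg1 e0 : bmf (fun e => g e e0).
Proof. by apply: (bmf_comp (f := fun e => (e, e0)) bg); apply/measurable_fun_pair. Qed.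

Let g_mean e0 i : Ex P (fun w => g (Z i w) e0) = 0.
Proof.
rewrite (Ex_iid i (bg1 e0)) /g ExB ?Ex_cst ?subrr//; last exact: itg_cst.
apply: bmf_itg; apply: (bmf_comp (f := fun w => (Z 0 w, e0)) bh).
by apply/measurable_fun_pair.
Qed.

Let g_orth i j m : i != j -> i != m -> j != m ->
  Ex P (fun w => g (Z i w) (Z m w) * g (Z j w) (Z m w)) = 0.
Proof.
move=> ij im jm.
pose t n := if n == 0%N then i else j.
have := @Ex_blocks _ _ R _ E P Z mZ indepZ idZ 1 2 (fun=> m) t
    (fun z z' => g (z' 0%N) (z 0%N) * g (z' 1%N) (z 0%N)).
rewrite /comp /smp /= => ->.
- rewrite -[RHS](Ex_cst P); congr (Ex P _); apply/funext => w.
  have := @Ex_blocks _ _ R _ E P Z mZ indepZ idZ 1 1 (fun=> i) (fun=> j)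
    (fun z z' => g (z 0%N) (Z m w) * g (z' 0%N) (Z m w)).
  rewrite /comp /smp /= => ->.
  + rewrite -[RHS](Ex_cst P); congr (Ex P _); apply/funext => w'.
    by rewrite ExZ ?g_mean ?mulr0//; apply: bmf_itg; exact: (bmf_comp (bg1 _)).
  + split.
      move=> d' S z z' mz mz'; have [m1 _] := bg1 (Z m w).
      by apply: measurable_funM; apply: (measurableT_comp m1); [exact: mz|exact: mz'].
    have [_ [M gM]] := bg1 (Z m w); exists (M * M) => z z'.
    by rewrite normrM ler_pM.
  + by move=> z' z1 z2 ->.
  + by move=> z' z1 z2 ->.
  + by move=> [|?] [|?].
  + by move=> [|?] [|?].
  + by [].
- have [m1 [M gM]] := bg; split.
    move=> d' S z z' mz mz'; have H a b : mfunT (fun s => g (z' s a) (z s b)).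
      have mp : mfunT (fun s => (z' s a, z s b)) by apply/measurable_fun_pair.
      by case: (bmf_comp bg mp).
    by apply: measurable_funM.
  exists (M * M) => z z'; rewrite normrM.
  by apply: ler_pM => //; [exact: (gM (z' 0%N, z 0%N))|exact: (gM (z' 1%N, z 0%N))].
- by move=> z' z1 z2 H; rewrite H.
- by move=> z' z1 z2 H; rewrite !H.
- by move=> [|?] [|?].
- move=> [|[|?]] [|[|?]] // _ _; rewrite /t/=; first by move/eqP; rewrite (negbTE ij).
  by move/eqP; rewrite eq_sym (negbTE ij).
- by move=> [|?] [|[|?]] // _ _; rewrite /t/= eq_sym.
Qed.

(** Given [Z m], the summands are independent and centred, so all cross terms vanish by [g_orth] and
    each diagonal term is at most [(2 M)^2]. *)
Lemma second_moment_sum_le M m : (forall p, `|h p| <= M) ->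
  Ex P (fun w => (\sum_(i < m) (h (Z i w, Z m w) - partial_mean (Z m w))) ^+ 2)
  <= 4 * M ^+ 2 * m%:R.
Proof.
move=> hM.
have -> : (fun w => (\sum_(i < m) (h (Z i w, Z m w) - partial_mean (Z m w))) ^+ 2) =
  fun w => \sum_(i < m) \sum_(j < m) g (Z i w) (Z m w) * g (Z j w) (Z m w).
  apply/funext => w; rewrite expr2 mulr_suml; apply: eq_bigr => i _.
  by rewrite mulr_sumr.
have bgm i : bmf (fun w => g (Z i w) (Z m w)).
  apply: (bmf_comp (f := fun w => (Z i w, Z m w)) bg).
  by apply/measurable_fun_pair.
have ig i j : itg P (fun w => g (Z i w) (Z m w) * g (Z j w) (Z m w)).
  by apply: bmf_itg; exact: bmfM.
rewrite Ex_sum; last by move=> i _; exact: itg_sum.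
apply: (@le_trans _ _ (\sum_(i < m) 4 * M ^+ 2)); last first.
  by rewrite sumr_const card_ord -[_ *+ m]mulr_natr.
apply: ler_sum => i _; rewrite Ex_sum; last by move=> j _; exact: ig.
rewrite (bigD1 i)//= big1 ?addr0; last first.
  move=> j ji; apply: g_orth; first by rewrite eq_sym.
    by rewrite neq_ltn ltn_ord.
  by rewrite neq_ltn ltn_ord.
apply: Ex_le_cst; first exact: ig.
move=> w; rewrite -expr2 -real_normK ?num_real// (_ : 4 * _ = (M + M) ^+ 2); last by ring.
have M0 : 0 <= M by exact: le_trans (hM (Z 0 w, Z 0 w)).
apply: lerXn2r; rewrite ?nnegrE ?addr_ge0// (le_trans (ler_normB _ _))// lerD//.
apply: norm_Ex_cst => //; apply: bmf_itg.
by apply: (bmf_comp (f := fun w' => (Z 0 w', Z m w)) bh); apply/measurable_fun_pair.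
Qed.

End law_of_large_numbers.

(** * Linearization of rank sums with smooth scores *)

Section linearization.
Context {R : realType} {d} {T : measurableType d}.
Notation E := (R * R)%type.
Variables (P : probability T R) (Z : nat -> T -> E).
Hypotheses (mZ : forall i, mfunT (Z i))
  (indepZ : mutually_independent P Z)
  (idZ : forall i, same_law P P (Z i) (Z 0))
  (Z01 : forall i w, 0 <= (Z i w).1 <= 1 /\ 0 <= (Z i w).2 <= 1)
  (uZ1 : uniform01 P (fst \o Z 0)) (uZ2 : uniform01 P (snd \o Z 0)).

Notation smp := (smp Z).

Lemma itv01_bool (b : bool) : 0 <= (b%:R : R) <= 1.
Proof. by case: b; rewrite ?lexx ?ler01. Qed.

Lemma itg_ext (f g : T -> R) : itg P f -> (forall w, g w = f w) -> itg P g.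
Proof. by move=> fi gf; rewrite (_ : g = f)//; apply/funext. Qed.

Section grid_rank.
Variable c : E -> R.
Hypotheses (mc : mfunT c) (uc : uniform01 P (c \o Z 0))
  (c01 : forall i w, 0 <= c (Z i w) <= 1).

Let bc : bmf (fun p : E * E => (c p.1 <= c p.2)%R%:R : R).
Proof.
apply: bmf_bool; apply: measurable_fun_ler; exact: (measurableT_comp mc).
Qed.

Lemma bstat_full_dist n k :
  bstat (fun z : nat -> E => (full n (c \o z) k - clip01 (c (z k))) ^+ 2 : R).
Proof.
apply: bstatX; apply: bstatB; first exact: (bstat_rank mc (fun p => p%:R / n.+1%:R)).
apply: (bstat_coord (h := fun e => clip01 (c e))); split.
  by apply: measurable_maxr => //; apply: measurable_minr.
by exists 1 => e; have /andP[? ?] := clip01_itv (c e); rewrite ger0_norm.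
Qed.

(** Times [n + 2], the error is a centred sum over the other [n] points plus the correction
    [1 - 2 c]: the point counts itself once, and the denominator exceeds the number of other points
    by two. *)
Lemma full_dist_last n : Ex P (fun w => (full n.+1 (c \o smp w) n - c (Z n w)) ^+ 2)
  <= 10 / n.+2%:R.
Proof.
pose S w : R := \sum_(i < n) ((c (Z i w) <= c (Z n w))%R%:R - partial_mean P Z (fun p => (c p.1 <= c p.2)%R%:R) (Z n w)).
have pE w : partial_mean P Z (fun p => (c p.1 <= c p.2)%R%:R) (Z n w) = c (Z n w).
  by case: uc => _ _ /(_ (c (Z n w)) (c01 n w)).
have n2 : (0 : R) < n.+2%:R by rewrite ltr0n.
have FE w : full n.+1 (c \o smp w) n - c (Z n w) =
    (S w + (1 - 2 * c (Z n w))) / n.+2%:R.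
  apply: (mulIf (x := n.+2%:R)); first by rewrite gt_eqF.
  rewrite divfK ?gt_eqF// mulrBl /full divfK ?gt_eqF//.
  rewrite /rank_in big_ord_recr/= lexx natrD natr_sum /S.
  under [X in _ = X + _]eq_bigr do rewrite pE.
  rewrite /smp /= sumrB sumr_const card_ord -[_ *+ n]mulr_natr.
  rewrite -[n.+2%:R]natr1 -[n.+1%:R]natr1; ring.
have bS : bmf S.
  apply: bmf_sum => i _; apply: bmfB.
    have mp : mfunT (fun w => (Z i w, Z n w)) by apply/measurable_fun_pair.
    exact: (bmf_comp bc mp).
  exact: (bmf_comp (bmf_partial_mean P mZ bc)).
have S2 := second_moment_sum_le mZ indepZ idZ bc (M := 1) n _.
have {}S2 : Ex P (fun w => S w ^+ 2) <= 4 * n%:R.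
  have hb (p : E * E) : `|(c p.1 <= c p.2)%R%:R| <= 1 :> R.
    by case: (c p.1 <= c p.2); rewrite ?normr1 ?normr0.
  by move: (S2 hb); rewrite expr1n mulr1.
apply: (@le_trans _ _ (Ex P (fun w => n.+2%:R ^- 2 * (2 * S w ^+ 2 + 2)))).
  apply: le_Ex.
  - have := bstat_bmf (bstat_full_dist n.+1 n) (mfamily_smp mZ).
    by move=> /(bmf_itg P)/itg_ext; apply => w; rewrite clip01_id//; exact: c01.
  - apply: itgZ; apply: itgD; last exact: itg_cst.
    by apply: itgZ; apply: bmf_itg; exact: bmfX.
  - move=> w; rewrite FE expr_div_n mulrC ler_pM2l ?invr_gt0 ?exprn_gt0//.
    have /andP[c0 c1] := c01 n w.
    have : (1 - 2 * c (Z n w)) ^+ 2 <= 1 by nra.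
    by have := sqr_ge0 (S w - (1 - 2 * c (Z n w))); rewrite sqrrB sqrrD; lra.
have iS : itg P (fun w => S w ^+ 2) by apply: bmf_itg; exact: bmfX.
rewrite ExZ; last by apply: itgD; [exact: itgZ|exact: itg_cst].
rewrite ExD; [|exact: itgZ|exact: itg_cst].
rewrite ExZ// Ex_cst ler_pdivlMr// [leLHS](_ : _ = (2 * Ex P (fun w => S w ^+ 2) + 2) / n.+2%:R); last first.
  by field; rewrite gt_eqF.
rewrite ler_pdivrMr// -2!natr1.
have : (0 : R) <= n%:R by []. 
lra.
Qed.

Lemma full_dist n k : (k < n)%N ->
  Ex P (fun w => (full n (c \o smp w) k - c (Z k w)) ^+ 2) <= 10 / n.+1%:R.
Proof.
case: n => // n kn; apply: le_trans (full_dist_last n).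
pose f z := (full n.+1 (c \o z) n - clip01 (c (z n))) ^+ 2 : R.
have df : depends n.+1 f.
  move=> z z' zz'; rewrite /f /full (@rank_in_local _ _ _ (c \o z')) ?zz'// => i im /=.
  by rewrite zz'.
have := @Ex_exchangeable _ _ _ _ _ _ _ mZ indepZ idZ _ (swapn k n) _ (bstat_full_dist n.+1 n) df.
have -> : (fun w => f (smp w)) = (fun w => (full n.+1 (c \o smp w) n - c (Z n w)) ^+ 2).
  by apply/funext => w; rewrite /f/= clip01_id//; exact: c01.
move=> <-; last by move=> i j _ _ /(inv_inj (swapnK k n)).
rewrite le_eqVlt; apply/orP; left; apply/eqP; congr (Ex P _); apply/funext => w.
rewrite /= /full (rank_in_swapn_all (c \o smp w) n (kn : (k <= n)%N)).
have -> : swapn k n n = k by rewrite /swapn eqxx; case: ifP => // /eqP ->.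
by rewrite clip01_id//; exact: c01.
Qed.

End grid_rank.

Variables (B : R) (J j K k : R -> R).
Hypotheses (sJ : smooth B J j) (sK : smooth B K k).

(** First-order effect on the summand of the point [p.1] when the observation [p.2] joins the sample
    and shifts its two ranks. *)
Definition rank_kernel (p : E * E) : R :=
  let u := clip01 p.1.1 in let v := clip01 p.1.2 in
  j u * K v * ((p.2.1 <= p.1.1)%R%:R - u) + J u * k v * ((p.2.2 <= p.1.2)%R%:R - v).

(** The influence function of [E J(U) K(V)] when the marginal distribution functions are estimated
    by ranks: the direct contribution of [e], plus its mean effect on the ranks of all the
    others. *)
Definition influence (e : E) : R :=
  J (clip01 e.1) * K (clip01 e.2) + partial_mean P Z rank_kernel e.

Let B0 : 0 <= B. Proof. exact: smooth_bound_ge0 sJ. Qed.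

Let mclip {d'} {S : measurableType d'} (f : S -> R) : mfunT f ->
  mfunT (fun s => clip01 (f s)).
Proof. by move=> mf; apply: measurable_maxr => //; apply: measurable_minr. Qed.

Let bmf_score (F : R -> R) {d'} {S : measurableType d'} (f : S -> R) :
  mfunT F -> (forall u, `|F u| <= B) -> mfunT f ->
  bmf (fun s => F (clip01 (f s))).
Proof.
move=> mF bF mf; split; last by exists B => s.
by apply: (measurableT_comp mF); exact: mclip.
Qed.

Lemma bmf_rank_kernel : bmf rank_kernel.
Proof.
have [mJ mj bJ bj _] := sJ; have [mK mk bK bk _] := sK.
have bcl (f : E * E -> R) : mfunT f -> bmf (fun p => clip01 (f p)).
  move=> mf; split; first exact: mclip.
  by exists 1 => e; have /andP[? ?] := clip01_itv (f e); rewrite ger0_norm.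
have m11 : mfunT (fun p : E * E => p.1.1) by exact: measurableT_comp.
have m12 : mfunT (fun p : E * E => p.1.2) by exact: measurableT_comp.
have m21 : mfunT (fun p : E * E => p.2.1) by exact: measurableT_comp.
have m22 : mfunT (fun p : E * E => p.2.2) by exact: measurableT_comp.
apply: bmfD; apply: bmfM.
- by apply: bmfM; exact: bmf_score.
- by apply: bmfB; [apply: bmf_bool; exact: measurable_fun_ler|exact: bcl].
- by apply: bmfM; exact: bmf_score.
- by apply: bmfB; [apply: bmf_bool; exact: measurable_fun_ler|exact: bcl].
Qed.

Lemma rank_kernel_le p : `|rank_kernel p| <= 2 * B ^+ 2.
Proof.
have [_ _ bJ bj _] := sJ; have [_ _ bK bk _] := sK.
have H (x y : R) (b : bool) u : `|x| <= B -> `|y| <= B -> 0 <= u <= 1 ->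
    `|x * y * (b%:R - u)| <= B ^+ 2.
  move=> xB yB u01; rewrite !normrM expr2 -[leRHS]mulr1.
  apply: ler_pM => //; first exact: ler_pM.
  by have /andP[? ?] := itv01_bool b; apply/ler_normlP; split; lra.
rewrite /rank_kernel (le_trans (ler_normD _ _))// (_ : 2 * _ = B ^+ 2 + B ^+ 2); last by ring.
by apply: lerD; apply: H => //; exact: clip01_itv.
Qed.

Lemma bmf_influence : bmf influence.
Proof.
have [mJ mj bJ bj _] := sJ; have [mK mk bK bk _] := sK.
apply: bmfD; first by apply: bmfM; exact: bmf_score.
exact: (bmf_partial_mean P mZ bmf_rank_kernel).
Qed.

Lemma full_succ n (x : nat -> R) i : (i < n)%N ->
  n.+2%:R * (full n x i - full n.+1 x i) = full n x i - (x n <= x i)%R%:R.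
Proof.
move=> i_n; rewrite /full {2}/rank_in big_ord_recr/= -/(rank_in n x i) natrD.
rewrite -2!natr1; field.
by rewrite !natr1 !pnatr_eq0.
Qed.

Let fullE01 n (x : nat -> R) i : (i < n)%N -> 0 <= full n x i <= 1.
Proof. by move=> /(full_itv x)/andP[? ?]; rewrite !ltW. Qed.

(** The product expansion is summed over the [n] old points; the sum of [rank_kernel] is replaced by
    its conditional mean given the new point, and the summand of the new point is compared with its
    value at the true coordinates. Each of the six terms has a second moment of order [1 / n]. *)
Let remainder_le n w :
  `|rank_sum J K n (smp w) - rank_sum J K n.+1 (smp w) + influence (Z n w)| <=
  2 * B ^+ 2 * `|full n.+1 (fst \o smp w) n - (Z n w).1| +
  2 * B ^+ 2 * `|full n.+1 (snd \o smp w) n - (Z n w).2| +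
  `|\sum_(i < n) (rank_kernel (Z i w, Z n w) - partial_mean P Z rank_kernel (Z n w))| / n.+2%:R +
  9 * B ^+ 2 / n.+2%:R +
  5 * B ^+ 2 / n.+2%:R * (\sum_(i < n) `|full n (fst \o smp w) i - (Z i w).1|) +
  5 * B ^+ 2 / n.+2%:R * (\sum_(i < n) `|full n (snd \o smp w) i - (Z i w).2|).
Proof.
have [_ _ bJ bj _] := sJ; have [_ _ bK bk _] := sK.
set N : R := n.+2%:R; have N1 : 1 <= N by rewrite ler1n.
have nN : n%:R <= N by rewrite /N ler_nat -addn2 leq_addr.
have N0 : 0 < N by rewrite ltr0n.
have [z1 z2] := Z01 n w.
set H := partial_mean _ _ _ _; set Sg := \sum_(i < n) (_ - H).
pose term i := J (full n (fst \o smp w) i) * K (full n (snd \o smp w) i) -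
  J (full n.+1 (fst \o smp w) i) * K (full n.+1 (snd \o smp w) i).
have tE i : (i < n)%N -> `|N * term i + rank_kernel (Z i w, Z n w)| <=
   5 * B ^+ 2 * (`|full n (fst \o smp w) i - (Z i w).1| +
                 `|full n (snd \o smp w) i - (Z i w).2| + N^-1).
  move=> i_n; have [u01 v01] := Z01 i w; rewrite /rank_kernel/= !clip01_id//.
  have i_n1 : (i < n.+1)%N by exact: ltnW.
  apply: (product_expansion sJ sK) => //; try exact: fullE01; try exact: itv01_bool.
  - exact: (full_succ (fst \o smp w) i_n).
  - exact: (full_succ (snd \o smp w) i_n).
have E1 : rank_sum J K n (smp w) - rank_sum J K n.+1 (smp w) + influence (Z n w) =
  N^-1 * (\sum_(i < n) (N * term i + rank_kernel (Z i w, Z n w))) - N^-1 * Sg +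
  (J (Z n w).1 * K (Z n w).2 - J (full n.+1 (fst \o smp w) n) * K (full n.+1 (snd \o smp w) n)) +
  2 / N * H.
  have tS : \sum_(i < n) term i = rank_sum J K n (smp w) -
     \sum_(i < n) J (full n.+1 (fst \o smp w) i) * K (full n.+1 (snd \o smp w) i).
    by rewrite /rank_sum -sumrB.
  have -> : rank_sum J K n (smp w) - rank_sum J K n.+1 (smp w) = \sum_(i < n) term i -
     J (full n.+1 (fst \o smp w) n) * K (full n.+1 (snd \o smp w) n).
    by rewrite tS {2}/rank_sum big_ord_recr/= opprD addrA.
  rewrite [X in _ = N^-1 * X - _ + _ + _]big_split/= -mulr_sumr mulrDr mulrA mulVf ?gt_eqF// mul1r.
  have -> : Sg = \sum_(i < n) rank_kernel (Z i w, Z n w) - n%:R * H.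
    by rewrite /Sg sumrB sumr_const card_ord -[_ *+ n]mulr_natl.
  rewrite /influence !clip01_id// -/H.
  have nN2 : n%:R = N - 2 by rewrite /N -2!natr1; ring.
  rewrite nN2; field; by rewrite gt_eqF.
have HB : `|H| <= 2 * B ^+ 2.
  apply: norm_Ex_cst; last by move=> w'; exact: rank_kernel_le.
  apply: bmf_itg; apply: (bmf_comp (f := fun w' => (Z 0 w', Z n w)) bmf_rank_kernel).
  by apply/measurable_fun_pair.
have T1 : `|N^-1 * (\sum_(i < n) (N * term i + rank_kernel (Z i w, Z n w)))| <=
  5 * B ^+ 2 / N * (\sum_(i < n) `|full n (fst \o smp w) i - (Z i w).1|) +
  5 * B ^+ 2 / N * (\sum_(i < n) `|full n (snd \o smp w) i - (Z i w).2|) +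
  5 * B ^+ 2 / N.
  rewrite normrM gtr0_norm ?invr_gt0// mulrC ler_pdivrMr//.
  apply: (le_trans (ler_norm_sum _ _ _)).
  apply: (@le_trans _ _ (\sum_(i < n) 5 * B ^+ 2 * (`|full n (fst \o smp w) i - (Z i w).1| +
                 `|full n (snd \o smp w) i - (Z i w).2| + N^-1))).
    by apply: ler_sum => i _; exact: tE.
  rewrite -mulr_sumr !big_split/= sumr_const card_ord -[_ *+ n]mulr_natl.
  set s1 := \sum_(i < n) _; set s2 := \sum_(i < n) _.
  rewrite [leRHS](_ : _ = 5 * B ^+ 2 * (s1 + s2 + 1)); last by field; rewrite gt_eqF.
  apply: ler_wpM2l; first by rewrite mulr_ge0 ?sqr_ge0.
  by rewrite lerD2l ler_pdivrMr// mul1r.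
have T3 : `|J (Z n w).1 * K (Z n w).2 - J (full n.+1 (fst \o smp w) n) * K (full n.+1 (snd \o smp w) n)| <=
  2 * B ^+ 2 * `|full n.+1 (fst \o smp w) n - (Z n w).1| +
  2 * B ^+ 2 * `|full n.+1 (snd \o smp w) n - (Z n w).2|.
  set a := full _ _ _; set b := full _ _ _.
  have a01 : 0 <= a <= 1 by exact: fullE01.
  have b01 : 0 <= b <= 1 by exact: fullE01.
  rewrite (_ : _ - _ = (J (Z n w).1 - J a) * K (Z n w).2 + J a * (K (Z n w).2 - K b)); last by ring.
  rewrite (le_trans (ler_normD _ _))//; apply: lerD; rewrite normrM.
  - rewrite distrC (_ : 2 * B ^+ 2 * _ = (2 * B * `|a - (Z n w).1|) * B); last by ring.
    by apply: ler_pM => //; exact: (smooth_lip sJ z1 a01).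
  - rewrite [X in _ * X <= _]distrC (_ : 2 * B ^+ 2 * _ = B * (2 * B * `|b - (Z n w).2|)); last by ring.
    by apply: ler_pM => //; exact: (smooth_lip sK z2 b01).
have T4 : `|2 / N * H| <= 4 * B ^+ 2 / N.
  have h2N : 0 <= 2 / N by apply: divr_ge0 => //; exact: ltW.
  rewrite normrM (ger0_norm h2N) [leRHS](_ : _ = 2 / N * (2 * B ^+ 2)); last by field; rewrite gt_eqF.
  exact: ler_wpM2l.
have T2 : `|N^-1 * Sg| <= `|Sg| / N by rewrite normrM gtr0_norm ?invr_gt0// mulrC.
rewrite E1.
rewrite (le_trans (ler_normD _ _))// (le_trans (lerD (le_trans (ler_normD _ _)
  (lerD (le_trans (ler_normB _ _) (lerD T1 T2)) T3)) T4))//.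
have -> : 9 * B ^+ 2 / N = 5 * B ^+ 2 / N + 4 * B ^+ 2 / N by field; rewrite gt_eqF.
by rewrite le_eqVlt; apply/orP; left; apply/eqP; ring.
Qed.

(** Efron-Stein for the rank sum minus its influences, with the same difference at [n + 1] as [c].
    The influence of the new point cancels the first-order change, the squared remainder has
    expectation of order [1 / n], and the factor [2 n] leaves a bound free of [n]. *)
Lemma variance_rank_sum_linear n :
  Ex P (fun w => ((rank_sum J K n (smp w) - \sum_(i < n) influence (Z i w)) -
    Ex P (fun w => rank_sum J K n (smp w) - \sum_(i < n) influence (Z i w))) ^+ 2) <=
  12 * 800 * B ^+ 4.
Proof.
pose f n z := rank_sum J K n z - \sum_(i < n) influence (z i) : R.
have bf m : bstat (f m).
  apply: bstatB; first exact: bstat_rank_sum.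
  by apply: bstat_sum => i _; apply: (bstat_coord (h := influence)); exact: bmf_influence.
have df m : depends m (f m).
  move=> z z' zz'; rewrite /f (depends_rank_sum _ _ zz'); congr (_ - _).
  by apply: eq_bigr => i _; rewrite zz'.
apply: (le_trans (variance_le_add_one mZ indepZ idZ (bf n) (bf n.+1) (df n) (df n.+1) _)).
  move=> i z i_n; rewrite /f rank_sum_swapn_all 1?ltnW//; congr (_ - _).
  exact: (big_swapn_all _ (fun k => influence (z k)) (ltnW i_n)).
set N : R := n.+2%:R; have N0 : 0 < N by rewrite ltr0n.
have N1 : 1 <= N by rewrite ler1n.
have nN : n%:R <= N by rewrite /N ler_nat -addn2 leq_addr.
set Sg := fun w => \sum_(i < n) (rank_kernel (Z i w, Z n w) - partial_mean P Z rank_kernel (Z n w)).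
set a1 := fun w => full n.+1 (fst \o smp w) n - (Z n w).1.
set a2 := fun w => full n.+1 (snd \o smp w) n - (Z n w).2.
set b1 := fun (i : 'I_n) w => full n (fst \o smp w) i - (Z i w).1.
set b2 := fun (i : 'I_n) w => full n (snd \o smp w) i - (Z i w).2.
have u1 : forall i w, 0 <= (Z i w).1 <= 1 by move=> i w; case: (Z01 i w).
have u2 : forall i w, 0 <= (Z i w).2 <= 1 by move=> i w; case: (Z01 i w).
have ic (c : E -> R) m i : mfunT c -> (forall i w, 0 <= c (Z i w) <= 1) ->
    itg P (fun w => (full m (c \o smp w) i - c (Z i w)) ^+ 2).
  move=> mc c01; have := bstat_bmf (bstat_full_dist mc m i) (mfamily_smp mZ).
  by move=> /(bmf_itg P)/itg_ext; apply => w; rewrite clip01_id//; exact: c01.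
have ia1 : itg P (fun w => a1 w ^+ 2) by exact: (ic fst).
have ia2 : itg P (fun w => a2 w ^+ 2) by exact: (ic snd).
have ib1 i : itg P (fun w => b1 i w ^+ 2) by exact: (ic fst).
have ib2 i : itg P (fun w => b2 i w ^+ 2) by exact: (ic snd).
have bSg : bmf Sg.
  apply: bmf_sum => i _; apply: bmfB.
    have mp : mfunT (fun w => (Z i w, Z n w)) by apply/measurable_fun_pair.
    exact: (bmf_comp bmf_rank_kernel mp).
  exact: (bmf_comp (bmf_partial_mean P mZ bmf_rank_kernel)).
have iSg : itg P (fun w => Sg w ^+ 2) by apply: bmf_itg; exact: bmfX.
pose G w := 6 * (4 * B ^+ 4 * a1 w ^+ 2 + 4 * B ^+ 4 * a2 w ^+ 2 + N ^- 2 * Sg w ^+ 2 +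
   81 * B ^+ 4 * N ^- 2 + 25 * B ^+ 4 / N * (\sum_i b1 i w ^+ 2) + 25 * B ^+ 4 / N * (\sum_i b2 i w ^+ 2)).
have iG : itg P G.
  apply: itgZ; apply: itgD; last by apply: itgZ; exact: itg_sum.
  apply: itgD; last by apply: itgZ; exact: itg_sum.
  apply: itgD; last exact: itg_cst.
  by apply: itgD; [apply: itgD; exact: itgZ|exact: itgZ].
have le1 : Ex P (fun w => (f n (smp w) - f n.+1 (smp w)) ^+ 2) <= Ex P G.
  apply: le_Ex => //.
    apply: (itg_bstat P mZ (f := fun z => (f n z - f n.+1 z) ^+ 2)).
    by apply: bstatX; exact: bstatB.
  move=> w; rewrite (_ : f n _ - f n.+1 _ = rank_sum J K n (smp w) - rank_sum J K n.+1 (smp w) + influence (Z n w)); last first.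
    by rewrite /f [X in _ - (_ - X)]big_ord_recr/= /smp; ring.
  have H := remainder_le n w.
  rewrite -real_normK ?num_real//.
  apply: (le_trans (lerXn2r 2 _ _ H)); rewrite ?nnegrE//; first exact: le_trans H.
  apply: (le_trans (sqr6_le _ _ _ _ _ _)); apply: ler_wpM2l => //.
  have sq (x : R) : `|x| ^+ 2 = x ^+ 2 by rewrite real_normK ?num_real.
  have ss (b : 'I_n -> T -> R) : (5 * B ^+ 2 / N * (\sum_i `|b i w|)) ^+ 2 <=
      25 * B ^+ 4 / N * (\sum_i b i w ^+ 2).
    have := sqr_sum_le (fun i => `|b i w|).
    under [X in _ <= _ * X -> _]eq_bigr do rewrite sq.
    set s := \sum_i `|_|; set q := \sum_i _ => h.
    have q0 : 0 <= q by apply: sumr_ge0 => i _; exact: sqr_ge0.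
    rewrite (_ : _ ^+ 2 = 25 * B ^+ 4 / N * (s ^+ 2 / N)); last by field; rewrite gt_eqF.
    apply: ler_wpM2l.
      by apply: divr_ge0; [apply: mulr_ge0 => //; exact: exprn_ge0|exact: ltW].
    rewrite ler_pdivrMr// (le_trans h)// mulrC; exact: ler_wpM2l.
  apply: lerD (ss b2); apply: lerD (ss b1).
  rewrite -(sq (a1 w)) -(sq (a2 w)) -(sq (Sg w)) /a1 /a2 /Sg -/N.
  rewrite le_eqVlt; apply/orP; left; apply/eqP; field; by rewrite gt_eqF.
have A1 : Ex P (fun w => a1 w ^+ 2) <= 10 / N by exact: (full_dist_last measurable_fst uZ1 u1 n).
have A2 : Ex P (fun w => a2 w ^+ 2) <= 10 / N by exact: (full_dist_last measurable_snd uZ2 u2 n).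
have SB (b : 'I_n -> T -> R) : (forall i, itg P (fun w => b i w ^+ 2)) ->
   (forall i, Ex P (fun w => b i w ^+ 2) <= 10 / n.+1%:R) ->
   Ex P (fun w => \sum_i b i w ^+ 2) <= 10.
  move=> ib hb; rewrite Ex_sum//.
  apply: (le_trans (ler_sum _ (fun i _ => hb i))).
  rewrite sumr_const card_ord -[_ *+ n]mulr_natr mulrAC ler_pdivrMr ?ltr0n//.
  by apply: ler_wpM2l => //; rewrite ler_nat.
have S1 := SB b1 ib1 (fun i => full_dist measurable_fst uZ1 u1 (ltn_ord i)).
have S2 := SB b2 ib2 (fun i => full_dist measurable_snd uZ2 u2 (ltn_ord i)).
have S3 := second_moment_sum_le mZ indepZ idZ bmf_rank_kernel n rank_kernel_le.
rewrite -/(Sg) in S3.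
have EG : Ex P G = 6 * (4 * B ^+ 4 * Ex P (fun w => a1 w ^+ 2) + 4 * B ^+ 4 * Ex P (fun w => a2 w ^+ 2) +
   N ^- 2 * Ex P (fun w => Sg w ^+ 2) + 81 * B ^+ 4 * N ^- 2 +
   25 * B ^+ 4 / N * Ex P (fun w => \sum_i b1 i w ^+ 2) + 25 * B ^+ 4 / N * Ex P (fun w => \sum_i b2 i w ^+ 2)).
  have is1 : itg P (fun w => \sum_i b1 i w ^+ 2) by exact: itg_sum.
  have is2 : itg P (fun w => \sum_i b2 i w ^+ 2) by exact: itg_sum.
  have j1 := itgZ (4 * B ^+ 4) ia1; have j2 := itgZ (4 * B ^+ 4) ia2.
  have j3 := itgZ (N ^- 2) iSg; have j4 := itg_cst P (81 * B ^+ 4 * N ^- 2).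
  have j5 := itgZ (25 * B ^+ 4 / N) is1; have j6 := itgZ (25 * B ^+ 4 / N) is2.
  have k2 := itgD j1 j2; have k3 := itgD k2 j3; have k4 := itgD k3 j4.
  have k5 := itgD k4 j5; have k6 := itgD k5 j6.
  rewrite /G (ExZ 6 k6) (ExD k5 j6) (ExD k4 j5) (ExD k3 j4) (ExD k2 j3) (ExD j1 j2) Ex_cst.
  by rewrite (ExZ _ ia1) (ExZ _ ia2) (ExZ _ iSg) (ExZ _ is1) (ExZ _ is2).
have B4 : 0 <= B ^+ 4 by exact: exprn_ge0.
have NV : 0 <= N^-1 by rewrite invr_ge0 ltW.
(* The six contributions add up to 40 + 40 + 16 + 81 + 250 + 250 = 677, rounded up to 800. *)
have bound : Ex P G <= 6 * 800 * B ^+ 4 / N.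
  rewrite EG (_ : 6 * 800 * B ^+ 4 / N = 6 * (800 * (B ^+ 4 / N))); last by rewrite -!mulrA.
  apply: ler_wpM2l => //.
  have h1 := ler_wpM2l B4 A1; have h2 := ler_wpM2l B4 A2.
  have h3 : N ^- 2 * Ex P (fun w => Sg w ^+ 2) <= 16 * B ^+ 4 / N.
    apply: (@le_trans _ _ (N ^- 2 * (16 * B ^+ 4 * N))); last first.
      by rewrite le_eqVlt; apply/orP; left; apply/eqP; field; rewrite gt_eqF.
    apply: ler_wpM2l; first by rewrite invr_ge0 exprn_ge0 ?ltW.
    apply: (le_trans S3); rewrite (_ : 4 * _ * _ = 16 * B ^+ 4 * n%:R); last by ring.
    apply: ler_wpM2l; first exact: mulr_ge0.
    exact: nN.
  have h4 : 81 * B ^+ 4 * N ^- 2 <= 81 * B ^+ 4 / N.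
    apply: ler_wpM2l; first exact: mulr_ge0.
    by rewrite expr2 invfM ler_piMr// invf_le1.
  have BN : 0 <= 25 * B ^+ 4 / N by apply: divr_ge0; [exact: mulr_ge0|exact: ltW].
  have h5 := ler_wpM2l BN S1; have h6 := ler_wpM2l BN S2.
  have -> : 800 * (B ^+ 4 / N) = 4 * (B ^+ 4 * (10 / N)) + 4 * (B ^+ 4 * (10 / N)) + 16 * B ^+ 4 / N + 81 * B ^+ 4 / N + 25 * B ^+ 4 / N * 10 + 25 * B ^+ 4 / N * 10 + 123 * (B ^+ 4 / N).
    by field; rewrite gt_eqF.
  have BN' : 0 <= B ^+ 4 / N by exact: mulr_ge0.
  apply: le_trans (_ : _ <= 4 * (B ^+ 4 * (10 / N)) + 4 * (B ^+ 4 * (10 / N)) + 16 * B ^+ 4 / N + 81 * B ^+ 4 / N + 25 * B ^+ 4 / N * 10 + 25 * B ^+ 4 / N * 10) _; last first.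
    by rewrite lerDl mulr_ge0.
  do 2 apply: lerD => //; apply: lerD => //; apply: lerD => //; apply: lerD;
   by rewrite -mulrA; apply: ler_wpM2l.
apply: (@le_trans _ _ (2 * n%:R * (6 * 800 * B ^+ 4 / N))).
  by apply: ler_wpM2l; [exact: mulr_ge0|exact: le_trans le1 bound].
rewrite (_ : 2 * _ * _ = 12 * 800 * B ^+ 4 * (n%:R / N)); last by field; rewrite gt_eqF.
have c0 : 0 <= 12 * 800 * B ^+ 4 by apply: mulr_ge0; [apply: mulr_ge0; exact: ler0n|].
rewrite -[leRHS]mulr1; apply: ler_wpM2l; first exact: c0.
by rewrite ler_pdivrMr// mul1r.
Qed.

End linearization.

(** * The normal law: density, stability, moments *)

Lemma continuous_measurable {R : realType} (f : R -> R) :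
  continuous f -> mfunT f.
Proof. by move=> cf; exact: (continuous_measurable_fun cf). Qed.

Lemma complete_square (R : realFieldType) (q t y u : R) : q != 0 -> q + t ^+ 2 != 0 ->
 - (u - t * y) ^+ 2 / (q * 2) + - y ^+ 2 / (1 * 2) =
  - u ^+ 2 / ((q + t ^+ 2) * 2) +
  - (y - t * u / (q + t ^+ 2)) ^+ 2 / (q / (q + t ^+ 2) * 2).
Proof.
move=> qn pn. 
have [v vE] : exists v, v = u / (q + t ^+ 2) by eexists.
have uE : u = v * (q + t ^+ 2) by rewrite vE divfK.
rewrite -(mulrA t u) -vE uE.
have [p pE] : exists p, p = q + t ^+ 2 by eexists.
rewrite -pE in pn *.
have q2 : q * 2 != 0 by rewrite mulf_neq0// pnatr_eq0.
apply: (mulIf q2); rewrite !mulrDl divfK//.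
rewrite -[X in _ + X = _]mulrA (_ : (1 * 2)^-1 * (q * 2) = q); last by field.
rewrite -[X in _ = X + _]mulrA (_ : (p * 2)^-1 * (q * 2) = q / p); last by field.
rewrite -[X in _ = _ + X]mulrA (_ : (q / p * 2)^-1 * (q * 2) = p); last first.
  by field; rewrite pn qn.
rewrite (_ : - (v * p) ^+ 2 * (q / p) = - (v ^+ 2 * p * q)); last by field.
rewrite pE; ring.
Qed.

Section normal_density.
Context {R : realType}.
Local Notation mu := (@lebesgue_measure R).
Local Notation gam := (@std_normal R).

Lemma integral_std_normal (f : R -> \bar R) : mfunT f ->
  (forall x, 0 <= f x)%E ->
  (\int[gam]_x f x = \int[mu]_x (f x * (normal_pdf 0 1 x)%:E))%E.
Proof.
move=> mf f0.
have dom := @normal_prob_dominates R 0 1.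
(* The density formula concerns [normal_prob] on the carrier [measurableTypeR R]; the identity map
   transports it to [std_normal]. *)
have mid : @measurable_fun _ _ (measurableTypeR R) R setT id.
  by move=> ? A; rewrite setTI; exact.
rewrite (_ : (\int[gam]_x f x)%E = (\int[normal_prob (0 : R) 1]_x f x)%E); last first.
  have <- := @ge0_integral_pushforward _ _ (measurableTypeR R) R R id mid
    (normal_prob (0:R) 1) setT f measurableT mf (fun x _ => f0 x).
  by apply: eq_measure_integral => A mA _.
rewrite -(Radon_Nikodym_SigmaFinite.change_of_variables dom)//=.
apply: ae_eq_integral => //.
- apply: emeasurable_funM => //; apply: (measurable_int mu).
  exact: Radon_Nikodym_SigmaFinite.f_integrable.
- apply: emeasurable_funM => //=; apply/measurableT_comp => //=.
  exact: measurable_normal_pdf.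
- apply: ae_eqe_mul2l => /=.
  apply: integral_ae_eq => //=.
  + exact: Radon_Nikodym_SigmaFinite.f_integrable.
  + by apply/measurableT_comp =>//; exact: measurable_normal_pdf.
  + move=> E _ mE; rewrite -Radon_Nikodym_SigmaFinite.f_integral//.
Qed.

Lemma integral_normal_affine (g : R -> R) (m s : R) : 0 < s ->
  continuous g -> (forall x, 0 <= g x) ->
  (\int[mu]_u (g u * normal_pdf m s u)%:E = \int[gam]_x (g (m + s * x))%:E)%E.
Proof.
move=> s0 cg g0.
have cF : continuous (fun x : R => m + s * x).
  move=> x; apply: cvgD; first exact: cvg_cst.
  by apply: cvgM; [exact: cvg_cst|exact: cvg_id].
rewrite integral_std_normal; last 2 first.
- apply/measurable_EFinP; apply: (continuous_measurable (f := fun x => g (m + s * x))) => x.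
  by apply: continuous_comp; [exact: cF|exact: cg].
- by move=> x; rewrite lee_fin.
have dF : ((fun x : R => m + s * x)^`())%classic = cst s.
  apply/funext => x; rewrite derive1E.
  have : is_derive x (1:R) (fun x : R => m + s * x) (0 + s *: (1:R)).
    by apply: is_deriveD.
  by case=> _ ->; rewrite add0r /GRing.scale/= mulr1.
rewrite (@increasing_ge0_integration_by_substitutionT R (fun x => m + s * x)).
- apply: eq_integral => x _ /=; rewrite dF/= -EFinM; congr EFin.
  rewrite -mulrA; congr (_ * _).
  rewrite !normal_pdfE ?gt_eqF// /normal_peak /normal_fun.
  rewrite !fctE /= addrAC subrr add0r subr0 expr1n mul1r.
  rewrite -mulrnAr sqrtrM ?sqr_ge0// sqrtr_sqr gtr0_norm// invfM.
  rewrite exprMn -mulr_natr -[1 *+ 2]mulr_natr mul1r -mulNr.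
  rewrite [LHS]mulrAC (mulrAC _ _ s) mulVf ?gt_eqF// mul1r.
  congr (_ * expR _); rewrite -mulr_natr mulNr mulNr invfM mulrACA divff.
    by rewrite mul1r mulNr.
  by rewrite sqrf_eq0 gt_eqF.
- by move=> x y xy; rewrite ltrD2l ltr_pM2l.
- by rewrite dF => ?; exact: cvg_cst.
- by rewrite dF; exact: is_cvg_cst.
- by rewrite dF; exact: is_cvg_cst.
- move=> x; by apply: derivableD.
- apply/cvgrNyPle => A; exists ((A - m) / s); split; first exact: num_real.
  by move=> x xA; rewrite -lerBrDl mulrC -ler_pdivlMr// ltW.
- apply/cvgryPge => A; exists ((A - m) / s); split; first exact: num_real.
  by move=> x xA; rewrite -lerBlDl mulrC -ler_pdivrMr// ltW.
- move=> x; apply: cvgM; first exact: cg.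
  by apply: continuous_normal_pdf; rewrite gt_eqF.
- by move=> x; rewrite mulr_ge0 ?normal_pdf_ge0.
Qed.

(** The joint density of [t Y + s X] and [Y] at [(u, y)], factored once through [Y] and once through
    the sum, whose conditional law of [Y] is normal with mean [t u / r^2] and deviation [s / r]. *)
Lemma normal_pdf_convolution (s t r u y : R) : 0 < s -> 0 < r ->
  s ^+ 2 + t ^+ 2 = r ^+ 2 ->
  normal_pdf (t * y) s u * normal_pdf 0 1 y =
  normal_pdf 0 r u * normal_pdf (t * u / r ^+ 2) (s / r) y.
Proof.
move=> s0 r0 str.
have q0 : 0 < s / r by rewrite divr_gt0.
rewrite !normal_pdfE ?gt_eqF// /normal_peak /normal_fun.
rewrite mulrACA [RHS]mulrACA -!expRD; congr (_ * expR _).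
  have P := @pi_gt0 R.
  have h (a b : R) : 0 < a -> 0 < b ->
      (Num.sqrt (a ^+ 2 * pi *+ 2))^-1 * (Num.sqrt (b ^+ 2 * pi *+ 2))^-1 =
      (a * b * (pi *+ 2))^-1.
    move=> a0 b0; rewrite -invfM -sqrtrM; last first.
      by rewrite mulrn_wge0// mulr_ge0 ?sqr_ge0// ltW.
    congr _^-1; rewrite [X in Num.sqrt X](_ : _ = (a * b * (pi *+ 2)) ^+ 2).
      by rewrite sqrtr_sqr gtr0_norm// !mulr_gt0// mulrn_wgt0.
    rewrite -mulr_natr; ring.
  rewrite !h//; congr _^-1; field; lra.
rewrite !subr0 (exprMn _ s) exprVn -str -!(mulr_natr (_ ^+ 2)) -(mulr_natr (_ + _)) -(mulr_natr (_ / _)) expr1n.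
apply: complete_square; first by rewrite sqrf_eq0 gt_eqF.
by rewrite str sqrf_eq0 gt_eqF.
Qed.


(** After the substitution [u = t y + s x] and Tonelli, the variable [y] only occurs in the
    conditional density of the previous factorization, which integrates to 1. *)
Lemma normal_stable_ge0 (g : R -> R) (s t r : R) : 0 < s -> 0 < r ->
  s ^+ 2 + t ^+ 2 = r ^+ 2 -> continuous g -> (forall x, 0 <= g x) ->
  (\int[gam]_y \int[gam]_x (g (t * y + s * x))%:E =
   \int[gam]_x (g (r * x))%:E)%E.
Proof.
move=> s0 r0 str cg g0.
pose h (z : R * R) : R :=
  g z.1 * normal_pdf 0 r z.1 * normal_pdf (t * z.1 / r ^+ 2) (s / r) z.2.
have sr0 : 0 < s / r by rewrite divr_gt0.
have mg : mfunT g by exact: continuous_measurable.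
have h0 z : 0 <= h z by rewrite !mulr_ge0 ?normal_pdf_ge0.
have mn m : mfunT (fun z : R * R => normal_pdf (m * z.1) (s / r) z.2).
  rewrite (_ : (fun _ => _) = fun z : R * R =>
    normal_pdf 0 (s / r) (z.2 - m * z.1)).
    apply: (measurableT_comp (measurable_normal_pdf _ _)).
    apply: measurable_funB => //; apply: measurable_funM => //.
  by apply/funext => z; rewrite !normal_pdfE ?gt_eqF// /normal_fun subr0.
have mh : mfunT h.
  apply: measurable_funM.
    apply: measurable_funM; first exact: (measurableT_comp mg).
    exact: (measurableT_comp (measurable_normal_pdf _ _)).
  rewrite (_ : (fun _ => _) = fun z : R * R =>
    normal_pdf (t / r ^+ 2 * z.1) (s / r) z.2) //.
  by apply/funext => z; rewrite mulrAC.
have mhE : mfunT (EFin \o h) by exact/measurable_EFinP.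
have inner y : ((\int[gam]_x (g (t * y + s * x))%:E) * (normal_pdf 0 1 y)%:E =
    \int[mu]_u (h (u, y))%:E)%E.
  have E1 := integral_normal_affine (t * y) s0 cg g0.
  have E2 := @ge0_integralZr _ _ _ mu _ measurableT
    (fun u => (g u * normal_pdf (t * y) s u)%:E) _ (normal_pdf 0 1 y)%:E.
  rewrite -E1 -E2.
  - apply: eq_integral => u _; rewrite -EFinM /h/= -!mulrA.
    by rewrite (normal_pdf_convolution _ _ s0 r0 str) (mulrA t u).
  - apply/measurable_EFinP; apply: measurable_funM => //.
    exact: measurable_normal_pdf.
  - by move=> x _; rewrite lee_fin mulr_ge0 ?normal_pdf_ge0.
  - by rewrite lee_fin normal_pdf_ge0.
have i0 y : (0 <= \int[gam]_x (g (t * y + s * x))%:E)%E.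
  by apply: integral_ge0 => x _; rewrite lee_fin.
rewrite integral_std_normal//; last first.
  pose k (z : R * R) : \bar R := (g (t * z.1 + s * z.2))%:E.
  have mk : mfunT k.
    apply/measurable_EFinP; apply: (measurableT_comp mg).
    by apply: measurable_funD; apply: measurable_funM.
  have k0 z : (0 <= k z)%E by rewrite lee_fin.
  exact: (measurable_fun_fubini_tonelli_F (m2 := gam) k mk k0).
under eq_integral do rewrite inner.
have H0 z : (0 <= (EFin \o h) z)%E by rewrite lee_fin.
rewrite -(@fubini_tonelli _ _ _ _ _ mu mu (EFin \o h) mhE H0).
have -> : (\int[gam]_x (g (r * x))%:E = \int[mu]_u (g u * normal_pdf 0 r u)%:E)%E.
  rewrite integral_normal_affine//; apply: eq_integral => x _.
  by rewrite add0r.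
apply: eq_integral => u _ /=.
under eq_integral do rewrite /h/= EFinM.
rewrite ge0_integralZl//.
- by rewrite integral_normal_pdf mule1.
- by apply/measurable_EFinP; exact: measurable_normal_pdf.
- by move=> x _; rewrite lee_fin normal_pdf_ge0.
- by rewrite lee_fin mulr_ge0 ?normal_pdf_ge0.
Qed.


Lemma EFin_Ex {d} {T : measurableType d} (P : probability T R) f : itg P f ->
  (Ex P f)%:E = (\int[P]_w (f w)%:E)%E.
Proof.
by move=> fi; rewrite /Ex fineK//; exact: (integrable_fin_num measurableT fi).
Qed.

Lemma normal_stable (g : R -> R) (s t r : R) : 0 < s -> 0 < r ->
  s ^+ 2 + t ^+ 2 = r ^+ 2 -> continuous g -> bmf g ->
  Ex gam (fun y => Ex gam (fun x => g (t * y + s * x))) =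
  Ex gam (fun x => g (r * x)).
Proof.
move=> s0 r0 str cg [mg [M gM]].
have M0 : 0 <= M by rewrite (le_trans _ (gM 0)).
pose h x := g x + M.
have ch : continuous h by move=> x; apply: cvgD; [exact: cg|exact: cvg_cst].
have h0 x : 0 <= h x by have := gM x; rewrite ler_norml /h; lra.
have bh : bmf h by apply: bmfD; [split=> //; exists M|exact: bmf_cst].
have bg2 : bmf (fun z : R * R => g (t * z.1 + s * z.2)).
  split; last by exists M.
  by apply: (measurableT_comp mg); apply: measurable_funD; apply: measurable_funM.
have bgr : bmf (fun x => g (r * x)).
  split; last by exists M.
  by apply: (measurableT_comp mg); apply: measurable_funM.
have := normal_stable_ge0 s0 r0 str ch h0.
have E1 y : (\int[gam]_x (h (t * y + s * x))%:E)%E =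
    (Ex gam (fun x => g (t * y + s * x)) + M)%:E.
  rewrite -EFin_Ex; last first.
    by apply: bmf_itg; apply: bmfD; [exact: (bmf_pair1 bg2 y)|exact: bmf_cst].
  rewrite ExD ?Ex_cst//; last exact: itg_cst.
  by apply: bmf_itg; exact: (bmf_pair1 bg2 y).
under eq_integral do rewrite E1.
have bE := bmf_Ex1 gam gam bg2.
rewrite -EFin_Ex; last by apply: bmf_itg; apply: bmfD => //; exact: bmf_cst.
rewrite -EFin_Ex; last by apply: bmf_itg; apply: bmfD => //; exact: bmf_cst.
case; rewrite ExD ?Ex_cst; [|exact: bmf_itg|exact: itg_cst].
rewrite ExD ?Ex_cst; [|exact: bmf_itg|exact: itg_cst].
by move/addIr.
Qed.

(** The integrand times the standard density is [q] times the density of deviation [q]. For [q = 2]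
    the exponential grows, which dominates all powers; for [q] slightly below 1 it is a Laplace
    transform of [x ^+ 2] that yields the variance. *)
Lemma integral_exp_sqr (q : R) : 0 < q ->
  (\int[gam]_x (expR (- ((q ^- 2 - 1) / 2) * x ^+ 2))%:E = q%:E)%E.
Proof.
move=> q0.
rewrite integral_std_normal; last 2 first.
- apply/measurable_EFinP; apply: measurableT_comp => //.
  by apply: measurable_funM => //; exact: measurable_funX.
- by move=> x; rewrite lee_fin expR_ge0.
transitivity (\int[mu]_x (q%:E * (normal_pdf 0 q x)%:E))%E; last first.
  rewrite ge0_integralZl//.
  - by rewrite integral_normal_pdf mule1.
  - by apply/measurable_EFinP; exact: measurable_normal_pdf.
  - by move=> x _; rewrite lee_fin normal_pdf_ge0.
  - by rewrite lee_fin ltW.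
apply: eq_integral => x _; rewrite -!EFinM; congr EFin.
rewrite !normal_pdfE ?gt_eqF// /normal_peak /normal_fun.
rewrite mulrCA -expRD [RHS]mulrA; congr (_ * expR _).
  rewrite -[X in q / Num.sqrt X]mulrnAr sqrtrM ?sqr_ge0// sqrtr_sqr gtr0_norm//.
  by rewrite invfM mulrA divff ?gt_eqF// mul1r expr1n mul1r.
rewrite !subr0 expr1n -(mulr_natr (q ^+ 2)) [X in _ = _ * X]invfM.
by move: (q ^- 2) (x ^+ 2) => a b; lra.
Qed.

Lemma pow_le_expR (n : nat) (x : R) : 0 <= x -> x ^+ n <= n%:R ^+ n * expR x.
Proof.
move=> x0; case: n => [|n]; first by rewrite !expr0 mul1r -expR0 ler_expR.
have n0 : (0 : R) < n.+1%:R by rewrite ltr0n.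
rewrite (_ : expR x = expR (x / n.+1%:R) ^+ n.+1); last first.
  by rewrite -expRM_natr mulfVK ?gt_eqF.
rewrite -exprMn lerXn2r ?nnegrE ?mulr_ge0 ?expR_ge0//.
rewrite mulrC -ler_pdivrMr//; apply: le_trans (expR_ge1Dx _).
by rewrite lerDr.
Qed.

Lemma itg_normal_exp_sqr (q : R) : 0 < q ->
  itg gam (fun x => expR (- ((q ^- 2 - 1) / 2) * x ^+ 2)).
Proof.
move=> q0; apply/integrableP; split.
  apply/measurable_EFinP; apply: measurableT_comp => //.
  by apply: measurable_funM => //; exact: measurable_funX.
under eq_integral do rewrite /= ger0_norm ?expR_ge0//.
by rewrite integral_exp_sqr// ltry.
Qed.

Lemma Ex_exp_sqr (q : R) : 0 < q ->
  Ex gam (fun x => expR (- ((q ^- 2 - 1) / 2) * x ^+ 2)) = q.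
Proof. by move=> q0; rewrite /Ex /Rintegral integral_exp_sqr. Qed.

Lemma itg_normal_pow (k : nat) : itg gam (fun x : R => x ^+ k).
Proof.
pose f (x : R) : R := 3%:R ^+ k * (k%:R ^+ k * expR (- ((2 ^- 2 - 1) / 2) * x ^+ 2) + 1).
have fi : itg gam f.
  apply: itgZ; apply: itgD; last exact: itg_cst.
  by apply: itgZ; exact: itg_normal_exp_sqr.
apply: itg_le fi _ => [|x]; first exact: measurable_funX.
rewrite normrX /f; have [x1|x1] := leP `|x| 1.
  apply: (@le_trans _ _ 1); first by rewrite exprn_ile1.
  rewrite -[leLHS]mul1r ler_pM// ?exprn_ege1 ?ler1n//.
  by rewrite lerDr mulr_ge0 ?exprn_ge0 ?expR_ge0.
have x0 : 0 <= 3 / 8 * x ^+ 2 by rewrite mulr_ge0 ?sqr_ge0.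
apply: (@le_trans _ _ (3%:R ^+ k * (3 / 8 * x ^+ 2) ^+ k)).
  rewrite -exprMn lerXn2r ?nnegrE//.
    by rewrite mulr_ge0.
  by rewrite -(real_normK (num_real x)); nra.
rewrite ler_pM2l ?exprn_gt0//.
apply: le_trans (pow_le_expR k x0) _.
rewrite (_ : - ((2 ^- 2 - 1) / 2) * x ^+ 2 = 3 / 8 * x ^+ 2); last by field.
by rewrite lerDl.
Qed.

Lemma expRN_le (a : R) : 0 <= a -> expR (- a) <= 1 - a + a ^+ 2.
Proof.
move=> a0.
have E : expR a = expR (a / 2) ^+ 2 by rewrite -expRM_natr divfK.
have h : 1 + a / 2 <= expR (a / 2) := expR_ge1Dx _.
have P : (1 + a / 2) ^+ 2 <= expR a.
  by rewrite E lerXn2r ?nnegrE ?expR_ge0// addr_ge0// divr_ge0.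
rewrite expRN -[leLHS]mul1r ler_pdivrMr ?expR_gt0//.
have q0 : 0 <= 1 - a + a ^+ 2 by nra.
apply: le_trans (ler_wpM2l q0 P).
rewrite [leRHS](_ : _ = 1 + a ^+ 2 / 4 + 3 / 4 * a ^+ 3 + a ^+ 4 / 4); last by field.
have := exprn_ge0 2 a0; have := exprn_ge0 3 a0; have := exprn_ge0 4 a0; lra.
Qed.

(** The Laplace transform of [x ^+ 2] at [h] is [q], and lies between [1 - h m] and
    [1 - h m + h^2 m4]. With [q = 1 - u], [h] equals [u] up to order [u^2], so [m - 1] is of order
    [u] for every small [u]. *)
Lemma normal_second_moment : Ex gam (fun x => x ^+ 2) = 1.
Proof.
set m := Ex _ _; pose m4 := Ex gam (fun x : R => x ^+ 4).
have m40 : 0 <= m4 by apply: Ex_ge0 => x; rewrite (exprM x 2 2) sqr_ge0.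
have key (q h : R) : 0 < q < 1 -> h = (q ^- 2 - 1) / 2 ->
    1 - h * m <= q <= 1 - h * m + h ^+ 2 * m4.
  move=> /andP[q0 q1] hE.
  have h0 : 0 <= h.
    rewrite hE divr_ge0// subr_ge0 -[leLHS]invr1 lef_pV2 ?posrE ?exprn_gt0//.
    by rewrite exprn_ile1// ltW.
  have i2 := itg_normal_pow 2; have i4 := itg_normal_pow 4.
  have iq := itg_normal_exp_sqr q0.
  rewrite -hE in iq.
  have := Ex_exp_sqr q0; rewrite -hE => Eq.
  have i1 : itg gam (fun x : R => 1 - h * x ^+ 2).
    by apply: itgB; [exact: itg_cst|exact: itgZ].
  have E1 : Ex gam (fun x : R => 1 - h * x ^+ 2) = 1 - h * m.
    by rewrite ExB ?Ex_cst ?ExZ//; [exact: itg_cst|exact: itgZ].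
  rewrite -Eq -E1 /m4 -ExZ// -ExD//; last exact: itgZ.
  apply/andP; split; apply: le_Ex => //.
  - by move=> x; apply: le_trans (expR_ge1Dx _); rewrite mulNr.
  - by apply: itgD => //; exact: itgZ.
  - move=> x; rewrite mulNr; apply: le_trans (expRN_le _) _.
      by rewrite mulr_ge0 ?sqr_ge0.
    by rewrite exprMn -exprM.
have close (u : R) : 0 < u -> u <= 1 / 2 -> `|m - 1| <= 8 * (m4 + 1) * u.
  move=> u0 u1.
  have q01 : 0 < 1 - u < 1 by apply/andP; split; lra.
  have [h hE] : exists h, h = ((1 - u) ^- 2 - 1) / 2 by eexists.
  have /andP[H1 H2] := key (1 - u) h q01 hE.
  have E : h * (1 - u) ^+ 2 * 2 = u * (2 - u) by rewrite hE; field; lra.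
  have P0 : 1 / 4 <= (1 - u) ^+ 2 by nra.
  have P1 : (1 - u) ^+ 2 <= 1 by nra.
  have hu4 : h <= 4 * u by nra.
  have h0 : 0 < h by nra.
  have hu : u <= h by nra.
  have hb : h - u <= 6 * u ^+ 2 by nra.
  have K1 : h * m <= u + h ^+ 2 * m4 by lra.
  have K2 : u <= h * m by lra.
  have N1 : m - 1 <= 8 * (m4 + 1) * u.
    rewrite -(ler_pM2l h0) mulrBr mulr1.
    have : h ^+ 2 * m4 <= h * (4 * u * m4) by rewrite expr2 -mulrA ler_pM2l// ler_wpM2r.
    have : 0 <= h * u * m4 by rewrite !mulr_ge0// ltW.
    nra.
  have N2 : 1 - m <= 8 * (m4 + 1) * u.
    rewrite -(ler_pM2l h0) mulrBr mulr1.
    have : 0 <= h * u * m4 by rewrite !mulr_ge0// ltW.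
    have : u ^+ 2 <= h * u by rewrite expr2 ler_pM2r.
    nra.
  by rewrite ler_norml; lra.
apply/eqP; rewrite -subr_eq0 -normr_le0; apply/ler_addgt0Pr => e e0; rewrite add0r.
have m1 : 0 < 8 * (m4 + 1) by rewrite mulr_gt0// ltr_wpDl.
apply: le_trans (close (Num.min (1 / 2) (e / (8 * (m4 + 1)))) _ _) _.
- by rewrite lt_min divr_gt0//= divr_gt0.
- by rewrite ge_min lexx.
- by rewrite mulrC -ler_pdivlMr// ge_min lexx orbT.
Qed.

Lemma rays_unique (m1 m2 : probability R R) :
  (forall x : R, m1 `]-oo, x]%classic = m2 `]-oo, x]%classic) ->
  forall A, measurable A -> m1 A = m2 A.
Proof.
move=> H A mA.
apply: (measure_unique (@RGenOInfty.G R) (fun n => `]- n%:R, +oo[%classic)) => //.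
- exact: RGenOInfty.measurableE.
- move=> _ _ [x ->] [y ->]; exists (Num.max x y).
  by apply/seteqP; split => z /=; rewrite !in_itv/= !andbT gt_max => /andP.
- by move=> n; exists (- n%:R).
- apply/seteqP; split => // x _.
  have [n nx] : exists n : nat, - x < n%:R.
    exists (Num.bound `|x|); apply: le_lt_trans (archi_boundP (normr_ge0 x)).
    by rewrite -normrN ler_norm.
  by exists n => //=; rewrite in_itv/= andbT ltrNl.
- have E (m : probability R R) (x : R) :
      m `]x, +oo[%classic = (1 - m `]-oo, x]%classic)%E.
    by rewrite -setCitvl; apply: probability_setC.
  move=> _ [x ->]; apply: etrans (E m1 x) _.
  by rewrite H; exact: esym (E m2 x).
- by move=> n; apply: (le_lt_trans (probability_le1 m1 _)); rewrite ?ltry.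
Qed.

Lemma normal_ray_opp (x : R) : gam `]-oo, - x]%classic = gam `[x, +oo[%classic.
Proof.
rewrite /std_normal /normal_prob ge0_integration_by_substitutionNy.
- apply: eq_integral => y _ /=; congr EFin.
  by rewrite !normal_pdfE ?oner_neq0// /normal_fun !subr0 sqrrN.
- by apply: continuous_subspaceT; apply: continuous_normal_pdf; exact: oner_neq0.
- by move=> y _; exact: normal_pdf_ge0.
Qed.

Lemma normal_point (x : R) : gam [set x] = 0%E.
Proof.
by rewrite /std_normal /normal_prob integral_set1.
Qed.

Lemma Ex_normal_opp (g : R -> R) : itg gam g -> Ex gam (fun x => g (- x)) = Ex gam g.
Proof.
move=> gi; have mg := itg_measurable gi.
have mN : mfunT (fun x : R => - x) by exact: measurableT_comp.
have E A : measurable A -> law gam mN A = gam A.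
  apply: rays_unique => x; rewrite lawE.
  rewrite (_ : _ @^-1` _ = `[- x, +oo[%classic).
    by rewrite /= -[in LHS]normal_ray_opp opprK.
  by apply/seteqP; split => y /=; rewrite !in_itv/= ?andbT lerNl.
have gi' : itg gam (g \o (fun x => - x)).
  apply: (itg_law_comp (mU := mN)).
  case/integrableP: gi => m1 m2; apply/integrableP; split; first exact: m1.
  by rewrite (eq_measure_integral gam)// => A mA _; exact: E.
rewrite -[LHS](Ex_law mN mg gi'); congr fine.
by apply: eq_measure_integral => A mA _; exact: E.
Qed.

Lemma normal_mean : Ex gam (fun x => x) = 0.
Proof.
have := Ex_normal_opp (itg_normal_pow 1).
under eq_fun do rewrite expr1.
under [in X in _ = X]eq_fun do rewrite expr1.
rewrite ExN; last by have := itg_normal_pow 1; under eq_fun do rewrite expr1.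
lra.
Qed.

End normal_density.

(** * Uniform continuity and Bernstein polynomials *)

Section uniform_continuity.
Context {R : realType}.

Lemma uniform_continuity_box (F : R * R -> R) (a b e : R) : continuous F -> 0 < e ->
  exists2 r : R, 0 < r & forall x y : R * R,
    a <= x.1 <= b -> a <= x.2 <= b ->
    `|x.1 - y.1| < r -> `|x.2 - y.2| < r -> `|F x - F y| <= e.
Proof.
move=> cF e0.
have cK : compact (`[a, b]%classic `*` `[a, b]%classic : set (R * R)).
  by apply: compact_setX; exact: segment_compact.
move/compact_near_coveringP : cK => /(_ _ (0 : R)^'+
  (fun r x => forall y : R * R, `|x.1 - y.1| < r -> `|x.2 - y.2| < r ->
     `|F x - F y| <= e) _) [].
  move=> x _.
  have /cvgrPdist_lt/(_ (e / 2)) := cF x; rewrite divr_gt0// => /(_ isT).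
  move=> /nbhs_ballP[r /= r0 rF].
  exists (ball x (r / 2), [set s | s < r / 2]) => /=.
    split; first by apply: nbhsx_ballx; rewrite divr_gt0.
    by apply: nbhs_right_lt; rewrite divr_gt0.
  move=> [x' s] /= [[x1 x2] sr] y y1 y2; rewrite /ball/= in x1 x2.
  have Fx' : `|F x - F x'| < e / 2.
    by apply: rF; split => /=; rewrite /ball/=; [move: x1|move: x2] => H; apply: lt_le_trans H _; lra.
  have Fy : `|F x - F y| < e / 2.
    apply: rF; split => /=; rewrite /ball/=.
      rewrite (_ : x.1 - y.1 = (x.1 - x'.1) + (x'.1 - y.1)); last by ring.
      apply: (le_lt_trans (ler_normD _ _)); lra.
    rewrite (_ : x.2 - y.2 = (x.2 - x'.2) + (x'.2 - y.2)); last by ring.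
    apply: (le_lt_trans (ler_normD _ _)); lra.
  rewrite (_ : F x' - F y = (F x - F y) - (F x - F x')); last by ring.
  apply: (le_trans (ler_normB _ _)); lra.
move=> r /= r0 H.
exists (r / 2); first by rewrite divr_gt0.
move=> x y x1 x2 y1 y2; apply: (H (r / 2)) => //=.
- by rewrite sub0r normrN gtr0_norm ?divr_gt0//; lra.
- by rewrite divr_gt0.
Qed.

End uniform_continuity.

Section bernstein.
Context {R : realType}.

(** The expectation of [g] at a binomial variable with [n] trials and success probability [s], by
    recursion on one trial. It serves both for polynomial approximation and for the law of a
    rank. *)
Fixpoint bernstein (n : nat) (s : R) (g : nat -> R) : R :=
  if n is m.+1 then s * bernstein m s (fun k => g k.+1) + (1 - s) * bernstein m s g
  else g 0%N.

Lemma bernstein_dist n s g h c : 0 <= s <= 1 ->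
  (forall k, (k <= n)%N -> `|g k - c| <= h k) ->
  `|bernstein n s g - c| <= bernstein n s h.
Proof.
move=> /andP[s0 s1]; elim: n g h => [|n IH] g h gh /=; first exact: gh.
rewrite (_ : _ - c = s * (bernstein n s (fun k => g k.+1) - c) +
  (1 - s) * (bernstein n s g - c)); last by ring.
apply: (le_trans (ler_normD _ _)); rewrite !normrM (ger0_norm s0).
rewrite (@ger0_norm _ (1 - s)) ?subr_ge0//; apply: lerD.
  by apply: ler_wpM2l => //; apply: IH => k kn; exact: gh.
apply: ler_wpM2l; first by rewrite subr_ge0.
by apply: IH => k kn; apply: gh; exact: leqW.
Qed.

Lemma bernstein_affine n s (a b : R) g :
  bernstein n s (fun k => a + b * g k) = a + b * bernstein n s g.
Proof. by elim: n g => [//|n IH] g /=; rewrite (IH (fun k => g k.+1)) IH; ring. Qed.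

(** The free shift [a] is what makes the induction close, since a success turns [a] into [1 + a]. *)
Lemma bernstein_sqr n s (a : R) : bernstein n s (fun k => (k%:R + a) ^+ 2) =
  n%:R * s * (1 - s) + (n%:R * s + a) ^+ 2.
Proof.
elim: n a => [|n IH] a /=; first by rewrite !mul0r !add0r.
rewrite IH (_ : (fun k => _) = fun k => (k%:R + (1 + a)) ^+ 2).
  by rewrite IH -!natr1; ring.
by apply/funext => k; rewrite -natr1 addrA.
Qed.

Lemma bernstein_variance n s : (0 < n)%N ->
  bernstein n s (fun k => (k%:R / n%:R - s) ^+ 2) = s * (1 - s) / n%:R.
Proof.
move=> n0; have nn : n%:R != 0 :> R by rewrite pnatr_eq0 -lt0n.
rewrite (_ : (fun k => _) = fun k => 0 + n%:R ^- 2 * (k%:R + (- (n%:R * s))) ^+ 2).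
  by rewrite bernstein_affine bernstein_sqr subrr expr0n/= addr0 add0r; field.
by apply/funext => k; field.
Qed.

Lemma bernstein_approx n s t (F : R * R -> R) (e K : R) : (0 < n)%N ->
  0 <= s <= 1 -> 0 <= t <= 1 -> 0 <= K ->
  (forall x y, 0 <= x <= 1 -> 0 <= y <= 1 ->
     `|F (x, y) - F (s, t)| <= e + K * ((x - s) ^+ 2 + (y - t) ^+ 2)) ->
  `|bernstein n s (fun k => bernstein n t (fun l => F (k%:R / n%:R, l%:R / n%:R)))
    - F (s, t)| <= e + K / n%:R.
Proof.
move=> n0 s01 t01 K0 H.
have nn : (0 : R) < n%:R by rewrite ltr0n.
have g01 k : (k <= n)%N -> 0 <= (k%:R / n%:R : R) <= 1.
  by move=> kn; rewrite divr_ge0//= ler_pdivrMr// mul1r ler_nat.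
have v x : 0 <= x <= 1 -> x * (1 - x) <= 1 / 4 :> R.
  by move=> _; have := sqr_ge0 (x - 1 / 2); nra.
apply: (le_trans (bernstein_dist (h := fun k =>
    (e + K * (t * (1 - t) / n%:R)) + K * (k%:R / n%:R - s) ^+ 2) s01 _)).
  move=> k kn; apply: (le_trans (bernstein_dist (h := fun l =>
    (e + K * (k%:R / n%:R - s) ^+ 2) + K * (l%:R / n%:R - t) ^+ 2) t01 _)).
    move=> l ln; apply: le_trans (H _ _ (g01 k kn) (g01 l ln)) _.
    by rewrite mulrDr addrA.
  by rewrite bernstein_affine bernstein_variance// addrAC.
rewrite bernstein_affine bernstein_variance//.
rewrite (_ : _ + _ = e + K * (s * (1 - s) + t * (1 - t)) / n%:R); last first.
  by field; rewrite gt_eqF.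
rewrite lerD2l ler_pM2r ?invr_gt0// -[leRHS]mulr1 ler_wpM2l//.
have := v s s01; have := v t t01; lra.
Qed.

End bernstein.

(** * Test functions with a third-order Taylor bound *)

Section smooth3.
Context {R : realType}.
Implicit Types (L M : R) (f g : R * R -> R) (h : R * R).

Definition size2 h : R := `|h.1| + `|h.2|.

Definition shift2 (x h : R * R) : R * R := (x.1 + h.1, x.2 + h.2).

Definition lin2 (p h : R * R) : R := p.1 * h.1 + p.2 * h.2.

Definition quad2 (q : R * R * R) h : R :=
  q.1.1 * h.1 ^+ 2 + q.1.2 * h.1 * h.2 + q.2 * h.2 ^+ 2.

(** A Taylor bound with bounded coefficients replaces three derivatives: closure under sums and
    products is then algebra, and the Lindeberg argument uses nothing else. The coefficient [q.1.2]
    is that of the full mixed term. *)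
Definition smooth3 L f : Prop :=
  mfunT f /\ forall x, `|f x| <= L /\
  exists p q, [/\ `|p.1| <= L, `|p.2| <= L, `|q.1.1| <= L, `|q.1.2| <= L & `|q.2| <= L] /\
   forall h, size2 h <= 1 ->
    `|f (shift2 x h) - (f x + lin2 p h + quad2 q h)| <= L * size2 h ^+ 3.

Lemma size2_ge0 h : 0 <= size2 h. Proof. by rewrite addr_ge0. Qed.

Lemma norm_mul_le (x y a b : R) : `|x| <= a -> `|y| <= b -> `|x * y| <= a * b.
Proof. by move=> xa yb; rewrite normrM ler_pM. Qed.

Lemma lin2_le L p h : `|p.1| <= L -> `|p.2| <= L -> `|lin2 p h| <= L * size2 h.
Proof.
move=> p1 p2; apply: (le_trans (ler_normD _ _)).
by rewrite mulrDr lerD// normrM ler_wpM2r.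
Qed.

Lemma quad2_le L q h : `|q.1.1| <= L -> `|q.1.2| <= L -> `|q.2| <= L ->
  `|quad2 q h| <= L * size2 h ^+ 2.
Proof.
move=> q1 q2 q3; apply: (le_trans (ler_normD _ _)).
apply: (le_trans (lerD (ler_normD _ _) (lexx _))).
rewrite (normrM q.1.1) (normrM q.2) !normrX (normrM (_ * _) h.2) (normrM q.1.2 h.1) /size2.
have L0 : 0 <= L by exact: le_trans q1.
have h1 := normr_ge0 h.1; have h2 := normr_ge0 h.2.
apply: (@le_trans _ _ (L * (`|h.1| ^+ 2 + `|h.1| * `|h.2| + `|h.2| ^+ 2))).
  rewrite !mulrDr (mulrA L `|h.1| `|h.2|); apply: lerD; first apply: lerD.
  - by rewrite ler_wpM2r.
  - by rewrite ler_wpM2r// ler_wpM2r.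
  - by rewrite ler_wpM2r.
by rewrite ler_wpM2l//; nra.
Qed.

Lemma smooth3_ge0 L f : smooth3 L f -> 0 <= L.
Proof. by move=> [_ /(_ (0, 0))[f0 _]]; exact: le_trans f0. Qed.

Lemma smooth3_bmf L f : smooth3 L f -> bmf f.
Proof. by move=> [mf sf]; split=> //; exists L => x; case: (sf x). Qed.

Lemma smooth3_lip L f : smooth3 L f ->
  forall x h, `|f (shift2 x h) - f x| <= 3 * L * size2 h.
Proof.
move=> sf x h; have L0 := smooth3_ge0 sf; case: sf => mf sf.
have H0 := size2_ge0 h; set H := size2 h in H0 *.
have [H1|H1] := leP H 1; last first.
  apply: (le_trans (ler_normB _ _)).
  have [? _] := sf x; have [? _] := sf (shift2 x h); nra.
have [_ [p [q [[p1 p2 q1 q2 q3] /(_ h H1)]]]] := sf x.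
have := lin2_le h p1 p2; have := quad2_le h q1 q2 q3; rewrite -/H.
set l := lin2 p h; set k := quad2 q h => qe le Re.
rewrite (_ : _ - _ = (f (shift2 x h) - (f x + l + k)) + l + k); last by ring.
apply: (le_trans (ler_normD _ _)).
apply: (le_trans (lerD (ler_normD _ _) (lexx _))).
have : H ^+ 2 <= H by nra.
have : H ^+ 3 <= H by rewrite exprS; nra.
nra.
Qed.

(** Beyond size 1 the value and the three parts of the polynomial are each at most [L] times the
    cube of the size. *)
Lemma smooth3_taylor L f : smooth3 L f -> forall x, exists p q, forall h,
  `|f (shift2 x h) - (f x + lin2 p h + quad2 q h)| <= 4 * L * size2 h ^+ 3.
Proof.
move=> sf x; have L0 := smooth3_ge0 sf; case: sf => mf sf.
have [fx [p [q [[p1 p2 q1 q2 q3] T]]]] := sf x; exists p, q => h.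
have H0 := size2_ge0 h.
have [H1|H1] := leP (size2 h) 1.
  apply: (le_trans (T h H1)); rewrite ler_wpM2r ?exprn_ge0//; lra.
have := lin2_le h p1 p2; have := quad2_le h q1 q2 q3.
have [fxh _] := sf (shift2 x h).
set l := lin2 p h; set k := quad2 q h; set H := size2 h in H0 H1 * => qe le.
apply: (le_trans (ler_normB _ _)).
apply: (le_trans (lerD (lexx _) (ler_normD _ _))).
apply: (le_trans (lerD (lexx _) (lerD (ler_normD _ _) (lexx _)))).
have H2 : H <= H ^+ 2 by nra.
have H3 : H ^+ 2 <= H ^+ 3 by rewrite (exprS H 2); nra.
nra.
Qed.

Lemma smooth3_continuous L f : smooth3 L f -> continuous f.
Proof.
move=> sf x; have L0 := smooth3_ge0 sf; apply/cvgrPdist_le => e e0.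
have r0 : 0 < e / (6 * L + 1) by rewrite divr_gt0// ltr_wpDl// mulr_ge0.
apply: filterS (nbhsx_ballx x _ r0) => y [y1 y2]; rewrite /ball/= in y1 y2.
have := smooth3_lip sf x (y.1 - x.1, y.2 - x.2).
rewrite (_ : shift2 _ _ = y); last by rewrite /shift2/= !subrKC -surjective_pairing.
rewrite distrC; move/le_trans; apply; rewrite /size2/=.
rewrite distrC (distrC y.2).
have : (6 * L + 1) * (e / (6 * L + 1)) = e by field; lra.
nra.
Qed.

Lemma smooth3_cst c : smooth3 `|c| (fun=> c).
Proof.
split; first exact: measurable_cst.
move=> x; split => //; exists (0, 0), (0, 0, 0); rewrite !normr0; split => // h _.
by rewrite /lin2 /quad2/= !mul0r !addr0 subrr normr0 mulr_ge0 ?exprn_ge0 ?size2_ge0.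
Qed.

Lemma smooth3D L M f g : smooth3 L f -> smooth3 M g ->
  smooth3 (L + M) (fun x => f x + g x).
Proof.
move=> [mf sf] [mg sg]; split; first exact: measurable_funD.
move=> x; have [fx [p [q [[p1 p2 q1 q2 q3] T]]]] := sf x.
have [gx [p' [q' [[p1' p2' q1' q2' q3'] T']]]] := sg x.
have D (a b : R) : `|a| <= L -> `|b| <= M -> `|a + b| <= L + M.
  by move=> aL bM; apply: (le_trans (ler_normD _ _)); exact: lerD.
split; first exact: D.
exists (p.1 + p'.1, p.2 + p'.2), (q.1.1 + q'.1.1, q.1.2 + q'.1.2, q.2 + q'.2).
split; first by split => /=; exact: D.
move=> h h1; rewrite (_ : _ - _ = (f (shift2 x h) - (f x + lin2 p h + quad2 q h)) +
  (g (shift2 x h) - (g x + lin2 p' h + quad2 q' h))); last first.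
  by rewrite /lin2 /quad2/=; ring.
by rewrite mulrDl; apply: (le_trans (ler_normD _ _)); apply: lerD; [exact: T|exact: T'].
Qed.

Lemma smooth3M L M f g : smooth3 L f -> smooth3 M g ->
  smooth3 (10 * (L * M)) (fun x => f x * g x).
Proof.
move=> sf sg; have L0 := smooth3_ge0 sf; have M0 := smooth3_ge0 sg.
case: sf sg => [mf sf] [mg sg]; split; first exact: measurable_funM.
move=> x; have [fx [p [q [[p1 p2 q1 q2 q3] T]]]] := sf x.
have [gx [p' [q' [[p1' p2' q1' q2' q3'] T']]]] := sg x.
have LM0 : 0 <= L * M by exact: mulr_ge0.
have D (a b : R) u v : `|a| <= u -> `|b| <= v -> `|a + b| <= u + v.
  by move=> aL bM; apply: (le_trans (ler_normD _ _)); exact: lerD.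
have N (a b : R) : `|a| <= L -> `|b| <= M -> `|a * b| <= L * M by exact: norm_mul_le.
have W (a u : R) : `|a| <= u -> u <= 10 * (L * M) -> `|a| <= 10 * (L * M).
  exact: le_trans.
split; first by apply: (W _ _ (N _ _ fx gx)); lra.
exists (f x * p'.1 + p.1 * g x, f x * p'.2 + p.2 * g x),
  (f x * q'.1.1 + p.1 * p'.1 + q.1.1 * g x,
   f x * q'.1.2 + p.1 * p'.2 + p.2 * p'.1 + q.1.2 * g x,
   f x * q'.2 + p.2 * p'.2 + q.2 * g x).
split.
  split => /=.
  - apply: (W _ (L * M + L * M)); last by clear - LM0; lra.
    by apply: D; exact: N.
  - apply: (W _ (L * M + L * M)); last by clear - LM0; lra.
    by apply: D; exact: N.
  - apply: (W _ (L * M + L * M + L * M)); last by clear - LM0; lra.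
    by apply: (D); [apply: (D); exact: N|exact: N].
  - apply: (W _ (L * M + L * M + L * M + L * M)); last by clear - LM0; lra.
    by apply: (D); [apply: (D); [apply: (D); exact: N|exact: N]|exact: N].
  - apply: (W _ (L * M + L * M + L * M)); last by clear - LM0; lra.
    by apply: (D); [apply: (D); exact: N|exact: N].
move=> h h1; have h0 := size2_ge0 h.
have := T h h1; have := T' h h1.
have := lin2_le h p1 p2; have := quad2_le h q1 q2 q3.
have := lin2_le h p1' p2'; have := quad2_le h q1' q2' q3'.
move: h0 h1; set H := size2 h => H0 H1.
set b2 := quad2 q' h; set b1 := lin2 p' h; set a2 := quad2 q h; set a1 := lin2 p h.
move=> b2e b1e a2e a1e.
set rg := (X in `|X| <= _ -> _); set rf := (X in _ -> `|X| <= _ -> _) => rge rfe.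
rewrite (_ : _ - _ = a1 * b2 + a2 * b1 + a2 * b2 + rf * g (shift2 x h) +
   (f x + a1 + a2) * rg); last first.
  have -> : g (shift2 x h) = rg + (g x + b1 + b2) by rewrite /rg; ring.
  have -> : f (shift2 x h) = rf + (f x + a1 + a2) by rewrite /rf; ring.
  rewrite /a1 /a2 /b1 /b2 /lin2 /quad2/=; ring.
have H2 : H ^+ 2 <= 1 by rewrite exprn_ile1.
have H3 : 0 <= H ^+ 3 by exact: exprn_ge0.
have E1 : `|a1 * b2| <= L * M * H ^+ 3.
  by apply: le_trans (norm_mul_le a1e b2e) _; rewrite le_eqVlt; apply/orP; left; apply/eqP; ring.
have E2 : `|a2 * b1| <= L * M * H ^+ 3.
  by apply: le_trans (norm_mul_le a2e b1e) _; rewrite le_eqVlt; apply/orP; left; apply/eqP; ring.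
have E3 : `|a2 * b2| <= L * M * H ^+ 3.
  apply: le_trans (norm_mul_le a2e b2e) _.
  rewrite (_ : _ * _ = (L * M * H ^+ 3) * H); last by ring.
  by rewrite ler_piMr// mulr_ge0.
have E4 : `|rf * g (shift2 x h)| <= L * M * H ^+ 3.
  apply: le_trans (norm_mul_le rfe (proj1 (sg _))) _.
  by rewrite le_eqVlt; apply/orP; left; apply/eqP; ring.
have E5 : `|(f x + a1 + a2) * rg| <= (3 * L) * (M * H ^+ 3).
  apply: norm_mul_le => //; apply: (@le_trans _ _ (L + L + L)); last by clear; lra.
  apply: (D); first apply: (D) => //.
    by apply: (le_trans a1e); rewrite ler_piMr.
  by apply: (le_trans a2e); rewrite ler_piMr.
apply: (@le_trans _ _ (L * M * H ^+ 3 + L * M * H ^+ 3 + L * M * H ^+ 3 +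
  L * M * H ^+ 3 + 3 * L * (M * H ^+ 3))).
  by do 4!(apply: (D) => //).
have : 0 <= L * M * H ^+ 3 by exact: mulr_ge0.
clear; lra.
Qed.


(** Its range is [[-1/2, 1/2]], so that [sigmoid y + 1 / 2] can be fed to Bernstein polynomials, and
    it is injective on [[-1, 1]]. Being rational, its Taylor remainder is explicit. *)
Definition sigmoid (y : R) : R := y / (1 + y ^+ 2).

(* With z = y - i, sigmoid y is the real part of 1 / z and the Taylor remainder
   that of - a^3 / (z^3 (z + a)); the three polynomials below are real parts of
   powers of the conjugate of z. *)
Lemma sigmoid_taylor (y a : R) :
  `|sigmoid (y + a) - (sigmoid y + (1 - y ^+ 2) / (1 + y ^+ 2) ^+ 2 * a +
     (y ^+ 3 - 3 * y) / (1 + y ^+ 2) ^+ 3 * a ^+ 2)| <= `|a| ^+ 3.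
Proof.
set A := 1 + y ^+ 2; set D := 1 + (y + a) ^+ 2.
have A1 : 1 <= A by rewrite lerDl sqr_ge0.
have D1 : 1 <= D by rewrite lerDl sqr_ge0.
have A0 : 0 < A by lra.
have D0 : 0 < D by lra.
pose N := (y ^+ 3 - 3 * y) * (y + a) - (3 * y ^+ 2 - 1).
pose I := (y ^+ 3 - 3 * y) + (y + a) * (3 * y ^+ 2 - 1).
have NI : N ^+ 2 + I ^+ 2 = A ^+ 3 * D by rewrite /N /I /A /D; ring.
have AD1 : 1 <= A ^+ 3 * D by rewrite -[leLHS]mul1r ler_pM// exprn_ege1.
have N1 : `|N| <= A ^+ 3 * D.
  rewrite -(ler_pXn2r (n := 2))// ?nnegrE//; last by lra.
  rewrite real_normK ?num_real//.
  apply: (@le_trans _ _ (A ^+ 3 * D)); first by rewrite -NI lerDl sqr_ge0.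
  by rewrite -[leLHS]mul1r expr2 ler_wpM2r//; lra.
rewrite (_ : _ - _ = - a ^+ 3 * (N / (A ^+ 3 * D))); last first.
  rewrite /sigmoid -/A -/D /N.
  have An : A != 0 by rewrite gt_eqF.
  have Dn : D != 0 by rewrite gt_eqF.
  have DE : D = A + 2 * y * a + a ^+ 2 by rewrite /D /A; ring.
  have yE : y ^+ 2 = A - 1 by rewrite /A; ring.
  apply: (mulIf (x := A ^+ 3 * D)); first by rewrite mulf_neq0 ?expf_neq0.
  rewrite -[RHS]mulrA divfK ?mulf_neq0 ?expf_neq0//.
  rewrite (_ : _ * (A ^+ 3 * D) = (y + a) * A ^+ 3 - (y * A ^+ 2 * D +
    (1 - y ^+ 2) * A * a * D + (y ^+ 3 - 3 * y) * a ^+ 2 * D)); last first.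
    by field; rewrite An Dn.
  by rewrite /D /A; ring.
rewrite normrM normrN normrX ler_piMr ?exprn_ge0//.
by rewrite normrM normfV (gtr0_norm (lt_le_trans ltr01 AD1)) ler_pdivrMr ?mul1r// (lt_le_trans ltr01 AD1).
Qed.

Lemma sigmoid_coef_le (y : R) : [/\ `|sigmoid y| <= 1 / 2,
  `|(1 - y ^+ 2) / (1 + y ^+ 2) ^+ 2| <= 1 &
  `|(y ^+ 3 - 3 * y) / (1 + y ^+ 2) ^+ 3| <= 1].
Proof.
rewrite /sigmoid; set A := 1 + y ^+ 2.
have A1 : 1 <= A by rewrite lerDl sqr_ge0.
have A0 : 0 < A by lra.
have H x k : `|x| <= A ^+ k -> `|x / A ^+ k| <= 1.
  by move=> xA; rewrite normrM normfV normrX (gtr0_norm A0) ler_pdivrMr ?exprn_gt0// mul1r.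
split.
- rewrite normrM normfV (gtr0_norm A0) ler_pdivrMr// /A -[y ^+ 2]real_normK ?num_real//.
  by have := sqr_ge0 (`|y| - 1); nra.
- apply: H; apply: (@le_trans _ _ A); last by rewrite expr2 ler_peMr// ltW.
  by apply: (le_trans (ler_normB _ _)); rewrite normr1 ger0_norm// sqr_ge0.
- apply: H; have A3 : 1 <= A ^+ 3 by exact: exprn_ege1.
  rewrite -(ler_pXn2r (n := 2))// ?nnegrE//; last by lra.
  rewrite real_normK ?num_real//; apply: (@le_trans _ _ (A ^+ 3)).
    rewrite (_ : A ^+ 3 = (y ^+ 3 - 3 * y) ^+ 2 + (3 * y ^+ 2 - 1) ^+ 2).
      by rewrite lerDl sqr_ge0.
    by rewrite /A; ring.
  by rewrite -[leLHS]mul1r [leRHS]expr2 ler_wpM2r//; lra.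
Qed.

Lemma measurable_sigmoid : mfunT sigmoid.
Proof.
apply: continuous_measurable => y; apply: cvgM; first exact: cvg_id.
apply: cvgV; first by rewrite gt_eqF// ltr_pwDl// sqr_ge0.
by apply: cvgD; [exact: cvg_cst|exact: sqr_continuous].
Qed.

Lemma smooth3_sigmoid (c : R) (b : bool) : 0 <= c <= 1 ->
  smooth3 1 (fun x => sigmoid (c * (if b then x.1 else x.2))).
Proof.
move=> /andP[c0 c1]; split.
  apply: (measurableT_comp measurable_sigmoid); apply: measurable_funM => //.
  by case: b; [exact: measurable_fst|exact: measurable_snd].
move=> x; set y := c * _; have [s0 s1 s2] := sigmoid_coef_le y.
split; first by lra.
set p := (1 - _) / _ in s1; set q := (_ - _) / _ in s2.
have pc : `|p * c| <= 1 by rewrite -[leRHS]mulr1; apply: norm_mul_le => //; rewrite ger0_norm.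
have qc : `|q * c ^+ 2| <= 1.
  rewrite -[leRHS]mulr1; apply: norm_mul_le => //.
  by rewrite ger0_norm ?exprn_ge0// exprn_ile1.
exists (if b then (p * c, 0) else (0, p * c)),
  (if b then (q * c ^+ 2, 0, 0) else (0, 0, q * c ^+ 2)).
split; first by move: (p * c) (q * c ^+ 2) pc qc => u v; case: (b) => /=; rewrite normr0.
move=> h h1; have := sigmoid_taylor y (c * (if b then h.1 else h.2)).
rewrite -/p -/q mul1r.
set T := (X in `|X| <= _ -> _); set U := (X in _ -> `|X| <= _).
have -> : T = U.
  rewrite /T /U /lin2 /quad2 /shift2 /y /=; case: (b) => /=;
    by rewrite mulrDr; congr (_ - _); ring.
move/le_trans; apply; rewrite lerXn2r ?nnegrE ?size2_ge0//.
rewrite normrM (ger0_norm c0).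
apply: (@le_trans _ _ `|if b then h.1 else h.2|); first by rewrite ler_piMl.
by case: (b); rewrite /size2 ?lerDl ?lerDr.
Qed.

Definition test_fun f : Prop := exists L, smooth3 L f.

Lemma test_funD f g : test_fun f -> test_fun g -> test_fun (fun x => f x + g x).
Proof. by move=> [L fL] [M gM]; exists (L + M); exact: smooth3D. Qed.

Lemma test_funM f g : test_fun f -> test_fun g -> test_fun (fun x => f x * g x).
Proof. by move=> [L fL] [M gM]; exists (10 * (L * M)); exact: smooth3M. Qed.

Lemma test_fun_cst c : test_fun (fun=> c).
Proof. by exists `|c|; exact: smooth3_cst. Qed.

Lemma test_fun_bernstein n (s : R * R -> R) (G : nat -> R * R -> R) :
  test_fun s -> (forall k, test_fun (G k)) ->
  test_fun (fun x => bernstein n (s x) (G^~ x)).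
Proof.
move=> ts; elim: n G => [|n IH] G tG /=; first exact: tG.
apply: test_funD; apply: test_funM => //.
- by apply: (IH (fun k => G k.+1)).
- apply: test_funD; first exact: test_fun_cst.
  under eq_fun do rewrite -mulN1r.
  by apply: test_funM => //; exact: test_fun_cst.
- exact: IH.
Qed.

(** Rescaled sigmoids send the plane into the unit square, where a Bernstein polynomial approximates
    [f] read in the new coordinates. These determine the point only while both coordinates are at
    most [r]; further out the trivial error [2 M] is charged to [|x|^2 / r^2], which second moments
    control. *)
Lemma test_fun_approx f (M e r : R) : continuous f -> (forall x, `|f x| <= M) ->
  0 < e -> 1 <= r ->
  exists2 p, test_fun p & forall x, `|f x - p x| <= e + 2 * M * (x.1 ^+ 2 + x.2 ^+ 2) / r ^+ 2.
Proof.
move=> cf fM e0 r1.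
have M0 : 0 <= M by exact: le_trans (fM (0, 0)).
have r0 : 0 < r by lra.
pose s (b : bool) (x : R * R) := sigmoid (r^-1 * (if b then x.1 else x.2)) + 1 / 2.
have ts b : test_fun (s b).
  apply: test_funD; last exact: test_fun_cst.
  by exists 1; apply: smooth3_sigmoid; rewrite invr_ge0 (ltW r0)/= invf_le1.
have s01 b x : 0 <= s b x <= 1.
  rewrite /s; have [+ _ _] := sigmoid_coef_le (r^-1 * (if b then x.1 else x.2)).
  by rewrite ler_norml; lra.
(* The inverse of the rescaled sigmoid on [[-r, r]], written with the denominator that keeps it
   continuous at [u = 1 / 2]. Square roots of negative numbers are 0, so [g] is continuous on the
   whole line. *)
pose g (u : R) : R := 2 * r * (u - 1 / 2) / (1 + Num.sqrt (1 - 4 * (u - 1 / 2) ^+ 2)).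
have cg : continuous g.
  move=> u; have cu : (fun x : R => x - 1 / 2) @ u --> u - 1 / 2.
    by apply: cvgB; [exact: cvg_id|exact: cvg_cst].
  apply: cvgM; first by apply: cvgM => //; exact: cvg_cst.
  apply: cvgV; first by rewrite gt_eqF// ltr_pwDl// sqrtr_ge0.
  apply: cvgD; first exact: cvg_cst.
  apply: (cvg_comp _ Num.sqrt); last exact: sqrt_continuous.
  apply: cvgB; first exact: cvg_cst.
  apply: cvgM; first exact: cvg_cst.
  by apply: (cvg_comp _ (fun x => x ^+ 2) cu); exact: sqr_continuous.
have gK (y : R) : `|y| <= r -> g (sigmoid (r^-1 * y) + 1 / 2) = y.
  move=> yr; rewrite /g addrK.
  pose w := y / r; have -> : r^-1 * y = w by rewrite /w mulrC.
  have yE : y = w * r by rewrite /w divfK ?gt_eqF.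
  have w1 : w ^+ 2 <= 1.
    rewrite -[w ^+ 2]real_normK ?num_real// exprn_ile1//.
    by rewrite /w normrM normfV (gtr0_norm r0) ler_pdivrMr// mul1r.
  have W0 : 0 < 1 + w ^+ 2 by rewrite ltr_pwDl// sqr_ge0.
  have -> : 1 - 4 * sigmoid w ^+ 2 = ((1 - w ^+ 2) / (1 + w ^+ 2)) ^+ 2.
    by rewrite /sigmoid; field; rewrite gt_eqF.
  rewrite sqrtr_sqr ger0_norm; last by rewrite divr_ge0 ?(ltW W0)// subr_ge0.
  rewrite yE /sigmoid; field; rewrite gt_eqF//=.
  by rewrite (_ : _ + _ = 2) ?pnatr_eq0//; ring.
pose F (z : R * R) := f (g z.1, g z.2).
have cF : continuous F.
  move=> z.
  have c1 : {for z, continuous (fun z : R * R => g z.1)}.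
    by apply: (@continuous_comp _ _ _ fst g); [exact: cvg_fst|exact: cg].
  have c2 : {for z, continuous (fun z : R * R => g z.2)}.
    by apply: (@continuous_comp _ _ _ snd g); [exact: cvg_snd|exact: cg].
  have c : {for z, continuous (fun z : R * R => (g z.1, g z.2))}.
    exact: (cvg_pair c1 c2).
  exact: (continuous_comp c (cf _)).
have e2 : 0 < e / 2 by rewrite divr_gt0.
have [dl d0 ucF] := uniform_continuity_box 0 1 cF e2.
pose K := 2 * M / dl ^+ 2.
have K0 : 0 <= K by rewrite divr_ge0 ?exprn_ge0 ?(ltW d0)// mulr_ge0.
pose n := (Num.bound (2 * K / e)).+1.
have nK : K / n%:R <= e / 2.
  rewrite ler_pdivrMr ?ltr0n// -ler_pdivrMl// invf_div mulrAC.
  apply: (@le_trans _ _ (Num.bound (2 * K / e))%:R); last by rewrite ler_nat.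
  by rewrite ltW// archi_boundP// divr_ge0 ?(ltW e0)// mulr_ge0.
pose p x := bernstein n (s true x) (fun k => bernstein n (s false x)
  (fun l => F (k%:R / n%:R, l%:R / n%:R))).
have tp : test_fun p.
  apply: (@test_fun_bernstein n (s true) (fun k x => bernstein n (s false x)
    (fun l => F (k%:R / n%:R, l%:R / n%:R))) (ts true)) => k.
  apply: (@test_fun_bernstein n (s false) (fun l => fun=> F (k%:R / n%:R, l%:R / n%:R)) (ts false)) => l.
  exact: test_fun_cst.
have pF x : `|p x - F (s true x, s false x)| <= e.
  apply: (@le_trans _ _ (e / 2 + K / n%:R)); last by lra.
  apply: bernstein_approx => // u v u01 v01.
  have q0 : 0 <= (u - s true x) ^+ 2 + (v - s false x) ^+ 2 by rewrite addr_ge0 ?sqr_ge0.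
  have far t : dl <= `|t| -> 2 * M <= K * t ^+ 2.
    move=> dt; rewrite /K -mulrA ler_peMr ?mulr_ge0// mulrC ler_pdivlMr ?exprn_gt0//.
    by rewrite mul1r -[t ^+ 2]real_normK ?num_real// lerXn2r ?nnegrE// ltW.
  have triv : `|F (u, v) - F (s true x, s false x)| <= 2 * M.
    by apply: (le_trans (ler_normB _ _)); rewrite mulr_natl mulr2n lerD// /F.
  have [u1|u1] := ltP `|u - s true x| dl; last first.
    apply: (le_trans triv); have := far _ u1; rewrite mulrDr.
    have : 0 <= K * (v - s false x) ^+ 2 by rewrite mulr_ge0 ?sqr_ge0.
    lra.
  have [v1|v1] := ltP `|v - s false x| dl; last first.
    apply: (le_trans triv); have := far _ v1; rewrite mulrDr.
    have : 0 <= K * (u - s true x) ^+ 2 by rewrite mulr_ge0 ?sqr_ge0.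
    lra.
  apply: (@le_trans _ _ (e / 2)); first exact: ucF.
  by rewrite lerDl mulr_ge0.
exists p => // x.
have [x1|x1] := leP `|x.1| r; last first.
  apply: (@le_trans _ _ (`|f x - F (s true x, s false x)| + e)).
    rewrite (_ : f x - p x = (f x - F (s true x, s false x)) - (p x - F (s true x, s false x))); last by ring.
    by apply: (le_trans (ler_normB _ _)); rewrite lerD2l.
  rewrite addrC lerD2l; apply: (le_trans (ler_normB _ _)).
  apply: (@le_trans _ _ (2 * M)); first by rewrite mulr_natl mulr2n lerD// /F.
  rewrite -mulrA ler_peMr ?mulr_ge0// ler_pdivlMr ?exprn_gt0// mul1r.
  rewrite -[x.1 ^+ 2]real_normK ?num_real//.
  have : r ^+ 2 <= `|x.1| ^+ 2 by rewrite lerXn2r ?nnegrE//; lra.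
  by have := sqr_ge0 x.2; lra.
have [x2|x2] := leP `|x.2| r; last first.
  apply: (@le_trans _ _ (`|f x - F (s true x, s false x)| + e)).
    rewrite (_ : f x - p x = (f x - F (s true x, s false x)) - (p x - F (s true x, s false x))); last by ring.
    by apply: (le_trans (ler_normB _ _)); rewrite lerD2l.
  rewrite addrC lerD2l; apply: (le_trans (ler_normB _ _)).
  apply: (@le_trans _ _ (2 * M)); first by rewrite mulr_natl mulr2n lerD// /F.
  rewrite -mulrA ler_peMr ?mulr_ge0// ler_pdivlMr ?exprn_gt0// mul1r.
  rewrite -[x.2 ^+ 2]real_normK ?num_real//.
  have : r ^+ 2 <= `|x.2| ^+ 2 by rewrite lerXn2r ?nnegrE//; lra.
  by have := sqr_ge0 x.1; lra.
have <- : F (s true x, s false x) = f x.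
  by rewrite /F /s /= !gK// -surjective_pairing.
rewrite distrC; apply: (le_trans (pF x)); rewrite lerDl.
by rewrite divr_ge0 ?exprn_ge0 ?(ltW r0)// !mulr_ge0 ?addr_ge0 ?sqr_ge0.
Qed.

(** Measurability on the plane is inherited from the test functions with precision [1 / (k + 1)] and
    radius [k + 1], which converge to [f] pointwise. *)
Lemma bmf_continuous2 f (M : R) : continuous f -> (forall x, `|f x| <= M) -> bmf f.
Proof.
move=> cf fM; split; last by exists M.
have e0 (k : nat) : (0 : R) < k.+1%:R^-1 by rewrite invr_gt0 ltr0n.
have r1 (k : nat) : (1 : R) <= k.+1%:R by rewrite ler1n.
pose p k := sval (cid2 (test_fun_approx cf fM (e0 k) (r1 k))).
have tp k : test_fun (p k) by rewrite /p; case: cid2.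
have pf k x : `|f x - p k x| <= k.+1%:R^-1 + 2 * M * (x.1 ^+ 2 + x.2 ^+ 2) / k.+1%:R ^+ 2.
  by rewrite /p; case: cid2 => q /= tq H; exact: H.
apply: (measurable_fun_cvg (h := p)) => [k|x _]; first by case: (tp k) => L [].
have M0 : 0 <= M by exact: le_trans (fM (0, 0)).
have c0 : 0 <= 2 * M * (x.1 ^+ 2 + x.2 ^+ 2).
  by rewrite !mulr_ge0 ?addr_ge0 ?sqr_ge0.
have bd k : `|f x - p k x| <= (1 + 2 * M * (x.1 ^+ 2 + x.2 ^+ 2)) * k.+1%:R^-1.
  have := pf k x; move: (2 * M * _) c0 => c c0 H; apply: (le_trans H).
  rewrite mulrDl mul1r lerD2l ler_wpM2l//.
  by rewrite expr2 invfM ler_piMr ?invr_ge0 ?ler0n// invf_le1 ?ltr0n.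
apply/cvgrPdist_le => e e1; near=> k; apply: (le_trans (bd k)).
rewrite ler_pdivrMr ?ltr0n// -ler_pdivrMl//.
near: k; exists (Num.bound (e^-1 * (1 + 2 * M * (x.1 ^+ 2 + x.2 ^+ 2)))) => // k /= kn.
apply: (@le_trans _ _ (Num.bound (e^-1 * (1 + 2 * M * (x.1 ^+ 2 + x.2 ^+ 2))))%:R).
  by rewrite ltW// archi_boundP// mulr_ge0 ?invr_ge0 ?(ltW e1)// addr_ge0.
by rewrite ler_nat ltnW// ltnS.
Unshelve. all: by end_near. Qed.

End smooth3.

(** * The standard normal law of the plane *)

Section normal_plane.
Context {R : realType}.
Local Notation gam := (@std_normal R).

Definition std_normal2 : probability (R * R)%type R := (gam \x gam)%E.

Lemma same_law_fst : same_law std_normal2 gam fst id.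
Proof.
move=> A mA; rewrite (_ : fst @^-1` A = A `*` setT); last first.
  by apply/seteqP; split => z /= => [|[]].
by rewrite probability_prodE_prob// probability_setT mule1.
Qed.

Lemma same_law_snd : same_law std_normal2 gam snd id.
Proof.
move=> A mA; rewrite (_ : snd @^-1` A = setT `*` A); last first.
  by apply/seteqP; split => z /= => [|[]].
by rewrite probability_prodE_prob// probability_setT mul1e.
Qed.

Lemma itg_normal2_fst (f : R -> R) : itg gam f -> itg std_normal2 (fun z => f z.1).
Proof.
move=> fi; apply: (itg_same_law measurable_fst (@measurable_id _ _ setT) same_law_fst fi).
exact: itg_measurable fi.
Qed.

Lemma itg_normal2_snd (f : R -> R) : itg gam f -> itg std_normal2 (fun z => f z.2).
Proof.
move=> fi; apply: (itg_same_law measurable_snd (@measurable_id _ _ setT) same_law_snd fi).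
exact: itg_measurable fi.
Qed.

Lemma Ex_normal2_fst (f : R -> R) : itg gam f -> Ex std_normal2 (fun z => f z.1) = Ex gam f.
Proof.
move=> fi; apply: (Ex_same_law measurable_fst (@measurable_id _ _ setT) same_law_fst fi).
exact: itg_measurable fi.
Qed.

Lemma Ex_normal2_snd (f : R -> R) : itg gam f -> Ex std_normal2 (fun z => f z.2) = Ex gam f.
Proof.
move=> fi; apply: (Ex_same_law measurable_snd (@measurable_id _ _ setT) same_law_snd fi).
exact: itg_measurable fi.
Qed.

Lemma itg_normal2_prod : itg std_normal2 (fun z => z.1 * z.2).
Proof.
apply: (itg_le (g := fun z : R * R => z.1 ^+ 2 + z.2 ^+ 2)).
- exact: measurable_funM.
- apply: itgD; first exact: (itg_normal2_fst (itg_normal_pow 2)).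
  exact: (itg_normal2_snd (itg_normal_pow 2)).
- move=> z; rewrite normrM -(real_normK (num_real z.1)) -(real_normK (num_real z.2)).
  by have := sqr_ge0 (`|z.1| - `|z.2|); have := normr_ge0 z.1; have := normr_ge0 z.2; nra.
Qed.

Lemma normal2_covariance : Ex std_normal2 (fun z => z.1 * z.2) = 0.
Proof.
have i1 : itg gam (fun x => x).
  by have := @itg_normal_pow R 1; under eq_fun do rewrite expr1.
rewrite /Ex /Rintegral -(integral12_prod_meas1 itg_normal2_prod)/=.
rewrite (eq_integral (fun=> 0%E)) ?integral0// => x _.
rewrite /fubini_F/= -(@EFin_Ex R _ _ gam (fun y => x * y)); last exact: itgZ.
by rewrite ExZ ?normal_mean ?mulr0.
Qed.

(** The one-dimensional stability is applied to the second coordinate with the first frozen, then to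
    the first; Fubini brings the two variables concerned next to each other. *)
Lemma normal2_stable (F : R * R -> R) (s t r : R) : 0 < s -> 0 < r ->
  s ^+ 2 + t ^+ 2 = r ^+ 2 -> continuous F -> bmf F ->
  Ex std_normal2 (fun z => Ex std_normal2 (fun z' =>
    F (t * z.1 + s * z'.1, t * z.2 + s * z'.2))) =
  Ex std_normal2 (fun z => F (r * z.1, r * z.2)).
Proof.
move=> s0 r0 str cF bF.
have mlin (d : measure_display) (T : measurableType d) (p q : T -> R) (a b : R) :
    mfunT p -> mfunT q ->
    mfunT (fun x => a * p x + b * q x).
  by move=> mp mq; apply: measurable_funD; apply: measurable_funM.
have bFc (d : measure_display) (T : measurableType d) (p q : T -> R) :
    mfunT p -> mfunT q -> bmf (fun x => F (p x, q x)).
  by move=> mp mq; apply: (bmf_comp bF); apply/measurable_fun_pair.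
pose G (q : R * R * (R * R)) := F (t * q.1.1 + s * q.2.1, t * q.1.2 + s * q.2.2).
have m1 (d1 d2 : measure_display) (T1 : measurableType d1) (T2 : measurableType d2) (d : measure_display)
   (T : measurableType d) (p : T -> T1 * T2) : mfunT p -> mfunT (fst \o p).
  by move=> mp; apply: measurableT_comp mp.
have m2 (d1 d2 : measure_display) (T1 : measurableType d1) (T2 : measurableType d2) (d : measure_display)
   (T : measurableType d) (p : T -> T1 * T2) : mfunT p -> mfunT (snd \o p).
  by move=> mp; apply: measurableT_comp mp.
have bG : bmf G.
  apply: bFc; apply: mlin.
  - by do 2 apply: (m1).
  - by apply: (m1); apply: (m2).
  - by apply: (m2); apply: (m1).
  - by do 2 apply: (m2).
have -> : Ex std_normal2 (fun z => Ex std_normal2 (fun z' =>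
    F (t * z.1 + s * z'.1, t * z.2 + s * z'.2))) =
  Ex gam (fun a => Ex gam (fun b => Ex gam (fun a' => Ex gam (fun b' =>
    F (t * a + s * a', t * b + s * b'))))).
  rewrite Ex_prod1; last exact: (bmf_Ex1 std_normal2 std_normal2 bG).
  congr (Ex gam _); apply/funext => a; congr (Ex gam _); apply/funext => b.
  by rewrite Ex_prod1//; exact: (bmf_pair1 bG (a, b)).
rewrite [RHS]Ex_prod2; last first.
  by apply: bFc; apply: measurable_funM.
transitivity (Ex gam (fun a => Ex gam (fun a' => Ex gam (fun b =>
    F (t * a + s * a', r * b))))).
  congr (Ex gam _); apply/funext => a.
  pose H (q : R * R * R) := F (t * a + s * q.1.2, t * q.1.1 + s * q.2).
  have bH : bmf H.
    apply: bFc; last first.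
      by apply: mlin; [do 2 apply: (m1)|apply: (m2)].
    apply: measurable_funD => //; apply: measurable_funM => //.
    by apply: (m2); apply: (m1).
  rewrite (@Ex_swap _ _ _ _ _ gam gam _ (bmf_Ex1 std_normal2 gam bH)).
  congr (Ex gam _); apply/funext => a'.
  apply: (@normal_stable R (fun v => F (t * a + s * a', v)) s t r) => //.
    move=> v; apply: (@continuous_comp _ _ _ (fun v : R => (t * a + s * a', v)) F).
      have c1 : {for v, continuous (fun=> t * a + s * a' : R)} by exact: cvg_cst.
      have c2 : {for v, continuous (fun x : R => x)} by exact: cvg_id.
      exact: (cvg_pair c1 c2).
    exact: cF.
  exact: (bmf_pair1 bF).
have bK : bmf (fun q : R * (R * R) => F (t * q.1 + s * q.2.1, r * q.2.2)).
  apply: bFc.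
    by apply: mlin; [apply: (m1)|apply: (m1); apply: (m2)].
  by apply: measurable_funM => //; apply: (m2); apply: (m2).
transitivity (Ex gam (fun a => Ex std_normal2 (fun q =>
    F (t * a + s * q.1, r * q.2)))).
  by congr (Ex gam _); apply/funext => a; rewrite Ex_prod1//; exact: (bmf_pair1 bK a).
rewrite (Ex_swap gam std_normal2 bK).
rewrite Ex_prod2; last exact: (bmf_Ex2 gam std_normal2 bK).
congr (Ex gam _); apply/funext => b.
pose L (q : R * R) := F (t * q.2 + s * q.1, r * b).
have bL : bmf L by apply: bFc => //; apply: mlin; [apply: (m2)|apply: (m1)].
rewrite (Ex_swap gam gam bL).
apply: (@normal_stable R (fun u => F (u, r * b)) s t r) => //; last exact: (bmf_pair2 bF).
move=> v; apply: (@continuous_comp _ _ _ (fun v : R => (v, r * b)) F).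
  have c1 : {for v, continuous (fun x : R => x)} by exact: cvg_id.
  have c2 : {for v, continuous (fun=> r * b : R)} by exact: cvg_cst.
  exact: (cvg_pair c1 c2).
exact: cF.
Qed.

End normal_plane.

(** * The central limit theorem by Lindeberg's exchange *)

Section taylor_moments.
Context {R : realType} {d} {S : measurableType d}.
Variables (Q : probability S R) (h : S -> R * R) (v11 v12 v22 : R).
Hypotheses (mh1 : mfunT (fun w => (h w).1))
  (mh2 : mfunT (fun w => (h w).2))
  (i1 : itg Q (fun w => (h w).1)) (i2 : itg Q (fun w => (h w).2))
  (i11 : itg Q (fun w => (h w).1 ^+ 2)) (i12 : itg Q (fun w => (h w).1 * (h w).2))
  (i22 : itg Q (fun w => (h w).2 ^+ 2)) (i3 : itg Q (fun w => size2 (h w) ^+ 3))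
  (E1 : Ex Q (fun w => (h w).1) = 0) (E2 : Ex Q (fun w => (h w).2) = 0)
  (E11 : Ex Q (fun w => (h w).1 ^+ 2) = v11)
  (E12 : Ex Q (fun w => (h w).1 * (h w).2) = v12)
  (E22 : Ex Q (fun w => (h w).2 ^+ 2) = v22).

Lemma bmf_shift2 (f : R * R -> R) y : bmf f -> bmf (fun w => f (shift2 y (h w))).
Proof.
move=> bf; apply: (bmf_comp bf); apply/measurable_fun_pair; exact: measurable_funD.
Qed.

(** The approximating value depends on the law of the increment through its first two moments only,
    so two increments sharing them differ by their third absolute moments. *)
Lemma Ex_taylor (L a : R) (f : R * R -> R) (y p : R * R) (q : R * R * R) : bmf f ->
  (forall h, `|f (shift2 y h) - (a + lin2 p h + quad2 q h)| <= L * size2 h ^+ 3) ->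
  `|Ex Q (fun w => f (shift2 y (h w))) - (a + (q.1.1 * v11 + q.1.2 * v12 + q.2 * v22))|
  <= L * Ex Q (fun w => size2 (h w) ^+ 3).
Proof.
move=> bf T.
have il : itg Q (fun w => lin2 p (h w)) by apply: itgD; exact: itgZ.
have i12' : itg Q (fun w => q.1.2 * (h w).1 * (h w).2).
  by under eq_fun do rewrite -mulrA; exact: itgZ.
have iq' : itg Q (fun w => q.1.1 * (h w).1 ^+ 2 + q.1.2 * (h w).1 * (h w).2).
  by apply: itgD => //; exact: itgZ.
have iq : itg Q (fun w => quad2 q (h w)) by apply: itgD => //; exact: itgZ.
have ia : itg Q (fun w => a + lin2 p (h w)) by apply: itgD => //; exact: itg_cst.
have it : itg Q (fun w => a + lin2 p (h w) + quad2 q (h w)) by exact: itgD.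
have -> : a + (q.1.1 * v11 + q.1.2 * v12 + q.2 * v22) =
    Ex Q (fun w => a + lin2 p (h w) + quad2 q (h w)).
  rewrite ExD// ExD//; last exact: itg_cst.
  rewrite Ex_cst [X in _ = _ + X + _]ExD ?ExZ//; try exact: itgZ.
  rewrite E1 E2 !mulr0 !addr0; congr (_ + _).
  rewrite [RHS]ExD//; last exact: itgZ.
  rewrite ExD ?ExZ//; last exact: itgZ.
  rewrite E11 E22; congr (_ + _ + _).
  by rewrite -E12 -ExZ//; congr (Ex Q _); apply/funext => w; rewrite mulrA.
have bfh := bmf_itg Q (bmf_shift2 y bf).
rewrite -ExB// -ExZ//; apply: norm_Ex_le.
- exact: itgB.
- exact: itgZ.
- by move=> w; exact: T.
Qed.

End taylor_moments.

Section central_limit.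
Context {R : realType} {dT dE : measure_display} {T : measurableType dT}
  {E : measurableType dE}.
Variables (P : probability T R) (Z : nat -> T -> E).
Hypotheses (mZ : forall i, mfunT (Z i))
  (indepZ : mutually_independent P Z)
  (idZ : forall i, same_law P P (Z i) (Z 0)).
Variables (phi psi : E -> R) (A : 'M[R]_2).
Hypotheses (bphi : bmf phi) (bpsi : bmf psi)
  (phi0 : Ex P (phi \o Z 0) = 0) (psi0 : Ex P (psi \o Z 0) = 0)
  (cov11 : Ex P (fun w => phi (Z 0 w) ^+ 2) = A 0 0 ^+ 2 + A 0 1 ^+ 2)
  (cov12 : Ex P (fun w => phi (Z 0 w) * psi (Z 0 w)) = A 0 0 * A 1 0 + A 0 1 * A 1 1)
  (cov22 : Ex P (fun w => psi (Z 0 w) ^+ 2) = A 1 0 ^+ 2 + A 1 1 ^+ 2).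

Notation smp := (smp Z).
Notation gam2 := (@std_normal2 R).

Definition scale2 (c : R) (z : R * R) : R * R := (c * z.1, c * z.2).

Definition walk (c : R) k (z : nat -> E) : R * R :=
  scale2 c (\sum_(i < k) phi (z i), \sum_(i < k) psi (z i)).

Let step (w : T) : R * R := (phi (Z 0 w), psi (Z 0 w)).

Let bphiZ : bmf (fun w => phi (Z 0 w)). Proof. exact: bmf_comp. Qed.
Let bpsiZ : bmf (fun w => psi (Z 0 w)). Proof. exact: bmf_comp. Qed.

Definition third_moment : R :=
  Ex P (fun w => size2 (step w) ^+ 3) + Ex gam2 (fun z => size2 (mulmx_pair A z) ^+ 3).

Let bstep3 : bmf (fun w => size2 (step w) ^+ 3).
Proof. by apply: bmfX; apply: bmfD; exact: bmf_norm. Qed.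

Let itg_cubeA : itg gam2 (fun z => size2 (mulmx_pair A z) ^+ 3).
Proof.
pose a : R := (`|A 0 0| + `|A 1 0| + `|A 0 1| + `|A 1 1|).
apply: (itg_le (g := fun z : R * R => a ^+ 3 * 4 * (`|z.1 ^+ 3| + `|z.2 ^+ 3|))).
- apply: measurable_funX; apply: measurable_funD; apply: measurableT_comp => //;
    by apply: measurable_funD; apply: measurable_funM.
- apply: itgZ; apply: itgD; apply: itg_norm.
    exact: (itg_normal2_fst (itg_normal_pow 3)).
  exact: (itg_normal2_snd (itg_normal_pow 3)).
- move=> z; rewrite ger0_norm ?exprn_ge0 ?size2_ge0//.
  apply: (@le_trans _ _ ((a * (`|z.1| + `|z.2|)) ^+ 3)).
    rewrite lerXn2r ?nnegrE ?size2_ge0// ?mulr_ge0 ?addr_ge0//.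
    rewrite /size2 /mulmx_pair/=.
    apply: (le_trans (lerD (ler_normD _ _) (ler_normD _ _))); rewrite !normrM /a.
    have := normr_ge0 (A 0 0); have := normr_ge0 (A 0 1).
    have := normr_ge0 (A 1 0); have := normr_ge0 (A 1 1).
    have := normr_ge0 z.1; have := normr_ge0 z.2.
    move: `|A 0 0| `|A 0 1| `|A 1 0| `|A 1 1| `|z.1| `|z.2| => a1 a2 a3 a4 x y *.
    have : 0 <= a1 * y + a3 * y + a2 * x + a4 * x by rewrite !addr_ge0// mulr_ge0.
    lra.
  rewrite exprMn -mulrA ler_wpM2l ?exprn_ge0 ?addr_ge0// !normrX.
  have := normr_ge0 z.1; have := normr_ge0 z.2.
  move: `|z.1| `|z.2| => x y x0 y0.
  rewrite -subr_ge0 (_ : _ - _ = 3 * (x + y) * (x - y) ^+ 2); last by ring.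
  by rewrite mulr_ge0 ?sqr_ge0// mulr_ge0// addr_ge0.
Qed.

Let size2_scale c z : 0 <= c -> size2 (scale2 c z) = c * size2 z.
Proof. by move=> c0; rewrite /size2 /= !normrM ger0_norm// mulrDr. Qed.

Let step_compare c L f y : 0 <= c -> smooth3 L f ->
  `|Ex P (fun w => f (shift2 y (scale2 c (step w)))) -
    Ex gam2 (fun z => f (shift2 y (scale2 c (mulmx_pair A z))))| <=
  4 * L * c ^+ 3 * third_moment.
Proof.
move=> c0 sf; have bf := smooth3_bmf sf.
have [p [q Tf]] := smooth3_taylor sf y.
pose v11 := c ^+ 2 * (A 0 0 ^+ 2 + A 0 1 ^+ 2).
pose v12 := c ^+ 2 * (A 0 0 * A 1 0 + A 0 1 * A 1 1).
pose v22 := c ^+ 2 * (A 1 0 ^+ 2 + A 1 1 ^+ 2).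
have i1 := itg_normal2_fst (@itg_normal_pow R 1).
have i2 := itg_normal2_snd (@itg_normal_pow R 1).
have i11 := itg_normal2_fst (@itg_normal_pow R 2).
have i22 := itg_normal2_snd (@itg_normal_pow R 2).
have i12 := @itg_normal2_prod R.
have e1 : Ex gam2 (fun z => z.1) = 0.
  rewrite (Ex_normal2_fst (f := fun x => x)) ?normal_mean//.
  by have := @itg_normal_pow R 1; under eq_fun do rewrite expr1.
have e2 : Ex gam2 (fun z => z.2) = 0.
  rewrite (Ex_normal2_snd (f := fun x => x)) ?normal_mean//.
  by have := @itg_normal_pow R 1; under eq_fun do rewrite expr1.
have e11 : Ex gam2 (fun z => z.1 ^+ 2) = 1.
  by rewrite (Ex_normal2_fst (itg_normal_pow 2)) normal_second_moment.
have e22 : Ex gam2 (fun z => z.2 ^+ 2) = 1.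
  by rewrite (Ex_normal2_snd (itg_normal_pow 2)) normal_second_moment.
have j1 : itg gam2 (fun z => z.1) by under eq_fun do rewrite -[_.1]expr1.
have j2 : itg gam2 (fun z => z.2) by under eq_fun do rewrite -[_.2]expr1.
have lin a b : itg gam2 (fun z => a * z.1 + b * z.2) by apply: itgD; exact: itgZ.
have Elin a b : Ex gam2 (fun z => a * z.1 + b * z.2) = 0.
  by rewrite ExD ?ExZ ?e1 ?e2 ?mulr0 ?addr0//; exact: itgZ.
have bilE a b a' b' : (fun z : R * R => (a * z.1 + b * z.2) * (a' * z.1 + b' * z.2)) =
    (fun z => a * a' * z.1 ^+ 2 + (a * b' + b * a') * (z.1 * z.2) + b * b' * z.2 ^+ 2).
  by apply/funext => z; ring.
have bil a b a' b' : itg gam2 (fun z => (a * z.1 + b * z.2) * (a' * z.1 + b' * z.2)).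
  by rewrite bilE; apply: itgD; [apply: itgD|]; exact: itgZ.
have Ebil a b a' b' : Ex gam2 (fun z => (a * z.1 + b * z.2) * (a' * z.1 + b' * z.2)) =
    a * a' + b * b'.
  rewrite bilE ExD ?ExZ//; [|by apply: itgD; exact: itgZ|exact: itgZ].
  rewrite ExD ?ExZ//; [|exact: itgZ|exact: itgZ].
  by rewrite e11 e22 normal2_covariance; ring.
have mlin a b : mfunT (fun z : R * R => a * z.1 + b * z.2).
  by apply: measurable_funD; apply: measurable_funM.
have sZ (S : Type) (u v : S -> R) : (fun w => c * u w * (c * v w)) = fun w => c ^+ 2 * (u w * v w).
  by apply/funext => w; ring.
have sZ2 (S : Type) (u : S -> R) : (fun w => (c * u w) ^+ 2) = fun w => c ^+ 2 * (u w * u w).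
  by apply/funext => w; ring.
have iP (u v : T -> R) : bmf u -> bmf v -> itg P (fun w => c * u w * (c * v w)).
  by move=> bu bv; apply: bmf_itg; apply: bmfM; exact: bmfZ.
have i3 (d' : measure_display) (S : measurableType d') (Q : probability S R) (h : S -> R * R) :
    itg Q (fun w => size2 (h w) ^+ 3) -> itg Q (fun w => size2 (scale2 c (h w)) ^+ 3).
  move=> H; have := itgZ (c ^+ 3) H; congr (itg Q _); apply/funext => w.
  by rewrite size2_scale// exprMn.
have HP := @Ex_taylor R _ T P (fun w => scale2 c (step w)) v11 v12 v22.
have HG := @Ex_taylor R _ _ gam2 (fun z => scale2 c (mulmx_pair A z)) v11 v12 v22.
set a := Ex P _; set b := Ex gam2 _.
rewrite (_ : a - b = (a - (f y + (q.1.1 * v11 + q.1.2 * v12 + q.2 * v22))) -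
  (b - (f y + (q.1.1 * v11 + q.1.2 * v12 + q.2 * v22)))); last by ring.
apply: (le_trans (ler_normB _ _)); rewrite /third_moment mulrDr.
have scE (d' : measure_display) (S : measurableType d') (Q : probability S R) (h : S -> R * R) :
    itg Q (fun w => size2 (h w) ^+ 3) ->
    4 * L * c ^+ 3 * Ex Q (fun w => size2 (h w) ^+ 3) =
    4 * L * Ex Q (fun w => size2 (scale2 c (h w)) ^+ 3).
  move=> H; rewrite -[LHS]mulrA -ExZ//; congr (_ * Ex Q _); apply/funext => w.
  by rewrite size2_scale// exprMn.
have c11 : Ex P (fun w => phi (Z 0 w) * phi (Z 0 w)) = A 0 0 ^+ 2 + A 0 1 ^+ 2.
  by rewrite -cov11; congr (Ex P _); apply/funext => w; rewrite expr2.
have c22 : Ex P (fun w => psi (Z 0 w) * psi (Z 0 w)) = A 1 0 ^+ 2 + A 1 1 ^+ 2.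
  by rewrite -cov22; congr (Ex P _); apply/funext => w; rewrite expr2.
have iPm (u v : T -> R) : bmf u -> bmf v -> itg P (fun w => u w * v w).
  by move=> bu bv; apply: bmf_itg; exact: bmfM.
apply: lerD; rewrite scE; [|exact: bmf_itg| |exact: itg_cubeA].
- apply: (HP _ _ _ _ _ _ _ _ _ _ _ _ _ (4 * L) (f y) f y p q) => //=.
  + by case: (bmfZ c bphiZ).
  + by case: (bmfZ c bpsiZ).
  + by apply: bmf_itg; exact: bmfZ.
  + by apply: bmf_itg; exact: bmfZ.
  + by rewrite sZ2; apply: itgZ; exact: iPm.
  + exact: iP.
  + by rewrite sZ2; apply: itgZ; exact: iPm.
  + by apply: i3; exact: bmf_itg.
  + by rewrite ExZ ?phi0 ?mulr0//; exact: bmf_itg.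
  + by rewrite ExZ ?psi0 ?mulr0//; exact: bmf_itg.
  + by rewrite sZ2 ExZ ?c11//; exact: iPm.
  + by rewrite sZ ExZ ?cov12//; exact: iPm.
  + by rewrite sZ2 ExZ ?c22//; exact: iPm.
- apply: (HG _ _ _ _ _ _ _ _ _ _ _ _ _ (4 * L) (f y) f y p q) => //=.
  + by apply: measurable_funM => //; exact: mlin.
  + by apply: measurable_funM => //; exact: mlin.
  + by apply: itgZ; exact: lin.
  + by apply: itgZ; exact: lin.
  + by rewrite sZ2; apply: itgZ; exact: bil.
  + by rewrite sZ; apply: itgZ; exact: bil.
  + by rewrite sZ2; apply: itgZ; exact: bil.
  + by apply: i3; exact: itg_cubeA.
  + by rewrite ExZ ?Elin ?mulr0//; exact: lin.
  + by rewrite ExZ ?Elin ?mulr0//; exact: lin.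
  + by rewrite sZ2 ExZ ?Ebil//; exact: bil.
  + by rewrite sZ ExZ ?Ebil//; exact: bil.
  + by rewrite sZ2 ExZ ?Ebil//; exact: bil.
Qed.


Let bstat_walk c k x (f : R * R -> R) : bmf f -> bstat (fun z => f (shift2 x (walk c k z))).
Proof.
move=> [mf [M fM]]; split; last by exists M.
move=> d' S z mz; apply: (measurableT_comp mf).
apply/measurable_fun_pair; apply: measurable_funD => //; apply: measurable_funM => //;
  apply: measurable_sum => i.
- by apply: (measurableT_comp (proj1 bphi)); exact: mz.
- by apply: (measurableT_comp (proj1 bpsi)); exact: mz.
Qed.

Let mmul a b c : mfunT (fun z : R * R => c * (a * z.1 + b * z.2)).
Proof.
by apply: measurable_funM => //; apply: measurable_funD; apply: measurable_funM.
Qed.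

(** Induction on the number of steps, uniformly in the starting point. The last step is replaced by
    a normal one at cost [e], Fubini moves that normal step into the starting point, the induction
    hypothesis treats the other [k] steps, and normal stability merges the two normal vectors. *)
Let walk_normal c L f k x : 0 <= c -> smooth3 L f ->
  `|Ex P (fun w => f (shift2 x (walk c k (smp w)))) -
    Ex gam2 (fun z => f (shift2 x (scale2 (c * Num.sqrt k%:R) (mulmx_pair A z))))| <=
  k%:R * (4 * L * c ^+ 3 * third_moment).
Proof.
move=> c0 sf; have bf := smooth3_bmf sf; have cf := smooth3_continuous sf.
set e := 4 * L * _ * _.
have bsh (d' : measure_display) (S : measurableType d') y (h : S -> R * R) :
    mfunT (fun w => (h w).1) -> mfunT (fun w => (h w).2) ->
    bmf (fun w => f (shift2 y (h w))) by move=> *; exact: bmf_shift2.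
have bG y a : bmf (fun z => f (shift2 y (scale2 a (mulmx_pair A z)))).
  by apply: bsh; exact: mmul.
elim: k x => [|k IH] x.
  rewrite mul0r sqrtr0 mulr0.
  have -> : (fun w => f (shift2 x (walk c 0 (smp w)))) = fun=> f x.
    by apply/funext => w; rewrite /walk !big_ord0 /shift2/= mulr0 !addr0 -surjective_pairing.
  have -> : (fun z => f (shift2 x (scale2 0 (mulmx_pair A z)))) = fun=> f x.
    by apply/funext => z; rewrite /shift2/= !mul0r !addr0 -surjective_pairing.
  by rewrite !Ex_cst subrr normr0.
pose S y := Ex P (fun w => f (shift2 y (scale2 c (step w)))).
pose N y := Ex gam2 (fun z => f (shift2 y (scale2 c (mulmx_pair A z)))).
have shA y h h' : shift2 (shift2 y h) h' = shift2 (shift2 y h') h.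
  by rewrite /shift2/= !(addrAC _ h.1) !(addrAC _ h.2).
have bF2 : bmf (fun p : E * (R * R) => f (shift2 p.2 (scale2 c (phi p.1, psi p.1)))).
  apply: (bmf_comp bf); apply/measurable_fun_pair; apply: measurable_funD.
  - exact: measurableT_comp.
  - by apply: measurable_funM => //; apply: (measurableT_comp (proj1 bphi)).
  - exact: measurableT_comp.
  - by apply: measurable_funM => //; apply: (measurableT_comp (proj1 bpsi)).
have bFN : bmf (fun p : (R * R) * (R * R) => f (shift2 p.1 (scale2 c (mulmx_pair A p.2)))).
  apply: (bmf_comp bf); apply/measurable_fun_pair; apply: measurable_funD.
  - exact: measurableT_comp.
  - by apply: (measurableT_comp (mmul (A 0 0) (A 0 1) c)).
  - exact: measurableT_comp.
  - by apply: (measurableT_comp (mmul (A 1 0) (A 1 1) c)).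
have bN : bmf N := bmf_Ex1 gam2 gam2 bFN.
have bS : bmf S.
  have := bmf_Ex2 (law P (mZ 0)) gam2 bF2; congr bmf; apply/funext => y.
  rewrite (Ex_law (mZ 0)) //; first by case: (bmf_pair2 bF2 y).
  by apply: bmf_itg; apply: bsh; apply: measurable_funM => //; [case: bphiZ|case: bpsiZ].
have SN y : `|S y - N y| <= e by exact: step_compare.
have stepE : Ex P (fun w => f (shift2 x (walk c k.+1 (smp w)))) =
    Ex P (fun w => S (shift2 x (walk c k (smp w)))).
  have := @Ex_blocks _ _ R _ E P Z mZ indepZ idZ k 1 id (fun=> k)
    (fun z z' => f (shift2 (shift2 x (walk c k z)) (scale2 c (phi (z' 0%N), psi (z' 0%N))))).
  rewrite (_ : (fun w => f (shift2 (shift2 x (walk c k (smp w \o id))) _)) =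
     (fun w => f (shift2 x (walk c k.+1 (smp w))))); last first.
    apply/funext => w; rewrite /walk /shift2/= !big_ord_recr/=.
    by rewrite !mulrDr !addrA.
  move=> ->.
  - congr (Ex P _); apply/funext => w /=.
    pose y := shift2 x (walk c k (smp w)).
    rewrite -/y; have := @Ex_iid _ _ _ T E P Z mZ idZ (fun e0 => f (shift2 y (scale2 c (phi e0, psi e0)))) k.
    by apply; exact: (bmf_pair2 bF2 y).
  - case: bf => mf [M fM]; split; last by exists M.
    move=> d' U z z' mz mz'; apply: (measurableT_comp mf).
    apply/measurable_fun_pair; apply: measurable_funD; try apply: measurable_funD => //;
      apply: measurable_funM => //; try (apply: measurable_sum => i).
    + by apply: (measurableT_comp (proj1 bphi)); exact: mz.
    + by apply: (measurableT_comp (proj1 bphi)); exact: mz'.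
    + by apply: (measurableT_comp (proj1 bpsi)); exact: mz.
    + by apply: (measurableT_comp (proj1 bpsi)); exact: mz'.
  - move=> z' z1 z2 z12; congr (f (shift2 (shift2 x (scale2 c (_, _))) _));
      by apply: eq_bigr => i _; rewrite z12.
  - by move=> z z1 z2 z12; rewrite z12.
  - by [].
  - by move=> [|?] [|?].
  - by move=> i j ik _; rewrite neq_ltn ik.
have itS := bmf_itg P (bstat_bmf (bstat_walk c k x bS) (mfamily_smp mZ)).
have itN := bmf_itg P (bstat_bmf (bstat_walk c k x bN) (mfamily_smp mZ)).
have dSN : `|Ex P (fun w => S (shift2 x (walk c k (smp w)))) -
    Ex P (fun w => N (shift2 x (walk c k (smp w))))| <= e.
  by rewrite -ExB//; apply: norm_Ex_cst => [|w]; [exact: itgB|exact: SN].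
have bW : bmf (fun p : T * (R * R) => f (shift2 (shift2 x (walk c k (smp p.1)))
    (scale2 c (mulmx_pair A p.2)))).
  case: (bstat_walk c k x bf) => mw _; case: bf => mf [M fM]; split; last by exists M.
  apply: (measurableT_comp mf); apply/measurable_fun_pair; apply: measurable_funD.
  - apply: measurable_funD => //; apply: measurable_funM => //.
    apply: measurable_sum => i; apply: (measurableT_comp (proj1 bphi)).
    exact: (measurableT_comp (mZ i)).
  - by apply: (measurableT_comp (mmul (A 0 0) (A 0 1) c)).
  - apply: measurable_funD => //; apply: measurable_funM => //.
    apply: measurable_sum => i; apply: (measurableT_comp (proj1 bpsi)).
    exact: (measurableT_comp (mZ i)).
  - by apply: (measurableT_comp (mmul (A 1 0) (A 1 1) c)).
have swapE : Ex P (fun w => N (shift2 x (walk c k (smp w)))) =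
    Ex gam2 (fun z => Ex P (fun w => f (shift2 (shift2 x (scale2 c (mulmx_pair A z))) (walk c k (smp w))))).
  rewrite (Ex_swap P gam2 bW); congr (Ex gam2 _); apply/funext => z.
  by congr (Ex P _); apply/funext => w; rewrite shA.
have bWz : bmf (fun z => Ex P (fun w => f (shift2 (shift2 x (scale2 c (mulmx_pair A z))) (walk c k (smp w))))).
  have := bmf_Ex2 P gam2 bW; congr bmf; apply/funext => z.
  by congr (Ex P _); apply/funext => w; rewrite shA.
pose ck := c * Num.sqrt k%:R.
have bV : bmf (fun p : (R * R) * (R * R) => f (shift2 (shift2 x (scale2 c (mulmx_pair A p.1)))
    (scale2 ck (mulmx_pair A p.2)))).
  apply: (bmf_comp bf); apply/measurable_fun_pair; apply: measurable_funD.
  - by apply: measurable_funD => //; apply: (measurableT_comp (mmul (A 0 0) (A 0 1) c)).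
  - by apply: (measurableT_comp (mmul (A 0 0) (A 0 1) ck)).
  - by apply: measurable_funD => //; apply: (measurableT_comp (mmul (A 1 0) (A 1 1) c)).
  - by apply: (measurableT_comp (mmul (A 1 0) (A 1 1) ck)).
pose V z := Ex gam2 (fun z' => f (shift2 (shift2 x (scale2 c (mulmx_pair A z))) (scale2 ck (mulmx_pair A z')))).
have bVz : bmf V := bmf_Ex1 gam2 gam2 bV.
have stabE : Ex gam2 V =
    Ex gam2 (fun z => f (shift2 x (scale2 (c * Num.sqrt k.+1%:R) (mulmx_pair A z)))).
  (* Stability asks for positive scales, so the empty walk, with normal part of scale 0, is treated
     apart. *)
  have [k0|k0] := posnP k.
    rewrite /V /ck k0 sqrtr0 sqrtr1 mulr0 mulr1; congr (Ex gam2 _); apply/funext => z.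
    rewrite -[RHS](Ex_cst gam2); congr (Ex gam2 _); apply/funext => z'.
    by rewrite /shift2/= !mul0r !addr0.
  pose F z := f (shift2 x (scale2 c (mulmx_pair A z))).
  have sk0 : 0 < Num.sqrt (k%:R : R) by rewrite sqrtr_gt0 ltr0n.
  have sk1 : 0 < Num.sqrt (k.+1%:R : R) by rewrite sqrtr_gt0 ltr0n.
  have str : Num.sqrt (k%:R : R) ^+ 2 + 1 ^+ 2 = Num.sqrt (k.+1%:R) ^+ 2.
    by rewrite !sqr_sqrtr// expr1n natr1.
  have cF : continuous F.
    have clin a b y0 : continuous (fun z : R * R => y0 + c * (a * z.1 + b * z.2)).
      move=> z; apply: cvgD; first exact: cvg_cst.
      apply: cvgM; first exact: cvg_cst.
      apply: cvgD; apply: cvgM; [exact: cvg_cst|exact: cvg_fst|exact: cvg_cst|exact: cvg_snd].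
    move=> z; apply: (@continuous_comp _ _ _ (fun z : R * R => shift2 x (scale2 c (mulmx_pair A z))) f).
      exact: (cvg_pair (clin _ _ _ z) (clin _ _ _ z)).
    exact: cf.
  have := normal2_stable sk0 sk1 str cF (bG x c).
  rewrite /V /F; set X := Ex gam2 _; set Y := Ex gam2 _ => XY.
  transitivity X.
    congr (Ex gam2 _); apply/funext => z; congr (Ex gam2 _); apply/funext => z'.
    by congr (f _); rewrite /shift2 /ck /=; congr (_, _); ring.
  rewrite XY; congr (Ex gam2 _); apply/funext => z.
  by congr (f _); rewrite /shift2 /=; congr (_, _); ring.
rewrite stepE -stabE.
rewrite (_ : _ - _ = (Ex P (fun w => S (shift2 x (walk c k (smp w)))) -
    Ex P (fun w => N (shift2 x (walk c k (smp w))))) +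
   (Ex P (fun w => N (shift2 x (walk c k (smp w)))) - Ex gam2 V)); last by ring.
apply: (le_trans (ler_normD _ _)); rewrite -natr1 mulrDl mul1r addrC lerD//.
rewrite swapE -ExB; [|exact: bmf_itg|exact: bmf_itg].
apply: norm_Ex_cst => [|z]; last exact: IH.
by apply: itgB; exact: bmf_itg.
Qed.

Lemma clt_smooth3 L f n : (0 < n)%N -> smooth3 L f ->
  `|Ex P (fun w => f (walk (Num.sqrt n%:R)^-1 n (smp w))) -
    Ex gam2 (fun z => f (mulmx_pair A z))| <= 4 * L * third_moment / Num.sqrt n%:R.
Proof.
move=> n0 sf; set r := Num.sqrt n%:R.
have r0 : 0 < r by rewrite sqrtr_gt0 ltr0n.
have c0 : 0 <= r^-1 by rewrite invr_ge0 ltW.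
have := walk_normal n (0, 0) c0 sf; rewrite -/r mulVf ?gt_eqF//.
have sh0 (y : R * R) : shift2 (0, 0) y = y.
  by rewrite /shift2/= !add0r -surjective_pairing.
have sc1 (y : R * R) : scale2 1 y = y by rewrite /scale2 !mul1r -surjective_pairing.
under eq_fun do rewrite sh0.
under [X in _ - Ex gam2 X]eq_fun do rewrite sh0 sc1.
move/le_trans; apply; rewrite (_ : n%:R = r ^+ 2); last by rewrite sqr_sqrtr.
by rewrite le_eqVlt; apply/orP; left; apply/eqP; field; rewrite gt_eqF.
Qed.

End central_limit.

(** * Score bounds from derivatives on the unit interval *)

Section calculus01.
Context {R : realType}.
Implicit Types (f df ddf : R -> R).

Lemma mean_value01 f df : (forall x : R, 0 < x < 1 -> is_derive x 1 f (df x)) ->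
  forall a b, 0 < a -> a < b -> b < 1 ->
  exists2 c, a < c < b & f b - f a = df c * (b - a).
Proof.
move=> dfE a b a0 ab b1.
have der x : a <= x <= b -> is_derive x 1 f (df x).
  by move=> /andP[ax xb]; apply: dfE; rewrite (lt_le_trans a0 ax) (le_lt_trans xb b1).
have d1 (x : R) : x \in `]a, b[ -> is_derive x 1 f (df x).
  by rewrite in_itv/= => /andP[ax xb]; apply: der; rewrite !ltW.
have d2 : {within `[a, b], continuous f}.
  apply: derivable_within_continuous => x; rewrite in_itv/= => H.
  by have [] := der x H.
by have [c] := MVT ab d1 d2; rewrite in_itv/= => cab E; exists c.
Qed.

Lemma nondecreasing01 f df : (forall x : R, 0 < x < 1 -> is_derive x 1 f (df x)) ->
  (forall x, 0 < x < 1 -> 0 <= df x) ->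
  forall u w, 0 < u -> u <= w -> w < 1 -> f u <= f w.
Proof.
move=> dfE df0 u w u0; rewrite le_eqVlt => /predU1P[->//|uw] w1.
have [c /andP[uc cw] E] := mean_value01 dfE u0 uw w1.
rewrite -subr_ge0 E mulr_ge0 ?subr_ge0 ?(ltW uw)//.
by apply: df0; rewrite (lt_trans u0 uc) (lt_trans cw w1).
Qed.

Lemma above_tangent01 f df ddf :
  (forall x : R, 0 < x < 1 -> is_derive x 1 f (df x)) ->
  (forall x : R, 0 < x < 1 -> is_derive x 1 df (ddf x)) ->
  (forall x, 0 < x < 1 -> 0 <= ddf x) ->
  forall u w, 0 < u < 1 -> 0 < w < 1 -> 0 <= f w - f u - (w - u) * df u.
Proof.
move=> dfE ddfE ddf0 u w /andP[u0 u1] /andP[w0 w1].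
have [uw|wu|->] := ltgtP u w; last by rewrite !subrr mul0r subr0.
- have [c /andP[uc cw] ->] := mean_value01 dfE u0 uw w1.
  rewrite mulrC -mulrBr mulr_ge0 ?subr_ge0 ?(ltW uw)//.
  by apply: (nondecreasing01 ddfE ddf0) => //; [exact: ltW|exact: lt_trans cw w1].
- have [c /andP[wc cu] E] := mean_value01 dfE w0 wu u1.
  have -> : f w - f u = - (df c * (u - w)) by rewrite -E opprB.
  rewrite (_ : _ - _ = (u - w) * (df u - df c)); last by ring.
  rewrite mulr_ge0 ?subr_ge0 ?(ltW wu)//.
  by apply: (nondecreasing01 ddfE ddf0) => //; [exact: lt_trans w0 wc|exact: ltW].
Qed.

Lemma is_derive_onem (u : R) : is_derive u 1 (fun x : R => 1 - x) (-1).
Proof.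
have := @is_deriveB R R^o R^o (cst 1) id u 1 0 1 (is_derive_cst _ _ _) (is_derive_id _ _).
by rewrite sub0r.
Qed.

Lemma is_derive_ell (u : R) : 0 < u < 1 -> is_derive u 1 ell (u * (1 - u))^-1.
Proof.
move=> /andP[u0 u1]; have u1' : 0 < 1 - u by rewrite subr_gt0.
have d1 : is_derive u 1 (@ln R) u^-1 by exact: is_derive1_ln.
have d2 : is_derive u 1 (fun x : R => ln (1 - x)) (- (1 - u)^-1).
  have := @is_derive1_comp R (@ln R) (fun x => 1 - x) u (1 - u)^-1 (-1) (is_derive1_ln u1').
  rewrite mulrN1; apply.
  exact: is_derive_onem.
apply: (@is_derive_eq _ _ _ ell u 1 (u * (1 - u))^-1 (u^-1 - - (1 - u)^-1)).
by field; rewrite !gt_eqF.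
Qed.

(** As [ell] has derivative [1 / (x (1 - x))], both [C ell + f] and [C ell - f] are
    nondecreasing. *)
Lemma score_of_derivative C f df :
  (forall x : R, 0 < x < 1 -> is_derive x 1 f (df x)) ->
  (forall x, 0 < x < 1 -> `|df x| <= C / (x * (1 - x))) -> score C f.
Proof.
move=> dfE dfC.
have mono s u w : `|s| = 1 -> 0 < u -> u <= w -> w < 1 ->
    C * ell u + s * f u <= C * ell w + s * f w.
  move=> s1 u0 uw w1.
  apply: (@nondecreasing01 (fun x => C * ell x + s * f x)
    (fun x => C * (x * (1 - x))^-1 + s * df x)) => //.
    by move=> x x01; apply: is_deriveD; apply: is_deriveZ; [exact: is_derive_ell|exact: dfE].
  move=> x x01; have := dfC x x01; have : `|s * df x| = `|df x| by rewrite normrM s1 mul1r.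
  by move=> <- H; have := ler_norm (- (s * df x)); rewrite normrN; lra.
have mono' u w : 0 < u -> u <= w -> w < 1 -> `|f u - f w| <= C * (ell w - ell u).
  move=> u0 uw w1; have H1 := mono 1 u w (normr1 _) u0 uw w1.
  have H2 := mono (-1) u w (normrN1 _) u0 uw w1.
  by rewrite ler_norml; lra.
have C0 : 0 <= C.
  have h01 : 0 < (2^-1 : R) < 1 by lra.
  by have := le_trans (normr_ge0 _) (dfC _ h01); rewrite pmulr_lge0// invr_gt0; nra.
move=> u w /andP[u0 u1] /andP[w0 w1]; have [uw|wu] := leP u w.
  apply: (le_trans (mono' u w u0 uw w1)); rewrite ler_wpM2l//.
  by rewrite distrC ler_norm.
rewrite distrC; apply: (le_trans (mono' w u w0 (ltW wu) u1)).
by rewrite ler_wpM2l// ler_norm.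
Qed.

(** A symmetric chi-square type distance. It controls the Taylor remainder of the scores up to the
    ends of the interval, and its expectation is explicit when [w] is a normalized binomial rank. *)
Definition sqr_dev (u w : R) : R :=
  (w - u) ^+ 2 * ((u * w)^-1 + ((1 - u) * (1 - w))^-1).

(** The barrier [B] has second derivative [x^-2 + (1 - x)^-2], at least half of [(x (1 - x))^-2], so
    [2 C B + f] and [2 C B - f] are convex and lie above their tangents. The tangent gap of [B] is
    at most [sqr_dev], by [ln (1 + y) <= y]. *)
Lemma taylor_of_derivative C f df ddf :
  (forall x : R, 0 < x < 1 -> is_derive x 1 f (df x)) ->
  (forall x : R, 0 < x < 1 -> is_derive x 1 df (ddf x)) ->
  (forall x, 0 < x < 1 -> `|ddf x| <= C / (x * (1 - x)) ^+ 2) -> 0 <= C ->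
  forall u w, 0 < u < 1 -> 0 < w < 1 ->
  `|f w - f u - (w - u) * df u| <= 2 * C * sqr_dev u w.
Proof.
move=> dfE ddfE ddfC C0 u w u01 w01.
pose B (x : R) := - ln x - ln (1 - x).
pose dB (x : R) := - x^-1 + (1 - x)^-1.
pose ddB (x : R) := x ^- 2 + (1 - x) ^- 2.
have dBE (x : R) : 0 < x < 1 -> is_derive x 1 B (dB x).
  move=> /andP[x0 x1]; have x1' : 0 < 1 - x by rewrite subr_gt0.
  have d1 : is_derive x 1 (fun x => - ln x) (- x^-1).
    by apply: is_deriveN; exact: is_derive1_ln.
  have d2 : is_derive x 1 (fun x : R => ln (1 - x)) (- (1 - x)^-1).
    have := @is_derive1_comp R (@ln R) (fun x => 1 - x) x (1 - x)^-1 (-1) (is_derive1_ln x1').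
    rewrite mulrN1; apply.
    exact: is_derive_onem.
  apply: (@is_derive_eq _ _ _ B x 1 (dB x) (- x^-1 - - (1 - x)^-1)).
  by rewrite opprK.
have ddBE (x : R) : 0 < x < 1 -> is_derive x 1 dB (ddB x).
  move=> /andP[x0 x1]; have x1' : 0 < 1 - x by rewrite subr_gt0.
  have d1 : is_derive x 1 (fun x => - x^-1) (- (- x ^- 2 *: 1)).
    by apply: is_deriveN; apply: is_deriveV; rewrite gt_eqF.
  have dv : is_derive (1 - x) 1 (fun y : R => y^-1) (- (1 - x) ^- 2 *: 1).
    by apply: is_deriveV; rewrite gt_eqF.
  have d2 := @is_derive1_comp R (fun y => y^-1) (fun x => 1 - x) x _ (-1) dv (is_derive_onem x).
  apply: is_derive_eq (is_deriveD d1 d2) _.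
  by rewrite /GRing.scale/= !mulr1 opprK mulrN1 opprK.
have tang s : `|s| = 1 -> 0 <= 2 * C * (B w - B u - (w - u) * dB u) +
     s * (f w - f u - (w - u) * df u).
  move=> s1; have := @above_tangent01 (fun x => 2 * C * B x + s * f x)
    (fun x => 2 * C * dB x + s * df x) (fun x => 2 * C * ddB x + s * ddf x) _ _ _ u w u01 w01.
  rewrite (_ : _ - _ - _ = 2 * C * (B w - B u - (w - u) * dB u) +
     s * (f w - f u - (w - u) * df u)); last by ring.
  apply.
  - move=> x x01; apply: is_deriveD; apply: is_deriveZ; [exact: dBE|exact: dfE].
  - move=> x x01; apply: is_deriveD; apply: is_deriveZ; [exact: ddBE|exact: ddfE].
  - move=> x x01; have := ddfC x x01.
    have <- : `|s * ddf x| = `|ddf x| by rewrite normrM s1 mul1r.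
    move=> H; have := ler_norm (- (s * ddf x)); rewrite normrN.
    suff : C / (x * (1 - x)) ^+ 2 <= 2 * C * ddB x by lra.
    have [x0 x1] := andP x01; have x1' : 0 < 1 - x by rewrite subr_gt0.
    rewrite (mulrC 2 C) -[leRHS]mulrA ler_wpM2l//.
    rewrite /ddB (_ : _ ^- 2 = (x^-1 + (1 - x)^-1) ^+ 2); last first.
      by field; rewrite !gt_eqF.
    rewrite -!exprVn; have := sqr_ge0 (x^-1 - (1 - x)^-1); lra.
have BE : B w - B u - (w - u) * dB u <= sqr_dev u w.
  have lnle (a b : R) : 0 < a -> 0 < b -> - ln b + ln a + (b - a) / a <= (b - a) ^+ 2 / (a * b).
    move=> a0 b0; have ab0 : 0 < a / b by rewrite divr_gt0.
    have := @le_ln1Dx R (a / b - 1) _; rewrite subrKC.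
    have E : ln (a / b) = ln a - ln b by rewrite lnM ?posrE ?invr_gt0// lnV ?posrE.
    rewrite E => /(_ _); rewrite ltrBrDr addrC subrr => /(_ ab0) H.
    rewrite (_ : (b - a) ^+ 2 / (a * b) = a / b - 1 + (b - a) / a); last first.
      by field; rewrite !gt_eqF.
    lra.
  have [u0 u1] := andP u01; have [w0 w1] := andP w01.
  have u1' : 0 < 1 - u by rewrite subr_gt0.
  have w1' : 0 < 1 - w by rewrite subr_gt0.
  have := lnle _ _ u0 w0; have := lnle _ _ u1' w1'.
  rewrite (_ : 1 - w - (1 - u) = - (w - u)) ?sqrrN; last by ring.
  rewrite /sqr_dev /B /dB mulrDr; lra.
have C2 : 0 <= 2 * C by rewrite mulr_ge0.
have := ler_wpM2l C2 BE.
have := tang 1 (normr1 _); have := tang (-1) (normrN1 _).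
by rewrite ler_norml; lra.
Qed.

End calculus01.

(** * The normal distribution function and its inverse *)

Section normal_distribution_function.
Context {R : realType}.
Local Notation gam := (@std_normal R).
Local Notation phi := (normal_pdf (0 : R) 1).
Local Notation Phi := (@Phi R).

Lemma phi_gt0 x : 0 < phi x.
Proof.
by rewrite normal_pdfE ?oner_neq0// mulr_gt0 ?expR_gt0// normal_peak_gt0 ?oner_neq0.
Qed.

Lemma is_derive_Phi (x : R) : is_derive x 1 Phi (phi x).
Proof.
have x1 : x < x + 1 by rewrite ltrDl.
have fi : lebesgue_measure.-integrable `]-oo, (x + 1)] (EFin \o phi).
  apply: (@integrableS _ _ _ _ setT) => //; exact: integrable_normal_pdf.
have cf : {for x, continuous phi} by apply: continuous_normal_pdf; exact: oner_neq0.
have PhiE : Phi = fun y => (\int[lebesgue_measure]_(t in `]-oo, y]) phi t)%R by [].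
rewrite PhiE; have [d1 d2] := continuous_FTC1 x1 fi (ltNyr _) cf.
apply: (DeriveDef d1); exact: etrans (esym (derive1E _ _)) d2.
Qed.

Lemma continuous_Phi : continuous Phi.
Proof.
move=> x; apply: differentiable_continuous; apply/derivable1_diffP.
by case: (is_derive_Phi x).
Qed.

Lemma Phi_lt (x y : R) : x < y -> Phi x < Phi y.
Proof.
move=> xy; have [|c _ E] := @MVT R Phi phi x y xy (fun z _ => is_derive_Phi z).
  exact: (continuous_subspaceT continuous_Phi).
by rewrite -subr_gt0 E mulr_gt0 ?phi_gt0 ?subr_gt0.
Qed.

Lemma Phi_ltE (x y : R) : (Phi x < Phi y) = (x < y).
Proof.
have [xy|yx|->] := ltgtP x y; [exact: Phi_lt|by apply/negbTE; rewrite -leNgt ltW// Phi_lt|].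
by rewrite ltxx.
Qed.

Lemma Phi_leE (x y : R) : (Phi x <= Phi y) = (x <= y).
Proof. by rewrite leNgt Phi_ltE -leNgt. Qed.

Lemma Phi_opp (x : R) : Phi (- x) = 1 - Phi x.
Proof.
rewrite /Defs.Phi normal_ray_opp.
have -> : gam `[x, +oo[%classic = gam `]x, +oo[%classic.
  rewrite -(@setU1itv _ _ +oo%O x false)// measureU//.
    by apply: etrans (congr2 adde (normal_point x) erefl) _; exact: add0e.
  by apply/seteqP; split => // y /= []; rewrite in_itv/= => ->; rewrite ltxx.
rewrite -setCitvl (_ : gam (~` _) = 1 - gam `]-oo, x]%classic)%E; last first.
  exact: probability_setC.
by rewrite fineB// fin_num_measure.
Qed.

Lemma ExPhi (x : R) : Ex gam (fun z => (z <= x)%R%:R) = Phi x.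
Proof.
rewrite /Ex /Rintegral /Defs.Phi; congr fine.
have := @integral_indic _ _ R gam setT measurableT `]-oo, x]%classic (measurable_itv _).
rewrite setIT => <-.
by apply: eq_integral => z _; rewrite indicE mem_setE/= in_itv.
Qed.

Lemma Phi_itv (x : R) : 0 < Phi x < 1.
Proof.
have P0 y : 0 <= Phi y by exact: fine_ge0.
have H y : 0 < Phi y by apply: le_lt_trans (P0 (y - 1)) _; rewrite Phi_ltE; lra.
by rewrite H/= -subr_gt0 -Phi_opp H.
Qed.

Lemma Phi_tail (x : R) : 0 < x -> 1 - Phi x <= x ^- 2.
Proof.
move=> x0; have b1 : bmf (fun z : R => (z <= x)%R%:R : R).
  by apply: bmf_bool; apply: measurable_fun_ler.
have i1 := bmf_itg gam b1; have i2 := @itg_normal_pow R 2.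
rewrite -ExPhi -[X in X - _](Ex_cst gam) -ExB//; last exact: itg_cst.
rewrite (_ : x ^- 2 = Ex gam (fun z => x ^- 2 * z ^+ 2)); last first.
  by rewrite ExZ// normal_second_moment mulr1.
apply: le_Ex => //.
- by apply: itgB => //; exact: itg_cst.
- exact: itgZ.
- move=> z; case: (leP z x) => zx /=.
    by rewrite mulr1n subrr mulr_ge0 ?sqr_ge0// invr_ge0 sqr_ge0.
  rewrite mulr0n subr0 mulrC ler_pdivlMr ?exprn_gt0// mul1r.
  by rewrite lerXn2r ?nnegrE ?ltW// (lt_trans x0 zx).
Qed.

Lemma Phi_surj (u : R) : 0 < u < 1 -> exists x, Phi x = u.
Proof.
move=> /andP[u0 u1].
have far (e : R) : 0 < e -> exists2 y : R, 0 < y & 1 - Phi y < e.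
  move=> e0; exists (e^-1 + 1); first by rewrite addr_gt0 ?invr_gt0.
  have p0 : 0 < e^-1 + 1 by rewrite addr_gt0 ?invr_gt0.
  apply: le_lt_trans (Phi_tail p0) _.
  rewrite -[ltRHS]invrK ltf_pV2 ?posrE ?exprn_gt0 ?invr_gt0//.
  have : 0 < e^-1 by rewrite invr_gt0.
  nra.
have [y1 y10 Y1] := far u u0.
have [y2 y20 Y2] := far (1 - u) ltac:(by rewrite subr_gt0).
have y12 : - y1 <= y2 by lra.
have := @IVT R Phi (- y1) y2 u y12 (continuous_subspaceT continuous_Phi).
rewrite Phi_opp ge_min le_max (ltW Y1)/=.
have -> : u <= Phi y2 by lra.
by rewrite orbT => /(_ isT)[c _ <-]; exists c.
Qed.

Lemma PhiK : cancel Phi (@Phi_inv R).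
Proof.
move=> x; rewrite /Phi_inv; apply: pinvKV; rewrite ?inE//.
by move=> a b _ _ ab; apply/eqP; rewrite eq_le -(Phi_leE a b) -(Phi_leE b a) ab lexx.
Qed.

Lemma Phi_invK (u : R) : 0 < u < 1 -> Phi (Phi_inv u) = u.
Proof. by move=> /Phi_surj[x <-]; rewrite PhiK. Qed.

Lemma Phi_inv_opp (u : R) : 0 < u < 1 -> Phi_inv (1 - u) = - Phi_inv u.
Proof. by move=> /Phi_surj[x <-]; rewrite -Phi_opp !PhiK. Qed.

Lemma Phi_inv_outside (u : R) : ~ (0 < u < 1) -> Phi_inv u = 0.
Proof.
move=> nu; rewrite /Phi_inv /pinv_ splitV.
apply: (etrans (congr1 (odflt 0) (@oinv_surj _ _ setT (Phi @` setT) Phi (fun _ => id) u))).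
by case: pselect => [By|//]; case: nu; case: (By) => x _ <-; exact: Phi_itv.
Qed.

Lemma is_derive_Phi_inv (u : R) : 0 < u < 1 ->
  is_derive u 1 (@Phi_inv R) (phi (Phi_inv u))^-1.
Proof.
move=> u01; rewrite -{1}(Phi_invK u01); apply: is_derive_inverse.
- by exists 1 => //= z _; exact: PhiK.
- by exists 1 => //= z _; exact: continuous_Phi.
- exact: is_derive_Phi.
- by rewrite gt_eqF// phi_gt0.
Qed.

Lemma is_derive_phi (x : R) : is_derive x 1 phi (- x * phi x).
Proof.
have phiE : phi = fun y => normal_peak 1 * expR ((- 2^-1) * y ^+ 2).
  apply/funext => y; rewrite normal_pdfE ?oner_neq0// /normal_fun subr0 expr1n.
  by congr (_ * expR _); rewrite mulNr mulNr mulrC.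
rewrite phiE.
have d1 : is_derive x 1 (fun y : R => (- 2^-1) * y ^+ 2) (- 2^-1 * (x + x)).
  have := @is_deriveX R R^o id 2 x 1 1 (is_derive_id _ _) => H.
  have := is_deriveZ (- 2^-1 : R) H.
  rewrite /GRing.scale/= expr1 mulr1 => H2.
  by apply: is_derive_eq H2 _; ring.
have d2 := @is_derive1_comp R expR (fun y => (- 2^-1) * y ^+ 2) x _ _ (is_derive_expR _) d1.
have d3 := is_deriveZ (normal_peak (1 : R)) d2.
apply: is_derive_eq d3 _; rewrite /GRing.scale/=.
by move: (expR _) => e; field.
Qed.

(** The difference [h] has derivative [- (1 - Phi)], hence is nonincreasing, and it cannot stay
    below a negative constant because [y (1 - Phi y) <= 1 / y]. *)
Lemma mills (x : R) : 0 <= x -> x * (1 - Phi x) <= phi x.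
Proof.
move=> x0; rewrite leNgt; apply/negP => H.
pose h (y : R) := phi y - y * (1 - Phi y).
have dh (y : R) : is_derive y 1 h (- (1 - Phi y)).
  have d1 : is_derive y 1 (fun y => 1 - Phi y) (0 - phi y).
    by apply: is_deriveB; exact: is_derive_Phi.
  have d2 := @is_deriveM R R^o id (fun y => 1 - Phi y) y 1 1 _ (is_derive_id _ _) d1.
  apply: is_derive_eq (is_deriveB (is_derive_phi y) d2) _.
  rewrite /GRing.scale/=; ring.
have hdec (y : R) : x < y -> h y <= h x.
  move=> xy; have ch : {within `[x, y], continuous h}.
    by apply: derivable_within_continuous => z _; case: (dh z).
  have [c _ E] := MVT xy (fun z _ => dh z) ch.
  rewrite -subr_le0 E mulNr oppr_le0 mulr_ge0 ?subr_ge0 ?(ltW xy)//.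
  by have /andP[_ /ltW] := Phi_itv c.
have hx : h x < 0 by rewrite subr_lt0.
(* Large enough that [1 / y < - h x], which contradicts [h y <= h x]. *)
pose y := x + 1 + (- h x)^-1.
have hi : 0 < (- h x)^-1 by rewrite invr_gt0 oppr_gt0.
have xy : x < y by rewrite /y; lra.
have y0 : 0 < y by lra.
have := hdec y xy; rewrite [h y]/h; have := Phi_tail y0; have := phi_gt0 y.
have : (- h x)^-1 * (- h x) = 1 by rewrite mulVf// gt_eqF// oppr_gt0.
have : y * y ^- 2 = y^-1 by field; rewrite gt_eqF.
have : y^-1 < - h x.
  by rewrite -[ltRHS]invrK ltf_pV2 ?posrE// /y; lra.
move: (1 - Phi y) (phi y) => t p q1 q2 q3 q4 q5 q6.
have : y * t <= y * y ^- 2 by rewrite ler_wpM2l// ltW.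
lra.
Qed.

(** One unit comes from [mills]. The rest bounds [1 - Phi x] itself, by [phi x / phi 1] when
    [x <= 1] and by [x (1 - Phi x) <= phi x] beyond. *)
Definition mills_const : R := 2 + (phi 1)^-1.

Lemma mills_const_gt0 : 0 < mills_const.
Proof. by rewrite addr_gt0// invr_gt0 phi_gt0. Qed.

Let mills_pos (x : R) : 0 <= x -> (1 - Phi x) * (1 + x) <= mills_const * phi x.
Proof.
move=> x0; have M := mills x0; have p0 := phi_gt0 x; have p1 := phi_gt0 1.
have /andP[P0 P1] := Phi_itv x.
have i0 : 0 < (phi 1)^-1 by rewrite invr_gt0.
have ip : 0 < (phi 1)^-1 * phi x by rewrite mulr_gt0.
rewrite /mills_const mulrDl mulrDr mulr1 (mulrC _ x).
suff : 1 - Phi x <= (1 + (phi 1)^-1) * phi x by lra.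
rewrite mulrDl mul1r; have [x1|x1] := leP x 1.
  have : phi 1 <= phi x.
    rewrite !normal_pdfE ?oner_neq0// ler_wpM2l ?normal_peak_ge0//.
    rewrite /normal_fun ler_expR !subr0 expr1n ler_pM2r ?invr_gt0//.
    by rewrite lerN2 exprn_ile1.
  move=> H; have : 1 <= (phi 1)^-1 * phi x by rewrite mulrC ler_pdivlMr// mul1r.
  lra.
have : 1 - Phi x <= x * (1 - Phi x) by rewrite ler_peMl// ?subr_ge0 ltW.
lra.
Qed.

Lemma mills_two_sided (x : R) :
  Phi x * (1 - Phi x) * (1 + `|x|) <= mills_const * phi x.
Proof.
have H (y : R) : 0 <= y -> Phi y * (1 - Phi y) * (1 + y) <= mills_const * phi y.
  move=> y0; apply: le_trans (mills_pos y0); have /andP[P0 P1] := Phi_itv y.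
  by rewrite -mulrA ler_piMl ?(ltW P1)// mulr_ge0 ?subr_ge0 ?(ltW P1)// addr_ge0.
have [x0|x0] := leP 0 x; first by rewrite ger0_norm//; exact: H.
have -> : phi x = phi (- x).
  by rewrite !normal_pdfE ?oner_neq0// /normal_fun !subr0 sqrrN.
rewrite ltr0_norm//; apply: le_trans (H (- x) _); last by rewrite oppr_ge0 ltW.
by rewrite Phi_opp subKr (mulrC (Phi x)).
Qed.


(** Subtracting 1 centres the score under the normal law; the second estimator centres its scores
    anyway, so the shift only alters explicit deterministic terms. *)
Definition normal_sq (u : R) : R := Phi_inv u ^+ 2 - 1.

Definition dPhi_inv (u : R) : R := (phi (Phi_inv u))^-1.

Definition dnormal_sq (u : R) : R := 2 * Phi_inv u * dPhi_inv u.

Lemma is_derive_dPhi_inv (u : R) : 0 < u < 1 ->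
  is_derive u 1 dPhi_inv (Phi_inv u / phi (Phi_inv u) ^+ 2).
Proof.
move=> u01; have p0 := phi_gt0 (Phi_inv u).
have d1 := @is_derive1_comp R phi (@Phi_inv R) u _ _ (is_derive_phi _) (is_derive_Phi_inv u01).
have dv : is_derive ((phi \o @Phi_inv R) u) 1 (fun y : R => y^-1) (- (phi (Phi_inv u)) ^- 2 *: 1).
  by apply: is_deriveV; rewrite gt_eqF.
apply: is_derive_eq (@is_derive1_comp R (fun y => y^-1) _ u _ _ dv d1) _.
by rewrite /GRing.scale/=; field; rewrite gt_eqF.
Qed.

Lemma is_derive_normal_sq (u : R) : 0 < u < 1 -> is_derive u 1 normal_sq (dnormal_sq u).
Proof.
move=> u01; have d := is_derive_Phi_inv u01.
have E : normal_sq = fun u => Phi_inv u * Phi_inv u - 1 by apply/funext => v; rewrite /normal_sq expr2.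
rewrite E; apply: is_derive_eq (@is_deriveB R R^o R^o _ (cst 1) u 1 _ 0 (is_deriveM d d) (is_derive_cst _ _ _)) _.
by rewrite /GRing.scale/= /dnormal_sq /dPhi_inv; ring.
Qed.

Lemma is_derive_dnormal_sq (u : R) : 0 < u < 1 ->
  is_derive u 1 dnormal_sq (2 * (1 + Phi_inv u ^+ 2) / phi (Phi_inv u) ^+ 2).
Proof.
move=> u01; have d := is_derive_Phi_inv u01; have d' := is_derive_dPhi_inv u01.
have E : dnormal_sq = fun u => 2 * (Phi_inv u * dPhi_inv u).
  by apply/funext => v; rewrite /dnormal_sq mulrA.
rewrite E; apply: is_derive_eq (is_deriveZ (2 : R) (is_deriveM d d')) _.
by rewrite /GRing.scale/= /dPhi_inv; field; rewrite gt_eqF// phi_gt0.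
Qed.

(** The analytic facts on the normal scores that the variance, truncation and bias estimates use,
    with one constant for all of them. *)
Definition regular_score (C : R) (J j : R -> R) : Prop :=
  [/\ score C J, `|J 2^-1| <= C,
   forall u, 0 < u < 1 -> `|j u| <= C / (u * (1 - u)) &
   forall u w, 0 < u < 1 -> 0 < w < 1 ->
     `|J w - J u - (w - u) * j u| <= C * sqr_dev u w].

Lemma sqr_dev_ge0 (u w : R) : 0 < u < 1 -> 0 < w < 1 -> 0 <= sqr_dev u w.
Proof.
move=> /andP[u0 u1] /andP[w0 w1]; rewrite mulr_ge0 ?sqr_ge0// addr_ge0// invr_ge0.
  by rewrite mulr_ge0 ?ltW.
by rewrite mulr_ge0 ?subr_ge0 ?ltW.
Qed.

Lemma mills_Phi_inv (u : R) : 0 < u < 1 ->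
  (1 + `|Phi_inv u|) / phi (Phi_inv u) <= mills_const / (u * (1 - u)).
Proof.
move=> u01; have := mills_two_sided (Phi_inv u); rewrite Phi_invK// => H.
have [u0 u1] := andP u01.
have q0 : 0 < u * (1 - u) by rewrite mulr_gt0// subr_gt0.
by rewrite ler_pdivrMr ?phi_gt0// mulrAC ler_pdivlMr// mulrC.
Qed.

Lemma normal_scores_regular : exists C, [/\ 0 < C,
  regular_score C (@Phi_inv R) dPhi_inv & regular_score C normal_sq dnormal_sq].
Proof.
pose c := mills_const; have c0 : 0 < c := mills_const_gt0.
(* The Taylor bound for [normal_sq] needs [2 (2 c^2)], its derivative and logit bounds need [2 c],
   and its value at one half has modulus 1. *)
exists (4 * c ^+ 2 + 2 * c + 2).
have cc : 0 <= c ^+ 2 by exact: sqr_ge0.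
have q0 u : 0 < u < 1 -> 0 < u * (1 - u).
  by move=> /andP[u0 u1]; rewrite mulr_gt0// subr_gt0.
have M1 u : 0 < u < 1 -> `|dPhi_inv u| <= c / (u * (1 - u)).
  move=> u01; apply: le_trans (mills_Phi_inv u01); have p0 := phi_gt0 (Phi_inv u).
  by rewrite /dPhi_inv gtr0_norm ?invr_gt0// ler_peMl ?invr_ge0 ?(ltW p0)// lerDl.
have M2 u : 0 < u < 1 -> (1 + `|Phi_inv u|) ^+ 2 / phi (Phi_inv u) ^+ 2 <=
    c ^+ 2 / (u * (1 - u)) ^+ 2.
  move=> u01; have := mills_Phi_inv u01; rewrite -/c => H.
  have a0 : 0 <= (1 + `|Phi_inv u|) / phi (Phi_inv u).
    by apply: divr_ge0; [exact: addr_ge0|exact: ltW (phi_gt0 _)].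
  rewrite -!expr_div_n lerXn2r ?nnegrE//.
  by apply: divr_ge0; [exact: ltW c0|exact: ltW (q0 _ _ u01)].
have D1 u : 0 < u < 1 -> `|Phi_inv u / phi (Phi_inv u) ^+ 2| <= c ^+ 2 / (u * (1 - u)) ^+ 2.
  move=> u01; apply: le_trans (M2 u u01).
  rewrite normrM normfV normrX (gtr0_norm (phi_gt0 _)) ler_pM2r ?invr_gt0 ?exprn_gt0 ?phi_gt0//.
  by have := normr_ge0 (Phi_inv u); nra.
have D2 u : 0 < u < 1 -> `|2 * (1 + Phi_inv u ^+ 2) / phi (Phi_inv u) ^+ 2| <=
    2 * c ^+ 2 / (u * (1 - u)) ^+ 2.
  move=> u01; rewrite -!(mulrA 2) normrM (ger0_norm (ler0n _ 2)) ler_pM2l//.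
  apply: le_trans (M2 u u01).
  rewrite normrM normfV normrX (gtr0_norm (phi_gt0 _)) ler_pM2r ?invr_gt0 ?exprn_gt0 ?phi_gt0//.
  rewrite ger0_norm ?addr_ge0 ?sqr_ge0// -[Phi_inv u ^+ 2]real_normK ?num_real//.
  by have := normr_ge0 (Phi_inv u); nra.
have N1 u : 0 < u < 1 -> `|dnormal_sq u| <= 2 * c / (u * (1 - u)).
  move=> u01; rewrite /dnormal_sq -!mulrA normrM (ger0_norm (ler0n _ 2)) ler_pM2l//.
  apply: le_trans (mills_Phi_inv u01); have p0 := phi_gt0 (Phi_inv u).
  rewrite normrM /dPhi_inv (gtr0_norm (x := _^-1)) ?invr_gt0// ler_pM2r ?invr_gt0//.
  by rewrite lerDr.
have J0 : Phi_inv (2^-1 : R) = 0.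
  have h01 : 0 < (2^-1 : R) < 1 by lra.
  have := Phi_inv_opp h01; rewrite (_ : 1 - 2^-1 = 2^-1); last by lra.
  by lra.
have le_div a b u : a <= b -> 0 < u < 1 -> a / (u * (1 - u)) <= b / (u * (1 - u)).
  by move=> ab u01; rewrite ler_pM2r ?invr_gt0 ?q0.
split; first by lra.
- split.
  + apply: (@score_le _ c); first by lra.
    exact: (score_of_derivative is_derive_Phi_inv M1).
  + by rewrite J0 normr0; lra.
  + by move=> u u01; apply: le_trans (M1 u u01) _; apply: le_div => //; lra.
  + move=> u w u01 w01.
    apply: le_trans (taylor_of_derivative is_derive_Phi_inv is_derive_dPhi_inv D1 cc u01 w01) _.
    by apply: ler_wpM2r; [exact: sqr_dev_ge0|lra].
- split.
  + apply: (@score_le _ (2 * c)); first by lra.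
    exact: (score_of_derivative is_derive_normal_sq N1).
  + by rewrite /normal_sq J0 expr0n/= sub0r normrN1; lra.
  + by move=> u u01; apply: le_trans (N1 u u01) _; apply: le_div => //; lra.
  + move=> u w u01 w01; have cc2 : 0 <= 2 * c ^+ 2 by lra.
    apply: le_trans (taylor_of_derivative is_derive_normal_sq is_derive_dnormal_sq D2 cc2 u01 w01) _.
    by apply: ler_wpM2r; [exact: sqr_dev_ge0|lra].
Qed.

Lemma measurable_restrict01 (f : R -> R) : (forall u : R, 0 < u < 1 -> {for u, continuous f}) ->
  mfunT (fun u : R => if 0 < u < 1 then f u else 0).
Proof.
move=> cf; apply: measurable_fun_if => //.
- rewrite (_ : (fun _ => _) = fun u : R => (0 < u) && (u < 1)) //.
  by apply: measurable_and; apply: measurable_fun_ltr.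
- rewrite setTI (_ : _ @^-1` _ = `]0, 1[%classic); last first.
    by apply/seteqP; split => u /=; rewrite in_itv.
  apply: open_continuous_measurable_fun; first exact: interval_open.
  by move=> u; rewrite inE/= in_itv/= => u01; exact: cf.
Qed.

Lemma measurable_Phi_inv : mfunT (@Phi_inv R).
Proof.
have -> : @Phi_inv R = fun u => if 0 < u < 1 then Phi_inv u else 0.
  by apply/funext => u; case: ifPn => // /negP; exact: Phi_inv_outside.
apply: measurable_restrict01 => u u01.
by apply: differentiable_continuous; apply/derivable1_diffP; case: (is_derive_Phi_inv u01).
Qed.

End normal_distribution_function.

(** * Normal scores of a uniform variable *)

Section normal_scores_of_uniform.
Context {R : realType} {d} {T : measurableType d}.
Variables (P : probability T R) (U : T -> R).
Hypothesis uU : uniform01 P U.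
Local Notation gam := (@std_normal R).

Lemma uniform01_itv_ae : {ae P, forall w, 0 < U w < 1}.
Proof.
have [mU U01 _] := uU.
have H x : {ae P, forall w, U w != x}.
  apply: (Ex_bool0_ae (b := fun w => U w == x)); last exact: uniform01_point.
  exact: measurable_fun_eqr.
apply: filterS2 (H 0) (H 1) => w w0 w1; have /andP[u0 u1] := U01 w.
by rewrite !lt_neqAle eq_sym w0 u0 w1 u1.
Qed.

(** Rays suffice, and off the null event where [U] is 0 or 1 the condition [Phi_inv (U w) <= x]
    reads [U w <= Phi x]. *)
Lemma same_law_normal_score : same_law P gam (@Phi_inv R \o U) id.
Proof.
have [mU U01 uE] := uU.
have mJ : mfunT (@Phi_inv R \o U).
  exact: (measurableT_comp measurable_Phi_inv mU).
move=> A mA; rewrite -(lawE P mJ) preimage_id.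
apply: rays_unique => // x; rewrite lawE.
have E1 : Ex P (fun w => (Phi_inv (U w) <= x)%R%:R) = Phi x.
  have /andP[P0 P1] := Phi_itv x.
  rewrite -[RHS]uE ?ltW//; apply: Ex_ae.
  - by apply: bmf_itg; apply: bmf_bool; exact: measurable_fun_ler.
  - by apply: bmf_itg; apply: bmf_bool; exact: measurable_fun_ler.
  - apply: filterS uniform01_itv_ae => w u01.
    by rewrite -[in RHS](Phi_invK u01) Phi_leE.
move: E1; rewrite Ex_bool; last exact: measurable_fun_ler.
rewrite (_ : [set w | _] = (@Phi_inv R \o U) @^-1` `]-oo, x]%classic); last first.
  by apply/seteqP; split => w /=; rewrite in_itv.
have mB : measurable ((@Phi_inv R \o U) @^-1` `]-oo, x]%classic).
  by rewrite -[X in measurable X]setTI; apply: mJ.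
move=> E1; rewrite -[LHS]fineK ?fin_num_measure//.
by rewrite -[RHS]fineK ?fin_num_measure//; congr EFin.
Qed.

Lemma itg_normal_score f : itg gam f -> itg P (fun w => f (Phi_inv (U w))).
Proof.
have [mU _ _] := uU; have mJ := measurableT_comp measurable_Phi_inv mU.
move=> fi; apply: (itg_same_law mJ (@measurable_id _ _ setT) same_law_normal_score fi).
exact: itg_measurable fi.
Qed.

Lemma Ex_normal_score f : itg gam f -> Ex P (fun w => f (Phi_inv (U w))) = Ex gam f.
Proof.
have [mU _ _] := uU; have mJ := measurableT_comp measurable_Phi_inv mU.
move=> fi; apply: (Ex_same_law mJ (@measurable_id _ _ setT) same_law_normal_score fi).
exact: itg_measurable fi.
Qed.

End normal_scores_of_uniform.

(** * Binomial moments of the rank deviation *)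

Section bernstein_moments.
Context {R : realType}.
Implicit Types (u : R) (g h : nat -> R).

Lemma bernstein_ext n u g h : (forall k, (k <= n)%N -> g k = h k) ->
  bernstein n u g = bernstein n u h.
Proof.
elim: n g h => [|n IH] g h gh /=; first exact: gh.
by rewrite (IH (fun k => g k.+1) (fun k => h k.+1)) ?(IH g h)// => k kn; apply: gh; lia.
Qed.

Lemma bernsteinD n u g h : bernstein n u (fun k => g k + h k) =
  bernstein n u g + bernstein n u h.
Proof.
by elim: n g h => [//|n IH] g h /=; rewrite (IH (fun k => g k.+1)) IH; ring.
Qed.

Lemma bernstein_le n u g h : 0 <= u <= 1 -> (forall k, (k <= n)%N -> g k <= h k) ->
  bernstein n u g <= bernstein n u h.
Proof.
move=> /andP[u0 u1]; elim: n g h => [|n IH] g h gh /=; first exact: gh.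
apply: lerD; apply: ler_wpM2l; rewrite ?subr_ge0//; apply: IH => k kn; apply: gh; lia.
Qed.

Lemma bernstein_sym n u g :
  bernstein n (1 - u) (fun k => g (n - k)%N) = bernstein n u g.
Proof.
elim: n g => [//|n IH] g /=; rewrite subKr addrC; congr (_ * _ + _ * _).
  rewrite -(IH (fun k => g k.+1)); apply: bernstein_ext => k kn.
  by rewrite subSn.
by rewrite -IH; apply: bernstein_ext => k kn; rewrite subSS.
Qed.

Lemma bernstein_mean n u : bernstein n u (fun k => k%:R) = n%:R * u.
Proof.
elim: n => [|n IH] /=; first by rewrite mul0r.
rewrite (_ : (fun k => _) = fun k => 1 + 1 * k%:R); last first.
  by apply/funext => k; rewrite mul1r -natr1 addrC.
by rewrite bernstein_affine IH -natr1; ring.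
Qed.

(** Size biasing: a binomial variable weighted by its own value is one success plus a binomial
    variable with one trial less. *)
Lemma bernstein_size_bias n u g :
  bernstein n.+1 u (fun k => k%:R * g k) = n.+1%:R * u * bernstein n u (fun k => g k.+1).
Proof.
elim: n g => [|n IH] g; first by rewrite /= !mul1r mul0r mulr0 addr0.
have E h : bernstein n.+1 u (fun k => k.+1%:R * h k) =
    bernstein n.+1 u (fun k => k%:R * h k) + bernstein n.+1 u h.
  by rewrite -bernsteinD; apply: bernstein_ext => k _; rewrite -natr1; ring.
rewrite [LHS]/= -/(bernstein n.+1 u (fun k => k.+1%:R * g k.+1)) -/(bernstein n.+1 u (fun k => k%:R * g k)).
rewrite (E (fun k => g k.+1)) (IH g) (IH (fun k => g k.+1)).
have -> : bernstein n.+1 u (fun k => g k.+1) =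
  u * bernstein n u (fun k => g k.+2) + (1 - u) * bernstein n u (fun k => g k.+1) by [].
by rewrite -(natr1 n.+1); ring.
Qed.

Lemma bernstein_inv_succ n u : 0 < u <= 1 ->
  bernstein n u (fun k => k.+1%:R^-1) <= (n.+1%:R * u)^-1.
Proof.
move=> /andP[u0 u1]; have n0 : 0 < n.+1%:R * u by rewrite mulr_gt0// ltr0n.
rewrite -[leRHS]mul1r ler_pdivlMr// mulrC -(bernstein_size_bias n u (fun k => k%:R^-1)).
have c1 : bernstein n.+1 u (fun k => 1 + 0 * 1) = 1.
  by rewrite bernstein_affine mul0r addr0.
rewrite -[leRHS]c1; apply: bernstein_le; first by rewrite (ltW u0).
(* Size biasing is used with [g k = 1 / k]. The product [k * k^-1] is 1 except at [k = 0], where it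
   is 0, and this is the source of the inequality. *)
move=> k _; rewrite mul0r addr0; have [->|k0] := posnP k; first by rewrite mul0r.
by rewrite divff// pnatr_eq0 -lt0n.
Qed.

(** The expanded form of [sqr_dev]: it separates [w] from its reciprocal, so that the binomial mean
    and inverse moment apply term by term. *)
Definition dev (u w : R) : R := w / u + u / w + (1 - w) / (1 - u) + (1 - u) / (1 - w) - 4.

Lemma devE u w : 0 < u < 1 -> 0 < w < 1 -> dev u w = sqr_dev u w.
Proof.
move=> /andP[u0 u1] /andP[w0 w1]; rewrite /dev /sqr_dev; field.
by rewrite !gt_eqF ?subr_gt0.
Qed.

(** Reflection of successes and failures carries the half in [1 - u] to the half in [u]; there the
    inverse moment [bernstein_inv_succ] compensates the constant up to an error of order
    [1 / (n u)]. *)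
Lemma bernstein_dev n u : 0 < u < 1 ->
  bernstein n u (fun k => dev u (k.+1%:R / n.+2%:R)) <= (u^-1 + (1 - u)^-1) / n.+2%:R.
Proof.
move=> /andP[u0 u1]; set N : R := n.+2%:R.
have N0 : 0 < N by rewrite ltr0n.
have v0 : 0 < 1 - u by rewrite subr_gt0.
have nN : n.+1%:R = N - 1 :> R by rewrite /N -[n.+2%:R]natr1 addrK.
have n1 : 0 < N - 1 by rewrite -nN ltr0n.
have half x : 0 < x -> x < 1 -> bernstein n x (fun k => k.+1%:R / N / x + x / (k.+1%:R / N) - 2)
    <= x^-1 / N.
  move=> x0 x1; have x01 : 0 < x <= 1 by rewrite x0 ltW.
  rewrite (_ : (fun k => _) = fun k => ((N * x)^-1 - 2 + (N * x)^-1 * k%:R) +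
     (0 + x * N * k.+1%:R^-1)); last first.
    apply/funext => k; have k0 : (k%:R : R) + 1 != 0 by rewrite natr1 pnatr_eq0.
    by rewrite -natr1; field; rewrite k0 !gt_eqF.
  rewrite bernsteinD !bernstein_affine bernstein_mean.
  have H := bernstein_inv_succ n x01.
  have xN : 0 < x * N by rewrite mulr_gt0.
  apply: (le_trans (lerD (lexx _) (lerD (lexx _) (ler_wpM2l (ltW xN) H)))).
  rewrite nN (_ : n%:R = N - 2); last by rewrite /N -2!natr1; ring.
  rewrite -subr_ge0 (_ : _ - _ = ((N - 1) * N)^-1 * (N - 2)); last first.
    by field; rewrite !gt_eqF.
  apply: mulr_ge0; first by rewrite invr_ge0 mulr_ge0// ltW.
  by rewrite (_ : N - 2 = n%:R) // /N -2!natr1; ring.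
have H1 := half u u0 u1; have H2 := half (1 - u) v0 _.
have E : bernstein n u (fun k => dev u (k.+1%:R / N)) =
   bernstein n u (fun k => k.+1%:R / N / u + u / (k.+1%:R / N) - 2) +
   bernstein n (1 - u) (fun k => k.+1%:R / N / (1 - u) + (1 - u) / (k.+1%:R / N) - 2).
  rewrite -[X in _ + X]bernstein_sym subKr -bernsteinD; apply: bernstein_ext => k kn.
  have -> : (n - k).+1%:R / N = 1 - k.+1%:R / N.
    have -> : (n - k).+1%:R = N - 1 - k%:R :> R.
      by rewrite -subSn// natrB ?nN//; lia.
    by rewrite -[k.+1%:R]natr1; field; rewrite gt_eqF.
  by rewrite /dev; ring.
rewrite E mulrDl; apply: lerD => //; apply: H2; lra.
Qed.

End bernstein_moments.

(** * The rank of an observation given its value *)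

Section rank_given_value.
Context {R : realType} {dT} {T : measurableType dT}.
Notation E := (R * R)%type.
Variables (P : probability T R) (Z : nat -> T -> E) (c : E -> R).
Hypotheses (mZ : forall i, mfunT (Z i))
  (indepZ : mutually_independent P Z)
  (idZ : forall i, same_law P P (Z i) (Z 0))
  (mc : mfunT c) (uc : uniform01 P (c \o Z 0))
  (c01 : forall i w, 0 <= c (Z i w) <= 1).

Notation smp := (smp Z).

Let cnt m (u : R) (z : nat -> E) := (\sum_(i < m) (c (z i) <= u)%R)%N.

Let cntS m u z (g : nat -> R) : g (cnt m.+1 u z) =
  (c (z m) <= u)%R%:R * g (cnt m u z).+1 + (1 - (c (z m) <= u)%R%:R) * g (cnt m u z).
Proof.
rewrite /cnt big_ord_recr/=; case: (c (z m) <= u)%R => /=.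
  by rewrite addn1 mul1r subrr mul0r addr0.
by rewrite addn0 mul0r add0r subr0 mul1r.
Qed.

Let bstat_cnt m u g : bstat (fun z => g (cnt m u z) : R).
Proof.
elim: m g => [|m IH] g.
  rewrite (_ : (fun z => _) = fun=> g 0%N); first exact: bstat_cst.
  by apply/funext => z; rewrite /cnt big_ord0.
have bl : bstat (fun z : nat -> E => (c (z m) <= u)%R%:R : R).
  apply: (bstat_coord (h := fun e => (c e <= u)%R%:R)).
  by apply: bmf_bool; exact: measurable_fun_ler.
under eq_fun do rewrite cntS.
apply: bstatD; apply: bstatM => //; first exact: (IH (fun k => g k.+1)).
by apply: bstatB => //; exact: bstat_cst.
Qed.

Let depends_cnt m u (g : nat -> R) : depends m (fun z => g (cnt m u z)).
Proof. by move=> z z' zz'; congr g; apply: eq_bigr => i _; rewrite zz'. Qed.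

Let Ex_cnt m u g : 0 <= u <= 1 -> Ex P (fun w => g (cnt m u (smp w))) = bernstein m u g.
Proof.
move=> u01; elim: m g => [|m IH] g.
  rewrite -[RHS](Ex_cst P); congr (Ex P _); apply/funext => w.
  by rewrite /cnt big_ord0.
have bb : bmf (fun e => (c e <= u)%R%:R : R) by apply: bmf_bool; exact: measurable_fun_ler.
have Eb : Ex P (fun w => (c (Z m w) <= u)%R%:R) = u.
  by rewrite (@Ex_iid _ _ _ T E P Z mZ idZ _ m bb); case: uc => _ _ /(_ u u01).
have ib : itg P (fun w => (c (Z m w) <= u)%R%:R) by apply: bmf_itg; exact: (bmf_comp bb).
have prod (b : E -> R) h : bmf b ->
    Ex P (fun w => b (Z m w) * h (cnt m u (smp w))) =
    Ex P (fun w => b (Z m w)) * Ex P (fun w => h (cnt m u (smp w))).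
  move=> hb; have [_ [B bB]] := hb; have [_ [H hH]] := bstat_cnt m u h.
  have := @Ex_blocks _ _ R _ E P Z mZ indepZ idZ 1 m (fun=> m) id
    (fun z z' => b (z 0%N) * h (cnt m u z')).
  rewrite /comp /= => ->.
  - rewrite mulrC -ExZ; last by apply: bmf_itg; exact: (bmf_comp hb).
    congr (Ex P _); apply/funext => w.
    by rewrite ExZ 1?mulrC//; apply: (bmf_itg P (bstat_bmf (bstat_cnt m u h) (mfamily_smp mZ))).
  - split.
      move=> d' S z z' mz mz'; apply: measurable_funM.
        by apply: (measurableT_comp (proj1 hb)); exact: mz.
      by case: (bstat_bmf (bstat_cnt m u h) mz').
    by exists (B * H) => z z'; rewrite normrM ler_pM.
  - by move=> z' z1 z2 H12; rewrite H12.
  - by move=> z z1 z2 H12; congr (_ * _); exact: depends_cnt.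
  - by move=> [|?] [|?].
  - by [].
  - by move=> i j _ jm; rewrite neq_ltn jm orbT.
have bn : bmf (fun e => 1 - (c e <= u)%R%:R : R) by apply: bmfB => //; exact: bmf_cst.
have itgp (b : E -> R) h : bmf b -> itg P (fun w => b (Z m w) * h (cnt m u (smp w))).
  move=> hb; apply: bmf_itg; apply: bmfM; first exact: (bmf_comp hb).
  exact: (bstat_bmf (bstat_cnt m u h) (mfamily_smp mZ)).
under eq_fun do rewrite cntS.
rewrite ExD; [|exact: (itgp _ (fun k => g k.+1) bb)|exact: (itgp _ g bn)].
rewrite (prod _ (fun k => g k.+1) bb) (prod _ g bn) (IH (fun k => g k.+1)) IH Eb.
by rewrite ExB ?Ex_cst ?Eb//; exact: itg_cst.
Qed.

Lemma bmf_bernstein {d'} {S : measurableType d'} m (s : S -> R) (G : nat -> S -> R) :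
  bmf s -> (forall k, bmf (G k)) -> bmf (fun w => bernstein m (s w) (G^~ w)).
Proof.
move=> bs; elim: m G => [|m IH] G bG /=; first exact: bG.
apply: bmfD; apply: bmfM => //; first exact: (IH (fun k => G k.+1)).
  by apply: bmfB => //; exact: bmf_cst.
exact: IH.
Qed.

(** Given its value, the last observation has rank 1 (itself) plus a binomial number of earlier
    observations below it. *)
Lemma Ex_rank m (F : nat -> E -> R) : (forall k, bmf (F k)) ->
  Ex P (fun w => F (rank_in m.+1 (c \o smp w) m) (Z m w)) =
  Ex P (fun w => bernstein m (c (Z m w)) (fun k => F k.+1 (Z m w))).
Proof.
move=> bF.
have rE w : rank_in m.+1 (c \o smp w) m = (cnt m (c (Z m w)) (smp w)).+1.
  by rewrite /rank_in big_ord_recr/= lexx addn1.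
under eq_fun do rewrite rE.
have := @Ex_blocks _ _ R _ E P Z mZ indepZ idZ 1 m (fun=> m) id
    (fun z z' => F (cnt m (c (z 0%N)) z').+1 (z 0%N)).
rewrite /comp /= => ->.
- congr (Ex P _); apply/funext => w.
  exact: (Ex_cnt m (fun k => F k.+1 (Z m w)) (c01 m w)).
(* Measurability is proved by unrolling the count one observation at a time; the offset [j] absorbs
   those already counted. *)
- have H j : bstat2 (fun z z' => F (j + cnt m (c (z 0%N)) z')%N (z 0%N)).
    elim: {rE}m j => [|k IH] j.
      have [mF [M FM]] := bF j; split; last first.
        by exists M => z z'; rewrite /cnt big_ord0 addn0.
      move=> d' S z z' mz mz'; rewrite (_ : (fun s => _) = fun s => F j (z s 0%N)).
        by apply: (measurableT_comp mF); exact: mz.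
      by apply/funext => s; rewrite /cnt big_ord0 addn0.
    have [m1 [M1 h1]] := IH j.+1; have [m0 [M0 h0']] := IH j.
    have E0 z z' : F (j + cnt k.+1 (c (z 0%N)) z')%N (z 0%N) =
        (c (z' k) <= c (z 0%N))%R%:R * F (j.+1 + cnt k (c (z 0%N)) z')%N (z 0%N) +
        (1 - (c (z' k) <= c (z 0%N))%R%:R) * F (j + cnt k (c (z 0%N)) z')%N (z 0%N).
      by rewrite (cntS k (c (z 0%N)) z' (fun p => F (j + p)%N (z 0%N))) addnS addSn.
    split; last first.
      exists (M1 + M0) => z z'; rewrite E0 (le_trans (ler_normD _ _))// lerD//.
        apply: le_trans (h1 z z'); rewrite normrM ler_piMl//.
        by case: (c _ <= _)%R; rewrite ?normr1 ?normr0 ?lexx ?ler01.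
      apply: le_trans (h0' z z'); rewrite normrM ler_piMl//.
      by case: (c _ <= _)%R; rewrite ?subrr ?subr0 ?normr1 ?normr0 ?lexx ?ler01.
    move=> d' S z z' mz mz'; under eq_fun do rewrite E0.
    have mb : mfunT (fun s => (c (z' s k) <= c (z s 0%N))%R%:R : R).
      suff : bmf (fun s => (c (z' s k) <= c (z s 0%N))%R%:R : R) by case.
      apply: bmf_bool; apply: measurable_fun_ler; apply: (measurableT_comp mc);
        [exact: mz'|exact: mz].
    apply: measurable_funD; apply: measurable_funM => //.
    + exact: m1.
    + exact: measurable_funB.
    + exact: m0.
  exact: (H 1%N).
- by move=> z' z1 z2 H12; rewrite H12.
- move=> z z1 z2 H12; congr (F _.+1 _); apply: eq_bigr => i _; by rewrite H12.
- by move=> [|?] [|?].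
- by [].
- by move=> i j _ jm; rewrite neq_ltn jm orbT.
Qed.

Lemma uniform01_iid m : uniform01 P (c \o Z m).
Proof.
case: uc => _ _ uE; split; first exact: (measurableT_comp mc).
  by move=> w; exact: c01.
move=> u u01; rewrite -[RHS](uE u u01).
have bb : bmf (fun e => (c e <= u)%R%:R : R) by apply: bmf_bool; exact: measurable_fun_ler.
exact: (@Ex_iid _ _ _ T E P Z mZ idZ _ m bb).
Qed.

Variables (m : nat) (dl M : R) (h : E -> R).
Hypotheses (dl0 : 0 < dl) (mh : mfunT h) (hM : forall e, `|h e| <= M)
  (h0 : forall e, h e != 0 -> dl <= c e <= 1 - dl).

Notation rnk w := (full m.+1 (c \o smp w) m).

Let bh : bmf h. Proof. by split => //; exists M. Qed.

Let bch : bmf (fun e => c e * h e).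
Proof.
split; first exact: measurable_funM.
exists M => e; have [->|/h0/andP[ce0 ce1]] := eqVneq (h e) 0.
  by rewrite mulr0 normr0 (le_trans _ (hM e)).
have c0 : 0 <= c e by apply: le_trans ce0; exact: ltW.
have c1 : c e <= 1 by apply: (le_trans ce1); rewrite gerBl ltW.
by rewrite normrM (ger0_norm c0) -[M]mul1r ler_pM.
Qed.

Let bvh (f : E -> R) : mfunT f -> (forall e, h e != 0 -> 0 < dl <= f e) ->
  bmf (fun e => (f e)^-1 * h e).
Proof.
move=> mf f0; have -> : (fun e => (f e)^-1 * h e) = fun e => f e `^ (-1) * h e.
  apply/funext => e; have [->|/f0/andP[_ fe]] := eqVneq (h e) 0; first by rewrite !mulr0.
  by rewrite powR_inv1// (le_trans _ fe)// ltW.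
split.
  apply: measurable_funM => //; exact: (measurableT_comp (f := fun x => x `^ (-1)) (measurable_powR (-1)) mf).
exists (dl^-1 * M) => e; have [->|/f0/andP[_ fe]] := eqVneq (h e) 0.
  by rewrite mulr0 normr0 mulr_ge0 ?invr_ge0 ?(ltW dl0)// (le_trans _ (hM e)).
have f1 : 0 < f e by exact: lt_le_trans fe.
rewrite powR_inv1 ?(ltW f1)// normrM; apply: ler_pM => //.
by rewrite ger0_norm ?invr_ge0 ?(ltW f1)// lef_pV2.
Qed.

Let biu : bmf (fun e => (c e)^-1 * h e).
Proof. by apply: bvh => // e /h0/andP[ce _]; rewrite dl0. Qed.

Let biv : bmf (fun e => (1 - c e)^-1 * h e).
Proof.
apply: bvh; first exact: measurable_funB.
by move=> e /h0/andP[_ ce]; rewrite dl0 lerBrDl -lerBrDr.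
Qed.

Let bmZ (g : E -> R) : bmf g -> bmf (fun w => g (Z m w)).
Proof. by move=> bg; exact: (bmf_comp bg). Qed.

Lemma bmf_coord_inv : bmf (fun e => ((c e)^-1 + (1 - c e)^-1) * h e).
Proof. by under eq_fun do rewrite mulrDl; exact: bmfD. Qed.

(** The conditional mean of the normalized rank is [(m u + 1) / (m + 2)], which differs from [u] by
    [(1 - 2 u) / (m + 2)]. The weight [h] lives away from the ends. *)
Lemma Ex_rank_center :
  Ex P (fun w => (rnk w - c (Z m w)) * h (Z m w)) =
  Ex P (fun w => (1 - 2 * c (Z m w)) * h (Z m w)) / m.+2%:R.
Proof.
have N0 : (0 : R) < m.+2%:R by rewrite ltr0n.
rewrite (Ex_rank m (F := fun k e => (k%:R / m.+2%:R - c e) * h e)); last first.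
  move=> k; under eq_fun do rewrite mulrBl.
  by apply: bmfB => //; exact: bmfZ.
rewrite mulrC -ExZ; last first.
  apply: bmf_itg; apply: (bmZ (g := fun e => (1 - 2 * c e) * h e)).
  under eq_fun do rewrite mulrBl mul1r -mulrA.
  by apply: bmfB => //; exact: bmfZ.
congr (Ex P _); apply/funext => w; set u := c _; set hw := h _.
rewrite (_ : (fun k => _) = fun k => (m.+2%:R^-1 - u) * hw + hw / m.+2%:R * k%:R).
  rewrite bernstein_affine bernstein_mean (_ : m%:R = m.+2%:R - 2); last first.
    by rewrite -2!natr1; ring.
  by field; rewrite gt_eqF.
by apply/funext => k; rewrite -natr1; field; rewrite gt_eqF.
Qed.

Let hc e : h e != 0 -> 0 < c e < 1.
Proof. by move=> /h0/andP[ce0 ce1]; rewrite (lt_le_trans dl0 ce0) (le_lt_trans ce1)// gtrBl. Qed.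

Lemma Ex_rank_dev : (forall e, 0 <= h e) ->
  Ex P (fun w => sqr_dev (c (Z m w)) (rnk w) * h (Z m w)) <=
  Ex P (fun w => ((c (Z m w))^-1 + (1 - c (Z m w))^-1) * h (Z m w)) / m.+2%:R.
Proof.
move=> hge0.
have N0 : (0 : R) < m.+2%:R by rewrite ltr0n.
have E1 w : sqr_dev (c (Z m w)) (rnk w) * h (Z m w) = dev (c (Z m w)) (rnk w) * h (Z m w).
  have [->|/hc c1] := eqVneq (h (Z m w)) 0; first by rewrite !mulr0.
  by rewrite devE// full_itv.
under eq_fun do rewrite E1.
have bF k : bmf (fun e => dev (c e) (k%:R / m.+2%:R) * h e).
  set x : R := k%:R / _.
  rewrite (_ : (fun _ => _) = fun e => x * ((c e)^-1 * h e) + x^-1 * (c e * h e) +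
    (1 - x) * ((1 - c e)^-1 * h e) + (1 - x)^-1 * (h e - c e * h e) - 4 * h e).
    apply: bmfB; last exact: bmfZ.
    do 2 (apply: bmfD; last by apply: bmfZ => //; exact: bmfB).
    by apply: bmfD; exact: bmfZ.
  by apply/funext => e; rewrite /dev; ring.
rewrite (Ex_rank m bF).
have bH := bmf_coord_inv.
rewrite mulrC -ExZ; last by apply: bmf_itg; exact: (bmZ bH).
apply: le_Ex.
- apply: bmf_itg; apply: (bmf_bernstein m (s := fun w => c (Z m w)) (G := fun k w => dev (c (Z m w)) (k.+1%:R / m.+2%:R) * h (Z m w))).
    split; first exact: (measurableT_comp mc).
    by exists 1 => w; have /andP[? ?] := c01 m w; rewrite ger0_norm.
  by move=> k; exact: (bmZ (bF k.+1)).
- by apply: itgZ; apply: bmf_itg; exact: (bmZ bH).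
- move=> w; set hw := h (Z m w).
  rewrite (_ : (fun k => _) = fun k => 0 + hw * dev (c (Z m w)) (k.+1%:R / m.+2%:R)); last first.
    by apply/funext => k; rewrite add0r mulrC.
  rewrite bernstein_affine add0r.
  have [hw0|/hc c1] := eqVneq hw 0; first by rewrite hw0 !mul0r !mulr0.
  set D := _ + _; rewrite (_ : _ * (D * hw) = hw * (D / m.+2%:R)); last by ring.
  by apply: ler_wpM2l; [exact: hge0|exact: bernstein_dev].
Qed.

Lemma bmf_rank (g : R -> R) : bmf (fun w => g (rnk w)).
Proof.
exact: (bstat_bmf (bstat_rank mc (fun p => g (p%:R / m.+2%:R)) m.+1 m) (mfamily_smp mZ)).
Qed.

Lemma bmf_rank_dev : bmf (fun w => sqr_dev (c (Z m w)) (rnk w) * h (Z m w)).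
Proof.
rewrite (_ : (fun _ => _) = fun w => rnk w * ((c (Z m w))^-1 * h (Z m w)) +
  (rnk w)^-1 * (c (Z m w) * h (Z m w)) + (1 - rnk w) * ((1 - c (Z m w))^-1 * h (Z m w)) +
  (1 - rnk w)^-1 * (h (Z m w) - c (Z m w) * h (Z m w)) - 4 * h (Z m w)).
  apply: bmfB; last by apply: bmfZ; exact: bmZ.
  apply: bmfD; last first.
    apply: bmfM; first exact: (bmf_rank (fun x => (1 - x)^-1)).
    by apply: bmfB; [exact: bmZ|exact: (bmZ bch)].
  apply: bmfD; last first.
    by apply: bmfM; [exact: (bmf_rank (fun x => 1 - x))|exact: (bmZ biv)].
  apply: bmfD; apply: bmfM.
  - exact: (bmf_rank id).
  - exact: (bmZ biu).
  - exact: (bmf_rank (fun x => x^-1)).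
  - exact: (bmZ bch).
apply/funext => w; have [->|/hc c1] := eqVneq (h (Z m w)) 0; first by rewrite !mulr0 subrr !mulr0; ring.
by rewrite -devE ?full_itv// /dev; ring.
Qed.

End rank_given_value.

(** * Truncated inverse moments of a uniform variable *)

Section inverse_of_uniform.
Context {R : realType} {d} {T : measurableType d}.
Variable P : probability T R.

Lemma uniform01_onem (U : T -> R) : uniform01 P U -> uniform01 P (fun w => 1 - U w).
Proof.
move=> /[dup] uU [mU U01 uE]; split; first exact: measurable_funB.
  by move=> w; have := U01 w; lra.
move=> x x01.
have bU y : bmf (fun w => (U w <= y)%R%:R : R) by apply: bmf_bool; exact: measurable_fun_ler.
have be y : bmf (fun w => (U w == y)%:R : R) by apply: bmf_bool; exact: measurable_fun_eqr.
have -> : (fun w => (1 - U w <= x)%R%:R) = fun w => 1 - (U w <= 1 - x)%R%:R + (U w == 1 - x)%:R :> R.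
  apply/funext => w; have -> : (1 - U w <= x) = (1 - x <= U w) by apply/idP/idP; lra.
  by case: (ltgtP (U w) (1 - x)) => _ /=; rewrite ?subrr ?subr0 ?addr0 ?add0r.
rewrite ExD ?ExB ?Ex_cst ?(uniform01_point _ uU) ?addr0 ?uE; first by ring.
- lra.
- exact: itg_cst.
- exact: bmf_itg.
- by apply: bmf_itg; apply: bmfB => //; exact: bmf_cst.
- exact: bmf_itg.
Qed.

Variable U : T -> R.
Hypothesis uU : uniform01 P U.

Lemma uniform01_ge x : 0 <= x <= 1 -> Ex P (fun w => (x <= U w)%R%:R) = 1 - x.
Proof.
move=> x01; have [_ _ uE] := uniform01_onem uU.
rewrite -[RHS]uE; last by lra.
by congr (Ex P _); apply/funext => w; congr (_%:R); congr nat_of_bool; apply/idP/idP; lra.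
Qed.

Lemma bmf_cut_inv (x : R) : 0 < x -> bmf (fun w => (x <= U w)%R%:R * (U w)^-1).
Proof.
move=> x0; have [mU _ _] := uU; split.
  rewrite (_ : (fun _ => _) = fun w => (x <= U w)%R%:R * U w `^ (-1)).
    apply: measurable_funM.
      by case: (@bmf_bool _ _ R (fun w => x <= U w)) => //; exact: measurable_fun_ler.
    exact: (measurableT_comp (f := fun x => x `^ (-1)) (measurable_powR (-1)) mU).
  apply/funext => w; case: leP => [xU|_]; last by rewrite !mul0r.
  by rewrite powR_inv1// (le_trans _ xU)// ltW.
exists x^-1 => w; case: (leP x (U w)) => [xU|_]; last by rewrite mul0r normr0 invr_ge0 ltW.
have U0 : 0 < U w by exact: lt_le_trans xU.
by rewrite mul1r ger0_norm ?invr_ge0 ?(ltW U0)// lef_pV2.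
Qed.

(** Halving the cutoff adds an event of probability at most [2^-k] on which the inverse is at most
    [2^(k+1)], hence at most 2. This dyadic count stands for the logarithmic integral. *)
Lemma Ex_cut_inv k : Ex P (fun w => (2^-1 ^+ k <= U w)%R%:R * (U w)^-1) <= 1 + 2 * k%:R.
Proof.
have [mU U01 uE] := uU.
have h0 n : (0 : R) < 2^-1 ^+ n by rewrite exprn_gt0// invr_gt0.
have h1 n : (2^-1 : R) ^+ n <= 1 by rewrite exprn_ile1// ?invr_ge0// invf_le1// ler1n.
elim: k => [|k IH].
  rewrite mulr0 addr0; apply: Ex_le_cst; first by apply: bmf_itg; exact: bmf_cut_inv.
  move=> w; case: (leP _ (U w)) => U1; last by rewrite mul0r ler01.
  by rewrite mul1r invf_le1// (lt_le_trans _ U1).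
have bk : itg P (fun w => (U w <= 2^-1 ^+ k)%R%:R).
  by apply: bmf_itg; apply: bmf_bool; exact: measurable_fun_ler.
rewrite -(natr1 k) mulrDr mulr1 addrA.
have two : Ex P (fun w => 2^-1 ^- k.+1 * (U w <= 2^-1 ^+ k)%R%:R) = 2.
  rewrite ExZ// uE ?h1 ?ltW// exprS invfM invrK -mulrA mulVf ?mulr1// gt_eqF//.
rewrite -[X in _ + X]two; apply: (@le_trans _ _ (Ex P (fun w => (2^-1 ^+ k <= U w)%R%:R * (U w)^-1) +
  Ex P (fun w => 2^-1 ^- k.+1 * (U w <= 2^-1 ^+ k)%R%:R))); last by rewrite lerD2r.
have i1 : itg P (fun w => 2^-1 ^- k.+1 * (U w <= 2^-1 ^+ k)%R%:R) by exact: itgZ.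
have i2 n := bmf_itg P (bmf_cut_inv (h0 n)).
rewrite -ExD//; apply: le_Ex => //; first exact: itgD.
move=> w; case: (leP (2^-1 ^+ k) (U w)) => Uk.
  rewrite (le_trans (ltW _) Uk) ?mul1r; last first.
    by rewrite exprS gtr_pMl// invf_lt1// ltr1n.
  by rewrite lerDl mulr_ge0// invr_ge0 ltW.
rewrite (ltW Uk) mul0r add0r mulr1; case: (leP (2^-1 ^+ k.+1) (U w)) => Uk1; last by rewrite mul0r invr_ge0 ltW.
by rewrite mul1r lef_pV2// posrE// (lt_le_trans _ Uk1).
Qed.

End inverse_of_uniform.

(** * Increments of scores against the rank deviation *)

Section regular_score_bounds.
Context {R : realType}.

Lemma abs_ell_le k (u : R) : 2^-1 ^+ k <= u <= 1 - 2^-1 ^+ k -> `|ell u| <= k%:R.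
Proof.
move=> /andP[u0 u1].
have h0 : (0 : R) < 2^-1 ^+ k by rewrite exprn_gt0// invr_gt0.
have ln2 : - ln (2^-1 ^+ k) <= k%:R :> R.
  rewrite exprVn lnV ?posrE ?exprn_gt0// opprK lnXn//.
  rewrite -[leRHS]mul1r mulr_natr lerMn2r; apply/orP; right.
  rewrite -ler_expR lnK ?posrE//; exact: le_trans (expR_ge1Dx 1).
have B (x : R) : 2^-1 ^+ k <= x -> x <= 1 -> - k%:R <= ln x <= 0.
  move=> x0 x1; rewrite ln_le0// andbT lerNl (le_trans _ ln2)// lerN2 ler_ln// posrE//.
  exact: lt_le_trans x0.
have := B u u0; have := B (1 - u); rewrite /ell ler_norml; lra.
Qed.

(** With [r] the square root of [t], the right side is [4 (r - 1/r)^2], and [|ln r| <= |r - 1/r|]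
    follows from [ln y <= y - 1] at [r] and at [1/r]. *)
Lemma sqr_ln_le (t : R) : 0 < t -> ln t ^+ 2 <= 4 * ((t - 1) ^+ 2 / t).
Proof.
move=> t0; set r := Num.sqrt t.
have r0 : 0 < r by rewrite sqrtr_gt0.
have tE : t = r ^+ 2 by rewrite sqr_sqrtr// ltW.
have lE : ln t = 2 * ln r by rewrite tE lnXn// mulr_natl.
have U1 : ln r <= r - 1 by have := @le_ln1Dx R (r - 1); rewrite (addrC 1) subrK; apply; lra.
have U2 : - ln r <= r^-1 - 1.
  rewrite -lnV ?posrE//; have i0 : 0 < r^-1 by rewrite invr_gt0.
  have := @le_ln1Dx R (r^-1 - 1); rewrite (addrC 1) subrK; apply; lra.
have B : `|ln r| <= `|r - r^-1|.
  have [r1|r1] := leP 1 r.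
    have i1 : r^-1 <= 1 by rewrite invf_le1.
    by rewrite ger0_norm ?ln_ge0// ger0_norm; lra.
  have i1 : 1 <= r^-1 by rewrite -[1]invr1 lef_pV2 ?posrE// ltW.
  have lr : ln r <= 0 by rewrite ln_le0// ltW.
  by rewrite ler0_norm// ler0_norm; lra.
rewrite lE exprMn (_ : 2 ^+ 2 = 4 :> R); last by ring.
rewrite ler_pM2l// tE (_ : _ / _ = (r - r^-1) ^+ 2); last by field; rewrite gt_eqF.
by rewrite -[leLHS]real_normK ?num_real// -[leRHS]real_normK ?num_real// lerXn2r ?nnegrE.
Qed.

Lemma score_sqr_dev C J (u w : R) : 0 <= C -> score C J -> 0 < u < 1 -> 0 < w < 1 ->
  (J w - J u) ^+ 2 <= 8 * C ^+ 2 * sqr_dev u w.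
Proof.
move=> C0 sJ u01 w01; have [u0 u1] := andP u01; have [w0 w1] := andP w01.
have := sJ _ _ w01 u01 => H.
rewrite -[leLHS]real_normK ?num_real//.
apply: (@le_trans _ _ ((C * `|ell w - ell u|) ^+ 2)).
  by rewrite lerXn2r ?nnegrE// mulr_ge0.
rewrite exprMn real_normK ?num_real// [leRHS](_ : _ = C ^+ 2 * (8 * sqr_dev u w)); last by ring.
rewrite ler_wpM2l ?sqr_ge0//.
have a0 : 0 < w / u by rewrite divr_gt0.
have b0 : 0 < (1 - u) / (1 - w) by rewrite divr_gt0// subr_gt0.
have -> : ell w - ell u = ln (w / u) + ln ((1 - u) / (1 - w)).
  by rewrite !ln_div ?posrE ?subr_gt0// /ell; ring.
have := sqr_ln_le a0; have := sqr_ln_le b0.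
have -> : (w / u - 1) ^+ 2 / (w / u) = (w - u) ^+ 2 / (u * w).
  by field; rewrite !gt_eqF.
have -> : ((1 - u) / (1 - w) - 1) ^+ 2 / ((1 - u) / (1 - w)) = (w - u) ^+ 2 / ((1 - u) * (1 - w)).
  by field; rewrite !gt_eqF// subr_gt0.
move: (ln _) (ln _) => p q H1 H2; have := sqr_ge0 (p - q).
rewrite /sqr_dev mulrDr; set A := _ / _ in H1 *; set B := _ / _ in H2 *; nra.
Qed.

End regular_score_bounds.

(** * Moments of scores at ranks *)

Section rank_score_moments.
Context {R : realType} {dT} {T : measurableType dT}.
Notation E := (R * R)%type.
Variables (P : probability T R) (Z : nat -> T -> E).
Hypotheses (mZ : forall i, mfunT (Z i))
  (indepZ : mutually_independent P Z)
  (idZ : forall i, same_law P P (Z i) (Z 0)).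

Lemma Ex_rank_exchange m k (g : (nat -> E) -> nat -> R) : (k <= m)%N -> bstat (g^~ m) ->
  depends m.+1 (g^~ m) -> (forall z, g (z \o swapn k m) m = g z (swapn k m m)) ->
  Ex P (fun w => g (smp Z w) k) = Ex P (fun w => g (smp Z w) m).
Proof.
move=> km bg dg gs.
have swm : swapn k m m = k by rewrite /swapn eqxx; case: eqP => // ->.
rewrite -(@Ex_exchangeable _ _ R _ E P Z mZ indepZ idZ m.+1 (swapn k m) (g^~ m))//.
  by congr (Ex P _); apply/funext => w; rewrite gs swm.
by move=> i j _ _ /(congr1 (swapn k m)); rewrite !swapnK.
Qed.

Lemma Ex_rank_sum (J K : R -> R) m : Ex P (fun w => rank_sum J K m.+1 (smp Z w)) =
  m.+1%:R * Ex P (fun w => J (full m.+1 (fst \o smp Z w) m) * K (full m.+1 (snd \o smp Z w) m)).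
Proof.
pose g (z : nat -> E) k := J (full m.+1 (fst \o z) k) * K (full m.+1 (snd \o z) k).
have bg k : bstat (g^~ k).
  apply: bstatM.
    exact: (bstat_rank (c := fst) measurable_fst (fun p => J (p%:R / m.+2%:R))).
  exact: (bstat_rank (c := snd) measurable_snd (fun p => K (p%:R / m.+2%:R))).
rewrite /rank_sum Ex_sum; last by move=> k _; exact: (itg_bstat P mZ (bg k)).
rewrite (eq_bigr (fun=> Ex P (fun w => g (smp Z w) m))).
  by rewrite sumr_const card_ord mulr_natl.
move=> k _; have km : (k <= m)%N by rewrite -ltnS.
apply: (Ex_rank_exchange (g := g)) => //.
- move=> z z' zz'; rewrite /g /full.
  by congr (J (_%:R / _) * K (_%:R / _)); apply: rank_in_local => // i im /=; rewrite zz'.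
- by move=> z; rewrite /g /full -!(rank_in_swapn_all _ _ km).
Qed.

Variable c : E -> R.
Hypotheses (mc : mfunT c) (uc : uniform01 P (c \o Z 0)).

(** By exchangeability the moment is the average over all observations, which off ties is a
    deterministic grid sum. *)
Lemma Ex_rank_pow4 C (J : R -> R) m : 0 <= C -> score C J -> `|J 2^-1| <= C ->
  Ex P (fun w => J (full m.+1 (c \o smp Z w) m) ^+ 4) <= 9 * 48 ^+ 8 * C ^+ 4.
Proof.
move=> C0 sJ J2.
pose g (z : nat -> E) k := J (full m.+1 (c \o z) k) ^+ 4.
have bg k : bstat (g^~ k) by exact: (bstat_rank mc (fun p => J (p%:R / m.+2%:R) ^+ 4)).
have gm k : (k <= m)%N -> Ex P (fun w => g (smp Z w) k) = Ex P (fun w => g (smp Z w) m).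
  move=> km; apply: (Ex_rank_exchange (g := g)) => //.
    move=> z z' zz'; rewrite /g /full.
    by congr (J (_%:R / _) ^+ 4); apply: rank_in_local => // i im /=; rewrite zz'.
  by move=> z; rewrite /g /full -!(rank_in_swapn_all _ _ km).
have N0 : (0 : R) < m.+1%:R by rewrite ltr0n.
rewrite -(ler_pM2l N0).
have -> : m.+1%:R * Ex P (fun w => g (smp Z w) m) = Ex P (fun w => \sum_(k < m.+1) g (smp Z w) k).
  rewrite Ex_sum; last by move=> k _; exact: (itg_bstat P mZ (bg k)).
  rewrite (eq_bigr (fun=> Ex P (fun w => g (smp Z w) m))); last by move=> k _; apply: gm; rewrite -ltnS.
  by rewrite sumr_const card_ord mulr_natl.
have bs : bstat (fun z => \sum_(k < m.+1) g z k) by apply: bstat_sum.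
rewrite -[leRHS](Ex_cst P); apply: le_Ex_ae; [exact: (itg_bstat P mZ bs)|exact: itg_cst|].
have := no_ties mZ indepZ idZ mc uc; apply: filterS => w /(_ m.+1) dw.
rewrite /g /full (big_rank_in _ (fun p => J (p%:R / m.+2%:R) ^+ 4) dw).
apply: (@le_trans _ _ (\sum_(1 <= p < m.+2) C ^+ 4 * (48 ^+ 8 * envelope_bound (p%:R / m.+2%:R)))).
  apply: ler_sum_nat => p /andP[p1 pm].
  have p01 : 0 < (p%:R / m.+2%:R : R) < 1.
    by rewrite divr_gt0 ?ltr0n//= ltr_pdivrMr ?ltr0n// mul1r ltr_nat.
  set u : R := _ / _ in p01 *.
  have Ju := score_envelope C0 sJ J2 p01.
  have e1 := envelope_ge1 u.
  rewrite -[J u ^+ 4]ger0_norm ?exprn_even_ge0// normrX.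
  apply: (@le_trans _ _ ((C * envelope u) ^+ 4)).
    by rewrite lerXn2r ?nnegrE ?mulr_ge0// (le_trans ler01).
  rewrite exprMn ler_wpM2l ?exprn_ge0// (le_trans _ (envelope_pow8 p01))//.
  by rewrite ler_weXn2l.
rewrite -!mulr_sumr.
have := @sum_envelope_bound R m.+1 isT; set S := \sum_(1 <= _ < _) _ => HS.
rewrite [leRHS](_ : _ = C ^+ 4 * (48 ^+ 8 * (9 * m.+1%:R))); last by ring.
by rewrite ler_wpM2l ?exprn_ge0// ler_wpM2l// exprn_ge0.
Qed.

End rank_score_moments.

Lemma norm_mul_le_sqr (F : realFieldType) (x y u v : F) :
  x ^+ 2 <= u -> y ^+ 2 <= v -> `|x * y| <= (u + v) / 2.
Proof.
have := sqr_ge0 (x - y); have := sqr_ge0 (x + y).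
by move=> *; rewrite ler_norml; lra.
Qed.

(** * The bias of a rank sum *)

Section rank_bias.
Context {R : realType} {dT} {T : measurableType dT}.
Notation E := (R * R)%type.
Variables (P : probability T R) (Z : nat -> T -> E).
Hypotheses (mZ : forall i, mfunT (Z i))
  (indepZ : mutually_independent P Z)
  (idZ : forall i, same_law P P (Z i) (Z 0)).

Definition central (x : R) (e : E) : bool :=
  [&& x <= e.1, e.1 <= 1 - x, x <= e.2 & e.2 <= 1 - x].

Lemma measurable_central x : mfunT (fun e => (central x e)%:R : R).
Proof.
suff [] : bmf (fun e => (central x e)%:R : R) by [].
apply: bmf_bool; rewrite /central; do 3 (apply: measurable_and; first exact: measurable_fun_ler).
exact: measurable_fun_ler.
Qed.

Section one_coordinate.
Variables (m q : nat) (c : E -> R).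
Notation x := (2^-1 ^+ q : R).
Hypotheses (mc : mfunT c) (uc : uniform01 P (c \o Z 0))
  (c01 : forall i w, 0 <= c (Z i w) <= 1)
  (cc : forall e, central x e -> x <= c e <= 1 - x).

Notation rnk w := (full m.+1 (c \o smp Z w) m).
Notation inv e := ((c e)^-1 + (1 - c e)^-1).

Let x0 : 0 < x. Proof. by rewrite exprn_gt0// invr_gt0. Qed.

Let inv_le e : central x e -> 0 < inv e <= 2 * x^-1.
Proof.
move=> /cc/andP[c0 c1].
have u0 : 0 < c e by exact: lt_le_trans c0.
have v0 : 0 < 1 - c e by rewrite (lt_le_trans x0)// lerBrDl -lerBrDr.
rewrite addr_gt0 ?invr_gt0//= (_ : 2 = 1 + 1)// mulrDl !mul1r lerD// lef_pV2//.
by rewrite lerBrDl -lerBrDr.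
Qed.

Let h0 (f : E -> R) e : (central x e)%:R * f e != 0 -> x <= c e <= 1 - x.
Proof. by case: (boolP (central x e)) => [/cc//|_]; rewrite mul0r eqxx. Qed.

Let hM (f : E -> R) A : 0 <= A -> (forall e, central x e -> `|f e| <= A * inv e) ->
  forall e, `|(central x e)%:R * f e| <= A * (2 * x^-1).
Proof.
move=> A0 fA e; case: (boolP (central x e)) => [ce|_].
  have /andP[_ i1] := inv_le ce.
  by rewrite mul1r (le_trans (fA _ ce))// ler_wpM2l.
by rewrite mul0r normr0 mulr_ge0// mulr_ge0// invr_ge0 ltW.
Qed.

Let mh (f : E -> R) : mfunT f ->
  mfunT (fun e => (central x e)%:R * f e).
Proof. by move=> mf; apply: measurable_funM => //; exact: measurable_central. Qed.

Let central_inv : bmf (fun e => inv e * (central x e)%:R).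
Proof.
apply: (bmf_coord_inv mc x0 (M := 1)) => //.
- exact: measurable_central.
- by move=> e; case: central; rewrite ?normr1 ?normr0.
- by move=> e; case: (boolP (central x e)) => [/cc//|_]; rewrite eqxx.
Qed.

Lemma Ex_central_inv : Ex P (fun w => inv (Z m w) * (central x (Z m w))%:R) <= 2 + 4 * q%:R.
Proof.
have um := uniform01_iid mZ idZ mc uc c01 m.
have H1 := Ex_cut_inv um q; have H2 := Ex_cut_inv (uniform01_onem um) q.
rewrite [leRHS](_ : _ = (1 + 2 * q%:R) + (1 + 2 * q%:R)); last by ring.
apply: le_trans (lerD H1 H2).
have i1 := bmf_itg P (bmf_cut_inv um x0).
have i2 := bmf_itg P (bmf_cut_inv (uniform01_onem um) x0).
rewrite -ExD//; apply: le_Ex; first by apply: bmf_itg; exact: (bmf_comp central_inv).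
  exact: itgD.
move=> w /=; case: (boolP (central x (Z m w))) => [/cc/andP[c0 c1]|_].
  rewrite c0 (_ : x <= 1 - _); last by rewrite lerBrDl -lerBrDr.
  by rewrite mulr1 !mul1r.
by have := c01 m w; rewrite mulr0 => /andP[? ?]; rewrite addr_ge0// mulr_ge0// invr_ge0// subr_ge0.
Qed.

Lemma rank_center_central A (f : E -> R) : 0 <= A -> mfunT f ->
  (forall e, central x e -> `|f e| <= A * inv e) ->
  `|Ex P (fun w => (rnk w - c (Z m w)) * ((central x (Z m w))%:R * f (Z m w)))| <=
  A * (2 + 4 * q%:R) / m.+2%:R.
Proof.
move=> A0 mf fA.
rewrite (Ex_rank_center mZ indepZ idZ mc uc c01 m x0 (mh mf) (hM A0 fA) (@h0 f)).
rewrite normrM normfV (ger0_norm (ler0n _ m.+2)) ler_wpM2r ?invr_ge0//.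
have bi : bmf (fun w => A * (inv (Z m w) * (central x (Z m w))%:R)).
  by apply: bmfZ; exact: (bmf_comp central_inv).
apply: (@le_trans _ _ (Ex P (fun w => A * (inv (Z m w) * (central x (Z m w))%:R)))).
  apply: norm_Ex_le; last 2 first.
  - exact: bmf_itg.
  - move=> w; have cw := c01 m w; case: (boolP (central x (Z m w))) => [ce|_].
      rewrite mul1r mulr1 normrM; apply: le_trans (fA _ ce); rewrite ler_piMl// ler_norml; lra.
    by rewrite mul0r !mulr0 normr0.
  apply: bmf_itg; apply: bmfM; last first.
    by apply: (bmf_comp (h := fun e => (central x e)%:R * f e)) => //; split; [exact: mh|exists (A * (2 * x^-1)); exact: hM].
  apply: bmfB; first exact: bmf_cst.
  apply: bmfZ; split; first exact: measurableT_comp.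
  by exists 1 => w; have /andP[? ?] := c01 m w; rewrite ger0_norm.
rewrite ExZ; last by apply: bmf_itg; exact: (bmf_comp central_inv).
by rewrite ler_wpM2l//; exact: Ex_central_inv.
Qed.

Let hyp1 : (forall e, `|(central x e)%:R : R| <= 1) *
  (forall e, (central x e)%:R != 0 :> R -> x <= c e <= 1 - x).
Proof.
split=> e; case: (boolP (central x e)) => [ce|_]; rewrite ?normr1 ?normr0 ?eqxx//.
by move=> _; exact: cc.
Qed.

Lemma itg_rank_dev_central :
  itg P (fun w => sqr_dev (c (Z m w)) (rnk w) * (central x (Z m w))%:R).
Proof.
have [h1 h2] := hyp1.
by apply: bmf_itg; exact: (bmf_rank_dev mZ mc m x0 (measurable_central x) h1 h2).
Qed.

Lemma rank_dev_central :
  Ex P (fun w => sqr_dev (c (Z m w)) (rnk w) * (central x (Z m w))%:R) <=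
  (2 + 4 * q%:R) / m.+2%:R.
Proof.
have [h1 h2] := hyp1.
apply: (le_trans (Ex_rank_dev mZ indepZ idZ mc uc c01 m x0 (measurable_central x) h1 h2 _)).
  by move=> e; rewrite ler0n.
by rewrite ler_wpM2r ?invr_ge0//; exact: Ex_central_inv.
Qed.

End one_coordinate.

Hypotheses (Z01 : forall i w, 0 <= (Z i w).1 <= 1) (Z02 : forall i w, 0 <= (Z i w).2 <= 1)
  (uZ1 : uniform01 P (fst \o Z 0)) (uZ2 : uniform01 P (snd \o Z 0)).
Variables (C : R) (J j K k : R -> R).
Hypotheses (C0 : 0 <= C) (rJ : regular_score C J j) (rK : regular_score C K k)
  (mJ : mfunT J) (mj : mfunT j)
  (mK : mfunT K) (mk : mfunT k)
  (iJ : itg P (fun w => J (Z 0 w).1 ^+ 4)) (iK : itg P (fun w => K (Z 0 w).2 ^+ 4)).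

Definition moment4_bound : R :=
  2 * (9 * 48 ^+ 8 * C ^+ 4) + Ex P (fun w => J (Z 0 w).1 ^+ 4) + Ex P (fun w => K (Z 0 w).2 ^+ 4).

Section at_index.
Variables (m q : nat).
Notation x := (2^-1 ^+ q : R).
Notation rnk1 w := (full m.+1 (fst \o smp Z w) m).
Notation rnk2 w := (full m.+1 (snd \o smp Z w) m).
Notation X w := (J (rnk1 w) * K (rnk2 w) - J (Z m w).1 * K (Z m w).2).
Notation S w := (J (rnk1 w) ^+ 4 + K (rnk2 w) ^+ 4 + J (Z m w).1 ^+ 4 + K (Z m w).2 ^+ 4).
Notation cw w := ((central x (Z m w))%:R : R).

Let x0 : 0 < x. Proof. by rewrite exprn_gt0// invr_gt0. Qed.

Let mZ1 : mfunT (fun w => (Z m w).1).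
Proof. exact: measurableT_comp. Qed.
Let mZ2 : mfunT (fun w => (Z m w).2).
Proof. exact: measurableT_comp. Qed.

Let bJ (g : R -> R) : bmf (fun w => g (rnk1 w)).
Proof. exact: (bmf_rank mZ measurable_fst m). Qed.
Let bK (g : R -> R) : bmf (fun w => g (rnk2 w)).
Proof. exact: (bmf_rank mZ measurable_snd m). Qed.

Let mJ4 : mfunT (fun e : E => J e.1 ^+ 4).
Proof. by apply: measurable_funX; exact: measurableT_comp. Qed.
Let mK4 : mfunT (fun e : E => K e.2 ^+ 4).
Proof. by apply: measurable_funX; exact: measurableT_comp. Qed.

Let iJm : itg P (fun w => J (Z m w).1 ^+ 4).
Proof. exact: (itg_same_law (mZ m) (mZ 0) (idZ m) (f := fun e => J e.1 ^+ 4)). Qed.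
Let iKm : itg P (fun w => K (Z m w).2 ^+ 4).
Proof. exact: (itg_same_law (mZ m) (mZ 0) (idZ m) (f := fun e => K e.2 ^+ 4)). Qed.

Let iS : itg P (fun w => S w).
Proof.
do 2 (apply: itgD => //); apply: itgD; apply: bmf_itg.
  exact: (bJ (fun u => J u ^+ 4)).
exact: (bK (fun u => K u ^+ 4)).
Qed.

Let ES : Ex P (fun w => S w) <= moment4_bound.
Proof.
have [sJ J2 _ _] := rJ; have [sK K2 _ _] := rK.
have b1 := bJ (fun u => J u ^+ 4); have b2 := bK (fun u => K u ^+ 4).
have i1 := bmf_itg P b1; have i2 := bmf_itg P b2.
rewrite ExD//; last by apply: itgD => //; exact: itgD.
rewrite ExD//; last exact: itgD.
rewrite ExD//.
rewrite (Ex_same_law (mZ m) (mZ 0) (idZ m) (f := fun e => J e.1 ^+ 4))//.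
rewrite (Ex_same_law (mZ m) (mZ 0) (idZ m) (f := fun e => K e.2 ^+ 4))//.
rewrite /moment4_bound mulrDl !mul1r !lerD//.
  exact: (Ex_rank_pow4 mZ indepZ idZ measurable_fst uZ1).
exact: (Ex_rank_pow4 mZ indepZ idZ measurable_snd uZ2).
Qed.

Let mX : mfunT (fun w => X w).
Proof.
apply: measurable_funB.
  by have [] := bmfM (bJ J) (bK K).
by apply: measurable_funM; exact: measurableT_comp.
Qed.

Let amgm (a b c e : R) : (a * b - c * e) ^+ 2 <= a ^+ 4 + b ^+ 4 + c ^+ 4 + e ^+ 4.
Proof.
have := sqr_ge0 (a ^+ 2 - b ^+ 2); have := sqr_ge0 (c ^+ 2 - e ^+ 2).
have := sqr_ge0 (a * b + c * e); nra.
Qed.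

Lemma itg_rank_bias : itg P (fun w => X w).
Proof.
apply: (@itg_le _ _ _ P _ (fun w => 1 + S w)) => //; first by apply: itgD => //; exact: itg_cst.
move=> w; have := amgm (J (rnk1 w)) (K (rnk2 w)) (J (Z m w).1) (K (Z m w).2).
move: (X w) (S w) => y s H; have := sqr_ge0 (`|y| - 1).
by rewrite -(real_normK (num_real y)) in H; nra.
Qed.

(** Off the central square only moments are available: the square of the difference is below the sum
    of four fourth powers, the event has probability at most [4 x], and [t] balances the two. *)
Lemma rank_bias_outside t : 0 < t ->
  `|Ex P (fun w => (1 - cw w) * X w)| <= t * moment4_bound + 4 * x / t.
Proof.
move=> t0.
have bc : bmf (fun w => cw w).
  by apply: (bmf_comp (h := fun e => (central x e)%:R)) => //; split; [exact: measurable_central|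
    exists 1 => e; case: central; rewrite ?normr1 ?normr0].
have b1 : bmf (fun w => 1 - cw w) by apply: bmfB => //; exact: bmf_cst.
have x1 : x <= 1 by rewrite exprn_ile1// ?invr_ge0// invf_le1// ler1n.
have Eout : Ex P (fun w => 1 - cw w) <= 4 * x.
  have u1 := uniform01_iid mZ idZ measurable_fst uZ1 Z01 m.
  have u2 := uniform01_iid mZ idZ measurable_snd uZ2 Z02 m.
  have [_ _ e1] := u1; have [_ _ e2] := u2.
  have x01 : 0 <= x <= 1 by rewrite x1 ltW.
  have y01 : 0 <= 1 - x <= 1 by lra.
  have f1 := e1 x x01; have f2 := e2 x x01.
  have g1 := uniform01_ge u1 y01; have g2 := uniform01_ge u2 y01.
  have bb (b : T -> bool) : mfunT b -> itg P (fun w => (b w)%:R).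
    by move=> mb; apply: bmf_itg; exact: bmf_bool.
  have j1 : itg P (fun w => ((Z m w).1 <= x)%R%:R) by apply: bb; exact: measurable_fun_ler.
  have j2 : itg P (fun w => ((Z m w).2 <= x)%R%:R) by apply: bb; exact: measurable_fun_ler.
  have k1 : itg P (fun w => (1 - x <= (Z m w).1)%R%:R) by apply: bb; exact: measurable_fun_ler.
  have k2 : itg P (fun w => (1 - x <= (Z m w).2)%R%:R) by apply: bb; exact: measurable_fun_ler.
  have -> : 4 * x = Ex P (fun w => ((Z m w).1 <= x)%R%:R + ((Z m w).2 <= x)%R%:R +
     ((1 - x <= (Z m w).1)%R%:R + (1 - x <= (Z m w).2)%R%:R)).
    rewrite ExD; [|exact: itgD|exact: itgD]; rewrite ExD// ExD//.
    by move: f1 f2 g1 g2; rewrite /comp => -> -> -> ->; ring.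
  apply: le_Ex; first exact: bmf_itg.
    by apply: itgD; exact: itgD.
  move=> w; rewrite /central.
  case: (leP x (Z m w).1) => [_|/ltW ->]; last by rewrite /= subr0 -!addrA lerDl !addr_ge0// ler0n.
  case: (leP (Z m w).1 (1 - x)) => [_|/ltW ->]; last first.
    by rewrite /= subr0 addrCA lerDl !addr_ge0// ler0n.
  case: (leP x (Z m w).2) => [_|/ltW ->]; last first.
    by rewrite /= subr0 addrAC lerDr !addr_ge0// ler0n.
  case: (leP (Z m w).2 (1 - x)) => [_|/ltW ->]; last first.
    by rewrite /= subr0 !addrA lerDr !addr_ge0// ler0n.
  by rewrite /= subrr !addr_ge0// ler0n.
have iR : itg P (fun w => t * S w + (1 - cw w) / t).
  by apply: itgD; [exact: itgZ|under eq_fun do rewrite mulrC; apply: itgZ; exact: bmf_itg].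
apply: (@le_trans _ _ (Ex P (fun w => t * S w + (1 - cw w) / t))).
  have H w : `|(1 - cw w) * X w| <= t * S w + (1 - cw w) / t.
    have S0 : 0 <= S w by rewrite !addr_ge0// exprn_even_ge0.
    case: (central x (Z m w)) => /=.
      by rewrite subrr !mul0r normr0 addr0 mulr_ge0// ltW.
    have := amgm (J (rnk1 w)) (K (rnk2 w)) (J (Z m w).1) (K (Z m w).2).
    rewrite subr0 !mul1r; move: (X w) (S w) S0 => y s s0 H.
    rewrite -(real_normK (num_real y)) in H; have y0 := normr_ge0 y.
    rewrite -(ler_pM2r t0) mulrDl mulVf ?gt_eqF//.
    have := sqr_ge0 (t * `|y| - 1); have : t ^+ 2 * `|y| ^+ 2 <= t ^+ 2 * s.
      by rewrite ler_wpM2l ?sqr_ge0.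
    have : 0 <= t * `|y| by rewrite mulr_ge0// ltW.
    have : 0 <= t ^+ 2 * s by rewrite mulr_ge0 ?sqr_ge0.
    by move: `|y| => a; nra.
  apply: norm_Ex_le => //; apply: itg_le iR _ => //.
  by apply: measurable_funM => //; case: b1.
rewrite ExD; [|exact: itgZ|under eq_fun do rewrite mulrC; apply: itgZ; exact: bmf_itg].
apply: lerD; first by rewrite ExZ// ler_wpM2l ?(ltW t0).
under eq_fun do rewrite mulrC.
by rewrite ExZ; [rewrite mulrC ler_wpM2r ?invr_ge0 ?(ltW t0)|exact: bmf_itg].
Qed.

Let centered e : central x e -> (0 < e.1 < 1) * (0 < e.2 < 1) *
  (`|J e.1| <= C * (1 + q%:R)) * (`|K e.2| <= C * (1 + q%:R)).
Proof.
move=> /and4P[a1 a2 b1 b2]; have [sJ J2 _ _] := rJ; have [sK K2 _ _] := rK.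
have h y : x <= y -> y <= 1 - x -> 0 < y < 1.
  by move=> y0 y1; rewrite (lt_le_trans x0)//= (le_lt_trans y1)// gtrBl.
have h1 := h _ a1 a2; have h2 := h _ b1 b2; split; [split; [split|]|] => //.
  apply: (le_trans (score_envelope C0 sJ J2 h1)); rewrite ler_wpM2l// lerD2l.
  by apply: abs_ell_le; rewrite a1.
apply: (le_trans (score_envelope C0 sK K2 h2)); rewrite ler_wpM2l// lerD2l.
by apply: abs_ell_le; rewrite b1.
Qed.

Let inv_sum (y : R) : 0 < y < 1 -> (y * (1 - y))^-1 = y^-1 + (1 - y)^-1.
Proof. by move=> /andP[y0 y1]; field; rewrite !gt_eqF// subr_gt0. Qed.

(** On the central square the product is expanded to first order at the true coordinates. The linear
    terms [F1] and [F2] have means of order [1 / m] by [rank_center_central], the remainders are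
    bounded by [sqr_dev]. One logarithmic factor comes from the size of the scores, the other from
    the truncated inverse moment. *)
Lemma rank_bias_central :
  `|Ex P (fun w => cw w * X w)| <= 48 * C ^+ 2 * (1 + q%:R) ^+ 2 / m.+2%:R.
Proof.
have [sJ J2 jle Jt] := rJ; have [sK K2 kle Kt] := rK.
set L : R := 1 + q%:R; have L0 : 1 <= L by rewrite lerDl.
set D : R := (2 + 4 * q%:R) / m.+2%:R.
have D0 : 0 <= D by rewrite divr_ge0// addr_ge0// mulr_ge0.
have N0 : (0 : R) < m.+2%:R by rewrite ltr0n.
pose f1 (e : E) := j e.1 * K e.2; pose f2 (e : E) := J e.1 * k e.2.
have mf1 : mfunT f1 by apply: measurable_funM; exact: measurableT_comp.
have mf2 : mfunT f2 by apply: measurable_funM; exact: measurableT_comp.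
have A0 : 0 <= C * (C * L) by rewrite !mulr_ge0// (le_trans ler01).
have cc1 e : central x e -> x <= e.1 <= 1 - x by move=> /and4P[-> ->].
have cc2 e : central x e -> x <= e.2 <= 1 - x by move=> /and4P[_ _ -> ->].
have B1 e : central x e -> `|f1 e| <= C * (C * L) * (e.1^-1 + (1 - e.1)^-1).
  move=> /centered[[[h1 h2] hJ] hK]; rewrite normrM mulrAC; apply: ler_pM => //.
  by rewrite -inv_sum//; exact: jle.
have B2 e : central x e -> `|f2 e| <= C * (C * L) * (e.2^-1 + (1 - e.2)^-1).
  move=> /centered[[[h1 h2] hJ] hK]; rewrite normrM mulrAC mulrC; apply: ler_pM => //.
  by rewrite -inv_sum//; exact: kle.
have I1 := rank_center_central m measurable_fst uZ1 Z01 cc1 A0 mf1 B1.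
have I2 := rank_center_central m measurable_snd uZ2 Z02 cc2 A0 mf2 B2.
have I3 := rank_dev_central m measurable_fst uZ1 Z01 cc1.
have I4 := rank_dev_central m measurable_snd uZ2 Z02 cc2.
have i3 := itg_rank_dev_central m measurable_fst cc1.
have i4 := itg_rank_dev_central m measurable_snd cc2.
move: I1 I2 I3 I4 i3 i4.
set F1 := fun w => _ * (_ * f1 _); set F2 := fun w => _ * (_ * f2 _).
set G1 := fun w => sqr_dev _ _ * _; set G2 := fun w => sqr_dev (Z m w).2 _ * _.
move=> I1 I2 I3 I4 i3 i4.
have iF (g : E -> R) (r : T -> R) y : 0 <= y -> mfunT g -> bmf r ->
    (forall e, central x e -> `|g e| <= y) -> itg P (fun w => r w * (cw w * g (Z m w))).
  move=> y0 mg br gy; apply: bmf_itg; apply: bmfM => //.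
  apply: (bmf_comp (h := fun e => (central x e)%:R * g e)) => //; split.
    by apply: measurable_funM => //; exact: measurable_central.
  exists y => e; case: (boolP (central x e)) => [/gy|_]; rewrite ?mul1r// mul0r normr0//.
have ile (c' : R) : x <= c' <= 1 - x -> c'^-1 + (1 - c')^-1 <= 2 * x^-1 :> R.
  move=> /andP[c0 c1].
  have u0 : 0 < c' by exact: lt_le_trans c0.
  have v0 : 0 < 1 - c' by rewrite (lt_le_trans x0)// lerBrDl -lerBrDr.
  rewrite (_ : 2 = 1 + 1)// mulrDl !mul1r lerD// lef_pV2//.
  by rewrite lerBrDl -lerBrDr.
have y0 : 0 <= C * (C * L) * (2 * x^-1) by rewrite mulr_ge0// mulr_ge0// invr_ge0 ltW.
have bcoord (c' : E -> R) : mfunT c' -> (forall i w, 0 <= c' (Z i w) <= 1) ->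
    bmf (fun w => c' (Z m w)).
  move=> mc' c01; split; first exact: measurableT_comp.
  by exists 1 => w; have /andP[? ?] := c01 m w; rewrite ger0_norm.
have iF1 : itg P F1.
  apply: (iF f1 _ _ y0) => //.
    by apply: bmfB; [exact: (bJ id)|exact: bcoord].
  by move=> e ce; apply: (le_trans (B1 e ce)); rewrite ler_wpM2l//; apply: ile; exact: cc1.
have iF2 : itg P F2.
  apply: (iF f2 _ _ y0) => //.
    by apply: bmfB; [exact: (bK id)|exact: bcoord].
  by move=> e ce; apply: (le_trans (B2 e ce)); rewrite ler_wpM2l//; apply: ile; exact: cc2.
have iX := itg_rank_bias.
have mcw : mfunT (fun w => cw w).
  by apply: (measurableT_comp (f := fun e => (central x e)%:R : R)) => //; exact: measurable_central.
have icX : itg P (fun w => cw w * X w).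
  apply: (itg_le _ (itg_norm iX)); first exact: measurable_funM.
  by move=> w; case: central; rewrite ?mul1r// mul0r normr0.
have key w : `|cw w * X w - (F1 w + F2 w)| <= (C ^+ 2 * L + 4 * C ^+ 2) * (G1 w + G2 w).
  rewrite /F1 /F2 /G1 /G2; case: (boolP (central x (Z m w))) => [ce|_]; last first.
    by rewrite !mul0r !mulr0 !addr0 subr0 normr0 mulr0.
  have [[[h1 h2] hJ] hK] := centered ce.
  rewrite !mul1r !mulr1 /f1 /f2 /=.
  have r1 : 0 < rnk1 w < 1 by exact: full_itv.
  have r2 : 0 < rnk2 w < 1 by exact: full_itv.
  have T1 := Jt _ _ h1 r1; have T2 := Kt _ _ h2 r2.
  have Q1 := score_sqr_dev C0 sJ h1 r1; have Q2 := score_sqr_dev C0 sK h2 r2.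
  have s1 := sqr_dev_ge0 h1 r1; have s2 := sqr_dev_ge0 h2 r2.
  move: T1 T2 Q1 Q2 s1 s2 hJ hK; rewrite -/L.
  move: (sqr_dev _ _) (sqr_dev _ _) (J (rnk1 w)) (K (rnk2 w)) (J (Z m w).1) (K (Z m w).2)
    (rnk1 w - (Z m w).1) (rnk2 w - (Z m w).2) (j _) (k _) => t s a b a' b' u v jj kk T1 T2 Q1 Q2 s0 t0 hJ hK.
  rewrite (_ : _ - _ = (a - a' - u * jj) * b' + a' * (b - b' - v * kk) + (a - a') * (b - b')); last by ring.
  rewrite (le_trans (ler_normD _ _))//.
  rewrite (_ : _ * (s + t) = (C ^+ 2 * L * s + C ^+ 2 * L * t) + 4 * C ^+ 2 * (s + t)); last by ring.
  apply: lerD.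
    rewrite (le_trans (ler_normD _ _))// !normrM.
    rewrite (_ : C ^+ 2 * L * s = (C * s) * (C * L)); last by ring.
    rewrite (_ : C ^+ 2 * L * t = (C * L) * (C * t)); last by ring.
    by apply: lerD; apply: ler_pM.
  apply: le_trans (norm_mul_le_sqr Q1 Q2) _.
  by rewrite -mulrDr le_eqVlt; apply/orP; left; apply/eqP; field.
have iG : itg P (fun w => (C ^+ 2 * L + 4 * C ^+ 2) * (G1 w + G2 w)) by apply: itgZ; exact: itgD.
have iFF : itg P (fun w => F1 w + F2 w) by exact: itgD.
have := norm_Ex_le (itgB icX iFF) iG key.
rewrite ExB// ExD// ExZ; last exact: itgD.
rewrite ExD// => H.
have Dd : D = (2 + 4 * q%:R) / m.+2%:R by [].
rewrite -[C * (C * L) * _ / _]mulrA -Dd in I1 I2; rewrite -Dd in I3 I4.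
(* This is [4 C^2 L D + 8 C^2 D], at most [12 C^2 L D]; bounding [D] by [4 L / (m + 2)] gives the
   48. *)
apply: (@le_trans _ _ (2 * (C * (C * L) * D) + (C ^+ 2 * L + 4 * C ^+ 2) * (D + D))).
  have c1 : 0 <= C ^+ 2 * L + 4 * C ^+ 2.
    by rewrite addr_ge0// mulr_ge0 ?sqr_ge0// (le_trans ler01).
  have := ler_wpM2l c1 (lerD I3 I4) => H'.
  move: H H' I1 I2; move: (Ex P _) (Ex P F1) (Ex P F2) => a b c.
  move: (_ * (_ + _)) (_ * (D + D)) (C * _ * D) => p r s; rewrite !ler_norml; lra.
have -> : 48 * C ^+ 2 * L ^+ 2 / m.+2%:R = 12 * C ^+ 2 * L * (4 * L / m.+2%:R) by ring.
have D4 : D <= 4 * L / m.+2%:R.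
  by rewrite ler_wpM2r ?invr_ge0// /L mulrDr mulr1 lerD2r ler_nat.
have CL : 0 <= C ^+ 2 * L by rewrite mulr_ge0 ?sqr_ge0// (le_trans ler01).
have C2 : C ^+ 2 <= C ^+ 2 * L by rewrite ler_peMr ?sqr_ge0.
apply: (@le_trans _ _ (12 * C ^+ 2 * L * D)); last by rewrite ler_wpM2l// -mulrA mulr_ge0.
rewrite -subr_ge0 (_ : _ - _ = 8 * (C ^+ 2 * L - C ^+ 2) * D); last by ring.
by rewrite mulr_ge0// mulr_ge0// subr_ge0.
Qed.

Lemma rank_bias_le t : 0 < t -> `|Ex P (fun w => X w)| <=
  48 * C ^+ 2 * (1 + q%:R) ^+ 2 / m.+2%:R + (t * moment4_bound + 4 * x / t).
Proof.
move=> t0; apply: le_trans (lerD rank_bias_central (rank_bias_outside t0)).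
have iX := itg_rank_bias.
have mcw : mfunT (fun w => cw w).
  by apply: (measurableT_comp (f := fun e => (central x e)%:R : R)) => //; exact: measurable_central.
have icX : itg P (fun w => cw w * X w).
  apply: (itg_le _ (itg_norm iX)); first exact: measurable_funM.
  by move=> w; case: central; rewrite ?mul1r// mul0r normr0.
have E1 : (fun w => (1 - cw w) * X w) = fun w => X w - cw w * X w.
  by apply/funext => w; ring.
rewrite E1 [in leRHS]ExB//; apply: le_trans (ler_normD _ _).
by rewrite addrC subrK.
Qed.

End at_index.

Let log_growth m : (1 + 2 * (up_log 2 m.+2)%:R : R) ^+ 8 <= 32 ^+ 8 * 4 * m.+2%:R.
Proof.
set v := up_log 2 m.+2.
have v1 : (0 < v)%N by rewrite /v up_log_gt0.
pose y : R := (1 + 2 * v%:R) / 4.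
have y0 : 0 <= y by rewrite divr_ge0// addr_ge0// mulr_ge0.
have yE : 1 + 2 * v%:R = 4 * y by rewrite /y; field.
have e2 : expR 2^-1 <= 2 :> R.
  have H := expR_ge1Dx (- 2^-1 : R).
  by rewrite -[expR _]invrK -expRN invf_ple ?posrE ?expR_gt0// (le_trans _ H)//; lra.
have ey : expR y <= 4 * m.+2%:R.
  apply: (@le_trans _ _ (expR (2^-1 * v.+1%:R))).
    by rewrite ler_expR -(natr1 v) /y; lra.
  rewrite expRM_natr; apply: (@le_trans _ _ (2 ^+ v.+1)).
    by rewrite lerXn2r ?nnegrE ?expR_ge0.
  rewrite -natrX -natrM ler_nat.
  have /andP[+ _] := @up_log_bounds 2 m.+2 isT isT; rewrite -/v => H.
  rewrite -(prednK v1) 2!expnS mulnA; exact: leq_mul (ltnW H).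
have -> : 32 ^+ 8 * 4 * m.+2%:R = 4 ^+ 8 * (8 ^+ 8 * (4 * m.+2%:R)) :> R.
  by move: (m.+2%:R : R) => N; ring.
rewrite yE (exprMn 8 4 y); apply: ler_wpM2l; first exact: exprn_ge0.
apply: (le_trans (pow_le_expR 8 y0)); apply: ler_wpM2l => //; exact: exprn_ge0.
Qed.

(** A rate of [n^(-3/4)] for the bias: weaker than the true order but free of logarithms, and still
    negligible against [n^(-1/2)]. The fourth power keeps it in integer exponents. *)
Lemma rank_bias_rate : exists B, forall m,
  (Ex P (fun w => J (full m.+1 (fst \o smp Z w) m) * K (full m.+1 (snd \o smp Z w) m)) -
   Ex P (fun w => J (Z 0 w).1 * K (Z 0 w).2)) ^+ 4 * m.+1%:R ^+ 3 <= B.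
Proof.
pose B0 := 48 * C ^+ 2 + moment4_bound + 4.
have M0 : 0 <= moment4_bound.
  by rewrite !addr_ge0// ?mulr_ge0 ?exprn_ge0//; apply: Ex_ge0 => w; rewrite exprn_even_ge0.
have B00 : 0 <= B0 by rewrite /B0; have := sqr_ge0 C; lra.
exists (B0 ^+ 4 * (32 ^+ 8 * 4)) => m; set N : R := m.+2%:R.
have N0 : 0 < N by rewrite ltr0n.
set v := up_log 2 m.+2; set L : R := 1 + 2 * v%:R.
have L1 : 1 <= L by rewrite lerDl mulr_ge0.
have vN : (2^-1 : R) ^+ v <= N^-1.
  rewrite exprVn lef_pV2 ?posrE ?exprn_gt0// -natrX ler_nat; exact: up_logP.
have v0 : (0 : R) < 2^-1 ^+ v by rewrite exprn_gt0// invr_gt0.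
(* The cutoff is [4^-v] with weight [t = 2^-v]: then [4 x / t = 4 * 2^-v], and [2^-v <= 1 / (m + 2)]
   makes both outside terms of order [1 / m]. *)
have H := rank_bias_le m (2 * v) v0.
have iX := itg_rank_bias m.
have ijk : itg P (fun w => J (Z m w).1 * K (Z m w).2).
  apply: (itg_ext (f := fun w => J (full m.+1 (fst \o smp Z w) m) * K (full m.+1 (snd \o smp Z w) m) -
     (J (full m.+1 (fst \o smp Z w) m) * K (full m.+1 (snd \o smp Z w) m) - J (Z m w).1 * K (Z m w).2))).
    apply: itgB => //; apply: bmf_itg; apply: bmfM.
      exact: (bmf_rank mZ measurable_fst m).
    exact: (bmf_rank mZ measurable_snd m).
  by move=> w; ring.
have i2 : itg P (fun w => J (full m.+1 (fst \o smp Z w) m) * K (full m.+1 (snd \o smp Z w) m)).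
  apply: bmf_itg; apply: bmfM; first exact: (bmf_rank mZ measurable_fst m).
  exact: (bmf_rank mZ measurable_snd m).
have mJK : mfunT (fun e : E => J e.1 * K e.2).
  by apply: measurable_funM; exact: measurableT_comp.
have ij0 : itg P (fun w => J (Z 0 w).1 * K (Z 0 w).2).
  have id0 : same_law P P (Z 0) (Z m) by move=> A mA; rewrite (idZ m).
  exact: (itg_same_law (mZ 0) (mZ m) id0 (f := fun e => J e.1 * K e.2)).
have E0 : Ex P (fun w => J (Z m w).1 * K (Z m w).2) = Ex P (fun w => J (Z 0 w).1 * K (Z 0 w).2).
  exact: (Ex_same_law (mZ m) (mZ 0) (idZ m) (f := fun e => J e.1 * K e.2)).
rewrite -E0 -ExB//; move: (Ex P _) H => b H.
have Hb : `|b| <= B0 * L ^+ 2 / N.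
  apply: (le_trans H); rewrite natrM -/L.
  have -> : 4 * 2^-1 ^+ (2 * v) / 2^-1 ^+ v = 4 * 2^-1 ^+ v :> R.
    by rewrite mulnC exprM expr2 -!mulrA divff ?mulr1// gt_eqF.
  have -> : B0 * L ^+ 2 / N = 48 * C ^+ 2 * L ^+ 2 / N + (moment4_bound + 4) * L ^+ 2 / N.
    by rewrite /B0; ring.
  rewrite lerD2l [leLHS](_ : _ = (moment4_bound + 4) * 2^-1 ^+ v); last by ring.
  rewrite -[leRHS]mulrA; apply: ler_wpM2l; first exact: addr_ge0.
  by apply: (le_trans vN); rewrite ler_peMl ?invr_ge0 ?(ltW N0)// exprn_ege1.
have -> : b ^+ 4 = `|b| ^+ 4 by rewrite -normrX ger0_norm// exprn_even_ge0.
apply: (@le_trans _ _ ((B0 * L ^+ 2 / N) ^+ 4 * N ^+ 3)).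
  apply: ler_pM; rewrite ?exprn_ge0//.
    by rewrite lerXn2r ?nnegrE// divr_ge0 ?(ltW N0)// mulr_ge0 ?sqr_ge0.
  by rewrite lerXn2r ?nnegrE// ler_nat.
have -> : (B0 * L ^+ 2 / N) ^+ 4 * N ^+ 3 = B0 ^+ 4 * (L ^+ 8 / N).
  by field; rewrite gt_eqF.
rewrite ler_wpM2l ?exprn_ge0// ler_pdivrMr//; exact: log_growth.
Qed.

End rank_bias.

(** * Weak convergence from test functions *)

Section weak_convergence.
Context {R : realType}.
Local Notation gam := (@std_normal R).
Local Notation gam2 := (@std_normal2 R).

Lemma normal2_abs : (Ex gam2 (fun z => `|z.1|) <= 1) * (Ex gam2 (fun z => `|z.2|) <= 1).
Proof.
have i1 : itg gam (fun x => x) by have := @itg_normal_pow R 1; under eq_fun do rewrite expr1.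
have i2 := @itg_normal_pow R 2; have ia := itg_norm i1.
have H : Ex gam (fun x => `|x|) <= 1.
  have <- : Ex gam (fun x => 2^-1 * x ^+ 2 + 2^-1) = 1.
    rewrite ExD ?Ex_cst ?ExZ ?normal_second_moment//; first by field.
      exact: itgZ.
    exact: itg_cst.
  apply: le_Ex => //; first by apply: itgD; [exact: itgZ|exact: itg_cst].
  by move=> x; have := sqr_ge0 (`|x| - 1); rewrite -(real_normK (num_real x)); nra.
by split; [rewrite (Ex_normal2_fst ia)|rewrite (Ex_normal2_snd ia)].
Qed.

Lemma measurable_mulmx_pair (A : 'M[R]_2) : mfunT (mulmx_pair A).
Proof.
by apply/measurable_fun_pair; apply: measurable_funD; apply: measurable_funM.
Qed.

Lemma normal2_lip L f (A B : 'M[R]_2) : smooth3 L f ->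
  `|Ex gam2 (fun z => f (mulmx_pair A z)) - Ex gam2 (fun z => f (mulmx_pair B z))| <=
  3 * L * ((`|A 0 0 - B 0 0| + `|A 1 0 - B 1 0|) + (`|A 0 1 - B 0 1| + `|A 1 1 - B 1 1|)).
Proof.
move=> sf; have L0 := smooth3_ge0 sf; have bf := smooth3_bmf sf.
have iA C := bmf_itg gam2 (bmf_comp bf (measurable_mulmx_pair C)).
have i1 : itg gam (fun x => x) by have := @itg_normal_pow R 1; under eq_fun do rewrite expr1.
have j1 := itg_normal2_fst (itg_norm i1); have j2 := itg_normal2_snd (itg_norm i1).
rewrite -ExB//.
set a := _ + `|_ - B 1 0|; set b := _ + `|_ - B 1 1|.
have a0 : 0 <= a by exact: addr_ge0.
have b0 : 0 <= b by exact: addr_ge0.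
have [e1 e2] := normal2_abs.
apply: (@le_trans _ _ (Ex gam2 (fun z => 3 * L * (a * `|z.1| + b * `|z.2|)))).
  apply: norm_Ex_le; [exact: itgB|by apply: itgZ; apply: itgD; exact: itgZ|move=> z].
  have := smooth3_lip sf (mulmx_pair B z) ((A 0 0 - B 0 0) * z.1 + (A 0 1 - B 0 1) * z.2,
    (A 1 0 - B 1 0) * z.1 + (A 1 1 - B 1 1) * z.2).
  rewrite (_ : shift2 _ _ = mulmx_pair A z); last first.
    by rewrite /shift2 /mulmx_pair/=; congr (_, _); ring.
  move/le_trans; apply; rewrite ler_wpM2l ?mulr_ge0//.
  rewrite /size2/= (le_trans (lerD (ler_normD _ _) (ler_normD _ _)))// !normrM /a /b.
  by rewrite !mulrDl addrACA.
rewrite ExZ; last by apply: itgD; exact: itgZ.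
rewrite ler_wpM2l ?mulr_ge0// ExD; [|exact: itgZ|exact: itgZ].
by rewrite !ExZ// lerD// ler_piMr.
Qed.

Lemma itg_normal2_lin_sqr (a b : R) : itg gam2 (fun z => (a * z.1 + b * z.2) ^+ 2).
Proof.
have i11 := itg_normal2_fst (@itg_normal_pow R 2).
have i22 := itg_normal2_snd (@itg_normal_pow R 2).
have i12 := @itg_normal2_prod R.
apply: (itg_ext (f := fun z : R * R => a ^+ 2 * z.1 ^+ 2 + (2 * a * b) * (z.1 * z.2) + b ^+ 2 * z.2 ^+ 2)).
  by apply: itgD; [apply: itgD|]; exact: itgZ.
by move=> z; ring.
Qed.

Context {d} {T : measurableType d}.
Variable P : probability T R.

(** A bounded continuous function is replaced by a test function at an error growing like
    [|x|^2 / r^2]; the bounded second moments make it uniformly small, and so replace a tightness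
    argument. *)
Lemma cvg_to_normal2_of_test_fun (Y : nat -> T -> R * R) (A : 'M[R]_2) (C : R) :
  (forall n, bmf (fun w => (Y n w).1)) -> (forall n, bmf (fun w => (Y n w).2)) ->
  (\forall n \near \oo, Ex P (fun w => (Y n w).1 ^+ 2 + (Y n w).2 ^+ 2) <= C) ->
  (forall f, test_fun f ->
     Ex P (fun w => f (Y n w)) @[n --> \oo] --> Ex gam2 (fun z => f (mulmx_pair A z))) ->
  cvg_to_normal2 P Y (0, 0) (A *m A^T).
Proof.
move=> bY1 bY2 YC Ytest.
have mY n : mfunT (Y n).
  apply: (eq_measurable_fun (fun w => ((Y n w).1, (Y n w).2))); first by move=> w _; case: (Y n w).
  by apply/measurable_fun_pair; [case: (bY1 n)|case: (bY2 n)].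
pose s (z : R * R) := (0, 0) + mulmx_pair A z.
have sE z : s z = mulmx_pair A z by rewrite /s; case: (mulmx_pair A z) => x y; rewrite /GRing.add/= /add_pair/= !add0r.
have ms : mfunT s.
  by rewrite (_ : s = mulmx_pair A); [exact: measurable_mulmx_pair|apply/funext].
exists (law gam2 ms); first by exists A => // B mB; exact: lawE.
move=> f cf [M fM]; have bf := bmf_continuous2 cf fM; have [mf _] := bf.
have M0 : 0 <= M by exact: le_trans (fM (0, 0)).
have EY n : 'E_P[f \o Y n]%E = (Ex P (fun w => f (Y n w)))%:E.
  by rewrite unlock -EFin_Ex//; apply: bmf_itg; exact: (bmf_comp bf).
have EL : 'E_(law gam2 ms)[f]%E = (Ex gam2 (fun z => f (mulmx_pair A z)))%:E.
  rewrite unlock -EFin_Ex; last exact: bmf_itg.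
  rewrite (Ex_law ms mf); last by apply: bmf_itg; exact: (bmf_comp bf).
  by congr ((Ex _ _)%:E); apply/funext => z /=; rewrite sE.
rewrite EL; under eq_fun do rewrite EY.
apply: cvg_EFin; first by apply: nearW => n.
pose D := Ex gam2 (fun z => (mulmx_pair A z).1 ^+ 2 + (mulmx_pair A z).2 ^+ 2).
have iD : itg gam2 (fun z => (mulmx_pair A z).1 ^+ 2 + (mulmx_pair A z).2 ^+ 2).
  by apply: itgD; exact: itg_normal2_lin_sqr.
have D0 : 0 <= D by apply: Ex_ge0 => z; rewrite addr_ge0 ?sqr_ge0.
apply/cvgrPdist_le => e e0.
pose H := `|C| + D.
have H0 : 0 <= H by rewrite addr_ge0.
pose r := 1 + 2 * M * H / (e / 8).
have r1 : 1 <= r by rewrite lerDl; apply: divr_ge0; [rewrite !mulr_ge0|rewrite divr_ge0// ltW].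
have rH x : x <= H -> 2 * M * x / r ^+ 2 <= e / 8.
  move=> xH; rewrite ler_pdivrMr ?exprn_gt0 ?(lt_le_trans ltr01)//.
  apply: (@le_trans _ _ (2 * M * H)); first by rewrite ler_wpM2l ?mulr_ge0.
  apply: (@le_trans _ _ (e / 8 * r)); last first.
    by rewrite ler_wpM2l ?divr_ge0 ?(ltW e0)// ler_eXnr.
  rewrite (_ : e / 8 * r = e / 8 + 2 * M * H); last by rewrite /r; field; rewrite gt_eqF.
  by rewrite lerDr divr_ge0// ltW.
have e8 : 0 < e / 8 by rewrite divr_gt0.
have [p tp pf] := test_fun_approx cf fM e8 r1.
have bp : bmf p by case: tp => L; exact: smooth3_bmf.
have close (d0 : measure_display) (T0 : measurableType d0) (Q : probability T0 R) (V : T0 -> R * R) :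
    mfunT V -> itg Q (fun w => (V w).1 ^+ 2 + (V w).2 ^+ 2) ->
    Ex Q (fun w => (V w).1 ^+ 2 + (V w).2 ^+ 2) <= H ->
    `|Ex Q (fun w => f (V w)) - Ex Q (fun w => p (V w))| <= e / 4.
  move=> mV iV VH.
  have bfV := bmf_itg Q (bmf_comp bf mV); have bpV := bmf_itg Q (bmf_comp bp mV).
  rewrite -ExB//.
  apply: (@le_trans _ _ (Ex Q (fun w => e / 8 + 2 * M / r ^+ 2 * ((V w).1 ^+ 2 + (V w).2 ^+ 2)))).
    apply: norm_Ex_le; [exact: itgB|by apply: itgD; [exact: itg_cst|exact: itgZ]|].
    by move=> w; apply: (le_trans (pf _)); rewrite mulrAC.
  rewrite ExD ?Ex_cst ?ExZ//; [|exact: itg_cst|exact: itgZ].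
  rewrite mulrAC; have := rH _ VH; lra.
have cA := close _ _ gam2 (mulmx_pair A) (measurable_mulmx_pair A) iD _.
have {}cA := cA (ler_wpDl (normr_ge0 C) (lexx D)).
have Hp := Ytest p tp; move/cvgrPdist_le : Hp => /(_ (e / 4)).
have e4 : 0 < e / 4 by rewrite divr_gt0.
move=> /(_ e4) Hp; near=> n.
have C1 : Ex P (fun w => (Y n w).1 ^+ 2 + (Y n w).2 ^+ 2) <= C by near: n.
have iY : itg P (fun w => (Y n w).1 ^+ 2 + (Y n w).2 ^+ 2).
  by apply: bmf_itg; apply: bmfD; apply: bmfX.
have cY := close _ _ P (Y n) (mY n) iY.
have {}cY := cY (le_trans C1 (ler_wpDr D0 (ler_norm C))).
have Hn : `|Ex gam2 (fun z => p (mulmx_pair A z)) - Ex P (fun w => p (Y n w))| <= e / 4 by near: n.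
rewrite /=; move: cA cY Hn; move: (Ex _ _) (Ex _ _) (Ex _ _) (Ex _ _) => a b c a'.
rewrite !ler_norml; lra.
Unshelve. all: by end_near.
Qed.

End weak_convergence.

Lemma lip_share3 (F : realFieldType) (L e : F) : 0 <= L -> 0 < e ->
  3 * L * (e / (36 * L + 1) + e / (36 * L + 1) + e / (36 * L + 1)) <= e / 4.
Proof.
move=> L0 e0; have d0 : 0 < 36 * L + 1 by rewrite ltr_wpDl// mulr_ge0.
rewrite -!mulrDl mulrA ler_pdivrMr//.
have := mulr_ge0 L0 (ltW e0); lra.
Qed.

Lemma lip_share2 (F : realFieldType) (L e : F) : 0 <= L -> 0 < e ->
  3 * L * (e / (24 * L + 1) + e / (24 * L + 1)) <= e / 2.
Proof.
move=> L0 e0; have d0 : 0 < 24 * L + 1 by rewrite ltr_wpDl// mulr_ge0.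
rewrite -!mulrDl mulrA ler_pdivrMr//.
have := mulr_ge0 L0 (ltW e0); lra.
Qed.

Lemma le_shares (F : realFieldType) (x y z e : F) :
  x <= e / 4 -> y <= e / 4 -> z <= e / 2 -> x + y + z <= e.
Proof. by move=> *; lra. Qed.

(** * Limits of statistics approximated by normalized sums *)

Section approximation_by_walks.
Context {R : realType} {dT dE : measure_display} {T : measurableType dT}
  {E : measurableType dE}.
Variables (P : probability T R) (Z : nat -> T -> E).
Hypotheses (mZ : forall i, mfunT (Z i))
  (indepZ : mutually_independent P Z)
  (idZ : forall i, same_law P P (Z i) (Z 0)).
Local Notation gam2 := (@std_normal2 R).

Lemma Ex_pair_iid (f g : E -> R) i j : i != j -> bmf f -> bmf g ->
  Ex P (fun w => f (Z i w) * g (Z j w)) = Ex P (fun w => f (Z 0 w)) * Ex P (fun w => g (Z 0 w)).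
Proof.
move=> ij bf bg; have [mf [F fF]] := bf; have [mg [G gG]] := bg.
have ig := bmf_itg P (bmf_comp bg (mZ j)).
have := @Ex_blocks _ _ R _ E P Z mZ indepZ idZ 1 1 (fun=> i) (fun=> j)
  (fun z z' => f (z 0%N) * g (z' 0%N)).
rewrite /smp /comp /= => ->.
- under eq_fun do rewrite ExZ// mulrC.
  rewrite ExZ; last by apply: bmf_itg; exact: (bmf_comp bf).
  by rewrite (Ex_iid mZ idZ i bf) (Ex_iid mZ idZ j bg) mulrC.
- split; last by exists (F * G) => z z'; exact: norm_mul_le.
  move=> d' S z z' mz mz'; apply: measurable_funM.
    by apply: (measurableT_comp mf); exact: mz.
  by apply: (measurableT_comp mg); exact: mz'.
- by move=> z' z1 z2 ->.
- by move=> z' z1 z2 ->.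
- by move=> [|?] [|?].
- by move=> [|?] [|?].
- by [].
Qed.

Lemma Ex_sum_sqr (f : E -> R) n : bmf f -> Ex P (fun w => f (Z 0 w)) = 0 ->
  Ex P (fun w => (\sum_(i < n) f (Z i w)) ^+ 2) = n%:R * Ex P (fun w => f (Z 0 w) ^+ 2).
Proof.
move=> bf f0.
have bZ i : bmf (fun w => f (Z i w)) by exact: bmf_comp.
have bS m : bmf (fun w => \sum_(i < m) f (Z i w)) by apply: bmf_sum.
elim: n => [|n IH].
  by rewrite mul0r -[RHS](Ex_cst P); congr (Ex P _); apply/funext => w; rewrite big_ord0 expr0n.
have E1 : (fun w => (\sum_(i < n.+1) f (Z i w)) ^+ 2) = fun w => (\sum_(i < n) f (Z i w)) ^+ 2 +
    (2 * (\sum_(i < n) f (Z i w) * f (Z n w)) + f (Z n w) ^+ 2).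
  by apply/funext => w; rewrite big_ord_recr/= -mulr_suml; ring.
have bp : bmf (fun w => \sum_(i < n) f (Z i w) * f (Z n w)).
  by apply: bmf_sum => i _; exact: bmfM.
have bX : bmf (fun w => f (Z n w) ^+ 2) by exact: bmfX.
rewrite E1 ExD; [|by apply: bmf_itg; exact: bmfX|by apply: bmf_itg; apply: bmfD => //; exact: bmfZ].
rewrite ExD; [|by apply: bmf_itg; exact: bmfZ|exact: bmf_itg].
rewrite IH ExZ; last exact: bmf_itg.
rewrite Ex_sum; last by move=> i _; apply: bmf_itg; exact: bmfM.
rewrite big1 ?mulr0 ?add0r => [|i _]; last by rewrite Ex_pair_iid ?neq_ltn ?ltn_ord// f0 mulr0.
by rewrite (Ex_iid mZ idZ n (bmfX 2 bf)) -natr1; ring.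
Qed.

(** Explicit triangular factors are needed because limits are taken of square roots of the
    covariances. If [p] vanishes so does [q], and the first column is zero. *)
Lemma cholesky2 (p q r : R) : 0 <= p -> 0 <= r -> q ^+ 2 <= p * r ->
  exists a b c, [/\ p = a ^+ 2, q = a * b & r = b ^+ 2 + c ^+ 2].
Proof.
move=> p0 r0 qpr; have [p_eq0|pn0] := eqVneq p 0.
  have q0 : q = 0.
    by apply/eqP; rewrite -sqrf_eq0 eq_le sqr_ge0 andbT (le_trans qpr)// p_eq0 mul0r.
  exists 0, 0, (Num.sqrt r); rewrite p_eq0 q0 sqr_sqrtr//; split; ring.
have pp : 0 < p by rewrite lt_neqAle eq_sym pn0.
pose a := Num.sqrt p; have a0 : 0 < a by rewrite sqrtr_gt0.
have aE : a ^+ 2 = p by rewrite sqr_sqrtr.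
exists a, (q / a), (Num.sqrt (r - q ^+ 2 / p)); split => //.
  by rewrite mulrC divfK ?gt_eqF.
rewrite sqr_sqrtr; last by rewrite subr_ge0 ler_pdivrMr// mulrC.
by rewrite expr_div_n aE; ring.
Qed.

Definition lower2 (a b c : R) : 'M[R]_2 :=
  \matrix_(i, j) (if i == 0 then (if j == 0 then a else 0) else (if j == 0 then b else c)).

Variables (Y : nat -> T -> R * R) (phi psi : nat -> E -> R) (dl : nat -> R).
Hypotheses (bY1 : forall n, bmf (fun w => (Y n w).1)) (bY2 : forall n, bmf (fun w => (Y n w).2))
  (bphi : forall m, bmf (phi m)) (bpsi : forall m, bmf (psi m))
  (phi0 : forall m, Ex P (phi m \o Z 0) = 0) (psi0 : forall m, Ex P (psi m \o Z 0) = 0)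
  (dl0 : dl n @[n --> \oo] --> 0).

Notation W m n w := (walk (phi m) (psi m) (Num.sqrt n%:R)^-1 n (smp Z w)).

Hypotheses (YW1 : forall m, \forall n \near \oo,
    Ex P (fun w => ((Y n w).1 - (W m n w).1) ^+ 2) <= dl m)
  (YW2 : forall m, \forall n \near \oo,
    Ex P (fun w => ((Y n w).2 - (W m n w).2) ^+ 2) <= dl m).

Let bsum (f : E -> R) n : bmf f -> bmf (fun w => \sum_(i < n) f (Z i w)).
Proof. by move=> bf; apply: bmf_sum => i _; exact: (bmf_comp bf (mZ i)). Qed.

Let bW1 m n : bmf (fun w => (W m n w).1).
Proof. exact: (bmfZ _ (bsum n (bphi m))). Qed.
Let bW2 m n : bmf (fun w => (W m n w).2).
Proof. exact: (bmfZ _ (bsum n (bpsi m))). Qed.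

Let sqr2 (a b : R) : (a + b) ^+ 2 <= 2 * a ^+ 2 + 2 * b ^+ 2.
Proof. by have := sqr_ge0 (a - b); nra. Qed.

Let Ex_sqr2 (f g : T -> R) : bmf f -> bmf g ->
  Ex P (fun w => f w ^+ 2) <= 2 * Ex P (fun w => (g w - f w) ^+ 2) + 2 * Ex P (fun w => g w ^+ 2).
Proof.
move=> bf bg; have b2 : bmf (fun w => (g w - f w) ^+ 2) by apply: bmfX; exact: bmfB.
have b3 : bmf (fun w => g w ^+ 2) by exact: bmfX.
have i2 := bmf_itg P b2; have i3 := bmf_itg P b3.
rewrite -!ExZ// -ExD; [|exact: itgZ|exact: itgZ]; apply: le_Ex.
- by apply: bmf_itg; exact: bmfX.
- by apply: itgD; exact: itgZ.
- by move=> w; rewrite -[X in _ <= _ * X + _]sqrrN; apply: le_trans (sqr2 _ _); rewrite opprB subrK.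
Qed.

Let v m := Ex P (fun w => phi m (Z 0 w) ^+ 2).
Let u m := Ex P (fun w => psi m (Z 0 w) ^+ 2).
Let c m := Ex P (fun w => phi m (Z 0 w) * psi m (Z 0 w)).

Let EW1 m n : (0 < n)%N -> Ex P (fun w => (W m n w).1 ^+ 2) = v m.
Proof.
move=> n0; have r0 : 0 < Num.sqrt n%:R :> R by rewrite sqrtr_gt0 ltr0n.
under eq_fun do rewrite exprMn /=.
rewrite ExZ; last by apply: bmf_itg; apply: bmfX; exact: (bsum n (bphi m)).
rewrite (Ex_sum_sqr n (bphi m) (phi0 m)) mulrA -{2}[n%:R]sqr_sqrtr// -exprMn mulVf ?gt_eqF//.
by rewrite expr1n mul1r.
Qed.

Let EW2 m n : (0 < n)%N -> Ex P (fun w => (W m n w).2 ^+ 2) = u m.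
Proof.
move=> n0; have r0 : 0 < Num.sqrt n%:R :> R by rewrite sqrtr_gt0 ltr0n.
under eq_fun do rewrite exprMn /=.
rewrite ExZ; last by apply: bmf_itg; apply: bmfX; exact: (bsum n (bpsi m)).
rewrite (Ex_sum_sqr n (bpsi m) (psi0 m)) mulrA -{2}[n%:R]sqr_sqrtr// -exprMn mulVf ?gt_eqF//.
by rewrite expr1n mul1r.
Qed.

Let EY1 m : \forall n \near \oo, Ex P (fun w => (Y n w).1 ^+ 2) <= 2 * dl m + 2 * v m.
Proof.
near=> n; have n0 : (0 < n)%N by near: n; exact: nbhs_infty_gt.
rewrite -(EW1 m n0); apply: (le_trans (Ex_sqr2 (bY1 n) (bW1 m n))); rewrite lerD2r ler_wpM2l//.
under eq_fun do rewrite -sqrrN opprB.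
by near: n; exact: YW1.
Unshelve. all: by end_near.
Qed.

Let EY2 m : \forall n \near \oo, Ex P (fun w => (Y n w).2 ^+ 2) <= 2 * dl m + 2 * u m.
Proof.
near=> n; have n0 : (0 < n)%N by near: n; exact: nbhs_infty_gt.
rewrite -(EW2 m n0); apply: (le_trans (Ex_sqr2 (bY2 n) (bW2 m n))); rewrite lerD2r ler_wpM2l//.
under eq_fun do rewrite -sqrrN opprB.
by near: n; exact: YW2.
Unshelve. all: by end_near.
Qed.

(** All levels approximate the same [Y n] for large [n], so the variance at any level is compared
    with the one at level 0. The variances stay bounded, which the extraction of a limit
    requires. *)
Let v_le m : v m <= 2 * dl m + 2 * (2 * dl 0 + 2 * v 0).
Proof.
near \oo => n; have n0 : (0 < n)%N by near: n; exact: nbhs_infty_gt.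
rewrite -(EW1 m n0); apply: (le_trans (Ex_sqr2 (bW1 m n) (bY1 n))).
by apply: lerD; rewrite ler_wpM2l//; near: n; [exact: YW1|exact: EY1].
Unshelve. all: by end_near.
Qed.

Let u_le m : u m <= 2 * dl m + 2 * (2 * dl 0 + 2 * u 0).
Proof.
near \oo => n; have n0 : (0 < n)%N by near: n; exact: nbhs_infty_gt.
rewrite -(EW2 m n0); apply: (le_trans (Ex_sqr2 (bW2 m n) (bY2 n))).
by apply: lerD; rewrite ler_wpM2l//; near: n; [exact: YW2|exact: EY2].
Unshelve. all: by end_near.
Qed.

Let lower2E (a b e : R) : (lower2 a b e 0 0 = a) * (lower2 a b e 0 1 = 0) *
  (lower2 a b e 1 0 = b) * (lower2 a b e 1 1 = e).
Proof. by rewrite !mxE. Qed.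

Let increasing_oo (f : nat -> nat) : increasing_seq f -> f n @[n --> \oo] --> \oo.
Proof.
move=> fi; apply/cvgnyPge => N; exists N => // n /= Nn.
have H k : (k <= f k)%N.
  elim: k => // k IH; apply: (leq_ltn_trans IH).
  by rewrite ltnNge; have := fi k.+1 k; rewrite !leEnat => ->; rewrite ltnn.
exact: leq_trans Nn (H n).
Qed.

Let bounded_seq (f : nat -> R) B : (forall n, f n ^+ 2 <= B) -> bounded_fun f.
Proof.
move=> fB; exists (B + 1); split; first exact: num_real.
move=> x Bx n _; apply: (le_trans _ (ltW Bx)).
by have := fB n; have := sqr_ge0 (`|f n| - 2^-1); rewrite -(real_normK (num_real (f n))); nra.
Qed.

(** Bolzano-Weierstrass is applied in turn to the three Cholesky entries. The sequence [s] is
    returned together with the limits of the covariances, so that [A *m A^T] can be identified later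
    when these are known. *)
Lemma normal_limit : exists (s : nat -> nat) (A : 'M[R]_2),
  [/\ s n @[n --> \oo] --> \oo, v (s n) @[n --> \oo] --> (A *m A^T) 0 0,
     c (s n) @[n --> \oo] --> (A *m A^T) 0 1, u (s n) @[n --> \oo] --> (A *m A^T) 1 1 &
     cvg_to_normal2 P Y (0, 0) (A *m A^T)].
Proof.
have b2 (f g : nat -> E -> R) m : bmf (f m) -> bmf (g m) -> itg P (fun w => f m (Z 0 w) * g m (Z 0 w)).
  by move=> bf bg; apply: bmf_itg; apply: bmfM; exact: (bmf_comp _ (mZ 0)).
have v0 m : 0 <= v m by apply: Ex_ge0 => w; exact: sqr_ge0.
have u0 m : 0 <= u m by apply: Ex_ge0 => w; exact: sqr_ge0.
have chol m : exists t : R * R * R, [/\ v m = t.1.1 ^+ 2, c m = t.1.1 * t.1.2 &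
    u m = t.1.2 ^+ 2 + t.2 ^+ 2].
  have [] := @cholesky2 (v m) (c m) (u m) (v0 m) (u0 m).
    apply: Ex_CS; [exact: b2|exact: (b2 phi phi)|exact: (b2 psi psi)].
  by move=> x [y [z [? ? ?]]]; exists (x, y, z).
have [t tE] := choice chol.
have [B [_ dB]] := cvg_seq_bounded (cvgP _ dl0).
have {}dB m : dl m <= `|B| + 1.
  by apply: (le_trans (ler_norm _)); apply: (dB (`|B| + 1)) => //; rewrite (le_lt_trans (ler_norm B))// ltrDl.
pose D := 2 * (`|B| + 1) + 2 * (2 * dl 0 + 2 * v 0) + 2 * (2 * dl 0 + 2 * u 0) + (v 0 + u 0).
have dl00 : 0 <= dl 0.
  near \oo => n; apply: (@le_trans _ _ (Ex P (fun w => ((Y n w).1 - (W 0%N n w).1) ^+ 2))).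
    by apply: Ex_ge0 => w; exact: sqr_ge0.
  by near: n; exact: YW1.
have vD m : v m <= D.
  by have := v_le m; have := dB m; have := v0 0%N; have := u0 0%N; rewrite /D; lra.
have uD m : u m <= D.
  by have := u_le m; have := dB m; have := v0 0%N; have := u0 0%N; rewrite /D; lra.
have ba : bounded_fun (fun m => (t m).1.1).
  by apply: (@bounded_seq _ D) => m; have [<- _ _] := tE m.
have bb : bounded_fun (fun m => (t m).1.2).
  apply: (@bounded_seq _ D) => m; have [_ _ H] := tE m; apply: le_trans (uD m).
  by rewrite H lerDl sqr_ge0.
have [f1 f1i c1] := bolzano_weierstrass ba.
have [|f2 f2i c2] := @bolzano_weierstrass R (fun m => (t (f1 m)).1.2).
  apply: (@bounded_seq _ D) => m; have [_ _ H] := tE (f1 m); apply: le_trans (uD (f1 m)).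
  by rewrite H lerDl sqr_ge0.
have [|f3 f3i c3] := @bolzano_weierstrass R (fun m => (t (f1 (f2 m))).2).
  apply: (@bounded_seq _ D) => m; have [_ _ H] := tE (f1 (f2 m)); apply: le_trans (uD (f1 (f2 m))).
  by rewrite H lerDr sqr_ge0.
pose s n := f1 (f2 (f3 n)).
have o3 := increasing_oo f3i; have o2 := increasing_oo f2i; have o1 := increasing_oo f1i.
have o23 : f2 (f3 n) @[n --> \oo] --> \oo by exact: (cvg_comp _ _ o3 o2).
have so : s n @[n --> \oo] --> \oo by exact: (cvg_comp _ _ o23 o1).
pose a := limn (fun n => (t (f1 n)).1.1).
pose b := limn (fun n => (t (f1 (f2 n))).1.2).
pose e := limn (fun n => (t (s n)).2).
have la : (t (s n)).1.1 @[n --> \oo] --> a by exact: (cvg_comp _ _ o23 c1).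
have lb : (t (s n)).1.2 @[n --> \oo] --> b by exact: (cvg_comp _ _ o3 c2).
have le : (t (s n)).2 @[n --> \oo] --> e by exact: c3.
pose A := lower2 a b e.
pose Am n := lower2 (t (s n)).1.1 (t (s n)).1.2 (t (s n)).2.
have AAE : ((A *m A^T) 0 0 = a ^+ 2) * ((A *m A^T) 0 1 = a * b) * ((A *m A^T) 1 1 = b ^+ 2 + e ^+ 2).
  by rewrite !mxE !big_ord_recl !big_ord0 !mxE/=; split; [split|]; ring.
exists s, A; rewrite !AAE; split => //.
- have -> : (fun n => v (s n)) = fun n => (t (s n)).1.1 ^+ 2.
    by apply/funext => n; have [] := tE (s n).
  exact: (cvgM la la).
- have -> : (fun n => c (s n)) = fun n => (t (s n)).1.1 * (t (s n)).1.2.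
    by apply/funext => n; have [] := tE (s n).
  exact: cvgM.
- have -> : (fun n => u (s n)) = fun n => (t (s n)).1.2 ^+ 2 + (t (s n)).2 ^+ 2.
    by apply/funext => n; have [] := tE (s n).
  exact: (cvgD (cvgM lb lb) (cvgM le le)).
apply: (cvg_to_normal2_of_test_fun (C := 2 * dl 0 + 2 * v 0 + (2 * dl 0 + 2 * u 0))) => //.
  near=> n; rewrite ExD; [|by apply: bmf_itg; apply: bmfX|by apply: bmf_itg; apply: bmfX].
  by apply: lerD; near: n; [exact: EY1|exact: EY2].
move=> f [L sf]; have bf := smooth3_bmf sf; have L0 := smooth3_ge0 sf.
apply/cvgrPdist_le => eps eps0.
(* The level [n] is chosen first, so that its normal law is near the limit and its sums near [Y];
   the sample size [k] then grows with the level fixed. This gives convergence of the whole sequence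
   [Y]. *)
have dist n : forall k, `|Ex gam2 (fun z => f (mulmx_pair A z)) - Ex P (fun w => f (Y k w))| <=
   3 * L * ((`|a - (t (s n)).1.1| + `|b - (t (s n)).1.2|) + `|e - (t (s n)).2|) +
   `|Ex gam2 (fun z => f (mulmx_pair (Am n) z)) - Ex P (fun w => f (W (s n) k w))| +
   `|Ex P (fun w => f (W (s n) k w)) - Ex P (fun w => f (Y k w))|.
  move=> k; have := normal2_lip A (Am n) sf; rewrite !lower2E subrr normr0 add0r.
  move: (Ex _ _) (Ex _ _) (Ex _ _) (Ex _ _) => x3 x4 x2 x1 H.
  rewrite (_ : x1 - x4 = (x1 - x2) + (x2 - x3) + (x3 - x4)); last by ring.
  by rewrite (le_trans (ler_normD _ _))// lerD2r (le_trans (ler_normD _ _))// lerD2r.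
have small : \forall n \near \oo, 3 * L * ((`|a - (t (s n)).1.1| + `|b - (t (s n)).1.2|) + `|e - (t (s n)).2|)
    <= eps / 4 /\ dl (s n) <= (eps / (24 * L + 1)) ^+ 2.
  pose q := eps / (36 * L + 1).
  have q0 : 0 < q by rewrite divr_gt0// ltr_wpDl// mulr_ge0.
  have r0 : 0 < (eps / (24 * L + 1)) ^+ 2 by rewrite exprn_gt0// divr_gt0// ltr_wpDl// mulr_ge0.
  near=> n; split.
    have h1 : `|a - (t (s n)).1.1| <= q by near: n; move/cvgrPdist_le: la; apply.
    have h2 : `|b - (t (s n)).1.2| <= q by near: n; move/cvgrPdist_le: lb; apply.
    have h3 : `|e - (t (s n)).2| <= q by near: n; move/cvgrPdist_le: le; apply.
    apply: le_trans (lip_share3 L0 eps0); rewrite -/q.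
    by rewrite ler_wpM2l ?mulr_ge0// !lerD.
  have h4 : `|0 - dl (s n)| <= (eps / (24 * L + 1)) ^+ 2.
    by near: n; move/cvgrPdist_le: (cvg_comp _ _ so dl0); apply.
  by move: h4; rewrite sub0r normrN; exact: le_trans (ler_norm _).
near \oo => n.
have [small1 small2] : 3 * L * ((`|a - (t (s n)).1.1| + `|b - (t (s n)).1.2|) + `|e - (t (s n)).2|)
    <= eps / 4 /\ dl (s n) <= (eps / (24 * L + 1)) ^+ 2 by near: n; exact: small.
pose m := s n; set tm := third_moment P Z (phi m) (psi m) (Am n).
near=> k; have k0 : (0 < k)%N by near: k; exact: nbhs_infty_gt.
apply: (le_trans (dist n k)).
have sk0 : 0 < Num.sqrt k%:R :> R by rewrite sqrtr_gt0 ltr0n.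
have clt : `|Ex gam2 (fun z => f (mulmx_pair (Am n) z)) - Ex P (fun w => f (W m k w))| <= 4 * L * tm / Num.sqrt k%:R.
  rewrite distrC; have [e1 e2 e3] := tE m.
  apply: (clt_smooth3 mZ indepZ idZ (bphi m) (bpsi m) (phi0 m) (psi0 m)) => //.
  - by rewrite !lower2E expr0n addr0 -e1.
  - by rewrite !lower2E mul0r addr0 -e2.
  - by rewrite !lower2E -e3.
have tmk : 4 * L * tm / Num.sqrt k%:R <= eps / 4.
  rewrite ler_pdivrMr// -ler_pdivrMl ?divr_gt0//.
  apply: (le_trans (ler_norm _)); rewrite -sqrtr_sqr ler_sqrt//; near: k.
  apply: nbhs_infty_ger.
have i1 := bmf_itg P (bY1 k); have i2 := bmf_itg P (bW1 m k).
have w1 : Ex P (fun w => ((Y k w).1 - (W m k w).1) ^+ 2) <= dl m by near: k; exact: YW1.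
have w2 : Ex P (fun w => ((Y k w).2 - (W m k w).2) ^+ 2) <= dl m by near: k; exact: YW2.
have abs (g : T -> R) : bmf g -> Ex P (fun w => g w ^+ 2) <= dl m ->
    Ex P (fun w => `|g w|) <= eps / (24 * L + 1).
  move=> bg gd; have r0 : 0 < eps / (24 * L + 1) by rewrite divr_gt0// ltr_wpDl// mulr_ge0.
  rewrite -(@ler_pXn2r _ 2) ?nnegrE ?(ltW r0)//; last by apply: Ex_ge0 => w.
  apply: le_trans small2; apply: le_trans gd.
  have := @Ex_CS _ _ _ P (fun w => `|g w|) (fun=> 1).
  under eq_fun do rewrite mulr1.
  rewrite expr1n Ex_cst mulr1.
  under [X in _ <= Ex P X]eq_fun do rewrite real_normK ?num_real//.
  apply; first by apply: bmf_itg; exact: bmf_norm.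
    by apply: bmf_itg; apply: bmfX; exact: bmf_norm.
  exact: itg_cst.
have bd1 : bmf (fun w => (Y k w).1 - (W m k w).1) by exact: bmfB.
have bd2 : bmf (fun w => (Y k w).2 - (W m k w).2) by exact: bmfB.
have a1 := abs _ bd1 w1; have a2 := abs _ bd2 w2.
have last : `|Ex P (fun w => f (W m k w)) - Ex P (fun w => f (Y k w))| <= eps / 2.
  have mY : mfunT (Y k).
    apply: (eq_measurable_fun (fun w => ((Y k w).1, (Y k w).2))); first by move=> w _; case: (Y k w).
    by apply/measurable_fun_pair; [case: (bY1 k)|case: (bY2 k)].
  have mW : mfunT (fun w => W m k w).
    by apply/measurable_fun_pair; [case: (bW1 m k)|case: (bW2 m k)].
  have if1 := bmf_itg P (bmf_comp bf mY); have if2 := bmf_itg P (bmf_comp bf mW).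
  have n1 := bmf_itg P (bmf_norm bd1); have n2 := bmf_itg P (bmf_norm bd2).
  rewrite distrC -ExB//.
  apply: (@le_trans _ _ (Ex P (fun w => 3 * L * (`|(Y k w).1 - (W m k w).1| + `|(Y k w).2 - (W m k w).2|)))).
    apply: norm_Ex_le; [exact: itgB|by apply: itgZ; exact: itgD|move=> w].
    have := smooth3_lip sf (W m k w) ((Y k w).1 - (W m k w).1, (Y k w).2 - (W m k w).2).
    by rewrite (_ : shift2 _ _ = Y k w)// /shift2/= !subrKC -surjective_pairing.
  rewrite ExZ; last exact: itgD.
  rewrite ExD//; apply: le_trans (lip_share2 L0 eps0).
  by rewrite ler_wpM2l ?mulr_ge0// lerD.
exact: le_shares small1 (le_trans clt tmk) last.
Unshelve. all: by end_near.
Qed.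

End approximation_by_walks.

(** * Truncation of a score by its tangent lines *)

Section truncation.
Context {R : realType}.

Definition clamp (x u : R) : R := Num.max x (Num.min u (1 - x)).

(** Linear continuation beyond [x] and [1 - x]: a constant continuation would create kinks and
    destroy the quadratic Taylor bound of [smooth]. *)
Definition trunc x (J j : R -> R) u : R :=
  J (clamp x u) + (clip01 u - clamp x u) * j (clamp x u).

Lemma measurable_clamp x : mfunT (clamp x).
Proof. by apply: measurable_maxr => //; apply: measurable_minr. Qed.

Lemma measurable_clip01 : mfunT (@clip01 R).
Proof. by apply: measurable_maxr => //; apply: measurable_minr. Qed.

Lemma measurable_trunc x J j : mfunT J -> mfunT j ->
  mfunT (trunc x J j).
Proof.
move=> mJ mj; have mc := measurable_clamp x; apply: measurable_funD.
  exact: measurableT_comp.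
apply: measurable_funM; last exact: measurableT_comp.
by apply: measurable_funB => //; exact: measurable_clip01.
Qed.

Section fixed_level.
Variable q : nat.
Notation x := (2^-1 ^+ q.+1 : R).

Lemma level_gt0 : 0 < x. Proof. by rewrite exprn_gt0// invr_gt0. Qed.

Lemma level_le : x <= 2^-1.
Proof. by rewrite exprS ler_piMr ?invr_ge0// exprn_ile1 ?invr_ge0// invf_le1// ler1n. Qed.

Lemma clamp_itv u : x <= clamp x u <= 1 - x.
Proof.
have := level_le => xl; rewrite /clamp le_max lexx/= ge_max ge_min lexx orbT andbT.
lra.
Qed.

Lemma clamp01 u : 0 < clamp x u < 1.
Proof. by have := clamp_itv u; have := level_gt0; lra. Qed.

Lemma clamp_id u : x <= u <= 1 - x -> clamp x u = u.
Proof. by move=> /andP[u0 u1]; rewrite /clamp min_l// max_r. Qed.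

Lemma clamp_low u : u <= x -> clamp x u = x.
Proof. by move=> u0; have := level_le => xl; rewrite /clamp min_l ?max_l//; lra. Qed.

Lemma clamp_high u : 1 - x <= u -> clamp x u = 1 - x.
Proof. by move=> u0; have := level_le => xl; rewrite /clamp min_r ?max_r//; lra. Qed.

Lemma clamp_lip u w : `|clamp x w - clamp x u| <= `|w - u|.
Proof.
have := level_le => xl; have [u0|u0] := leP u x.
  rewrite (clamp_low u0); have [w0|w0] := leP w x; first by rewrite clamp_low// subrr normr0.
  have [w1|w1] := leP (1 - x) w; first by rewrite clamp_high// !ger0_norm; lra.
  by rewrite clamp_id ?(ltW w0) ?(ltW w1)// !ger0_norm; lra.
have [u1|u1] := leP (1 - x) u.
  rewrite (clamp_high u1); have [w0|w0] := leP w x.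
    by rewrite clamp_low// distrC (distrC w) !ger0_norm; lra.
  have [w1|w1] := leP (1 - x) w; first by rewrite clamp_high// subrr normr0.
  by rewrite clamp_id ?(ltW w0) ?(ltW w1)// distrC (distrC w) !ger0_norm; lra.
rewrite (clamp_id (u := u)) ?(ltW u0) ?(ltW u1)//.
have [w0|w0] := leP w x; first by rewrite clamp_low// distrC (distrC w) !ger0_norm; lra.
have [w1|w1] := leP (1 - x) w; first by rewrite clamp_high// !ger0_norm; lra.
by rewrite clamp_id ?(ltW w0) ?(ltW w1).
Qed.

(** If neither factor vanishes, [w] lies beyond one of the levels with [u] short of it, and both
    factors are at most lengths of disjoint pieces of the segment between them. *)
Lemma clamp_cross u w : `|w - clamp x w| * `|clamp x w - clamp x u| <= (w - u) ^+ 2.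
Proof.
have := level_le => xl.
have sq a b : 0 <= a -> 0 <= b -> `|w - u| = a + b -> a * b <= (w - u) ^+ 2.
  by move=> a0 b0 E; rewrite -(real_normK (num_real (w - u))) E; nra.
have [w0|w0] := leP w x.
  rewrite (clamp_low w0); have [u0|u0] := leP u x.
    by rewrite clamp_low// subrr normr0 mulr0 sqr_ge0.
  rewrite distrC (ger0_norm (x := x - w)) ?subr_ge0//.
  have H : `|x - clamp x u| <= u - x.
    have := clamp_lip u x; rewrite clamp_low// (distrC x u) (ger0_norm (x := u - x))//.
    by rewrite subr_ge0 ltW.
  apply: (@le_trans _ _ ((x - w) * (u - x))); first by rewrite ler_wpM2l ?subr_ge0.
  by apply: sq; rewrite ?subr_ge0 ?(ltW u0)// distrC ger0_norm; lra.
have [w1|w1] := leP (1 - x) w; last first.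
  by rewrite clamp_id ?(ltW w0) ?(ltW w1)// subrr normr0 mul0r sqr_ge0.
rewrite (clamp_high w1); have [u1|u1] := leP (1 - x) u.
  by rewrite clamp_high// subrr normr0 mulr0 sqr_ge0.
rewrite (ger0_norm (x := w - (1 - x))) ?subr_ge0//.
have H : `|1 - x - clamp x u| <= 1 - x - u.
  have := clamp_lip u (1 - x); rewrite clamp_high// (ger0_norm (x := 1 - x - u))//.
  by rewrite subr_ge0 ltW.
apply: (@le_trans _ _ ((w - (1 - x)) * (1 - x - u))); first by rewrite ler_wpM2l ?subr_ge0.
by apply: sq; rewrite ?subr_ge0 ?(ltW u1)// ger0_norm; lra.
Qed.

Variables (C : R) (J j : R -> R).
Hypotheses (C0 : 0 <= C) (rJ : regular_score C J j)
  (mJ : mfunT J) (mj : mfunT j).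
Notation JM := (trunc x J j).

Lemma trunc_id u : x <= u <= 1 - x -> JM u = J u.
Proof.
move=> u01; have := level_gt0 => x0; rewrite /trunc clamp_id// clip01_id; last by lra.
by rewrite subrr mul0r addr0.
Qed.

Lemma trunc_half : JM 2^-1 = J 2^-1.
Proof. by apply: trunc_id; have := level_le; lra. Qed.

Let sqr_dev_le u w : x <= u <= 1 - x -> x <= w <= 1 - x ->
  sqr_dev u w <= 2 * x ^- 2 * (w - u) ^+ 2.
Proof.
move=> /andP[u0 u1] /andP[w0 w1]; have := level_gt0 => x0.
have -> : 2 * x ^- 2 * (w - u) ^+ 2 = (w - u) ^+ 2 * (x ^- 2 + x ^- 2).
  by move: (x ^- 2) => y; ring.
rewrite /sqr_dev ler_wpM2l ?sqr_ge0//.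
have H a b : x <= a -> x <= b -> (a * b)^-1 <= x ^- 2.
  move=> a0 b0; have xx : 0 < x ^+ 2 by rewrite exprn_gt0.
  have ab : 0 < a * b by rewrite mulr_gt0// (lt_le_trans x0).
  by rewrite lef_pV2 ?posrE// expr2 ler_pM// ltW.
by apply: lerD; apply: H => //; lra.
Qed.

Let deriv_lip u w : x <= u <= 1 - x -> x <= w <= 1 - x ->
  `|j w - j u| <= 4 * C * x ^- 2 * `|w - u|.
Proof.
move=> u01 w01; have x0 := level_gt0; have [_ _ _ Jt] := rJ.
have uu : 0 < u < 1 by lra.
have ww : 0 < w < 1 by lra.
have H1 := Jt _ _ uu ww; have H2 := Jt _ _ ww uu.
have Q1 := ler_wpM2l C0 (sqr_dev_le u01 w01); have Q2 := ler_wpM2l C0 (sqr_dev_le w01 u01).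
have [->|wu] := eqVneq w u; first by rewrite !subrr normr0 mulr0.
have p0 : 0 < `|w - u| by rewrite normr_gt0 subr_eq0.
rewrite -(ler_pM2l p0) -normrM.
rewrite (_ : (w - u) * (j w - j u) = (J w - J u - (w - u) * j u) + (J u - J w - (u - w) * j w)); last by ring.
apply: (le_trans (ler_normD _ _)); apply: (le_trans (lerD (le_trans H1 Q1) (le_trans H2 Q2))).
rewrite -(opprB w u) sqrrN -(real_normK (num_real (w - u))).
by move: `|w - u| (x ^- 2) => a b; rewrite le_eqVlt; apply/orP; left; apply/eqP; ring.
Qed.

(** The error splits into the Taylor remainder between the clamped points, quadratic because
    [sqr_dev] is regular away from the ends, and a change of slope along the linear piece, quadratic
    by [clamp_cross]. The constant depends on the level. *)
Lemma smooth_trunc : exists B, smooth B JM (j \o clamp x).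
Proof.
have x0 := level_gt0; have xl := level_le; have [sJ J2 jb Jt] := rJ.
have jc u : `|j (clamp x u)| <= C * x ^- 2.
  have c01 := clamp01 u; apply: (le_trans (jb _ c01)); rewrite ler_wpM2l//.
  have /andP[c0 c1] := clamp_itv u.
  have xx : 0 < x ^+ 2 by rewrite exprn_gt0.
  rewrite lef_pV2 ?posrE//; first by rewrite expr2 ler_pM ?(ltW x0)//; lra.
  by rewrite mulr_gt0//; lra.
have Jc u : `|J (clamp x u)| <= C * (1 + q.+1%:R).
  apply: (le_trans (score_envelope C0 sJ J2 (clamp01 u))); rewrite ler_wpM2l// lerD2l.
  by apply: abs_ell_le; exact: clamp_itv.
have i0 : 0 <= x ^- 2 by rewrite invr_ge0 exprn_ge0 ?ltW.
have Ci : 0 <= C * x ^- 2 by rewrite mulr_ge0.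
have Cq : 0 <= C * (1 + q.+1%:R) by rewrite mulr_ge0// addr_ge0.
exists (C * (1 + q.+1%:R) + 6 * (C * x ^- 2)); split.
- exact: measurable_trunc.
- exact: measurableT_comp mj (measurable_clamp x).
- move=> u; apply: (le_trans (ler_normD _ _)); apply: lerD => //.
  have H : `|clip01 u - clamp x u| <= 1.
    have := clip01_itv u; have := clamp_itv u => c01 k01; rewrite ler_norml; lra.
  rewrite normrM (le_trans (ler_pM _ _ H (jc u)))// mul1r; lra.
- by move=> u; apply: (le_trans (jc u)); lra.
- move=> u w u01 w01; rewrite /trunc/= !clip01_id//.
  set a := clamp x u; set b := clamp x w.
  rewrite (_ : _ - _ = (J b - J a - (b - a) * j a) + (w - b) * (j b - j a)); last by ring.
  have T := Jt _ _ (clamp01 u) (clamp01 w); rewrite -/a -/b in T.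
  have S := ler_wpM2l C0 (sqr_dev_le (clamp_itv u) (clamp_itv w)); rewrite -/a -/b in S.
  have L := deriv_lip (clamp_itv u) (clamp_itv w); rewrite -/a -/b in L.
  have ab : (b - a) ^+ 2 <= (w - u) ^+ 2.
    rewrite -(real_normK (num_real (b - a))) -(real_normK (num_real (w - u))).
    by rewrite lerXn2r ?nnegrE//; exact: clamp_lip.
  have cr := clamp_cross u w; rewrite -/a -/b in cr.
  have T2 : `|(w - b) * (j b - j a)| <= 4 * (C * x ^- 2) * (w - u) ^+ 2.
    rewrite normrM; apply: (le_trans (ler_wpM2l (normr_ge0 _) L)).
    rewrite [leLHS](_ : _ = 4 * (C * x ^- 2) * (`|w - b| * `|b - a|)); last first.
      by move: (x ^- 2) => y; ring.
    by rewrite ler_wpM2l// mulr_ge0.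
  apply: (le_trans (ler_normD _ _)); apply: (le_trans (lerD (le_trans T S) T2)).
  have A : C * (2 * x ^- 2 * (b - a) ^+ 2) <= 2 * (C * x ^- 2) * (w - u) ^+ 2.
    rewrite (_ : C * _ = 2 * (C * x ^- 2) * (b - a) ^+ 2); last by move: (x ^- 2) => y; ring.
    by rewrite ler_wpM2l// mulr_ge0.
  have sq : 0 <= (w - u) ^+ 2 by exact: sqr_ge0.
  have Z : 0 <= C * (1 + q.+1%:R) * (w - u) ^+ 2 by rewrite mulr_ge0.
  rewrite mulrDl; lra.
Qed.

Let ln_ge (t : R) : 0 < t -> 1 - t <= - ln t.
Proof. by move=> t0; have := @le_ln1Dx R (t - 1); rewrite (addrC 1) subrK => H; have := H _; lra. Qed.

Let half_le (y : R) : 0 < y -> y <= 2^-1 -> C / (y * (1 - y)) <= 2 * C / y.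
Proof.
move=> y0 y1; have v0 : 0 < 1 - y by lra.
have -> : 2 * C / y = C / (y * (1 - y)) * (2 * (1 - y)) by field; rewrite !gt_eqF.
by apply: ler_peMr; [apply: divr_ge0 => //; rewrite mulr_ge0 ?ltW|lra].
Qed.

(** The tangent slope is at most [2 C / x], while below [x] the logit increases by at least
    [(w - u) / x]. *)
Let low_segment u w : 0 < u -> u <= w -> w <= x ->
  (w - u) * `|j x| <= 2 * C * (ell w - ell u).
Proof.
move=> u0 uw wx; have x0 := level_gt0; have xl := level_le; have [_ _ jb _] := rJ.
have x01 : 0 < x < 1 by lra.
have w0 : 0 < w by lra.
have jx : `|j x| <= 2 * C / x.
  exact: (le_trans (jb _ x01) (half_le x0 xl)).
have E : (w - u) / x <= ell w - ell u.
  apply: (@le_trans _ _ (- ln (u / w))).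
    apply: le_trans (ln_ge _); last by rewrite divr_gt0.
    rewrite (_ : 1 - u / w = (w - u) / w); last by field; rewrite gt_eqF.
    by rewrite ler_wpM2l ?subr_ge0// lef_pV2.
  rewrite ln_div ?posrE// /ell.
  have : ln (1 - w) <= ln (1 - u) by rewrite ler_ln ?posrE; lra.
  lra.
apply: (@le_trans _ _ ((w - u) * (2 * C / x))); first by rewrite ler_wpM2l ?subr_ge0.
rewrite [leLHS](_ : _ = 2 * C * ((w - u) / x)); last by move: x^-1 => y; ring.
by rewrite ler_wpM2l// mulr_ge0.
Qed.

Let high_segment u w : 1 - x <= u -> u <= w -> w < 1 ->
  (w - u) * `|j (1 - x)| <= 2 * C * (ell w - ell u).
Proof.
move=> xu uw w1; have x0 := level_gt0; have xl := level_le; have [_ _ jb _] := rJ.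
have x01 : 0 < 1 - x < 1 by lra.
have jx : `|j (1 - x)| <= 2 * C / x.
  by have := jb _ x01; rewrite subKr (mulrC (1 - x)); move/le_trans; apply; exact: half_le x0 xl.
have u1 : 0 < 1 - u by lra.
have v1 : 0 < 1 - w by lra.
have E : (w - u) / x <= ell w - ell u.
  apply: (@le_trans _ _ (- ln ((1 - w) / (1 - u)))).
    apply: le_trans (ln_ge _); last by rewrite divr_gt0.
    rewrite (_ : 1 - _ / _ = (w - u) / (1 - u)); last by field; rewrite gt_eqF.
    by rewrite ler_wpM2l ?subr_ge0// lef_pV2 ?posrE//; lra.
  rewrite ln_div ?posrE// /ell.
  have : ln u <= ln w by rewrite ler_ln ?posrE; lra.
  lra.
apply: (@le_trans _ _ ((w - u) * (2 * C / x))); first by rewrite ler_wpM2l ?subr_ge0.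
rewrite [leLHS](_ : _ = 2 * C * ((w - u) / x)); last by move: x^-1 => y; ring.
by rewrite ler_wpM2l// mulr_ge0.
Qed.

Let ell_le (u w : R) : 0 < u -> u <= w -> w < 1 -> ell u <= ell w.
Proof.
move=> u0 uw w1; have l1 : ln u <= ln w by rewrite ler_ln ?posrE; lra.
have l2 : ln (1 - w) <= ln (1 - u) by rewrite ler_ln ?posrE; lra.
by rewrite /ell; lra.
Qed.

(** The path from [u] to [w] is cut at the two levels: the linear pieces cost [2 C] by the segment
    lemmas, the middle one [C], and logit increments along an increasing path add up. Unlike the
    bound in [smooth_trunc], this one is uniform in the level. *)
Lemma score_trunc : score (2 * C) JM.
Proof.
have x0 := level_gt0; have xl := level_le; have [sJ _ _ _] := rJ.
have C2 : C <= 2 * C by rewrite ler_peMl// ler1n.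
suff H u w : 0 < u -> u <= w -> w < 1 -> `|JM w - JM u| <= 2 * C * (ell w - ell u).
  move=> u w /andP[u0 u1] /andP[w0 w1]; have [uw|/ltW wu] := leP u w.
    rewrite distrC (le_trans (H u w _ _ _))// ler_wpM2l ?mulr_ge0// distrC; exact: ler_norm.
  by rewrite (le_trans (H w u _ _ _))// ler_wpM2l ?mulr_ge0//; exact: ler_norm.
move=> u0 uw w1.
have JE y : 0 < y -> y < 1 -> JM y = J (clamp x y) + (y - clamp x y) * j (clamp x y).
  by move=> y0 y1; rewrite /trunc clip01_id// !ltW.
rewrite !JE//; try lra.
have [wx|wx] := leP w x.
  rewrite !clamp_low//; last exact: le_trans wx.
  rewrite (_ : _ - _ = (w - u) * j x); last by ring.
  by rewrite normrM ger0_norm ?subr_ge0//; exact: low_segment.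
have [ux|ux] := leP (1 - x) u.
  rewrite !clamp_high//; last exact: le_trans uw.
  rewrite (_ : _ - _ = (w - u) * j (1 - x)); last by ring.
  by rewrite normrM ger0_norm ?subr_ge0//; exact: high_segment.
set a := clamp x u; set b := clamp x w.
have [a0 A] : u <= a /\ (a - u) * `|j a| <= 2 * C * (ell a - ell u).
  rewrite /a; have [u2|u2] := leP u x.
    by rewrite clamp_low//; split => //; exact: low_segment.
  by rewrite clamp_id ?(ltW u2) ?(ltW ux)// !subrr mul0r mulr0.
have [b0 B] : b <= w /\ (w - b) * `|j b| <= 2 * C * (ell w - ell b).
  rewrite /b; have [w2|w2] := leP (1 - x) w.
    by rewrite clamp_high//; split => //; exact: high_segment.
  by rewrite clamp_id ?(ltW w2) ?(ltW wx)// !subrr mul0r mulr0.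
have ab : a <= b.
  rewrite /a /b /clamp ge_max le_max lexx/= le_max; apply/orP; right.
  by rewrite le_min !ge_min uw lexx orbT.
have a01 := clamp01 u; have b01 := clamp01 w; rewrite -/a -/b in a01 b01.
have M : `|J b - J a| <= 2 * C * (ell b - ell a).
  apply: (le_trans (sJ _ _ b01 a01)); rewrite ger0_norm.
    by rewrite ler_wpM2r// subr_ge0 ell_le//; lra.
  by rewrite subr_ge0 ell_le//; lra.
rewrite (_ : _ - _ = (J b - J a) + (w - b) * j b + (a - u) * j a); last by ring.
rewrite (_ : 2 * C * _ = 2 * C * (ell b - ell a) + 2 * C * (ell w - ell b) + 2 * C * (ell a - ell u)); last by ring.
rewrite (le_trans (ler_normD _ _))// lerD//; last by rewrite normrM ger0_norm ?subr_ge0.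
rewrite (le_trans (ler_normD _ _))// lerD// normrM ger0_norm ?subr_ge0//.
Qed.

Lemma trunc_error_le u : 0 < u < 1 -> `|J (clamp x u)| <= `|J u| + 2 ->
  `|J u - JM u| <= (~~ (x <= u <= 1 - x))%:R * (2 * `|J u| + 2 + 2 * C).
Proof.
move=> u01 Jc; have x0 := level_gt0; have xl := level_le; have [_ _ jb _] := rJ.
case: (boolP (x <= u <= 1 - x)) => [ux|nux]; first by rewrite trunc_id// subrr normr0 mul0r.
rewrite mul1r /trunc clip01_id; last by lra.
have lin : `|(u - clamp x u) * j (clamp x u)| <= 2 * C.
  have c01 := clamp01 u; rewrite normrM.
  apply: (le_trans (ler_wpM2l (normr_ge0 _) (jb _ c01))).
  have H : `|u - clamp x u| <= x /\ x / (clamp x u * (1 - clamp x u)) <= 2.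
    have i2 : (1 - x)^-1 <= 2 by rewrite invf_ple ?posrE//; lra.
    have [ux|ux] := leP u x.
      rewrite clamp_low//; split; first by rewrite ler_norml; lra.
      by rewrite invfM mulrA divff ?mul1r// gt_eqF.
    have ux' : 1 - x <= u.
      by rewrite leNgt; apply: contra nux => ?; rewrite (ltW ux) ltW.
    rewrite clamp_high//; split; first by rewrite ler_norml; lra.
    by rewrite subKr invfM mulrC -mulrA mulVf ?mulr1// gt_eqF.
  case: H => H1 H2; have [c0 c1] := andP c01.
  have i0 : 0 <= C / (clamp x u * (1 - clamp x u)).
    by rewrite divr_ge0// mulr_ge0 ?ltW// subr_gt0.
  apply: (le_trans (ler_wpM2r i0 H1)); rewrite mulrCA mulrC ler_wpM2r//.
rewrite opprD addrA (le_trans (ler_normB _ _))// lerD//.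
by rewrite (le_trans (ler_normB _ _))//; lra.
Qed.

End fixed_level.
End truncation.

(** * Centred truncations and their error *)

Section centered_truncation.
Context {R : realType}.
Local Notation gam := (@std_normal R).

Lemma smooth_shift B J j (a : R) : smooth B J j -> smooth (B + `|a|) (fun u => J u - a) j.
Proof.
move=> sJ; have B0 := smooth_bound_ge0 sJ; have [mJ mj bJ bj T] := sJ; split=> //.
- exact: measurable_funB.
- by move=> u; rewrite (le_trans (ler_normB _ _))// lerD2r.
- by move=> u; rewrite (le_trans (bj u))// lerDl.
move=> u w u01 w01; rewrite opprB addrA subrK; apply: (le_trans (T _ _ u01 w01)).
by rewrite ler_wpM2r ?sqr_ge0// lerDl.
Qed.

Lemma smooth_le B B' J j : B <= B' -> smooth B J j -> smooth B' (J : R -> R) j.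
Proof.
move=> BB' [mJ mj bJ bj T]; split=> //.
- by move=> u; exact: le_trans (bJ u) BB'.
- by move=> u; exact: le_trans (bj u) BB'.
by move=> u w u01 w01; rewrite (le_trans (T _ _ u01 w01))// ler_wpM2r ?sqr_ge0.
Qed.

Lemma bmf_trunc q C J j : 0 <= C -> regular_score C J j -> mfunT J ->
  mfunT j -> bmf (trunc (2^-1 ^+ q.+1 : R) J j).
Proof.
move=> C0 rJ mJ mj; have [B [m1 _ b1 _ _]] := smooth_trunc q C0 rJ mJ mj.
by split => //; exists B.
Qed.

(** An exact square, so that [eta = 2^-(l+1)] meets the condition [eta ^+ 2] of the jackknife
    bound. *)
Definition level (l : nat) : R := 2^-1 ^+ (2 * l).+2.

Lemma levelE l : level l = (2^-1 ^+ l.+1) ^+ 2.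
Proof. by rewrite -exprM mulnC mulnS. Qed.

(** Centred under the uniform law, written as the image of the standard normal by [Phi]; this is
    what makes the influence a plain product under independence. *)
Definition ctrunc l (J j : R -> R) u : R :=
  trunc (level l) J j u - Ex gam (fun z => trunc (level l) J j (Phi z)).

Lemma smooth_cut l C J j : 0 <= C -> regular_score C J j -> mfunT J ->
  mfunT j -> exists B, smooth B (ctrunc l J j) (j \o clamp (level l)).
Proof.
move=> C0 rJ mJ mj; have [B sB] := smooth_trunc (2 * l).+1 C0 rJ mJ mj.
by eexists; exact: smooth_shift sB.
Qed.

Lemma Ex_uniform01 {d} {T : measurableType d} (P : probability T R) (U : T -> R) (f : R -> R) :
  uniform01 P U -> bmf f -> Ex P (fun w => f (U w)) = Ex gam (fun z => f (Phi z)).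
Proof.
move=> uU bf; have [mU _ _] := uU.
have mPhi : mfunT (@Phi R) by exact: (continuous_measurable (@continuous_Phi R)).
have bP : bmf (fun z => f (Phi z)) by exact: bmf_comp.
rewrite -(Ex_normal_score uU (bmf_itg gam bP)); apply: Ex_ae.
- by apply: bmf_itg; exact: bmf_comp.
- apply: bmf_itg; apply: (bmf_comp bP (f := fun w => Phi_inv (U w))).
  exact: (measurableT_comp measurable_Phi_inv).
- by apply: filterS (uniform01_itv_ae uU) => w u01; rewrite Phi_invK.
Qed.

Lemma Ex_cut {d} {T : measurableType d} (P : probability T R) (U : T -> R) l C J j :
  uniform01 P U -> 0 <= C -> regular_score C J j -> mfunT J ->
  mfunT j -> Ex P (fun w => ctrunc l J j (U w)) = 0.
Proof.
move=> uU C0 rJ mJ mj; have b := bmf_trunc (2 * l).+1 C0 rJ mJ mj.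
have [mU _ _] := uU.
rewrite /ctrunc ExB; [|by apply: bmf_itg; exact: (bmf_comp b)|exact: itg_cst].
by rewrite Ex_cst (Ex_uniform01 uU b) subrr.
Qed.

Section cut_error.
Variables (C : R) (J j : R -> R).
Hypotheses (C0 : 0 <= C) (rJ : regular_score C J j)
  (mJ : mfunT J) (mj : mfunT j)
  (Jclamp : forall l (u : R), 0 < u < 1 -> `|J (clamp (level l) u)| <= `|J u| + 2)
  (J4 : itg gam (fun z => J (Phi z) ^+ 4)) (J1 : Ex gam (fun z => J (Phi z)) = 0).

Let mPhi : mfunT (@Phi R).
Proof. exact: (continuous_measurable (@continuous_Phi R)). Qed.

Let mJP : mfunT (fun z => J (Phi z)). Proof. exact: measurableT_comp. Qed.

Let J2 : itg gam (fun z => J (Phi z) ^+ 2).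
Proof.
apply: (@itg_le _ _ _ gam _ (fun z => 1 + J (Phi z) ^+ 4)).
- exact: measurable_funX.
- by apply: itgD => //; exact: itg_cst.
- move=> z; rewrite ger0_norm ?sqr_ge0//; have := sqr_ge0 (J (Phi z) ^+ 2 - 1); nra.
Qed.

Lemma itg_score : itg gam (fun z => J (Phi z)).
Proof.
apply: (@itg_le _ _ _ gam _ (fun z => 1 + J (Phi z) ^+ 2)) => //.
  by apply: itgD => //; exact: itg_cst.
move=> z; rewrite -(real_normK (num_real (J (Phi z)))).
by have := sqr_ge0 (`|J (Phi z)| - 2^-1); nra.
Qed.

Definition tail_bound : R :=
  Ex gam (fun z => (2 * `|J (Phi z)| + 2 + 2 * C) ^+ 4) + 8.

(** The truncation error is dominated by [G] on the two tails, so its square is at most [t G^4] plus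
    the tail indicators over [t], and [t = 2^-l] balances a tail of probability [t^2 / 2]. Centring
    can only reduce the second moment, since [J] has mean zero. *)
Lemma cut_error l : Ex gam (fun z => (J (Phi z) - ctrunc l J j (Phi z)) ^+ 2) <=
  tail_bound * 2^-1 ^+ l.
Proof.
set x := level l; set t : R := 2^-1 ^+ l.
have x0 : 0 < x := level_gt0 (2 * l).+1.
have xl : x <= 2^-1 := level_le (2 * l).+1.
have t0 : 0 < t by rewrite exprn_gt0// invr_gt0.
have bt : bmf (fun z => trunc x J j (Phi z)).
  by apply: (bmf_comp (bmf_trunc (2 * l).+1 C0 rJ mJ mj)).
pose D z := J (Phi z) - trunc x J j (Phi z).
have iD : itg gam D by apply: itgB; [exact: itg_score|exact: bmf_itg].
pose G z := 2 * `|J (Phi z)| + 2 + 2 * C.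
have G0 z : 0 <= G z by rewrite !addr_ge0// mulr_ge0.
have mG : mfunT G.
  apply: measurable_funD => //; apply: measurable_funD => //; apply: measurable_funM => //.
  exact: measurableT_comp.
have iG : itg gam (fun z => G z ^+ 4).
  apply: (@itg_le _ _ _ gam _ (fun z => 64 * (4 * J (Phi z) ^+ 4 + (2 + 2 * C) ^+ 4))).
  - exact: measurable_funX.
  - by apply: itgZ; apply: itgD; [exact: itgZ|exact: itg_cst].
  - move=> z; rewrite ger0_norm ?exprn_ge0// /G -addrA.
    have -> : J (Phi z) ^+ 4 = `|J (Phi z)| ^+ 4 by rewrite -normrX ger0_norm// exprn_even_ge0.
    have y0 : 0 <= `|J (Phi z)| by [].
    move: `|J (Phi z)| y0 (2 + 2 * C) => y y0 b.
    have h (a c : R) : (a + c) ^+ 2 <= 2 * (a ^+ 2 + c ^+ 2) by have := sqr_ge0 (a - c); nra.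
    have h1 := h (2 * y) b; have h2 := h ((2 * y) ^+ 2) (b ^+ 2).
    rewrite (_ : (2 * y + b) ^+ 4 = ((2 * y + b) ^+ 2) ^+ 2); last by ring.
    have h3 : ((2 * y + b) ^+ 2) ^+ 2 <= (2 * ((2 * y) ^+ 2 + b ^+ 2)) ^+ 2.
      by rewrite lerXn2r ?nnegrE ?sqr_ge0// mulr_ge0// addr_ge0 ?sqr_ge0.
    apply: (le_trans h3); rewrite exprMn.
    have b4 : 0 <= b ^+ 4 by rewrite exprn_even_ge0.
    have y4 : 0 <= y ^+ 4 by rewrite exprn_even_ge0.
    have e1 : ((2 * y) ^+ 2) ^+ 2 = 16 * y ^+ 4 by ring.
    have e2 : (b ^+ 2) ^+ 2 = b ^+ 4 by ring.
    rewrite e1 e2 in h2; lra.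
pose o z : R := ((Phi z <= x)%R%:R + (1 - x <= Phi z)%R%:R).
have bb (b : R -> bool) : mfunT b -> itg gam (fun z => (b z)%:R).
  by move=> mb; apply: bmf_itg; exact: bmf_bool.
have io1 : itg gam (fun z => (Phi z <= x)%R%:R) by apply: bb; exact: measurable_fun_ler.
have io2 : itg gam (fun z => (1 - x <= Phi z)%R%:R) by apply: bb; exact: measurable_fun_ler.
have io : itg gam o by exact: itgD.
have Eo : Ex gam o = 2 * x.
  have lowE y : 0 < y < 1 -> Ex gam (fun z => (Phi z <= y)%R%:R) = y.
    move=> y01; rewrite -[RHS](Phi_invK y01) -ExPhi; congr (Ex _ _); apply/funext => z.
    by rewrite -[in LHS](Phi_invK y01) Phi_leE.
  rewrite ExD// lowE; last by lra.
  have -> : (fun z => (1 - x <= Phi z)%R%:R : R) = fun z => (Phi (- z) <= x)%R%:R.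
    by apply/funext => z; rewrite Phi_opp lerBlDl -lerBlDr.
  rewrite (@Ex_normal_opp _ (fun z => (Phi z <= x)%R%:R))//.
    by rewrite lowE; [ring|lra].
have DG z : D z ^+ 2 <= t * G z ^+ 4 + o z / t.
  have u01 := Phi_itv z.
  have := trunc_error_le C0 rJ u01 (Jclamp l u01); rewrite -/(D z) -/(G z) => H.
  have o0 : 0 <= o z by rewrite addr_ge0// ler0n.
  have Gt : 0 <= t * G z ^+ 4 by rewrite mulr_ge0 ?exprn_ge0// ltW.
  rewrite -(real_normK (num_real (D z))).
  have : (~~ (x <= Phi z <= 1 - x))%:R <= o z :> R.
    rewrite /o; have [p1|p1] := leP (Phi z) x; first by case: (~~ _); rewrite /= ?lerDl ?addr_ge0 ?ler0n.
    rewrite (ltW p1)/=; have [p2|p2] := leP (Phi z) (1 - x); first by rewrite /= addr_ge0// ler0n.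
    by rewrite (ltW p2) /= add0r.
  move: H; case: (~~ _) => /=; last first.
    rewrite mul0r => H _; have -> : `|D z| = 0 by apply/eqP; rewrite eq_le H normr_ge0.
    by rewrite expr0n addr_ge0// divr_ge0// ltW.
  rewrite mul1r => H o1.
  have H2 : `|D z| ^+ 2 <= G z ^+ 2 by rewrite lerXn2r ?nnegrE.
  apply: (le_trans H2); apply: (@le_trans _ _ (t * G z ^+ 4 + t^-1)); last first.
    by rewrite lerD2l ler_peMl// invr_ge0 ltW.
  have a0 : 0 <= t * G z ^+ 2 by rewrite mulr_ge0 ?sqr_ge0// ltW.
  rewrite -(ler_pM2l t0) mulrDr divff ?gt_eqF//.
  rewrite (_ : t * (t * G z ^+ 4) = (t * G z ^+ 2) ^+ 2); last by ring.
  move: (t * G z ^+ 2) a0 => y y0; have := sqr_ge0 (y - 1); nra.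
have mD : mfunT D by exact: itg_measurable iD.
have iM : itg gam (fun z => t * G z ^+ 4 + o z / t).
  by apply: itgD; [exact: itgZ|under eq_fun do rewrite mulrC; exact: itgZ].
have iD2 : itg gam (fun z => D z ^+ 2).
  apply: (itg_le _ iM); first exact: measurable_funX.
  by move=> z; rewrite ger0_norm ?sqr_ge0.
have ED : Ex gam (fun z => D z ^+ 2) <= tail_bound * t.
  apply: (@le_trans _ _ (Ex gam (fun z => t * G z ^+ 4 + o z / t))); first exact: le_Ex.
  rewrite ExD; [|exact: itgZ|under eq_fun do rewrite mulrC; exact: itgZ].
  under [X in _ + Ex _ X]eq_fun do rewrite mulrC.
  rewrite !ExZ// Eo /tail_bound [leRHS]mulrDl (mulrC t) lerD2l.
  have -> : x = 4^-1 * t ^+ 2.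
    by rewrite /x /level /t -exprM (mulnC l) !exprS mulrA; congr (_ * _); field.
  have -> : t^-1 * (2 * (4^-1 * t ^+ 2)) = 2^-1 * t by field; rewrite gt_eqF.
  by rewrite ler_wpM2r// ?ltW//; lra.
apply: le_trans ED.
set m := Ex gam (fun z => trunc x J j (Phi z)).
have mE : m = - Ex gam D by rewrite /D ExB ?J1 ?sub0r ?opprK//; [exact: itg_score|exact: bmf_itg].
have -> : (fun z => (J (Phi z) - ctrunc l J j (Phi z)) ^+ 2) =
   fun z => D z ^+ 2 + (2 * m * D z + m ^+ 2).
  by apply/funext => z; rewrite /ctrunc -/x -/m /D; ring.
rewrite ExD//; last by apply: itgD; [exact: itgZ|exact: itg_cst].
rewrite ExD ?Ex_cst ?ExZ//; [|exact: itgZ|exact: itg_cst].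
rewrite gerDl (_ : Ex gam D = - m); last by rewrite mE opprK.
by rewrite (_ : _ + _ = - m ^+ 2); [rewrite oppr_le0 sqr_ge0|ring].
Qed.

End cut_error.
End centered_truncation.

Lemma sqr_sum3_le (F : realFieldType) (x y z : F) :
  (x + y + z) ^+ 2 <= 3 * (x ^+ 2 + y ^+ 2 + z ^+ 2).
Proof.
by have := sqr_ge0 (x - y); have := sqr_ge0 (y - z); have := sqr_ge0 (x - z); lra.
Qed.

Lemma le_sum3 (F : realFieldType) (x y z u v : F) :
  x <= u -> y <= u -> z <= v -> x + y + z <= 2 * u + v.
Proof. by move=> *; lra. Qed.

Lemma centered_sum3 (F : realFieldType) (t t' s s' a x y z x' y' z' : F) :
  t - s = x + y + z - a -> t' - s' = x' + y' + z' - a ->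
  t - t' - (s - s') = x - x' + (y - y') + (z - z').
Proof. by move=> *; lra. Qed.

(** * Approximation of rank sums in L2 *)

Section l2_approximation.
Context {R : realType} {dT} {T : measurableType dT}.
Notation E := (R * R)%type.

Definition flip (e : E) : E := (e.2, e.1).

Lemma measurable_flip : mfunT flip.
Proof. exact/measurable_fun_pair. Qed.

Lemma mutually_independent_comp {d1 d2} {T1 : measurableType d1} {T2 : measurableType d2}
  (P : probability T R) (Z : nat -> T -> T1) (g : T1 -> T2) : mfunT g ->
  mutually_independent P Z -> mutually_independent P (fun i => g \o Z i).
Proof.
move=> mg iZ I A mA; have mgA i : measurable (g @^-1` A i).
  by rewrite -[X in measurable X]setTI; exact: mg.
exact: (iZ I (fun i => g @^-1` A i) mgA).
Qed.

Lemma same_law_comp {d' d1 d2} {T' : measurableType d'} {T1 : measurableType d1}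
  {T2 : measurableType d2} (P : probability T R) (P' : probability T' R) (U : T -> T1)
  (V : T' -> T1) (g : T1 -> T2) : mfunT g ->
  same_law P P' U V -> same_law P P' (g \o U) (g \o V).
Proof.
move=> mg UV A mA; apply: (UV (g @^-1` A)).
by rewrite -[X in measurable X]setTI; exact: mg.
Qed.

Variables (P : probability T R) (Z : nat -> T -> E).
Hypotheses (mZ : forall i, mfunT (Z i))
  (indepZ : mutually_independent P Z)
  (idZ : forall i, same_law P P (Z i) (Z 0))
  (Z01 : forall i w, 0 <= (Z i w).1 <= 1 /\ 0 <= (Z i w).2 <= 1)
  (uZ1 : uniform01 P (fst \o Z 0)) (uZ2 : uniform01 P (snd \o Z 0)).

Lemma variance_rank_sum_tail2 C eta (D K : R -> R) n : 0 <= C -> 0 < eta ->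
  score C D -> score C K -> `|D 2^-1| <= C -> `|K 2^-1| <= C ->
  (forall u, eta ^+ 2 <= u <= 1 - eta ^+ 2 -> D u = 0) ->
  1 <= n.+2%:R * eta ^+ 2 ->
  Ex P (fun w => (rank_sum K D n (smp Z w) -
                  Ex P (fun w => rank_sum K D n (smp Z w))) ^+ 2) <=
  2 * n%:R * (jack_const * C ^+ 4 * eta).
Proof.
move=> C0 eta0 sD sK D2 K2 Dmid nbig.
have mf i : mfunT (flip \o Z i) by exact: (measurableT_comp measurable_flip).
have := @variance_rank_sum_tail _ _ _ P (fun i => flip \o Z i) mf
  (mutually_independent_comp measurable_flip indepZ)
  (fun i => same_law_comp measurable_flip (idZ i)) uZ2 uZ1 C eta D K n C0 eta0 sD sK D2 K2 Dmid nbig.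
have E0 : (fun w => rank_sum D K n (smp (fun i => flip \o Z i) w)) = fun w => rank_sum K D n (smp Z w).
  by apply/funext => w; apply: eq_bigr => k _; rewrite mulrC.
pose V (f : T -> R) := Ex P (fun w => (f w - Ex P f) ^+ 2).
by move=> H; rewrite -[leLHS]/(V (fun w => rank_sum K D n (smp Z w))) -E0.
Qed.

Variables (C : R) (J j K k : R -> R).
Hypotheses (C0 : 0 <= C) (rJ : regular_score C J j) (rK : regular_score C K k)
  (mJ : mfunT J) (mj : mfunT j)
  (mK : mfunT K) (mk : mfunT k).

Definition cut_influence l (e : E) : R :=
  influence P Z (ctrunc l J j) (j \o clamp (level l)) (ctrunc l K k) (k \o clamp (level l)) e -
  Ex P (fun w => influence P Z (ctrunc l J j) (j \o clamp (level l)) (ctrunc l K k)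
    (k \o clamp (level l)) (Z 0 w)).

Let smooth_cut2 l : exists B, smooth B (ctrunc l J j) (j \o clamp (level l)) /\
  smooth B (ctrunc l K k) (k \o clamp (level l)).
Proof.
have [B1 s1] := smooth_cut l C0 rJ mJ mj; have [B2 s2] := smooth_cut l C0 rK mK mk.
exists (Num.max B1 B2); split; [apply: smooth_le s1|apply: smooth_le s2];
  by rewrite le_max lexx ?orbT.
Qed.

Lemma bmf_cut_influence l : bmf (cut_influence l).
Proof.
have [B [s1 s2]] := smooth_cut2 l.
by apply: bmfB; [exact: (bmf_influence P mZ s1 s2)|exact: bmf_cst].
Qed.

Lemma Ex_cut_influence l : Ex P (cut_influence l \o Z 0) = 0.
Proof.
have [B [s1 s2]] := smooth_cut2 l; have b := bmf_influence P mZ s1 s2.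
rewrite /cut_influence /comp ExB; [|by apply: bmf_itg; exact: (bmf_comp b)|exact: itg_cst].
by rewrite Ex_cst subrr.
Qed.

(** Subtracting constants from the scores only produces sums over a single rank, which are
    deterministic off ties; [a n] collects them and disappears from variances. *)
Lemma rank_sum_cut_ae l : exists a : nat -> R, {ae P, forall w, forall n,
  rank_sum (ctrunc l J j) (ctrunc l K k) n (smp Z w) =
  rank_sum (trunc (level l) J j) (trunc (level l) K k) n (smp Z w) + a n}.
Proof.
set JM := trunc _ J j; set KM := trunc _ K k.
pose al := Ex std_normal (fun z => JM (Phi z)); pose be := Ex std_normal (fun z => KM (Phi z)).
exists (fun n => - be * (\sum_(1 <= p < n.+1) JM (p%:R / n.+1%:R)) -
  al * (\sum_(1 <= p < n.+1) KM (p%:R / n.+1%:R)) + n%:R * (al * be)).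
apply: filterS (no_ties2 mZ indepZ idZ uZ1 uZ2) => w H n; have [dx dy] := H n.
rewrite -(big_rank_in _ (fun p => JM (p%:R / n.+1%:R)) dx).
rewrite -(big_rank_in _ (fun p => KM (p%:R / n.+1%:R)) dy).
rewrite !mulr_sumr (_ : n%:R * (al * be) = \sum_(i < n) al * be); last first.
  by rewrite sumr_const card_ord mulr_natl.
rewrite /rank_sum -sumrB -!big_split/=; apply: eq_bigr => i _.
by rewrite /ctrunc -/JM -/KM -/al -/be /full; ring.
Qed.

Let bounds l : [/\ forall u : R, level l <= u <= 1 - level l -> J u - trunc (level l) J j u = 0,
   forall u : R, level l <= u <= 1 - level l -> K u - trunc (level l) K k u = 0,
   score (4 * C) (fun u => J u - trunc (level l) J j u) &
   score (4 * C) (fun u => K u - trunc (level l) K k u)].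
Proof.
have C2 : C <= 2 * C by rewrite ler_peMl// ler1n.
have [sJ _ _ _] := rJ; have [sK _ _ _] := rK.
have E4 : 4 * C = 2 * (2 * C) by ring.
split.
- by move=> u u01; rewrite (_ : trunc _ J j u = J u) ?subrr//; exact: trunc_id.
- by move=> u u01; rewrite (_ : trunc _ K k u = K u) ?subrr//; exact: trunc_id.
- by rewrite E4; apply: scoreB; [exact: score_le sJ|exact: score_trunc C0 rJ].
- by rewrite E4; apply: scoreB; [exact: score_le sK|exact: score_trunc C0 rK].
Qed.

Notation Tn n w := (rank_sum J K n (smp Z w)).

(** Two tail rank sums have variances of order [n eta], and the smooth one differs from its
    influences by a bounded variance, which is negligible after division by [n]. *)
Lemma rank_sum_approx l : \forall n \near \oo,
  Ex P (fun w => ((Num.sqrt n%:R)^-1 * (Tn n w - Ex P (fun w => Tn n w)) -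
     (Num.sqrt n%:R)^-1 * \sum_(i < n) cut_influence l (Z i w)) ^+ 2) <=
  (6 * (jack_const * (4 * C) ^+ 4) + 1) * 2^-1 ^+ l.
Proof.
have [B [s1 s2]] := smooth_cut2 l; have [z1 z2 sc1 sc2] := bounds l.
have [sJ J2 _ _] := rJ; have [sK K2 _ _] := rK.
have C4 : C <= 4 * C by rewrite ler_peMl// ler1n.
have C24 : 2 * C <= 4 * C by rewrite ler_wpM2r// ler_nat.
have C40 : 0 <= 4 * C by rewrite mulr_ge0.
set JM := trunc (level l) J j; set KM := trunc (level l) K k.
set infl := influence P Z (ctrunc l J j) (j \o clamp (level l)) (ctrunc l K k) (k \o clamp (level l)).
have binf : bmf infl by exact: (bmf_influence P mZ s1 s2).
set eta : R := 2^-1 ^+ l.+1; have eta0 : 0 < eta by exact: level_gt0.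
have eE : level l = eta ^+ 2 := levelE l.
have [a aE] := rank_sum_cut_ae l.
have L0 : (0 : R) < 2^-1 ^+ l by rewrite exprn_gt0// invr_gt0.
have [y yE] : exists y, y = 12 * 800 * B ^+ 4 by eexists.
near=> n; have n0 : (0 < n)%N by near: n; exact: nbhs_infty_gt.
have nR : (0 : R) < n%:R by rewrite ltr0n.
have nbig : 1 <= n.+2%:R * eta ^+ 2.
  rewrite -ler_pdivrMr ?exprn_gt0// mul1r (@le_trans _ _ n%:R) ?ler_nat ?leqW//.
  by near: n; exact: nbhs_infty_ger.
have nB : 3 * y / 2^-1 ^+ l <= n%:R by near: n; exact: nbhs_infty_ger.
(* The difference [J K - JM KM] is split as [(J - JM) K + JM (K - KM)], so each part has a tail
   score in one coordinate. Their variances give [12 eta = 6 * 2^-l] times the jackknife constant,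
   and [D3] gives the added 1. *)
pose D1 w := rank_sum (fun u => J u - JM u) K n (smp Z w).
pose D2 w := rank_sum JM (fun u => K u - KM u) n (smp Z w).
pose D3 w := rank_sum (ctrunc l J j) (ctrunc l K k) n (smp Z w) - \sum_(i < n) infl (Z i w).
have bT (F G : R -> R) : bmf (fun w => rank_sum F G n (smp Z w)).
  by exact: (bstat_bmf (bstat_rank_sum F G n) (mfamily_smp mZ)).
have bS : bmf (fun w => \sum_(i < n) infl (Z i w)).
  by apply: bmf_sum => i _; exact: (bmf_comp binf (mZ i)).
have b1 : bmf D1 := bT _ _; have b2 : bmf D2 := bT _ _.
have b3 : bmf D3 by exact: bmfB.
pose V (f : T -> R) := Ex P (fun w => (f w - Ex P f) ^+ 2).
have V1 : V D1 <= 2 * n%:R * (jack_const * (4 * C) ^+ 4 * eta).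
  apply: variance_rank_sum_tail => //.
  - exact: score_le sK.
  - by rewrite /JM (trunc_half (2 * l).+1) subrr normr0.
  - exact: le_trans K2 C4.
  - by move=> u u01; apply: z1; rewrite eE.
have V2 : V D2 <= 2 * n%:R * (jack_const * (4 * C) ^+ 4 * eta).
  apply: variance_rank_sum_tail2 => //.
  - exact: score_le C24 (score_trunc (2 * l).+1 C0 rJ).
  - by rewrite /KM (trunc_half (2 * l).+1) subrr normr0.
  - by rewrite /JM (trunc_half (2 * l).+1); exact: le_trans J2 C4.
  - by move=> u u01; apply: z2; rewrite eE.
have V3 : V D3 <= y.
  by rewrite yE; exact: (variance_rank_sum_linear mZ indepZ idZ Z01 uZ1 uZ2 s1 s2 n).
have TE : {ae P, forall w, Tn n w - \sum_(i < n) infl (Z i w) = D1 w + D2 w + D3 w - a n}.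
  apply: filterS aE => w /(_ n) Ew.
  rewrite /D3 Ew -/JM -/KM.
  have -> : Tn n w = D1 w + D2 w + rank_sum JM KM n (smp Z w).
    rewrite /D1 /D2 /rank_sum -!big_split/=; apply: eq_bigr => i _; ring.
  ring.
have ETE : Ex P (fun w => Tn n w) - n%:R * Ex P (fun w => infl (Z 0 w)) =
    Ex P D1 + Ex P D2 + Ex P D3 - a n.
  have -> : n%:R * Ex P (fun w => infl (Z 0 w)) = Ex P (fun w => \sum_(i < n) infl (Z i w)).
    rewrite Ex_sum; last by move=> i _; apply: bmf_itg; exact: (bmf_comp binf (mZ i)).
    rewrite (eq_bigr (fun=> Ex P (fun w => infl (Z 0 w)))).
      by rewrite sumr_const card_ord mulr_natl.
    by move=> i _; exact: (Ex_iid mZ idZ i binf).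
  rewrite -ExB; [|exact: bmf_itg|exact: bmf_itg].
  have b12 : bmf (fun w => D1 w + D2 w) by exact: bmfD.
  have b123 : bmf (fun w => D1 w + D2 w + D3 w) by exact: bmfD.
  have -> : Ex P D1 + Ex P D2 + Ex P D3 - a n = Ex P (fun w => D1 w + D2 w + D3 w - a n).
    rewrite ExB; [|exact: bmf_itg|exact: itg_cst].
    rewrite (ExD (bmf_itg P b12) (bmf_itg P b3)) (ExD (bmf_itg P b1) (bmf_itg P b2)).
    by rewrite Ex_cst.
  apply: Ex_ae => //; first by apply: bmf_itg; exact: bmfB.
  by apply: bmf_itg; apply: bmfB => //; exact: bmf_cst.
have c1 (f : T -> R) : bmf f -> bmf (fun w => (f w - Ex P f) ^+ 2).
  by move=> bf; apply: bmfX; apply: bmfB => //; exact: bmf_cst.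
apply: (@le_trans _ _ (Ex P (fun w => 3 / n%:R * ((D1 w - Ex P D1) ^+ 2 + (D2 w - Ex P D2) ^+ 2 + (D3 w - Ex P D3) ^+ 2)))).
  apply: le_Ex_ae.
  - apply: bmf_itg; apply: bmfX; apply: bmfB; apply: bmfZ.
      by apply: bmfB => //; exact: bmf_cst.
    by apply: bmf_sum => i _; exact: (bmf_comp (bmf_cut_influence l) (mZ i)).
  - by apply: bmf_itg; apply: bmfZ; apply: bmfD; [apply: bmfD|]; exact: c1.
  - apply: filterS TE => w Ew.
    have -> : \sum_(i < n) cut_influence l (Z i w) = \sum_(i < n) infl (Z i w) - n%:R * Ex P (fun w => infl (Z 0 w)).
      by rewrite sumrB sumr_const card_ord mulr_natl.
    rewrite -mulrBr exprMn exprVn sqr_sqrtr ?(ltW nR)//.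
    have -> : Tn n w - Ex P (fun w => Tn n w) - (\sum_(i < n) infl (Z i w) - n%:R * Ex P (fun w => infl (Z 0 w))) =
        (D1 w - Ex P D1) + (D2 w - Ex P D2) + (D3 w - Ex P D3).
      exact: centered_sum3 Ew ETE.
    rewrite (mulrC 3) -mulrA ler_wpM2l ?invr_ge0 ?(ltW nR)//.
    exact: sqr_sum3_le.
have i1 := bmf_itg P (c1 _ b1); have i2 := bmf_itg P (c1 _ b2); have i3 := bmf_itg P (c1 _ b3).
rewrite ExZ; last by apply: itgD => //; exact: itgD.
rewrite ExD//; last exact: itgD.
rewrite ExD// -!/(V _).
have B4 : 3 / n%:R * y <= 2^-1 ^+ l.
  by rewrite mulrAC ler_pdivrMr// (mulrC _ n%:R) -ler_pdivrMr.
set c := jack_const * (4 * C) ^+ 4 in V1 V2 *.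
have eta2 : eta = 2^-1 * 2^-1 ^+ l by rewrite /eta exprS.
apply: (@le_trans _ _ (3 / n%:R * (2 * (2 * n%:R * (c * eta)) + y))).
  apply: ler_wpM2l; first by rewrite divr_ge0// ltW.
  exact: le_sum3 V1 V2 V3.
rewrite [leLHS]mulrDr [leRHS]mulrDl mul1r; apply: lerD => //.
rewrite eta2 le_eqVlt; apply/orP; left; apply/eqP.
by move: (2^-1 ^+ l) => t; field; rewrite gt_eqF.
Unshelve. all: by end_near.
Qed.

End l2_approximation.

(** * Normal scores on the grid and under the normal law *)

Section normal_score_facts.
Context {R : realType}.
Local Notation gam := (@std_normal R).
Local Notation phi := (normal_pdf (0 : R) 1).

Lemma measurable_dPhi_inv : mfunT (@dPhi_inv R).
Proof.
apply: (measurableT_comp (f := fun x : R => (phi x)^-1)); last exact: measurable_Phi_inv.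
apply: continuous_measurable => x; apply: cvgV; first by rewrite gt_eqF// phi_gt0.
by have := is_derive_phi x => /@ex_derive/derivable1_diffP/differentiable_continuous.
Qed.

Lemma measurable_normal_sq : mfunT (@normal_sq R).
Proof. by apply: measurable_funB => //; apply: measurable_funX; exact: measurable_Phi_inv. Qed.

Lemma measurable_dnormal_sq : mfunT (@dnormal_sq R).
Proof.
apply: measurable_funM; last exact: measurable_dPhi_inv.
by apply: measurable_funM => //; exact: measurable_Phi_inv.
Qed.

Lemma Phi_inv_le (u w : R) : 0 < u < 1 -> 0 < w < 1 -> u <= w -> Phi_inv u <= Phi_inv w.
Proof. by move=> u01 w01 uw; rewrite -Phi_leE !Phi_invK. Qed.

Lemma Phi_inv_half : Phi_inv (2^-1 : R) = 0.
Proof.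
have h01 : 0 < (2^-1 : R) < 1 by lra.
have := Phi_inv_opp h01; rewrite (_ : 1 - 2^-1 = 2^-1); last by field.
by move=> H; lra.
Qed.

Lemma Phi_inv_clamp q (u : R) : 0 < u < 1 ->
  `|Phi_inv (clamp (2^-1 ^+ q.+1) u)| <= `|Phi_inv u|.
Proof.
move=> u01; have x0 := @level_gt0 R q; have xl := @level_le R q; have c01 := clamp01 q u.
have h01 : 0 < (2^-1 : R) < 1 by lra.
have [ux|ux] := leP u (2^-1 ^+ q.+1).
  rewrite clamp_low// in c01 *.
  have h := Phi_inv_le c01 h01 xl; rewrite Phi_inv_half in h.
  have h' := Phi_inv_le u01 c01 ux.
  by rewrite ler0_norm// ler0_norm ?lerN2//; exact: le_trans h.
have [ux'|ux'] := leP (1 - 2^-1 ^+ q.+1) u; last by rewrite clamp_id// (ltW ux) ltW.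
rewrite clamp_high// in c01 *.
have h : 0 <= Phi_inv (1 - 2^-1 ^+ q.+1 : R).
  by rewrite -Phi_inv_half; apply: Phi_inv_le => //; lra.
have h' := Phi_inv_le c01 u01 ux'.
by rewrite ger0_norm// ger0_norm//; exact: le_trans h'.
Qed.

Lemma Phi_inv_level l (u : R) : 0 < u < 1 ->
  `|Phi_inv (clamp (level l) u)| <= `|Phi_inv u| + 2.
Proof. by move=> u01; apply: (le_trans (Phi_inv_clamp _ u01)); rewrite lerDl. Qed.

Lemma normal_sq_level l (u : R) : 0 < u < 1 ->
  `|normal_sq (clamp (level l) u)| <= `|normal_sq u| + 2.
Proof.
move=> u01; have := Phi_inv_clamp (2 * l).+1 u01; rewrite /normal_sq -/(level l).
move: (Phi_inv (clamp _ u)) (Phi_inv u) => a b ab.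
have : a ^+ 2 <= b ^+ 2.
  by rewrite -(real_normK (num_real a)) -(real_normK (num_real b)) lerXn2r ?nnegrE.
have := ler_norm (b ^+ 2 - 1); have := sqr_ge0 a; have := sqr_ge0 b.
rewrite (ler_norml (a ^+ 2 - 1)); lra.
Qed.

Lemma normal_sqPhi (z : R) : normal_sq (Phi z) = z ^+ 2 - 1.
Proof. by rewrite /normal_sq PhiK. Qed.

Lemma itg_Phi_inv4 : itg gam (fun z => Phi_inv (Phi z) ^+ 4).
Proof. by under eq_fun do rewrite PhiK; exact: itg_normal_pow. Qed.

Lemma itg_normal_sq4 : itg gam (fun z => normal_sq (Phi z) ^+ 4).
Proof.
under eq_fun do rewrite normal_sqPhi.
apply: (itg_ext (f := fun z : R => z ^+ 8 - 4 * z ^+ 6 + 6 * z ^+ 4 - 4 * z ^+ 2 + 1)).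
  have i k := @itg_normal_pow R k.
  apply: itgD; last exact: itg_cst.
  apply: itgB; last exact: itgZ.
  apply: itgD; last exact: itgZ.
  by apply: itgB => //; exact: itgZ.
by move=> z; ring.
Qed.

Lemma Ex_Phi_inv1 : Ex gam (fun z => Phi_inv (Phi z)) = 0.
Proof. by under eq_fun do rewrite PhiK; exact: normal_mean. Qed.

Lemma Ex_normal_sq1 : Ex gam (fun z => normal_sq (Phi z)) = 0.
Proof.
under eq_fun do rewrite normal_sqPhi.
by rewrite ExB ?normal_second_moment ?Ex_cst ?subrr//; [exact: itg_normal_pow|exact: itg_cst].
Qed.

Lemma Ex_Phi_inv2 : Ex gam (fun z => Phi_inv (Phi z) ^+ 2) = 1.
Proof. by under eq_fun do rewrite PhiK; exact: normal_second_moment. Qed.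

Definition normal_sq_var : R := Ex gam (fun z => normal_sq (Phi z) ^+ 2).

Lemma itg_normal_sq2 : itg gam (fun z => normal_sq (Phi z) ^+ 2).
Proof.
under eq_fun do rewrite normal_sqPhi.
apply: (itg_ext (f := fun z : R => z ^+ 4 - 2 * z ^+ 2 + 1)).
  have i k := @itg_normal_pow R k.
  by apply: itgD; [apply: itgB => //; exact: itgZ|exact: itg_cst].
by move=> z; ring.
Qed.

(* If the variance vanished, [z ^+ 2] would be almost surely equal to [1], and
   [E exp (- 3 z ^+ 2 / 2) = 1 / 2] would be equal to [exp (- 3 / 2)]. *)
Lemma normal_sq_var_gt0 : 0 < normal_sq_var.
Proof.
have V0 : 0 <= normal_sq_var by apply: Ex_ge0 => z; exact: sqr_ge0.
rewrite lt_neqAle V0 andbT; apply/eqP => /esym VE.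
have q0 : (0 : R) < 2^-1 by lra.
have := Ex_exp_sqr q0; have := itg_normal_exp_sqr q0.
have -> : (2^-1 ^- 2 - 1) / 2 = 3 / 2 :> R by field.
set g := fun z : R => expR _ => ig Eg.
have i2 := itg_normal_sq2.
have e0 : expR (- (3 / 2)) <= 2 / 5 :> R.
  rewrite expRN invf_ple ?posrE ?expR_gt0//; have := expR_ge1Dx (3 / 2 : R); lra.
(* With [exp(-3/2) <= 2/5], convexity of the exponential bounds [g z] by 2/5 plus a multiple of
   [y p], which costs 3/40 and a square of [y]. What matters is that 19/40 is below 1/2. *)
have H (z : R) : g z <= 19 / 40 + 15 / 2 * normal_sq (Phi z) ^+ 2.
  rewrite normal_sqPhi /g; set y := z ^+ 2 - 1.
  have -> : - (3 / 2) * z ^+ 2 = - (3 / 2 * z ^+ 2) by ring.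
  have z0 : 0 <= 3 / 2 * z ^+ 2 by rewrite mulr_ge0// sqr_ge0.
  set a := 3 / 2 * z ^+ 2 in z0 *.
  have ea : expR (- a) <= 1 by rewrite -expR0 ler_expR oppr_le0.
  have ea0 : 0 < expR (- a) := expR_gt0 _.
  have : 1 + (a - 3 / 2) <= expR (a - 3 / 2) by exact: expR_ge1Dx.
  have : expR (- a) * expR (a - 3 / 2) = expR (- (3 / 2)).
    by rewrite -expRD; congr expR; ring.
  move: (expR (- a)) (expR (a - 3 / 2)) ea ea0 => p r p1 p0 pr rge.
  have pr2 : p * (1 + (a - 3 / 2)) <= expR (- (3 / 2)) by rewrite -pr ler_wpM2l// ltW.
  have ay : a - 3 / 2 = 3 / 2 * y by rewrite /a /y; field.
  rewrite ay in pr2.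
  have : - (3 / 2 * y * p) <= 3 / 40 + 15 / 2 * y ^+ 2.
    have : 0 <= (y + p / 10) ^+ 2 by exact: sqr_ge0.
    have : p ^+ 2 <= 1 by rewrite exprn_ile1// ltW.
    nra.
  nra.
have := le_Ex ig (itgD (itg_cst gam (19 / 40)) (itgZ (15 / 2) i2)) H.
rewrite ExD ?Ex_cst ?ExZ//; [|exact: itg_cst|exact: itgZ].
rewrite Eg -/normal_sq_var VE; lra.
Qed.

Lemma Phi_inv_odd_sum n : \sum_(1 <= p < n.+1) Phi_inv (p%:R / n.+1%:R : R) = 0.
Proof.
set S := \sum_(_ <= _ < _) _.
suff : S = - S by move=> H; lra.
rewrite /S -sumrN big_nat_rev/=; apply: eq_big_nat => p /andP[p1 pn].
rewrite -Phi_inv_opp; last first.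
  by rewrite divr_gt0 ?ltr0n//= ltr_pdivrMr ?ltr0n// mul1r ltr_nat.
congr (Phi_inv _); rewrite add1n subSS natrB; last by lia.
by rewrite mulrBl divff// pnatr_eq0.
Qed.

Definition grid n (f : R -> R) : R := n%:R^-1 * \sum_(1 <= p < n.+1) f (p%:R / n.+1%:R).

Lemma score_mean_a n : score_mean n (@score_a R n) = 0.
Proof. by rewrite /score_mean /score_a Phi_inv_odd_sum mulr0. Qed.

Lemma score_var_a n : score_var n (@score_a R n) = grid n (fun u => Phi_inv u * Phi_inv u).
Proof.
rewrite /score_var score_mean_a; congr (_ * _); apply: eq_bigr => p _.
by rewrite subr0 expr2.
Qed.

Lemma score_mean_b n : (0 < n)%N ->
  score_mean n (@score_b R n) = grid n (fun u => Phi_inv u * Phi_inv u).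
Proof. by []. Qed.

(** The variance about the mean rewritten about 1, so that it is a grid mean of [normal_sq] squared
    minus a correction of second order. *)
Lemma score_var_b n : (0 < n)%N -> score_var n (@score_b R n) =
  grid n (fun u => normal_sq u * normal_sq u) -
  (grid n (fun u => Phi_inv u * Phi_inv u) - 1) ^+ 2.
Proof.
move=> n0; have nR : (0 : R) < n%:R by rewrite ltr0n.
rewrite /score_var score_mean_b//; set m := grid n (fun u => Phi_inv u * _).
have S1 : \sum_(1 <= p < n.+1) Phi_inv (p%:R / n.+1%:R : R) ^+ 2 = n%:R * m.
  by rewrite /m /grid mulrA divff ?mul1r ?gt_eqF.
rewrite /grid (eq_bigr (fun p => normal_sq (p%:R / n.+1%:R : R) * normal_sq (p%:R / n.+1%:R : R) +
   (2 * (1 - m) * Phi_inv (p%:R / n.+1%:R : R) ^+ 2 + (m ^+ 2 - 1)))); last first.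
  by move=> p _; rewrite /score_b /score_a /normal_sq; ring.
rewrite big_split big_split/= -mulr_sumr S1 sumr_const_nat subSS subn0 -mulr_natl.
by field; rewrite gt_eqF.
Qed.

End normal_score_facts.

(** * Rates and perturbation of L2 approximations *)

Section rates.
Context {R : realType}.

Lemma sqrt_rate (b : nat -> R) B : (forall m, b m.+1 ^+ 4 * m.+1%:R ^+ 3 <= B) ->
  Num.sqrt n%:R * b n @[n --> \oo] --> 0.
Proof.
move=> bB; apply/cvgrPdist_le => e e0.
have e4 : 0 < e ^+ 4 by rewrite exprn_gt0.
near=> n; have n0 : (0 < n)%N by near: n; exact: nbhs_infty_gt.
have nR : (0 : R) < n%:R by rewrite ltr0n.
have nB : B / e ^+ 4 <= n%:R by near: n; exact: nbhs_infty_ger.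
rewrite sub0r normrN -(@ler_pXn2r _ 4) ?nnegrE ?(ltW e0)//.
rewrite -normrX ger0_norm ?exprn_even_ge0// exprMn.
rewrite (_ : Num.sqrt n%:R ^+ 4 = n%:R ^+ 2); last first.
  by rewrite -[in RHS](sqr_sqrtr (ltW nR)) -exprM.
have := bB n.-1; rewrite prednK// => H.
rewrite -(ler_pM2r nR); apply: (@le_trans _ _ B).
  by rewrite (_ : _ * _ * _ = b n ^+ 4 * n%:R ^+ 3)//; ring.
by rewrite mulrC -ler_pdivrMr.
Unshelve. all: by end_near.
Qed.

Lemma sqrt_rate_cvg0 (b : nat -> R) : Num.sqrt n%:R * b n @[n --> \oo] --> 0 ->
  b n @[n --> \oo] --> 0.
Proof.
move=> bn; apply/cvgrPdist_le => e e0; move/cvgrPdist_le : bn => /(_ e e0) bn.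
near=> n; have n0 : (0 < n)%N by near: n; exact: nbhs_infty_gt.
have H : `|0 - Num.sqrt n%:R * b n| <= e by near: n.
move: H; rewrite !sub0r !normrN normrM ger0_norm//; apply: le_trans.
by rewrite ler_peMl// -[leLHS]sqrtr1 ler_sqrt// ler1n.
Unshelve. all: by end_near.
Qed.

Context {d} {T : measurableType d}.
Variable P : probability T R.

(** A quantitative Slutsky argument in L2: a convergent factor and a vanishing offset cost
    arbitrarily little as the second moments of [Xn] are bounded, and this loss is absorbed in the
    added [dl]. *)
Lemma affine_l2 (Xn Wn : nat -> T -> R) (cn dn : nat -> R) (c dl C : R) :
  (forall n, bmf (Xn n)) -> (forall n, bmf (Wn n)) -> cn n @[n --> \oo] --> c ->
  dn n @[n --> \oo] --> 0 -> 0 < dl ->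
  (\forall n \near \oo, Ex P (fun w => Xn n w ^+ 2) <= C) ->
  (\forall n \near \oo, Ex P (fun w => (Xn n w - Wn n w) ^+ 2) <= dl) ->
  \forall n \near \oo, Ex P (fun w => (cn n * Xn n w + dn n - c * Wn n w) ^+ 2) <=
    (3 * c ^+ 2 + 1) * dl.
Proof.
move=> bX bW cc dd dl0 XC XW.
have M0 : 0 < 3 * (`|C| + 2) by rewrite mulr_gt0// ltr_wpDl.
pose t := Num.min 1 (dl / (3 * (`|C| + 2))).
have t0 : 0 < t by rewrite lt_min ltr01 divr_gt0.
have sm s : 0 <= s -> s <= t -> s ^+ 2 <= dl / (3 * (`|C| + 2)).
  move=> s0 st; have s1 : s <= 1 by rewrite (le_trans st)// ge_min lexx.
  have s2 : s <= dl / (3 * (`|C| + 2)) by rewrite (le_trans st)// ge_min lexx orbT.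
  by rewrite expr2 (le_trans _ s2)// ler_piMl.
near=> n.
have c1 : `|c - cn n| <= t by near: n; move/cvgrPdist_le: cc; apply.
have d1 : `|0 - dn n| <= t by near: n; move/cvgrPdist_le: dd; apply.
have X1 : Ex P (fun w => Xn n w ^+ 2) <= C by near: n.
have W1 : Ex P (fun w => (Xn n w - Wn n w) ^+ 2) <= dl by near: n.
have i1 : itg P (fun w => Xn n w ^+ 2) by apply: bmf_itg; exact: bmfX.
have i2 : itg P (fun w => (Xn n w - Wn n w) ^+ 2) by apply: bmf_itg; apply: bmfX; exact: bmfB.
have c2 := sm _ (normr_ge0 _) c1; have d2 := sm _ (normr_ge0 _) d1.
rewrite real_normK ?num_real// in c2; rewrite sub0r normrN real_normK ?num_real// in d2.
apply: (@le_trans _ _ (Ex P (fun w => 3 * (c - cn n) ^+ 2 * Xn n w ^+ 2 + 3 * dn n ^+ 2 +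
    3 * c ^+ 2 * (Xn n w - Wn n w) ^+ 2))).
  apply: le_Ex.
  - apply: bmf_itg; apply: bmfX; apply: bmfB; last exact: bmfZ.
    by apply: bmfD; [exact: bmfZ|exact: bmf_cst].
  - by apply: itgD; [apply: itgD; [exact: itgZ|exact: itg_cst]|exact: itgZ].
  - move=> w; move: (Xn n w) (Wn n w) (cn n) (dn n) => x y a b.
    rewrite (_ : a * x + b - c * y = - ((c - a) * x) + b + c * (x - y)); last by ring.
    have -> : 3 * (c - a) ^+ 2 * x ^+ 2 + 3 * b ^+ 2 + 3 * c ^+ 2 * (x - y) ^+ 2 =
        3 * ((c - a) * x) ^+ 2 + 3 * b ^+ 2 + 3 * (c * (x - y)) ^+ 2 by ring.
    move: ((c - a) * x) (c * (x - y)) => p q.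
    have := sqr_ge0 (p + b); have := sqr_ge0 (p + q); have := sqr_ge0 (b - q); nra.
rewrite ExD; [|by apply: itgD; [exact: itgZ|exact: itg_cst]|exact: itgZ].
rewrite ExD; [|exact: itgZ|exact: itg_cst].
rewrite (ExZ (3 * (c - cn n) ^+ 2) i1) (ExZ (3 * c ^+ 2) i2) Ex_cst [leRHS]mulrDl mul1r [leLHS]addrC; apply: lerD.
  by rewrite ler_wpM2l// mulr_ge0// sqr_ge0.
have X0 : 0 <= Ex P (fun w => Xn n w ^+ 2) by apply: Ex_ge0 => w; exact: sqr_ge0.
move: c2 d2; set s := dl / _ => c2 d2.
have s0 : 0 <= s by apply: le_trans c2; exact: sqr_ge0.
have sE : 3 * (s * (`|C| + 2)) = dl by rewrite /s; field; rewrite gt_eqF// ltr_wpDl.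
have XC' : Ex P (fun w => Xn n w ^+ 2) <= `|C| by exact: le_trans (ler_norm C).
have : (c - cn n) ^+ 2 * Ex P (fun w => Xn n w ^+ 2) <= s * `|C| by rewrite ler_pM// sqr_ge0.
lra.
Unshelve. all: by end_near.
Qed.

Lemma cvg_to_normal2_ae (Y Y' : nat -> T -> R * R) m Sigma :
  (forall n, mfunT (Y n)) -> (forall n, mfunT (Y' n)) ->
  {ae P, forall w, forall n, Y n w = Y' n w} ->
  cvg_to_normal2 P Y m Sigma -> cvg_to_normal2 P Y' m Sigma.
Proof.
move=> mY mY' YY [mu muN cv]; exists mu => // f cf [M fM].
have mf : mfunT f by case: (bmf_continuous2 cf fM).
rewrite (_ : (fun n => _) = fun n => 'E_P[f \o Y n]%E); first by apply: cv => //; exists M.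
apply/funext => n; rewrite unlock; apply: ae_eq_integral => //.
- by apply/measurable_EFinP; exact: measurableT_comp.
- by apply/measurable_EFinP; exact: measurableT_comp.
- by apply: filterS YY => w Yw _ /=; rewrite Yw.
Qed.

(** Write [f g - F G] as [f (g - G) + g (f - F) - (f - F) (g - G)] and apply Cauchy-Schwarz to each
    term. *)
Lemma Ex_mul_continuous (f g F G : T -> R) (df dg a b : R) : bmf F -> bmf G ->
  itg P f -> itg P g -> itg P (fun w => f w ^+ 2) -> itg P (fun w => g w ^+ 2) ->
  Ex P (fun w => (f w - F w) ^+ 2) <= df ^+ 2 -> Ex P (fun w => (g w - G w) ^+ 2) <= dg ^+ 2 ->
  Ex P (fun w => f w ^+ 2) <= a ^+ 2 -> Ex P (fun w => g w ^+ 2) <= b ^+ 2 ->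
  0 <= df -> 0 <= dg -> 0 <= a -> 0 <= b ->
  `|Ex P (fun w => f w * g w) - Ex P (fun w => F w * G w)| <= a * dg + b * df + df * dg.
Proof.
move=> bF bG if1 ig1 if2 ig2 Hf Hg fa gb df0 dg0 a0 b0.
have mf := itg_measurable if1; have mg := itg_measurable ig1.
have mul2 (p q : T -> R) : mfunT p -> mfunT q ->
    itg P (fun w => p w ^+ 2) -> itg P (fun w => q w ^+ 2) -> itg P (fun w => p w * q w).
  move=> mp mq ip iq; apply: (itg_le _ (itgD ip iq)); first exact: measurable_funM.
  move=> w; rewrite normrM -(real_normK (num_real (p w))) -(real_normK (num_real (q w))).
  by have := sqr_ge0 (`|p w| - `|q w|); have := normr_ge0 (p w); have := normr_ge0 (q w); nra.
have mF : mfunT F by case: bF.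
have mG : mfunT G by case: bG.
have iF2 : itg P (fun w => F w ^+ 2) by apply: bmf_itg; exact: bmfX.
have iG2 : itg P (fun w => G w ^+ 2) by apply: bmf_itg; exact: bmfX.
have sqB (p q : T -> R) : mfunT p -> mfunT q ->
    itg P (fun w => p w ^+ 2) -> itg P (fun w => q w ^+ 2) -> itg P (fun w => (p w - q w) ^+ 2).
  move=> mp mq ip iq; apply: (itg_ext (f := fun w => p w ^+ 2 + q w ^+ 2 - 2 * (p w * q w))).
    by apply: itgB; [exact: itgD|apply: itgZ; exact: mul2].
  by move=> w; ring.
have idf := sqB _ _ mf mF if2 iF2; have idg := sqB _ _ mg mG ig2 iG2.
have CS (p q : T -> R) s t : mfunT p -> mfunT q ->
    itg P (fun w => p w ^+ 2) -> itg P (fun w => q w ^+ 2) -> 0 <= s -> 0 <= t ->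
    Ex P (fun w => p w ^+ 2) <= s ^+ 2 -> Ex P (fun w => q w ^+ 2) <= t ^+ 2 ->
    `|Ex P (fun w => p w * q w)| <= s * t.
  move=> mp mq ip iq s0 t0 ps qt.
  rewrite -(@ler_pXn2r _ 2) ?nnegrE ?mulr_ge0// real_normK ?num_real//.
  apply: (le_trans (Ex_CS (mul2 _ _ mp mq ip iq) ip iq)); rewrite exprMn ler_pM//;
    by apply: Ex_ge0 => w; exact: sqr_ge0.
have md1 : mfunT (fun w => f w - F w) by exact: measurable_funB.
have md2 : mfunT (fun w => g w - G w) by exact: measurable_funB.
have h1 := CS _ _ a dg mf md2 if2 idg a0 dg0 fa Hg.
have h2 := CS _ _ b df mg md1 ig2 idf b0 df0 gb Hf.
have h3 := CS _ _ df dg md1 md2 idf idg df0 dg0 Hf Hg.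
have j1 := mul2 _ _ mf md2 if2 idg; have j2 := mul2 _ _ mg md1 ig2 idf.
have j3 := mul2 _ _ md1 md2 idf idg.
have jfg := mul2 _ _ mf mg if2 ig2.
have jFG : itg P (fun w => F w * G w) by apply: bmf_itg; exact: bmfM.
have E : Ex P (fun w => f w * g w) - Ex P (fun w => F w * G w) =
    Ex P (fun w => f w * (g w - G w)) + Ex P (fun w => g w * (f w - F w)) -
    Ex P (fun w => (f w - F w) * (g w - G w)).
  rewrite -ExB// -ExD// -ExB//; last exact: itgD.
  by congr (Ex P _); apply/funext => w; ring.
rewrite E (le_trans (ler_normB _ _))// lerD// (le_trans (ler_normD _ _))// lerD//.
Qed.

End rates.

(** * Rates and approximation for one score *)

Section rank_statistics_limits.
Context {R : realType} {dT} {T : measurableType dT}.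
Notation E := (R * R)%type.
Local Notation gam := (@std_normal R).
Variables (P : probability T R) (Z : nat -> T -> E).
Hypotheses (mZ : forall i, mfunT (Z i))
  (indepZ : mutually_independent P Z)
  (idZ : forall i, same_law P P (Z i) (Z 0))
  (Z01 : forall i w, 0 <= (Z i w).1 <= 1 /\ 0 <= (Z i w).2 <= 1)
  (uZ1 : uniform01 P (fst \o Z 0)) (uZ2 : uniform01 P (snd \o Z 0)).

Let dup (e : E) : E := (e.1, e.1).

Section one_score.
Variables (C : R) (F J j : R -> R).
Hypotheses (C0 : 0 <= C) (rJ : regular_score C J j)
  (mF : mfunT F) (JF : forall u, J u = F (Phi_inv u))
  (mj : mfunT j) (F4 : itg gam (fun z => F z ^+ 4)).

Let mJ : mfunT J.
Proof.
rewrite (_ : J = F \o @Phi_inv R); last exact/funext.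
exact: (measurableT_comp mF measurable_Phi_inv).
Qed.

Let itg4 (U : T -> R) : uniform01 P U -> itg P (fun w => J (U w) ^+ 4).
Proof. by move=> uU; under eq_fun do rewrite JF; exact: (itg_normal_score uU F4). Qed.

Lemma rank_mean_rate : exists B, forall m,
  (m.+1%:R^-1 * Ex P (fun w => rank_sum J J m.+1 (smp Z w)) -
   Ex P (fun w => J (Z 0 w).1 * J (Z 0 w).2)) ^+ 4 * m.+1%:R ^+ 3 <= B.
Proof.
have [B HB] := @rank_bias_rate _ _ _ P Z mZ indepZ idZ (fun i w => (Z01 i w).1)
  (fun i w => (Z01 i w).2) uZ1 uZ2 C J j J j C0 rJ rJ mJ mj mJ mj (itg4 uZ1) (itg4 uZ2).
by exists B => m; rewrite (Ex_rank_sum mZ indepZ idZ) mulKf ?pnatr_eq0.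
Qed.

(** For the sample of pairs [(U, U)] both ranks coincide, so off ties the rank sum is the
    deterministic grid sum. The bias bound for this sample is therefore the rate of convergence of
    the grid mean. *)
Lemma grid_rate : exists B, forall m,
  (grid m.+1 (fun u => J u * J u) - Ex gam (fun z => F z ^+ 2)) ^+ 4 * m.+1%:R ^+ 3 <= B.
Proof.
have md : mfunT dup by exact/measurable_fun_pair.
have mZ' i : mfunT (dup \o Z i) by exact: measurableT_comp.
have iZ' := mutually_independent_comp md indepZ.
have dZ' i := same_law_comp md (idZ i).
have z1 i w : 0 <= ((dup \o Z i) w).1 <= 1 by case: (Z01 i w).
have z2 i w : 0 <= ((dup \o Z i) w).2 <= 1 by case: (Z01 i w).
have [B HB] := @rank_bias_rate _ _ _ P (fun i => dup \o Z i) mZ' iZ' dZ' z1 z2 uZ1 uZ1 C J j J j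
  C0 rJ rJ mJ mj mJ mj (itg4 uZ1) (itg4 uZ1).
exists B => m; have := HB m.
have -> : Ex P (fun w => J ((dup \o Z 0) w).1 * J ((dup \o Z 0) w).2) = Ex gam (fun z => F z ^+ 2).
  have F2 : itg gam (fun z => F z ^+ 2).
    apply: (@itg_le _ _ _ gam _ (fun z => 1 + F z ^+ 4)).
    - exact: measurable_funX.
    - by apply: itgD => //; exact: itg_cst.
    - by move=> z; rewrite ger0_norm ?sqr_ge0//; have := sqr_ge0 (F z ^+ 2 - 1); nra.
  rewrite -(Ex_normal_score uZ1 F2); congr (Ex P _); apply/funext => w /=.
  by rewrite JF expr2.
suff -> : Ex P (fun w => J (full m.+1 (fst \o smp (fun i => dup \o Z i) w) m) *
    J (full m.+1 (snd \o smp (fun i => dup \o Z i) w) m)) = grid m.+1 (fun u => J u * J u) by [].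
apply: (mulfI (_ : m.+1%:R != 0 :> R)); first by rewrite pnatr_eq0.
rewrite -(Ex_rank_sum mZ' iZ' dZ' J J m) /grid mulVKf ?pnatr_eq0//.
rewrite -[RHS](Ex_cst P); apply: Ex_ae.
- exact: (itg_bstat P mZ' (bstat_rank_sum J J m.+1)).
- exact: itg_cst.
- apply: filterS (no_ties2 mZ' iZ' dZ' uZ1 uZ1) => w /(_ m.+1)[dx _].
  exact: (big_rank_in _ (fun p => J (p%:R / m.+2%:R) * J (p%:R / m.+2%:R)) dx).
Qed.

Notation Tn n w := (rank_sum J J n (smp Z w)).

Definition rank_dev n w : R := (Num.sqrt n%:R)^-1 * (Tn n w - Ex P (fun w => Tn n w)).

Lemma bmf_rank_dev_sum n : bmf (rank_dev n).
Proof.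
apply: bmfZ; apply: bmfB; last exact: bmf_cst.
exact: (bstat_bmf (bstat_rank_sum J J n) (mfamily_smp mZ)).
Qed.

Definition approx_const : R := 6 * (jack_const * (4 * C) ^+ 4) + 1.

Lemma approx_const_gt0 : 0 < approx_const.
Proof.
have jc : 0 <= jack_const :> R.
  rewrite /jack_const; apply: mulr_ge0; first exact: ler0n.
  apply: addr_ge0; first exact: ler0n.
  by apply: mulr_ge0; [exact: ler0n|apply: exprn_ge0; exact: ler0n].
rewrite /approx_const; move: (jack_const : R) jc => y y0; apply: ltr_wpDl => //.
by apply: mulr_ge0 => //; apply: mulr_ge0 => //; rewrite exprn_even_ge0.
Qed.

Lemma rank_dev_approx (cn dn : nat -> R) (c : R) l : cn n @[n --> \oo] --> c ->
  dn n @[n --> \oo] --> 0 ->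
  \forall n \near \oo, Ex P (fun w => (cn n * rank_dev n w + dn n -
    (Num.sqrt n%:R)^-1 * \sum_(i < n) (c * cut_influence P Z J j J j l (Z i w))) ^+ 2) <=
    (3 * c ^+ 2 + 1) * approx_const * 2^-1 ^+ l.
Proof.
move=> cc dd.
have bI l' := bmf_cut_influence P mZ C0 rJ rJ mJ mj mJ mj l'.
pose W l' n w : R := (Num.sqrt n%:R)^-1 * \sum_(i < n) cut_influence P Z J j J j l' (Z i w).
have bW l' n : bmf (W l' n).
  by apply: bmfZ; apply: bmf_sum => i _; exact: (bmf_comp (bI l') (mZ i)).
have XW l' : \forall n \near \oo, Ex P (fun w => (rank_dev n w - W l' n w) ^+ 2) <= approx_const * 2^-1 ^+ l'.
  exact: (rank_sum_approx mZ indepZ idZ Z01 uZ1 uZ2 C0 rJ rJ mJ mj mJ mj l').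
pose v := Ex P (fun w => cut_influence P Z J j J j 0 (Z 0 w) ^+ 2).
have EW n : (0 < n)%N -> Ex P (fun w => W 0%N n w ^+ 2) = v.
  move=> n0; have r0 : 0 < Num.sqrt n%:R :> R by rewrite sqrtr_gt0 ltr0n.
  under eq_fun do rewrite exprMn.
  rewrite ExZ; last first.
    by apply: bmf_itg; apply: bmfX; apply: bmf_sum => i _; exact: (bmf_comp (bI 0%N) (mZ i)).
  rewrite (Ex_sum_sqr mZ indepZ idZ n (bI 0%N) (Ex_cut_influence P mZ C0 rJ rJ mJ mj mJ mj 0)).
  by rewrite mulrA -{2}[n%:R]sqr_sqrtr// -exprMn mulVf ?gt_eqF// expr1n mul1r.
have XC : \forall n \near \oo, Ex P (fun w => rank_dev n w ^+ 2) <= 2 * approx_const + 2 * v.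
  near=> n; have n0 : (0 < n)%N by near: n; exact: nbhs_infty_gt.
  have H : Ex P (fun w => (rank_dev n w - W 0%N n w) ^+ 2) <= approx_const * 2^-1 ^+ 0 by near: n; exact: XW.
  rewrite expr0 mulr1 in H; rewrite -(EW n n0).
  have bX := bmf_rank_dev_sum n.
  have i1 : itg P (fun w => (rank_dev n w - W 0%N n w) ^+ 2) by apply: bmf_itg; apply: bmfX; exact: bmfB.
  have i2 : itg P (fun w => W 0%N n w ^+ 2) by apply: bmf_itg; exact: bmfX.
  apply: (@le_trans _ _ (2 * Ex P (fun w => (rank_dev n w - W 0%N n w) ^+ 2) + 2 * Ex P (fun w => W 0%N n w ^+ 2))).
    rewrite -!ExZ// -ExD; [|exact: itgZ|exact: itgZ]; apply: le_Ex.
    - by apply: bmf_itg; exact: bmfX.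
    - by apply: itgD; exact: itgZ.
    - by move=> w; move: (rank_dev n w) (W 0%N n w) => x y; have := sqr_ge0 (x - 2 * y); nra.
  by rewrite lerD2r ler_wpM2l.
have dl0 : 0 < approx_const * 2^-1 ^+ l by rewrite mulr_gt0 ?approx_const_gt0// exprn_gt0// invr_gt0.
have := affine_l2 bmf_rank_dev_sum (bW l) cc dd dl0 XC (XW l).
apply: filterS => n; rewrite mulrA; set G := fun w => (_ + _ - c * _) ^+ 2.
suff -> : G = fun w => (cn n * rank_dev n w + dn n -
    (Num.sqrt n%:R)^-1 * \sum_(i < n) (c * cut_influence P Z J j J j l (Z i w))) ^+ 2 by [].
by apply/funext => w; rewrite /G /W -mulr_sumr [c * _]mulrCA.
Unshelve. all: by end_near.
Qed.

End one_score.
End rank_statistics_limits.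

(** * Limits of covariances and the independent case *)

Section limit_covariance.
Context {R : realType}.
Local Notation gam := (@std_normal R).

Lemma cut_product_cvg C1 C2 (J j K k : R -> R) : 0 <= C1 -> 0 <= C2 ->
  regular_score C1 J j -> regular_score C2 K k ->
  mfunT J -> mfunT j -> mfunT K -> mfunT k ->
  (forall l (u : R), 0 < u < 1 -> `|J (clamp (level l) u)| <= `|J u| + 2) ->
  (forall l (u : R), 0 < u < 1 -> `|K (clamp (level l) u)| <= `|K u| + 2) ->
  itg gam (fun z => J (Phi z) ^+ 4) -> itg gam (fun z => K (Phi z) ^+ 4) ->
  Ex gam (fun z => J (Phi z)) = 0 -> Ex gam (fun z => K (Phi z)) = 0 ->
  Ex gam (fun z => ctrunc l J j (Phi z) * ctrunc l K k (Phi z)) @[l --> \oo] -->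
  Ex gam (fun z => J (Phi z) * K (Phi z)).
Proof.
move=> C10 C20 rJ rK mJ mj mK mk Jc Kc J4 K4 J1 K1.
have mPhi : mfunT (@Phi R) by exact: (continuous_measurable (@continuous_Phi R)).
have bcut l C0 (F f : R -> R) : 0 <= C0 -> regular_score C0 F f -> mfunT F ->
    mfunT f -> bmf (fun z => ctrunc l F f (Phi z)).
  move=> c0 rF mF mf; apply: bmfB; last exact: bmf_cst.
  by apply: (bmf_comp (bmf_trunc _ c0 rF mF mf)).
have sq (F : R -> R) : mfunT F -> itg gam (fun z => F (Phi z) ^+ 4) ->
    itg gam (fun z => F (Phi z) ^+ 2).
  move=> mF F4; apply: (@itg_le _ _ _ gam _ (fun z => 1 + F (Phi z) ^+ 4)).
  - by apply: measurable_funX; exact: measurableT_comp.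
  - by apply: itgD => //; exact: itg_cst.
  - by move=> z; rewrite ger0_norm ?sqr_ge0//; have := sqr_ge0 (F (Phi z) ^+ 2 - 1); nra.
pose a := Num.sqrt (Ex gam (fun z => J (Phi z) ^+ 2)).
pose b := Num.sqrt (Ex gam (fun z => K (Phi z) ^+ 2)).
pose t1 := Num.sqrt (tail_bound C1 J); pose t2 := Num.sqrt (tail_bound C2 K).
have tb0 C0 (F : R -> R) : 0 <= tail_bound C0 F.
  by rewrite addr_ge0//; apply: Ex_ge0 => z; rewrite exprn_even_ge0.
pose s l : R := Num.sqrt (2^-1 ^+ l).
have s0 : s l @[l --> \oo] --> 0.
  have h1 : `|2^-1 : R| < 1 by rewrite ger0_norm ?invr_ge0// invf_lt1// ltr1n.
  apply/cvgrPdist_le => e e0.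
  have := cvg_expr h1; move/cvgrPdist_le => /(_ (e ^+ 2)); rewrite exprn_gt0// => /(_ isT).
  apply: filterS => l; rewrite !sub0r !normrN (ger0_norm (sqrtr_ge0 _)).
  rewrite ger0_norm ?exprn_ge0 ?invr_ge0// => H.
  by rewrite -[leRHS]ger0_norm ?(ltW e0)// -sqrtr_sqr ler_sqrt ?exprn_ge0 ?(ltW e0).
have dist l : `|Ex gam (fun z => J (Phi z) * K (Phi z)) -
    Ex gam (fun z => ctrunc l J j (Phi z) * ctrunc l K k (Phi z))| <=
    (a * t2 + b * t1) * s l + t1 * t2 * (s l * s l).
  have L0 : (0 : R) <= 2^-1 ^+ l by rewrite exprn_ge0// invr_ge0.
  have := @Ex_mul_continuous _ _ _ gam (fun z => J (Phi z)) (fun z => K (Phi z))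
    (fun z => ctrunc l J j (Phi z)) (fun z => ctrunc l K k (Phi z)) (t1 * s l) (t2 * s l) a b
    (bcut l C1 J j C10 rJ mJ mj) (bcut l C2 K k C20 rK mK mk)
    (itg_score mJ J4) (itg_score mK K4) (sq J mJ J4) (sq K mK K4).
  rewrite !exprMn !sqr_sqrtr ?tb0//; try by apply: Ex_ge0 => z; exact: sqr_ge0.
  move=> /(_ (cut_error C10 rJ mJ mj Jc J4 J1 l) (cut_error C20 rK mK mk Kc K4 K1 l)).
  rewrite !lexx !mulr_ge0 ?sqrtr_ge0// => /(_ isT isT isT isT isT isT)/le_trans; apply.
  by rewrite le_eqVlt; apply/orP; left; apply/eqP; ring.
have lim0 : (a * t2 + b * t1) * s l + t1 * t2 * (s l * s l) @[l --> \oo] --> 0.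
  have : (a * t2 + b * t1) * s l + t1 * t2 * (s l * s l) @[l --> \oo] -->
      (a * t2 + b * t1) * 0 + t1 * t2 * (0 * 0).
    by apply: cvgD; [exact: (cvgM (cvg_cst _) s0)|exact: (cvgM (cvg_cst _) (cvgM s0 s0))].
  by rewrite !mulr0 addr0.
apply/cvgrPdist_le => e e0; move/cvgrPdist_le : lim0 => /(_ e e0).
apply: filterS => l H; apply: (le_trans (dist l)); apply: le_trans H.
by rewrite sub0r normrN ler_norm.
Qed.

Context {dT} {T : measurableType dT}.
Notation E := (R * R)%type.
Variables (P : probability T R) (Z : nat -> T -> E).
Hypotheses (mZ : forall i, mfunT (Z i))
  (Z01 : forall i w, 0 <= (Z i w).1 <= 1 /\ 0 <= (Z i w).2 <= 1)
  (uZ1 : uniform01 P (fst \o Z 0)) (uZ2 : uniform01 P (snd \o Z 0))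
  (indUV : independent_RV P (fst \o Z 0) (snd \o Z 0)).

Let mU : mfunT (fst \o Z 0). Proof. exact: measurableT_comp. Qed.
Let mV : mfunT (snd \o Z 0). Proof. exact: measurableT_comp. Qed.

Section cut_covariance.
Variables (C : R) (J j : R -> R).
Hypotheses (C0 : 0 <= C) (rJ : regular_score C J j)
  (mJ : mfunT J) (mj : mfunT j).

Let bcut l : bmf (ctrunc l J j).
Proof. by apply: bmfB; [exact: (bmf_trunc _ C0 rJ mJ mj)|exact: bmf_cst]. Qed.

(** Each term of the mean of [rank_kernel] factors, under independence, with the mean of a centred
    score in the other coordinate as one factor, and so vanishes. *)
Lemma cut_influence_independent l w : cut_influence P Z J j J j l (Z 0 w) =
  ctrunc l J j (Z 0 w).1 * ctrunc l J j (Z 0 w).2.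
Proof.
have [B [mc mjc bc bjc _]] := smooth_cut l C0 rJ mJ mj.
set f := ctrunc l J j in mc bc *; set f' := j \o clamp (level l) in mjc bjc.
have c1 i w0 : clip01 (Z i w0).1 = (Z i w0).1 by apply: clip01_id; case: (Z01 i w0).
have c2 i w0 : clip01 (Z i w0).2 = (Z i w0).2 by apply: clip01_id; case: (Z01 i w0).
have bf : bmf f by split => //; exists B.
have bf' : bmf f' by split => //; exists B.
have bcl : bmf (@clip01 R).
  split; first exact: measurable_clip01.
  by exists 1 => u; have /andP[? ?] := clip01_itv u; rewrite ger0_norm.
have Ef1 : Ex P (fun w => f (Z 0 w).1) = 0 by exact: (Ex_cut l uZ1 C0 rJ mJ mj).
have Ef2 : Ex P (fun w => f (Z 0 w).2) = 0 by exact: (Ex_cut l uZ2 C0 rJ mJ mj).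
have pm0 e : partial_mean P Z (rank_kernel f f' f f') e = 0.
  rewrite /partial_mean /rank_kernel /=.
  pose g x u := f' u * ((x <= u)%R%:R - clip01 u).
  have bg x : bmf (g x).
    apply: bmfM => //; apply: bmfB => //.
    by apply: bmf_bool; exact: measurable_fun_ler.
  have E1 : (fun w => f' (clip01 (Z 0 w).1) * f (clip01 (Z 0 w).2) * ((e.1 <= (Z 0 w).1)%R%:R - clip01 (Z 0 w).1) +
     f (clip01 (Z 0 w).1) * f' (clip01 (Z 0 w).2) * ((e.2 <= (Z 0 w).2)%R%:R - clip01 (Z 0 w).2)) =
     fun w => g e.1 ((fst \o Z 0) w) * f ((snd \o Z 0) w) + f ((fst \o Z 0) w) * g e.2 ((snd \o Z 0) w).
    by apply/funext => w0; rewrite /g /= !c1 !c2; ring.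
  have bU (h : R -> R) : bmf h -> bmf (fun w => h ((fst \o Z 0) w)) by move=> bh; exact: (bmf_comp bh mU).
  have bV (h : R -> R) : bmf h -> bmf (fun w => h ((snd \o Z 0) w)) by move=> bh; exact: (bmf_comp bh mV).
  rewrite E1 ExD; [|by apply: bmf_itg; apply: bmfM; [exact: bU|exact: bV]|by apply: bmf_itg; apply: bmfM; [exact: bU|exact: bV]].
  by rewrite !(Ex_independentM mU mV indUV)// Ef1 Ef2 mulr0 mul0r addr0.
have iE w0 : influence P Z f f' f f' (Z 0 w0) = f (Z 0 w0).1 * f (Z 0 w0).2.
  by rewrite /influence pm0 addr0 c1 c2.
rewrite /cut_influence -/f -/f' iE; under eq_fun do rewrite iE.
by rewrite (Ex_independentM mU mV indUV (f := f) (g := f))// Ef1 mul0r subr0.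
Qed.

End cut_covariance.

Lemma Ex_cut_influence_mul (C1 C2 : R) (J j K k : R -> R) l : 0 <= C1 -> 0 <= C2 ->
  regular_score C1 J j -> regular_score C2 K k ->
  mfunT J -> mfunT j -> mfunT K -> mfunT k ->
  Ex P (fun w => cut_influence P Z J j J j l (Z 0 w) * cut_influence P Z K k K k l (Z 0 w)) =
  Ex gam (fun z => ctrunc l J j (Phi z) * ctrunc l K k (Phi z)) ^+ 2.
Proof.
move=> C10 C20 rJ rK mJ mj mK mk.
pose f u := ctrunc l J j u * ctrunc l K k u.
have bf : bmf f.
  by apply: bmfM; apply: bmfB; try exact: bmf_cst;
    [exact: (bmf_trunc _ C10 rJ mJ mj)|exact: (bmf_trunc _ C20 rK mK mk)].
have -> : (fun w => cut_influence P Z J j J j l (Z 0 w) * cut_influence P Z K k K k l (Z 0 w)) =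
    fun w => f ((fst \o Z 0) w) * f ((snd \o Z 0) w).
  apply/funext => w; rewrite (cut_influence_independent C10 rJ mJ mj) (cut_influence_independent C20 rK mK mk).
  by rewrite /f /=; ring.
rewrite (Ex_independentM mU mV indUV)// (Ex_uniform01 uZ1 bf) (Ex_uniform01 uZ2 bf).
by rewrite -expr2.
Qed.

End limit_covariance.

(** * The limit theorem for uniform marginals *)

Section uniform_sample.
Context {R : realType} {dT} {T : measurableType dT}.
Notation E := (R * R)%type.
Local Notation gam := (@std_normal R).
Variables (P : probability T R) (Z : nat -> T -> E).
Hypotheses (mZ : forall i, mfunT (Z i))
  (indepZ : mutually_independent P Z)
  (idZ : forall i, same_law P P (Z i) (Z 0))
  (Z01 : forall i w, 0 <= (Z i w).1 <= 1 /\ 0 <= (Z i w).2 <= 1)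
  (uZ1 : uniform01 P (fst \o Z 0)) (uZ2 : uniform01 P (snd \o Z 0)).

Notation J := (@Phi_inv R).
Notation K := (@normal_sq R).
Notation V := (@normal_sq_var R).

Definition sample_hat1 n w : R := rho_R1_hat n (fst \o smp Z w) (snd \o smp Z w).
Definition sample_hat2 n w : R := rho_R2_hat n (fst \o smp Z w) (snd \o smp Z w).
Definition sample_rho1 : R := Ex P (fun w => J (Z 0 w).1 * J (Z 0 w).2).
Definition sample_rho2 : R := Ex P (fun w => K (Z 0 w).1 * K (Z 0 w).2) / V.

Let gJ n := grid n (fun u => J u * J u).
Let gK n := grid n (fun u => K u * K u).
(** Each centred estimator times [sqrt n] is an exact affine image of a normalized rank sum: [cn]
    and [en] are the inverse score variances, while [dn] and [fn] gather what is deterministic and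
    tend to 0 by the bias and grid rates. *)
Let cn n : R := (gJ n)^-1.
Let en n : R := (gK n - (gJ n - 1) ^+ 2)^-1.
Let TJ n := Ex P (fun w => rank_sum J J n (smp Z w)).
Let TK n := Ex P (fun w => rank_sum K K n (smp Z w)).
Let dn n : R := Num.sqrt n%:R * (n%:R^-1 * TJ n * cn n - sample_rho1).
Let fn n : R := Num.sqrt n%:R * ((n%:R^-1 * TK n - (gJ n - 1) ^+ 2) * en n - sample_rho2).

Lemma sample_hat1E n w : (0 < n)%N ->
  Num.sqrt n%:R * (sample_hat1 n w - sample_rho1) = cn n * rank_dev P Z J n w + dn n.
Proof.
move=> n0; have nR : (0 : R) < n%:R by rewrite ltr0n.
have r0 : 0 < Num.sqrt n%:R :> R by rewrite sqrtr_gt0.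
have hE : sample_hat1 n w = rank_sum J J n (smp Z w) * n%:R^-1 * cn n.
  by rewrite /sample_hat1 /rho_R1_hat score_var_a invfM mulrA.
rewrite hE /rank_dev /dn -/(TJ n); move: (rank_sum _ _ _ _) (TJ n) (cn n) sample_rho1 => t e c r.
have -> : n%:R = Num.sqrt n%:R ^+ 2 :> R by rewrite sqr_sqrtr// ltW.
rewrite sqrtr_sqr (gtr0_norm r0); move: (Num.sqrt n%:R) r0 => s s0.
by field; rewrite gt_eqF.
Qed.

(** Unlike for the first estimator, the identity holds only almost surely: passing from centring at
    the score mean to [normal_sq] leaves sums over a single rank, deterministic only without
    ties. *)
Lemma sample_hat2E : {ae P, forall w, forall n, (0 < n)%N ->
  Num.sqrt n%:R * (sample_hat2 n w - sample_rho2) = en n * rank_dev P Z K n w + fn n}.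
Proof.
apply: filterS (no_ties2 mZ indepZ idZ uZ1 uZ2) => w H n n0; have [dx dy] := H n.
have nR : (0 : R) < n%:R by rewrite ltr0n.
have r0 : 0 < Num.sqrt n%:R :> R by rewrite sqrtr_gt0.
have S1 (x : nat -> R) : distinct n x -> \sum_(i < n) K (full n x i) = n%:R * (gJ n - 1).
  move=> dd; rewrite /full (big_rank_in _ (fun p => K (p%:R / n.+1%:R)) dd).
  rewrite /normal_sq big_split/= sumr_const_nat subSS subn0 mulrBr mulr1 /gJ /grid mulrA.
  rewrite divff ?gt_eqF// mul1r mulNrn; congr (_ - _); apply: eq_bigr => p _; exact: expr2.
have hE : sample_hat2 n w = (rank_sum K K n (smp Z w) - n%:R * (gJ n - 1) ^+ 2) * n%:R^-1 * en n.
  rewrite /sample_hat2 /rho_R2_hat score_var_b// invfM mulrA; congr (_ / _ * _).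
  rewrite score_mean_b// -/(gJ n).
  set x := fst \o smp Z w in dx *; set y := snd \o smp Z w in dy *.
  have -> : \sum_(i < n) (score_b n (rank_in n x i) - gJ n) * (score_b n (rank_in n y i) - gJ n) =
      \sum_(i < n) (K (full n x i) * K (full n y i) + (- (gJ n - 1) * K (full n x i) +
        (- (gJ n - 1) * K (full n y i) + (gJ n - 1) ^+ 2))).
    apply: eq_bigr => i _; rewrite /score_b /score_a /full /normal_sq; ring.
  rewrite !big_split/= -!mulr_sumr (S1 x dx) (S1 y dy) sumr_const card_ord -mulr_natl.
  by rewrite /rank_sum; ring.
rewrite hE /rank_dev /fn -/(TK n).
move: (rank_sum _ _ _ _) (TK n) (en n) sample_rho2 ((gJ n - 1) ^+ 2) => t e c r q.
have -> : n%:R = Num.sqrt n%:R ^+ 2 :> R by rewrite sqr_sqrtr// ltW.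
rewrite sqrtr_sqr (gtr0_norm r0); move: (Num.sqrt n%:R) r0 => s s0.
by field; rewrite gt_eqF.
Qed.

Let mid : mfunT (fun x : R => x). Proof. exact: measurable_id. Qed.
Let msq : mfunT (fun x : R => x ^+ 2 - 1).
Proof. by apply: measurable_funB => //; exact: measurable_funX. Qed.
Let i4 : itg gam (fun z : R => z ^+ 4). Proof. exact: itg_normal_pow. Qed.
Let s4 : itg gam (fun z : R => (z ^+ 2 - 1) ^+ 4).
Proof. by have := @itg_normal_sq4 R; under eq_fun do rewrite normal_sqPhi. Qed.

Let VE : Ex gam (fun z : R => (z ^+ 2 - 1) ^+ 2) = V.
Proof. by congr (Ex _ _); apply/funext => z; rewrite normal_sqPhi. Qed.

Let cvg_eq (f : nat -> R) (l l' : R) : f n @[n --> \oo] --> l -> l = l' -> f n @[n --> \oo] --> l'.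
Proof. by move=> + <-. Qed.

Let C0 := projT1 (cid (@normal_scores_regular R)).
Let C_gt0 : 0 < C0. Proof. by rewrite /C0; case: cid => c []. Qed.
Let C_ge0 : 0 <= C0. Proof. exact: ltW C_gt0. Qed.
Let rJ : regular_score C0 J (@dPhi_inv R). Proof. by rewrite /C0; case: cid => c []. Qed.
Let rK : regular_score C0 K (@dnormal_sq R). Proof. by rewrite /C0; case: cid => c []. Qed.
Let mj := @measurable_dPhi_inv R.
Let mk := @measurable_dnormal_sq R.

Let rate_gJ : Num.sqrt n%:R * (gJ n - 1) @[n --> \oo] --> 0.
Proof.
have [B HB] := grid_rate mZ indepZ idZ Z01 uZ1 C_ge0 rJ mid (fun=> erefl) mj i4.
apply: (@sqrt_rate _ _ B) => m; have := HB m.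
by rewrite -[X in _ - X]/(Ex gam (fun z => z ^+ 2)) normal_second_moment.
Qed.

Let rate_gK : Num.sqrt n%:R * (gK n - V) @[n --> \oo] --> 0.
Proof.
have [B HB] := grid_rate mZ indepZ idZ Z01 uZ1 C_ge0 rK msq (fun=> erefl) mk s4.
by apply: (@sqrt_rate _ _ B) => m; have := HB m; rewrite VE.
Qed.

Let rate_TJ : Num.sqrt n%:R * (n%:R^-1 * TJ n - sample_rho1) @[n --> \oo] --> 0.
Proof.
have [B HB] := rank_mean_rate mZ indepZ idZ Z01 uZ1 uZ2 C_ge0 rJ mid (fun=> erefl) mj i4.
by apply: (@sqrt_rate _ _ B) => m; exact: HB.
Qed.

Let rate_TK : Num.sqrt n%:R * (n%:R^-1 * TK n - sample_rho2 * V) @[n --> \oo] --> 0.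
Proof.
have [B HB] := rank_mean_rate mZ indepZ idZ Z01 uZ1 uZ2 C_ge0 rK msq (fun=> erefl) mk s4.
apply: (@sqrt_rate _ _ B) => m; have := HB m.
by rewrite /sample_rho2 divfK// gt_eqF// normal_sq_var_gt0.
Qed.

Let cvg_gJ : gJ n @[n --> \oo] --> (1 : R).
Proof.
have E : gJ = fun n => gJ n - 1 + 1 by apply/funext => n; rewrite subrK.
rewrite E; apply: (cvg_eq (l := 0 + 1)); last by rewrite add0r.
exact: (cvgD (sqrt_rate_cvg0 rate_gJ) (cvg_cst _)).
Qed.

Let cvg_cn : cn n @[n --> \oo] --> (1 : R).
Proof.
apply: (cvg_eq (l := 1^-1)); last by rewrite invr1.
by apply: cvgV; [rewrite oner_eq0|exact: cvg_gJ].
Qed.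

Let cvg_r2 : (gJ n - 1) ^+ 2 @[n --> \oo] --> (0 : R).
Proof.
have h := sqrt_rate_cvg0 rate_gJ; apply: (cvg_eq (l := 0 * 0)); last by rewrite mulr0.
exact: (cvgM h h).
Qed.

Let cvg_en : en n @[n --> \oo] --> V^-1.
Proof.
apply: cvgV; first by rewrite gt_eqF// normal_sq_var_gt0.
have E : gK = fun n => gK n - V + V by apply/funext => n; rewrite subrK.
rewrite E; apply: (cvg_eq (l := 0 + V - 0)); last by rewrite add0r subr0.
exact: (cvgB (cvgD (sqrt_rate_cvg0 rate_gK) (cvg_cst _)) cvg_r2).
Qed.

Let cvg_dn : dn n @[n --> \oo] --> (0 : R).
Proof.
have H : (Num.sqrt n%:R * (n%:R^-1 * TJ n - sample_rho1) -
    sample_rho1 * (Num.sqrt n%:R * (gJ n - 1))) * cn n @[n --> \oo] --> (0 : R).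
  apply: (cvg_eq (l := (0 - sample_rho1 * 0) * 1)); last by rewrite mulr0 subr0 mul0r.
  exact: (cvgM (cvgB rate_TJ (cvgM (cvg_cst _) rate_gJ)) cvg_cn).
apply: cvg_trans H; apply: near_eq_cvg; near=> n => /=.
have g0 : 0 < gJ n.
  have h : `|1 - gJ n| <= 2^-1 by near: n; move/cvgrPdist_le: cvg_gJ; apply.
  by move: h; rewrite ler_norml; lra.
rewrite /dn /cn; move: (Num.sqrt n%:R) (n%:R^-1) (TJ n) (gJ n) g0 sample_rho1 => s y t g g0 r.
by field; rewrite gt_eqF.
Unshelve. all: by end_near.
Qed.

Let cvg_fn : fn n @[n --> \oo] --> (0 : R).
Proof.
have r2 : Num.sqrt n%:R * (gJ n - 1) * (gJ n - 1) @[n --> \oo] --> (0 : R).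
  apply: (cvg_eq (l := 0 * 0)); last by rewrite mulr0.
  exact: (cvgM rate_gJ (sqrt_rate_cvg0 rate_gJ)).
have H : (Num.sqrt n%:R * (n%:R^-1 * TK n - sample_rho2 * V) -
    Num.sqrt n%:R * (gJ n - 1) * (gJ n - 1) -
    sample_rho2 * (Num.sqrt n%:R * (gK n - V) - Num.sqrt n%:R * (gJ n - 1) * (gJ n - 1))) *
    en n @[n --> \oo] --> (0 : R).
  apply: (cvg_eq (l := (0 - 0 - sample_rho2 * (0 - 0)) * V^-1)).
    exact: (cvgM (cvgB (cvgB rate_TK r2) (cvgM (cvg_cst _) (cvgB rate_gK r2))) cvg_en).
  by rewrite !subr0 mulr0 subr0 mul0r.
have V0 := @normal_sq_var_gt0 R; have V2 : 0 < V^-1 / 2 by rewrite divr_gt0 ?invr_gt0.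
apply: cvg_trans H; apply: near_eq_cvg; near=> n => /=.
have e0 : gK n - (gJ n - 1) ^+ 2 != 0.
  have h : `|V^-1 - en n| <= V^-1 / 2 by near: n; move/cvgrPdist_le: cvg_en; apply.
  apply/eqP => h0; move: h; rewrite /en h0 invr0 subr0 ger0_norm ?invr_ge0 ?(ltW V0)//.
  have : 0 < V^-1 by rewrite invr_gt0.
  lra.
rewrite /fn /en; move: (Num.sqrt n%:R) (n%:R^-1) (TK n) (gJ n) (gK n) V e0 sample_rho2 => s y t g k v e0 r.
by field.
Unshelve. all: by end_near.
Qed.

Let Y n w : R * R := (cn n * rank_dev P Z J n w + dn n, en n * rank_dev P Z K n w + fn n).

Let bY1 n : bmf (fun w => (Y n w).1).
Proof. by apply: bmfD; [apply: bmfZ; exact: bmf_rank_dev_sum|exact: bmf_cst]. Qed.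
Let bY2 n : bmf (fun w => (Y n w).2).
Proof. by apply: bmfD; [apply: bmfZ; exact: bmf_rank_dev_sum|exact: bmf_cst]. Qed.

Let phi l e : R := 1 * cut_influence P Z J (@dPhi_inv R) J (@dPhi_inv R) l e.
Let psi l e : R := V^-1 * cut_influence P Z K (@dnormal_sq R) K (@dnormal_sq R) l e.

Let mJ := @measurable_Phi_inv R.
Let mK := @measurable_normal_sq R.

Let bI1 l := bmf_cut_influence P mZ C_ge0 rJ rJ mJ mj mJ mj l.
Let bI2 l := bmf_cut_influence P mZ C_ge0 rK rK mK mk mK mk l.

Let dl l : R := (4 + 3 * (V^-1) ^+ 2) * approx_const C0 * 2^-1 ^+ l.

(** The hypotheses of [normal_limit] hold with one error sequence [dl] for both coordinates, the sum
    of the two constants [3 c^2 + 1] with [c = 1] and [c = V^-1] being at most [4 + 3 V^-2], up to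
    the added units. *)
Let limit : exists (s : nat -> nat) (A : 'M[R]_2),
  [/\ s n @[n --> \oo] --> \oo,
     Ex P (fun w => phi (s n) (Z 0 w) ^+ 2) @[n --> \oo] --> (A *m A^T) 0 0,
     Ex P (fun w => phi (s n) (Z 0 w) * psi (s n) (Z 0 w)) @[n --> \oo] --> (A *m A^T) 0 1,
     Ex P (fun w => psi (s n) (Z 0 w) ^+ 2) @[n --> \oo] --> (A *m A^T) 1 1 &
     cvg_to_normal2 P Y (0, 0) (A *m A^T)].
Proof.
have E0 c f : itg P (fun w => f (Z 0 w)) -> Ex P (f \o Z 0) = 0 -> Ex P ((fun e => c * f e) \o Z 0) = 0.
  by move=> fi f0; rewrite /comp ExZ// [Ex P _]f0 mulr0.
have a0 := approx_const_gt0 C0; have V0 := @normal_sq_var_gt0 R.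
apply: (normal_limit mZ indepZ idZ (dl := dl)) => //.
- by move=> l; exact: (bmfZ 1 (bI1 l)).
- by move=> l; exact: (bmfZ V^-1 (bI2 l)).
- move=> l; apply: E0; first by apply: bmf_itg; exact: (bmf_comp (bI1 l)).
  exact: (Ex_cut_influence P mZ C_ge0 rJ rJ mJ mj mJ mj l).
- move=> l; apply: E0; first by apply: bmf_itg; exact: (bmf_comp (bI2 l)).
  exact: (Ex_cut_influence P mZ C_ge0 rK rK mK mk mK mk l).
- have h1 : `|2^-1 : R| < 1 by rewrite ger0_norm ?invr_ge0// invf_lt1// ltr1n.
  apply: (cvg_eq (l := (4 + 3 * (V^-1) ^+ 2) * approx_const C0 * 0)); last by rewrite mulr0.
  exact: (cvgM (cvg_cst _) (cvg_expr h1)).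
- move=> l; have := rank_dev_approx mZ indepZ idZ Z01 uZ1 uZ2 C_ge0 rJ mid (fun=> erefl) mj l cvg_cn cvg_dn.
  apply: filterS => n /le_trans; apply; rewrite /dl -!mulrA; apply: ler_wpM2r.
    by rewrite mulr_ge0 ?(ltW a0)// exprn_ge0// invr_ge0.
  by rewrite expr1n; have := sqr_ge0 V^-1; lra.
- move=> l; have := rank_dev_approx mZ indepZ idZ Z01 uZ1 uZ2 C_ge0 rK msq (fun=> erefl) mk l cvg_en cvg_fn.
  apply: filterS => n /le_trans; apply; rewrite /dl -!mulrA; apply: ler_wpM2r.
    by rewrite mulr_ge0 ?(ltW a0)// exprn_ge0// invr_ge0.
  by lra.
Qed.

Lemma bmf_sample_hat1 n : bmf (sample_hat1 n).
Proof.
rewrite /sample_hat1 /rho_R1_hat; under eq_fun do rewrite mulrC.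
apply: bmfZ; apply: bmf_sum => i _; apply: bmfM.
  exact: (bstat_bmf (bstat_rank measurable_fst (score_a n) n i) (mfamily_smp mZ)).
exact: (bstat_bmf (bstat_rank measurable_snd (score_a n) n i) (mfamily_smp mZ)).
Qed.

Lemma bmf_sample_hat2 n : bmf (sample_hat2 n).
Proof.
rewrite /sample_hat2 /rho_R2_hat; under eq_fun do rewrite mulrC.
apply: bmfZ; apply: bmf_sum => i _; apply: bmfM; apply: bmfB; try exact: bmf_cst.
  exact: (bstat_bmf (bstat_rank measurable_fst (score_b n) n i) (mfamily_smp mZ)).
exact: (bstat_bmf (bstat_rank measurable_snd (score_b n) n i) (mfamily_smp mZ)).
Qed.

Definition sample_stat n w : R * R :=
  (Num.sqrt n%:R * (sample_hat1 n w - sample_rho1),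
   Num.sqrt n%:R * (sample_hat2 n w - sample_rho2)).

Lemma measurable_sample_stat n : mfunT (sample_stat n).
Proof.
have [m1 _] := bmf_sample_hat1 n; have [m2 _] := bmf_sample_hat2 n.
by apply/measurable_fun_pair; apply: measurable_funM => //; exact: measurable_funB.
Qed.

Let transfer Sigma : cvg_to_normal2 P Y (0, 0) Sigma ->
  cvg_to_normal2 P sample_stat (0, 0) Sigma.
Proof.
apply: cvg_to_normal2_ae => [n|n|].
- by apply/measurable_fun_pair; [case: (bY1 n)|case: (bY2 n)].
- exact: measurable_sample_stat.
- apply: filterS sample_hat2E => w H n; rewrite /Y /sample_stat.
  have [->|n0] := posnP n; last by rewrite sample_hat1E// H.
  rewrite /rank_dev /dn /fn sqrtr0 invr0 !mul0r.
  by rewrite !(mulr0, addr0).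
Qed.

Theorem sample_normal_limit : exists Sigma, cvg_to_normal2 P sample_stat (0, 0) Sigma.
Proof. by have [s [A [_ _ _ _ H]]] := limit; exists (A *m A^T); exact: transfer. Qed.

(** The integrand is the odd function [z^3 - z]; this is why the two estimators are asymptotically
    uncorrelated under independence. *)
Lemma Ex_Phi_inv_normal_sq : Ex gam (fun z => J (Phi z) * K (Phi z)) = 0.
Proof.
have i k := @itg_normal_pow R k.
have -> : (fun z : R => J (Phi z) * K (Phi z)) = fun z => z ^+ 3 - z ^+ 1.
  by apply/funext => z; rewrite PhiK normal_sqPhi; ring.
have E3 : Ex gam (fun z : R => z ^+ 3 - z ^+ 1) = - Ex gam (fun z : R => z ^+ 3 - z ^+ 1).
  have i31 : itg gam (fun z : R => z ^+ 3 - z ^+ 1) by exact: itgB.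
  rewrite -[LHS](Ex_normal_opp i31) -ExN//; congr (Ex _ _); apply/funext => z; ring.
by lra.
Qed.

Hypothesis indUV : independent_RV P (fst \o Z 0) (snd \o Z 0).

Let oo_cvg (f : nat -> R) (s : nat -> nat) (l : R) : s n @[n --> \oo] --> \oo ->
  f n @[n --> \oo] --> l -> f (s n) @[n --> \oo] --> l.
Proof. by move=> so fl; exact: (cvg_comp _ _ so fl). Qed.

Let sqr_cvg (f : nat -> R) (l : R) : f n @[n --> \oo] --> l -> f n ^+ 2 @[n --> \oo] --> l ^+ 2.
Proof. by move=> fl; exact: (cvgM fl fl). Qed.

Let cvg_uniq (f : nat -> R) (l l' : R) : f n @[n --> \oo] --> l -> f n @[n --> \oo] --> l' -> l = l'.
Proof. by move=> h h'; rewrite -(cvg_lim (@Rhausdorff R) h) -(cvg_lim (@Rhausdorff R) h'). Qed.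

(** Under independence each covariance of influences is the square of a one-dimensional one, by
    [Ex_cut_influence_mul]. The limits are 1 for the first score, 0 across, and [V^2] for the
    second, which its normalization [V^-1] turns into 1. *)
Lemma sample_normal_limit_independent : cvg_to_normal2 P sample_stat (0, 0) 1%:M.
Proof.
have [s [A [so cphi ccov cpsi H]]] := limit.
have V0 := @normal_sq_var_gt0 R; have Vn0 : V != 0 by rewrite gt_eqF.
have J4 := @itg_Phi_inv4 R; have K4 := @itg_normal_sq4 R.
have J1 := @Ex_Phi_inv1 R; have K1 := @Ex_normal_sq1 R.
have L1 := cut_product_cvg C_ge0 C_ge0 rJ rJ mJ mj mJ mj (@Phi_inv_level R) (@Phi_inv_level R) J4 J4 J1 J1.
have L2 := cut_product_cvg C_ge0 C_ge0 rJ rK mJ mj mK mk (@Phi_inv_level R) (@normal_sq_level R) J4 K4 J1 K1.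
have L3 := cut_product_cvg C_ge0 C_ge0 rK rK mK mk mK mk (@normal_sq_level R) (@normal_sq_level R) K4 K4 K1 K1.
rewrite Ex_Phi_inv_normal_sq in L2.
rewrite [X in _ --> X](_ : _ = 1) in L1; last first.
  by rewrite -[RHS](@Ex_Phi_inv2 R); congr (Ex _ _); apply/funext => z; rewrite expr2.
rewrite [X in _ --> X](_ : _ = V) in L3; last first.
  by congr (Ex _ _); apply/funext => z; rewrite expr2.
have E11 l : Ex P (fun w => phi l (Z 0 w) ^+ 2) =
    Ex gam (fun z => ctrunc l J (@dPhi_inv R) (Phi z) * ctrunc l J (@dPhi_inv R) (Phi z)) ^+ 2.
  rewrite -(Ex_cut_influence_mul mZ Z01 uZ1 uZ2 indUV l C_ge0 C_ge0 rJ rJ mJ mj mJ mj).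
  by congr (Ex _ _); apply/funext => w; rewrite /phi mul1r expr2.
have ii (f g : E -> R) : bmf f -> bmf g -> itg P (fun w => f (Z 0 w) * g (Z 0 w)).
  by move=> bf bg; apply: bmf_itg; apply: bmfM; exact: (bmf_comp _ (mZ 0)).
have E12 l : Ex P (fun w => phi l (Z 0 w) * psi l (Z 0 w)) =
    V^-1 * Ex gam (fun z => ctrunc l J (@dPhi_inv R) (Phi z) * ctrunc l K (@dnormal_sq R) (Phi z)) ^+ 2.
  rewrite -(Ex_cut_influence_mul mZ Z01 uZ1 uZ2 indUV l C_ge0 C_ge0 rJ rK mJ mj mK mk).
  rewrite -(ExZ V^-1 (ii _ _ (bI1 l) (bI2 l))).
  by congr (Ex _ _); apply/funext => w; rewrite /phi /psi mul1r mulrCA.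
have E22 l : Ex P (fun w => psi l (Z 0 w) ^+ 2) =
    V^-1 ^+ 2 * Ex gam (fun z => ctrunc l K (@dnormal_sq R) (Phi z) * ctrunc l K (@dnormal_sq R) (Phi z)) ^+ 2.
  rewrite -(Ex_cut_influence_mul mZ Z01 uZ1 uZ2 indUV l C_ge0 C_ge0 rK rK mK mk mK mk).
  rewrite -(ExZ (V^-1 ^+ 2) (ii _ _ (bI2 l) (bI2 l))).
  by congr (Ex _ _); apply/funext => w; rewrite /psi exprMn -expr2.
suff <- : A *m A^T = 1%:M by exact: transfer.
have a11 : (A *m A^T) 0 0 = 1.
  apply: (cvg_uniq cphi); under eq_fun do rewrite E11.
  by apply: (cvg_eq (l := 1 ^+ 2)); [exact: (oo_cvg so (sqr_cvg L1))|rewrite expr1n].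
have a12 : (A *m A^T) 0 1 = 0.
  apply: (cvg_uniq ccov); under eq_fun do rewrite E12.
  apply: (cvg_eq (l := V^-1 * 0 ^+ 2)); last by rewrite expr0n mulr0.
  exact: (cvgM (cvg_cst _) (oo_cvg so (sqr_cvg L2))).
have a22 : (A *m A^T) 1 1 = 1.
  apply: (cvg_uniq cpsi); under eq_fun do rewrite E22.
  apply: (cvg_eq (l := V^-1 ^+ 2 * V ^+ 2)); last by rewrite -exprMn mulVf// expr1n.
  exact: (cvgM (cvg_cst _) (oo_cvg so (sqr_cvg L3))).
have tA : (A *m A^T)^T = A *m A^T by rewrite trmx_mul trmxK.
have a21 : (A *m A^T) 1 0 = 0 by rewrite -a12 -{1}tA mxE.
have ord2 (p : 'I_2) : p = 0 \/ p = 1.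
  by case: p => -[|[|//]] h; [left|right]; exact: val_inj.
apply/matrixP => p r; rewrite [RHS]mxE.
by case: (ord2 p) => ->; case: (ord2 r) => ->; rewrite ?a11 ?a12 ?a21 ?a22.
Qed.

Lemma same_law_independent_scores :
  same_law P (@std_normal2 R) (fun w => (J (Z 0 w).1, J (Z 0 w).2)) id.
Proof.
have mJU : mfunT (fun w => J (Z 0 w).1) by apply: (measurableT_comp mJ); exact: measurableT_comp.
have mJV : mfunT (fun w => J (Z 0 w).2) by apply: (measurableT_comp mJ); exact: measurableT_comp.
have mUV : mfunT (fun w => (J (Z 0 w).1, J (Z 0 w).2)) by exact/measurable_fun_pair.
move=> A mA; rewrite preimage_id -(lawE P mUV); apply/esym.
apply: (product_measure_unique (m' := law P mUV)) => //= B C mB mC.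
rewrite lawE.
have -> : gam B = P ((fst \o Z 0) @^-1` (J @^-1` B)).
  by rewrite -(same_law_normal_score uZ1 mB).
have -> : gam C = P ((snd \o Z 0) @^-1` (J @^-1` C)).
  by rewrite -(same_law_normal_score uZ2 mC).
rewrite -indUV; [|by rewrite -[X in measurable X]setTI; exact: mJ|by rewrite -[X in measurable X]setTI; exact: mJ].
by congr (P _); apply/seteqP; split=> w [].
Qed.

Lemma Ex_normal2_mul (f g : R -> R) : itg gam (fun z => f z ^+ 2) -> itg gam (fun z => g z ^+ 2) ->
  mfunT f -> mfunT g -> itg gam g -> Ex gam g = 0 ->
  itg (@std_normal2 R) (fun z => f z.1 * g z.2) /\
  Ex (@std_normal2 R) (fun z => f z.1 * g z.2) = 0.
Proof.
move=> f2 g2 mf mg ig g0.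
have i12 : itg (@std_normal2 R) (fun z => f z.1 * g z.2).
  apply: (itg_le (g := fun z : R * R => f z.1 ^+ 2 + g z.2 ^+ 2)).
  - by apply: measurable_funM; exact: measurableT_comp.
  - by apply: itgD; [exact: (itg_normal2_fst f2)|exact: (itg_normal2_snd g2)].
  - move=> z; rewrite normrM -(real_normK (num_real (f z.1))) -(real_normK (num_real (g z.2))).
    by have := sqr_ge0 (`|f z.1| - `|g z.2|); have := normr_ge0 (f z.1); have := normr_ge0 (g z.2); nra.
split => //; rewrite /Ex /Rintegral -(integral12_prod_meas1 i12)/=.
rewrite (eq_integral (fun=> 0%E)) ?integral0// => x _.
rewrite /fubini_F/= -(@EFin_Ex R _ _ gam (fun y => f x * g y)); last exact: itgZ.
by rewrite ExZ// g0 mulr0.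
Qed.

Lemma sample_rho_independent : sample_rho1 = 0 /\ sample_rho2 = 0.
Proof.
have mUV : mfunT (fun w => (J (Z 0 w).1, J (Z 0 w).2)).
  apply/measurable_fun_pair; apply: (measurableT_comp mJ); exact: measurableT_comp.
have main (f : R -> R) : itg gam (fun z => f z ^+ 2) -> mfunT f -> itg gam f ->
    Ex gam f = 0 -> Ex P (fun w => f (J (Z 0 w).1) * f (J (Z 0 w).2)) = 0.
  move=> f2 mf fi f0; have [i12 E12] := Ex_normal2_mul f2 f2 mf mf fi f0.
  rewrite -E12.
  apply: (Ex_same_law mUV (@measurable_id _ _ setT) same_law_independent_scores (f := fun z => f z.1 * f z.2)) => //.
  exact: itg_measurable i12.
have i1 : itg gam (fun x => x) by have := @itg_normal_pow R 1; under eq_fun do rewrite expr1.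
split; first by apply: (main (fun x => x)) => //; [exact: itg_normal_pow|exact: normal_mean].
rewrite /sample_rho2 (main (fun x => x ^+ 2 - 1)) ?mul0r//.
- by have := @itg_normal_sq2 R; under eq_fun do rewrite normal_sqPhi.
- by apply: itgB; [exact: itg_normal_pow|exact: itg_cst].
- by have := @Ex_normal_sq1 R; under eq_fun do rewrite normal_sqPhi.
Qed.

End uniform_sample.

(** * Reduction to uniform marginals *)

Section distribution_function.
Context {R : realType} {d} {T : measurableType d}.
Variables (P : probability T R) (X : {RV P >-> R}).
Hypothesis contF : continuous (rcdf X).
Notation F := (rcdf X).

Let mX : mfunT X. Proof. exact: measurable_funPT. Qed.

Lemma rcdfE x : F x = Ex P (fun w => (X w <= x)%R%:R).
Proof.
rewrite Ex_bool; last exact: measurable_fun_ler.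
rewrite /rcdf /cdf /distribution /pushforward; congr (fine (P _)).
Qed.

Let bX x : bmf (fun w => (X w <= x)%R%:R : R).
Proof. by apply: bmf_bool; exact: measurable_fun_ler. Qed.

Lemma rcdf_le x y : x <= y -> F x <= F y.
Proof.
move=> xy; rewrite !rcdfE; apply: le_Ex; [exact: bmf_itg|exact: bmf_itg|move=> w].
by rewrite ler_nat; case: (leP (X w) x) => // /le_trans/(_ xy) ->.
Qed.

Lemma rcdf01 x : 0 <= F x <= 1.
Proof.
rewrite rcdfE; apply/andP; split; first by apply: Ex_ge0 => w; rewrite ler0n.
by apply: Ex_le_cst => [|w]; [exact: bmf_itg|rewrite lern1 leq_b1].
Qed.

Lemma rcdf_surj u : 0 < u < 1 -> exists x, F x = u.
Proof.
move=> /andP[u0 u1].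
have h1 : F t @[t --> +oo] --> (1 : R) by exact: (fine_cvg (cvg_cdfy1 X)).
have h0 : F t @[t --> -oo] --> (0 : R) by exact: (fine_cvg (cvg_cdfNy0 X)).
have [b b0 Fb] : exists2 b, 0 < b & u <= F b.
  near (pinfty_nbhs R) => b; exists b; first by near: b; exact: nbhs_pinfty_gt.
  have : `|1 - F b| <= 1 - u.
    near: b; move/cvgrPdist_le : h1; apply; by rewrite subr_gt0.
  by rewrite ler_norml; lra.
have [a a0 Fa] : exists2 a, a < 0 & F a <= u.
  near (ninfty_nbhs R) => a; exists a; first by near: a; exact: nbhs_ninfty_lt.
  have : `|0 - F a| <= u by near: a; move/cvgrPdist_le : h0; apply.
  by rewrite ler_norml; lra.
have ab : a <= b by lra.
have := @IVT R F a b u ab (continuous_subspaceT contF).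
rewrite ge_min le_max Fa Fb orbT => /(_ isT)[c _ <-]; by exists c.
Unshelve. all: by end_near.
Qed.

Lemma measurable_rcdf : mfunT F.
Proof. exact: continuous_measurable. Qed.

(** The function [F] may have flat pieces, so the event [F (X w) <= u] is enclosed: it contains
    [X w <= x] with [F x = u], and lies in [X w <= y] with [F y = v] for each [v] slightly above
    [u]. *)
Lemma uniform01_rcdf : uniform01 P (fun w => F (X w)).
Proof.
have mFX : mfunT (fun w => F (X w)) by exact: (measurableT_comp measurable_rcdf).
have bu u : itg P (fun w => (F (X w) <= u)%R%:R).
  by apply: bmf_itg; apply: bmf_bool; exact: measurable_fun_ler.
split=> // [w|u /andP[u0 u1]]; first exact: rcdf01.
have [->|un1] := eqVneq u 1.
  rewrite -[RHS](Ex_cst P); congr (Ex P _); apply/funext => w.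
  by have /andP[_ ->] := rcdf01 (X w).
have {un1}u1 : u < 1 by rewrite lt_neqAle un1.
have up v : u < v -> v < 1 -> Ex P (fun w => (F (X w) <= u)%R%:R) <= v.
  move=> uv v1; have [|y Fy] := @rcdf_surj v; first by rewrite v1 andbT (le_lt_trans u0).
  rewrite -Fy rcdfE; apply: le_Ex => //; [exact: bmf_itg|move=> w].
  rewrite ler_nat; case: (leP (F (X w)) u) => // Fu.
  suff -> : X w <= y by [].
  rewrite leNgt; apply/negP => /ltW/rcdf_le; rewrite Fy => vF.
  by have := lt_le_trans uv (le_trans vF Fu); rewrite ltxx.
apply/eqP; rewrite eq_le; apply/andP; split.
  apply/ler_addgt0Pr => e e0; pose v := u + Num.min e ((1 - u) / 2).
  have m0 : 0 < Num.min e ((1 - u) / 2) by rewrite lt_min e0 divr_gt0// subr_gt0.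
  have me : Num.min e ((1 - u) / 2) <= e by rewrite ge_min lexx.
  have mu : Num.min e ((1 - u) / 2) <= (1 - u) / 2 by rewrite ge_min lexx orbT.
  by apply: (@le_trans _ _ v); [apply: up; rewrite /v; lra|rewrite /v lerD2l].
have [->|un0] := eqVneq u 0; first by apply: Ex_ge0 => w; rewrite ler0n.
have [|x Fx] := @rcdf_surj u; first by rewrite u1 lt_neqAle eq_sym un0 u0.
rewrite -[leLHS]Fx rcdfE; apply: le_Ex => //; [exact: bmf_itg|move=> w].
by rewrite ler_nat; case: (leP (X w) x) => // /rcdf_le; rewrite Fx => ->.
Qed.

End distribution_function.

(** * Population correlations as normalized moments *)

Section population_correlation.
Context {R : realType} {d} {T : measurableType d}.
Variables (P : probability T R) (X Y : {RV P >-> R}).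
Hypotheses (contFX : continuous (rcdf X)) (contFY : continuous (rcdf Y)).
Local Notation gam := (@std_normal R).

Lemma fine_covariance (U V : T -> R) : fine (covariance P U V) =
  Ex P (fun w => (U w - Ex P U) * (V w - Ex P V)).
Proof. by rewrite unlock [in LHS]unlock. Qed.

Let uX := uniform01_rcdf contFX.
Let uY := uniform01_rcdf contFY.

Let Ex_score (U : {RV P >-> R}) (f : R -> R) : continuous (rcdf U) -> itg gam f ->
  Ex P (fun w => f (normal_score U w)) = Ex gam f.
Proof. by move=> cU fi; exact: (Ex_normal_score (uniform01_rcdf cU) fi). Qed.

Lemma rho_R1E : rho_R1 X Y = Ex P (fun w => Phi_inv (rcdf X (X w)) * Phi_inv (rcdf Y (Y w))).
Proof.
have i1 : itg gam (fun x => x) by have := @itg_normal_pow R 1; under eq_fun do rewrite expr1.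
have i2 := @itg_normal_pow R 2.
have m0 (U : {RV P >-> R}) : continuous (rcdf U) -> Ex P (normal_score U) = 0.
  by move=> cU; rewrite (Ex_score cU i1) normal_mean.
have v1 (U : {RV P >-> R}) : continuous (rcdf U) -> fine (variance P (normal_score U)) = 1.
  move=> cU; rewrite /variance fine_covariance m0//.
  under eq_fun do rewrite subr0 -expr2.
  by rewrite (Ex_score cU i2) normal_second_moment.
rewrite /rho_R1 /pearson v1// v1// fine_covariance m0// m0// sqrtr1 mulr1 divr1.
by congr (Ex P _); apply/funext => w; rewrite !subr0.
Qed.

Lemma rho_R2E : rho_R2 X Y =
  Ex P (fun w => normal_sq (rcdf X (X w)) * normal_sq (rcdf Y (Y w))) / normal_sq_var.
Proof.
have i2 := @itg_normal_pow R 2.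
have m0 (U : {RV P >-> R}) : continuous (rcdf U) -> Ex P (fun w => normal_score U w ^+ 2) = 1.
  by move=> cU; rewrite (Ex_score cU i2) normal_second_moment.
have s2 : itg gam (fun z => (z ^+ 2 - 1) ^+ 2).
  by have := @itg_normal_sq2 R; under eq_fun do rewrite normal_sqPhi.
have v1 (U : {RV P >-> R}) : continuous (rcdf U) ->
    fine (variance P (fun w => normal_score U w ^+ 2)) = normal_sq_var.
  move=> cU; rewrite /variance fine_covariance m0//.
  under eq_fun do rewrite -expr2.
  rewrite (Ex_score cU s2) /normal_sq_var; congr (Ex _ _); apply/funext => z.
  by rewrite normal_sqPhi.
rewrite /rho_R2 /pearson v1// v1// fine_covariance m0// m0//.
by rewrite -expr2 sqr_sqrtr// ltW// normal_sq_var_gt0.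
Qed.

End population_correlation.

(** * From the original sample to the uniform one *)

Section transfer.
Context {R : realType} {d d' : measure_display} {T : measurableType d} {T' : measurableType d'}.
Variables (P : probability T R) (P' : probability T' R)
  (X Y : {RV P' >-> R}) (Xs Ys : nat -> {RV P >-> R}).
Hypotheses (contFX : continuous (rcdf X)) (contFY : continuous (rcdf Y))
  (iidXY : iid_copies P P' (fun i w => (Xs i w, Ys i w)) (fun w => (X w, Y w))).

Definition to_uniform (e : R * R) : R * R := (rcdf X e.1, rcdf Y e.2).

Let XYs i w : R * R := (Xs i w, Ys i w).
Let XY w : R * R := (X w, Y w).
Let Z i := to_uniform \o XYs i.

Lemma measurable_to_uniform : mfunT to_uniform.
Proof.
by apply/measurable_fun_pair; apply: (measurableT_comp _ _) => //; exact: measurable_rcdf.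
Qed.

Let mXYs i : mfunT (XYs i).
Proof. by apply/measurable_fun_pair; exact: measurable_funPT. Qed.
Let mXY : mfunT XY.
Proof. by apply/measurable_fun_pair; exact: measurable_funPT. Qed.
Let mZ i : mfunT (Z i).
Proof. exact: (measurableT_comp measurable_to_uniform). Qed.
Let mZ0 : mfunT (to_uniform \o XY).
Proof. exact: (measurableT_comp measurable_to_uniform). Qed.

Let sZ i : same_law P P' (Z i) (to_uniform \o XY).
Proof. by case: iidXY => _ H; exact: (same_law_comp measurable_to_uniform (H i)). Qed.

Let indepZ : mutually_independent P Z.
Proof. by apply: mutually_independent_comp measurable_to_uniform _; case: iidXY. Qed.

Let idZ i : same_law P P (Z i) (Z 0).
Proof. by move=> A mA; rewrite !sZ. Qed.

Let Z01 i w : 0 <= (Z i w).1 <= 1 /\ 0 <= (Z i w).2 <= 1.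
Proof. by split; exact: rcdf01. Qed.

Let uniform_same_law (c : R * R -> R) : mfunT c ->
  uniform01 P' (c \o (to_uniform \o XY)) -> (forall w, 0 <= c (Z 0 w) <= 1) ->
  uniform01 P (c \o Z 0).
Proof.
move=> mc [m1 _ uE] c01; split => //; first exact: measurableT_comp.
move=> u u01; rewrite -[RHS](uE u u01).
apply: (Ex_same_law (mZ 0) mZ0 (sZ 0) (f := fun e => (c e <= u)%R%:R)).
  by apply: bmf_itg; apply: bmf_bool; exact: measurable_fun_ler.
by case: (@bmf_bool _ _ R (fun e => c e <= u)) => //; exact: measurable_fun_ler.
Qed.

Let uZ1 : uniform01 P (fst \o Z 0).
Proof. by apply: uniform_same_law => // [|w]; [exact: uniform01_rcdf|case: (Z01 0 w)]. Qed.
Let uZ2 : uniform01 P (snd \o Z 0).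
Proof. by apply: uniform_same_law => // [|w]; [exact: uniform01_rcdf|case: (Z01 0 w)]. Qed.

Let rhoE (f : R -> R) : mfunT f ->
  itg P' (fun w => f (rcdf X (X w)) ^+ 2) -> itg P' (fun w => f (rcdf Y (Y w)) ^+ 2) ->
  Ex P (fun w => f (Z 0 w).1 * f (Z 0 w).2) = Ex P' (fun w => f (rcdf X (X w)) * f (rcdf Y (Y w))).
Proof.
move=> mf i1 i2.
apply: (Ex_same_law (mZ 0) mZ0 (sZ 0) (f := fun e => f e.1 * f e.2)); last first.
  by apply: measurable_funM; exact: measurableT_comp.
apply: (itg_le (g := fun w => f (rcdf X (X w)) ^+ 2 + f (rcdf Y (Y w)) ^+ 2)).
- apply: measurable_funM; apply: (measurableT_comp mf).
    exact: (measurableT_comp (measurable_rcdf contFX)).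
  exact: (measurableT_comp (measurable_rcdf contFY)).
- exact: itgD.
- move=> w /=; move: (f _) (f _) => x y; rewrite normrM.
  rewrite -(real_normK (num_real x)) -(real_normK (num_real y)).
  by have := sqr_ge0 (`|x| - `|y|); have := normr_ge0 x; have := normr_ge0 y; nra.
Qed.

Lemma rho_R1_sample : sample_rho1 P Z = rho_R1 X Y.
Proof.
rewrite rho_R1E//; apply: rhoE; first exact: measurable_Phi_inv.
- exact: (itg_normal_score (uniform01_rcdf contFX) (itg_normal_pow 2)).
- exact: (itg_normal_score (uniform01_rcdf contFY) (itg_normal_pow 2)).
Qed.

Lemma rho_R2_sample : sample_rho2 P Z = rho_R2 X Y.
Proof.
have s2 : itg (@std_normal R) (fun z => (z ^+ 2 - 1) ^+ 2).
  by have := @itg_normal_sq2 R; under eq_fun do rewrite normal_sqPhi.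
rewrite rho_R2E// /sample_rho2; congr (_ / _); apply: rhoE; first exact: measurable_normal_sq.
- exact: (itg_normal_score (uniform01_rcdf contFX) s2).
- exact: (itg_normal_score (uniform01_rcdf contFY) s2).
Qed.

(** A nondecreasing map could only alter a rank by merging two values, which the absence of ties
    among the images excludes. *)
Lemma rank_in_monotone (f : R -> R) n (x : nat -> R) k : {homo f : u v / u <= v} ->
  (forall i j, f (x i) = f (x j) -> i = j) -> rank_in n x k = rank_in n (f \o x) k.
Proof.
move=> fm fi; apply: eq_bigr => i _; congr nat_of_bool; apply/idP/idP => [/fm//|fx].
rewrite leNgt; apply/negP => xx; have fx' := fm _ _ (ltW xx).
have ik : i = k :> nat by apply: fi; apply/eqP; rewrite eq_le fx.
by rewrite ik ltxx in xx.
Qed.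

Lemma ranks_uniform_ae : {ae P, forall w, forall n k,
  rank_in n (fun i => Xs i w) k = rank_in n (fst \o smp Z w) k /\
  rank_in n (fun i => Ys i w) k = rank_in n (snd \o smp Z w) k}.
Proof.
apply: filterS (no_ties2 mZ indepZ idZ uZ1 uZ2) => w H n k.
have H' (c : R * R -> R) : (forall m, distinct m (c \o smp Z w)) ->
    forall i j, c (Z i w) = c (Z j w) -> i = j.
  by move=> D i j; apply: (D (maxn i j).+1); rewrite ltnS ?leq_maxl ?leq_maxr.
split.
  apply: (rank_in_monotone (f := rcdf X)) => [u v|i j].
    exact: rcdf_le.
  by apply: (H' fst) => m; case: (H m).
apply: (rank_in_monotone (f := rcdf Y)) => [u v|i j].
  exact: rcdf_le.
by apply: (H' snd) => m; case: (H m).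
Qed.

Definition stat n w : R * R :=
  (Num.sqrt n%:R * (rho_R1_hat n (fun i => Xs i w) (fun i => Ys i w) - rho_R1 X Y),
   Num.sqrt n%:R * (rho_R2_hat n (fun i => Xs i w) (fun i => Ys i w) - rho_R2 X Y)).

Lemma stat_limit Sigma : cvg_to_normal2 P (sample_stat P Z) (0, 0) Sigma ->
  cvg_to_normal2 P stat (0, 0) Sigma.
Proof.
apply: cvg_to_normal2_ae => [n|n|].
- exact: measurable_sample_stat.
- have [m1 _] := bmf_sample_hat1 mXYs n; have [m2 _] := bmf_sample_hat2 mXYs n.
  by apply/measurable_fun_pair; apply: measurable_funM => //; exact: measurable_funB.
- apply: filterS ranks_uniform_ae => w H n.
  rewrite /sample_stat /stat rho_R1_sample rho_R2_sample /sample_hat1 /sample_hat2.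
  congr (_ * (_ / _ - _), _ * (_ / _ - _)); apply: eq_bigr => k _.
    by have [-> ->] := H n k.
  by have [-> ->] := H n k.
Qed.

Lemma stat_normal_limit : exists Sigma, cvg_to_normal2 P stat (0, 0) Sigma.
Proof.
have [Sigma H] := sample_normal_limit mZ indepZ idZ Z01 uZ1 uZ2.
by exists Sigma; exact: stat_limit.
Qed.

Hypothesis indXY : independent_RV P' X Y.

Let indZ : independent_RV P (fst \o Z 0) (snd \o Z 0).
Proof.
move=> A B mA mB.
have mFA : measurable (rcdf X @^-1` A) by rewrite -[X in measurable X]setTI; exact: measurable_rcdf.
have mFB : measurable (rcdf Y @^-1` B) by rewrite -[X in measurable X]setTI; exact: measurable_rcdf.
have E1 : P ((fst \o Z 0) @^-1` A) = P' (X @^-1` (rcdf X @^-1` A)).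
  exact: (same_law_comp measurable_fst (sZ 0) mA).
have E2 : P ((snd \o Z 0) @^-1` B) = P' (Y @^-1` (rcdf Y @^-1` B)).
  exact: (same_law_comp measurable_snd (sZ 0) mB).
rewrite E1 E2 -indXY//.
have mAB : measurable (A `*` B) by exact: measurableX.
have -> : (fst \o Z 0) @^-1` A `&` (snd \o Z 0) @^-1` B = Z 0 @^-1` (A `*` B) by [].
by rewrite sZ.
Qed.

Lemma stat_normal_limit_independent :
  [/\ rho_R1 X Y = 0, rho_R2 X Y = 0 & cvg_to_normal2 P stat (0, 0) 1%:M].
Proof.
have [r1 r2] := sample_rho_independent mZ uZ1 uZ2 indZ.
split; [by rewrite -rho_R1_sample|by rewrite -rho_R2_sample|].
by apply: stat_limit; exact: (sample_normal_limit_independent mZ indepZ idZ Z01 uZ1 uZ2 indZ).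
Qed.

End transfer.

Theorem proposition2 (R : realType) (d d' : measure_display)
    (T : measurableType d) (T' : measurableType d')
    (P : probability T R) (P' : probability T' R)
    (X Y : {RV P' >-> R}) (Xs Ys : nat -> {RV P >-> R})
    (contFX : continuous (rcdf X)) (contFY : continuous (rcdf Y))
    (iidXY : iid_copies P P' (fun i w => (Xs i w, Ys i w))
                             (fun w => (X w, Y w))) :
  let hat1 n w := rho_R1_hat n (fun i => Xs i w) (fun i => Ys i w) in
  let hat2 n w := rho_R2_hat n (fun i => Xs i w) (fun i => Ys i w) in
  (exists Sigma : 'M[R]_2,
     cvg_to_normal2 P
       (fun n w => (Num.sqrt n%:R * (hat1 n w - rho_R1 X Y),
                    Num.sqrt n%:R * (hat2 n w - rho_R2 X Y)))
       (0, 0) Sigma) /\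
  (independent_RV P' X Y ->
     cvg_to_normal2 P
       (fun n w => (Num.sqrt n%:R * hat1 n w, Num.sqrt n%:R * hat2 n w))
       (0, 0) 1%:M).
Proof.
move=> hat1 hat2; split; first exact: (stat_normal_limit contFX contFY iidXY).
move=> indXY; have [r1 r2] := stat_normal_limit_independent contFX contFY iidXY indXY.
have -> : stat X Y Xs Ys = fun n w => (Num.sqrt n%:R * hat1 n w, Num.sqrt n%:R * hat2 n w) => //.
by apply/funext => n; apply/funext => w; rewrite /stat r1 r2 !subr0.
Qed.
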